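(* Let $\Sigma$ be a real symmetric positive definite $2\times 2$ matrix, $\mu\in\mathbb{R}^2$, and let $R=(r_{ij})$ be a real $2\times 2$ matrix such that $$r_{11}>0,\quad r_{22}>0,\quad r_{11}r_{22}-r_{12}r_{21}>0,\qquad r_{22}\mu_1-r_{12}\mu_2<0,\quad r_{11}\mu_2-r_{21}\mu_1<0 .$$ Let $Z(\infty)$ have the unique stationary distribution of the $(\Sigma,\mu,R)$-SRBM on $\mathbb{R}_+^2$, let $\varphi(\theta)=\mathbb{E}(e^{\langle\theta,Z(\infty)\rangle})$, and let $\mathcal{D}$ be the interior of $\{\theta\in\mathbb{R}^2:\varphi(\theta)<\infty\}$. With $\mathcal{D}^{(1)},\mathcal{D}^{(2)},\Gamma,\tilde\theta^{(i,\mathrm r)}$ and the value function $I$ of the variational problem as defined in the context, and with $\tau=(\tau_1,\tau_2)$, $\tau_i=\sup\{\theta_i>0:\theta\in\mathcal{D}^{(1)}\cap\mathcal{D}^{(2)}\}$: (a) $\mathcal{D}=\mathcal{D}^{(1)}\cap\mathcal{D}^{(2)}$. (b) For every $v\in\mathbb{R}_+^2$, $$I(v)=\begin{cases}\min\big(\langle v,\tilde\theta^{(1,\mathrm r)}\rangle,\ \langle v,\tilde\theta^{(2,\mathrm r)}\rangle\big), & \tau\in\Gamma,\\ \sup\{\langle v,\theta\rangle:\theta\in\mathcal{D}\}, & \tau\notin\Gamma.\end{cases}$$ In particular $I(\mathrm e^{(i)})=\tau_i$ for $i=1,2$, where $\mathrm e^{(1)}=(1,0)^{T}$ and $\mathrm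 e^{(2)}=(0,1)^{T}$.
   Context: Notation: $\langle\cdot,\cdot\rangle$ is the Euclidean inner product; vector inequalities such as $\theta<\theta'$ are componentwise (strict in each component); $R^1,R^2$ are the columns of $R$. SRBM: a $(\Sigma,\mu,R)$-SRBM on $\mathbb{R}_+^2$ is a continuous adapted process $Z$ on a filtered probability space with $Z(t)=X(t)+RY(t)\in\mathbb{R}_+^2$ for all $t\ge0$, where $X$ is a two-dimensional Brownian motion with drift $\mu$ and covariance matrix $\Sigma$ such that $X(t)-\mu t$ is a martingale up to its initial value with respect to the filtration, and $Y$ is adapted, continuous, $Y(0)=0$, with each component $Y_i$ nondecreasing and $\int_0^\infty Z_i(t)\,dY_i(t)=0$. Under the assumed conditions the SRBM is well defined and has a unique stationary distribution. Geometric objects: $\gamma(\theta)=-\frac12\langle\theta,\Sigma\theta\rangle-\langle\mu,\theta\rangle$ and $\gamma_i(\theta)=\langle R^i,\theta\rangle$, $i=1,2$. $\Gamma=\{\theta\in\mathbb{R}^2:\gamma(\theta)>0\}$ is the (open) interior of an ellipse, $\partial\Gamma=\{\gamma(\theta)=0\}$ is the ellipse. $\Gamma_i=\{\theta\in\Gamma:\gamma_{3-i}(\theta)<0\}$, with topological boundary $\partial\Gamma_i$. $\theta^{(i,\max)}$ is the unique maximizer of $\theta_i$ over $\partial\Gamma$. $\theta^{(i,\mathrm r)}$ is the unique nonzero point of $\partial\Gamma$ with $\gamma_{3-i}(\theta)=0$. $\tilde\theta^{(i,\mathrm r)}=\theta^{(i,\max)}$ if $\theta^{(i,\mathrm r)}=\theta^{(i,\max)}$;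 otherwise $\tilde\theta^{(i,\mathrm r)}$ is the unique point of $\partial\Gamma$ with the same $i$-th coordinate as $\theta^{(i,\mathrm r)}$ and a different $(3-i)$-th coordinate. Put $\theta^{(i,\Gamma)}=\theta^{(i,\max)}$ if $\theta^{(i,\max)}\in\partial\Gamma_i$, and $\theta^{(i,\Gamma)}=\theta^{(i,\mathrm r)}$ otherwise. Define $$\mathcal{D}^{(i)}=\{\theta\in\mathbb{R}^2:\ \exists\,\theta'\in\Gamma \text{ with } \theta<\theta' \text{ and } \theta'_i<\theta^{(i,\Gamma)}_i\}.$$ Variational problem: given a path $x:[0,\infty)\to\mathbb{R}^2$ (right continuous with left limits), a path $z$ of the same type is an $R$-regulation of $x$ if there is $y$ with $z(t)=x(t)+Ry(t)\ge 0$ for all $t\ge0$, $y(0)=0$, each component of $y$ nondecreasing, and $\int_0^\infty z_i(t)\,dy_i(t)=0$, $i=1,2$. Let $\mathcal{H}$ be the set of absolutely continuous $x:\mathbb{R}_+\to\mathbb{R}^2$ with $x(0)=0$ whose derivative is locally square integrable. For $v\in\mathbb{R}_+^2$, $$I(v)=\inf_{T\ge0}\ \inf\Big\{\frac12\int_0^T\langle\dot x(t)-\mu,\Sigma^{-1}(\dot x(t)-\mu)\rangle\,dt:\ x\in\mathcal{H},\ z \text{ an } R\text{-regulation of } x \text{ with } z(T)=v\Big\}.$$ *)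

(* Defs.v *)
From HB Require Import structures.
From mathcomp Require Import all_boot all_order all_algebra.
From mathcomp Require Import all_classical all_reals all_analysis.
Set Implicit Arguments.
Unset Strict Implicit.
Unset Printing Implicit Defensive.
Import Order.TTheory GRing.Theory Num.Theory.
Import numFieldNormedType.Exports.
Local Open Scope classical_set_scope.
Local Open Scope ring_scope.

(* Coordinates are indexed by i : 'I_2, i.e. by 0 and 1; the companion index
   "3 - i" of the usual 1-based numbering is rev_ord i. *)

Definition dot (R : realType) (u v : 'cV[R]_2) : R :=
  \sum_(i < 2) u i 0 * v i 0.

Definition nonneg_vec (R : realType) (v : 'cV[R]_2) : Prop :=
  forall i, 0 <= v i 0.

Definition lt_vec (R : realType) (u v : 'cV[R]_2) : Prop :=
  forall i, u i 0 < v i 0.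

Definition positive_definite (R : realType) (S : 'M[R]_2) : Prop :=
  forall v : 'cV[R]_2, v != 0 -> 0 < dot v (S *m v).

Definition topological_boundary (T : topologicalType) (A : set T) : set T :=
  closure A `\` interior A.

Section Geometry.
Context (R : realType) (Sigma : 'M[R]_2) (mu : 'cV[R]_2) (Rm : 'M[R]_2).
Implicit Types (theta : 'cV[R]_2) (i : 'I_2).

Definition gamma theta : R :=
  - (2^-1 * dot theta (Sigma *m theta)) - dot mu theta.

Definition gamma_ i theta : R := dot (col i Rm) theta.

Definition Gamma : set 'cV[R]_2 := [set theta | 0 < gamma theta].

Definition ellipse : set 'cV[R]_2 := [set theta | gamma theta = 0].

Definition Gamma_ i : set 'cV[R]_2 :=
  [set theta | Gamma theta /\ gamma_ (rev_ord i) theta < 0].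

(* Objects introduced as "the unique point such that" are rendered with get,
   which returns an element of the given set whenever there is one. *)
Definition theta_max i : 'cV[R]_2 :=
  get [set theta | ellipse theta /\
    forall theta', ellipse theta' -> theta' i 0 <= theta i 0].

Definition theta_r i : 'cV[R]_2 :=
  get [set theta |
    [/\ ellipse theta, theta != 0 & gamma_ (rev_ord i) theta = 0]].

Definition theta_r_tilde i : 'cV[R]_2 :=
  if theta_r i == theta_max i then theta_max i
  else get [set theta | [/\ ellipse theta, theta i 0 = theta_r i i 0 &
              theta (rev_ord i) 0 != theta_r i (rev_ord i) 0]].

Definition theta_Gamma i : 'cV[R]_2 :=
  if theta_max i \in topological_boundary (Gamma_ i) then theta_max i
  else theta_r i.

Definition D_ i : set 'cV[R]_2 :=
  [set theta | exists theta', [/\ Gamma theta', lt_vec theta theta' &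
    theta' i 0 < theta_Gamma i i 0]].

Definition tau : 'cV[R]_2 :=
  \col_i sup [set r : R | exists theta,
    [/\ (D_ 0 `&` D_ 1) theta, 0 < theta i 0 & r = theta i 0]].

End Geometry.

(* Paths on [0, +oo[ are total functions on R; their values at negative times
   are never used (the only derivatives taken are Lebesgue-a.e. ones on
   [0, T]). *)
Section Paths.
Context (R : realType) (Rm : 'M[R]_2).
Implicit Types (x y z : R -> 'cV[R]_2).

Definition rcll x : Prop :=
  (forall t, 0 <= t -> x s @[s --> t^'+] --> x t) /\
  (forall t, 0 < t -> cvg (x s @[s --> t^'-])).

(* int_[0, +oo[ g df = 0, for f right-continuous nondecreasing on [0, +oo[; f
   is extended by the constant f 0 to negative times, so that its
   Lebesgue-Stieltjes measure has no atom at 0. *)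
Definition stieltjes_integral_eq0 (g f : R -> R) : Prop :=
  exists F : cumulative R R, (forall t, F t = f (Num.max 0 t)) /\
    (\int[lebesgue_stieltjes_measure F]_(t in `[0%R, +oo[) (g t)%:E = 0)%E.

Definition reflected x y z : Prop :=
  [/\ forall t, 0 <= t -> z t = x t + Rm *m y t /\ nonneg_vec (z t),
      y 0 = 0,
      forall i s t, 0 <= s -> s <= t -> y s i 0 <= y t i 0 &
      forall i, stieltjes_integral_eq0 (fun t => z t i 0) (fun t => y t i 0)].

Definition regulation x z : Prop :=
  [/\ rcll x, rcll z & exists y, reflected x y z].

Definition absolutely_continuous_on (a b : R) x : Prop :=
  forall e : R, 0 < e -> exists2 delta : R, 0 < delta &
    forall (n : nat) (s t : 'I_n -> R),
      (forall k, [/\ a <= s k, s k <= t k & t k <= b]) ->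
      trivIset setT (fun k => `]s k, t k[%classic) ->
      \sum_(k < n) (t k - s k) < delta ->
      \sum_(k < n) `|x (t k) - x (s k)| < e.

Definition calH x : Prop :=
  [/\ x 0 = 0,
      forall T, 0 <= T -> absolutely_continuous_on 0 T x &
      forall T, 0 <= T -> (@lebesgue_measure R).-integrable `[0, T]
        (fun t => (dot (derive1 x t) (derive1 x t))%:E)].

End Paths.

Definition action (R : realType) (Sigma : 'M[R]_2) (mu : 'cV[R]_2)
    (T : R) (x : R -> 'cV[R]_2) : \bar R :=
  ((2^-1)%:E * \int[@lebesgue_measure R]_(t in `[0%R, T])
    (dot (derive1 x t - mu) (invmx Sigma *m (derive1 x t - mu)))%:E)%E.

(* The infimum of the empty set is +oo. *)
Definition value_function (R : realType) (Sigma : 'M[R]_2) (mu : 'cV[R]_2)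
    (Rm : 'M[R]_2) (v : 'cV[R]_2) : \bar R :=
  ereal_inf [set ereal_inf [set action Sigma mu T x | x in
      [set x | calH x /\ exists z, regulation Rm x z /\ z T = v]]
    | T in [set T : R | 0 <= T]].

(* The plane R^2 with its Borel sigma-algebra. *)
Notation plane R := (g_sigma_algebraType (@open 'cV[R]_2)).

Section Processes.
Context (R : realType) (d : measure_display) (T : measurableType d)
  (P : probability T R).
Implicit Types (F : R -> set (set T)) (W X Y Z : R -> T -> plane R).

Definition is_filtration F : Prop :=
  (forall t, 0 <= t -> sigma_algebra setT (F t) /\ F t `<=` measurable) /\
  (forall s t, 0 <= s -> s <= t -> F s `<=` F t).

Definition adapted F W : Prop :=
  forall t, 0 <= t -> forall B : set (plane R), measurable B ->
    F t (W t @^-1` B).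

Definition continuous_paths W : Prop :=
  forall w, {within `[0, +oo[, continuous (fun t => W t w : 'cV[R]_2)}.

Definition martingale F W : Prop :=
  [/\ adapted F W,
      forall t i, 0 <= t -> P.-integrable setT (fun w => (W t w i 0)%:E) &
      forall s t i A, 0 <= s -> s <= t -> F s A ->
        (\int[P]_(w in A) (W t w i 0%R)%:E =
         \int[P]_(w in A) (W s w i 0%R)%:E)%E].

(* The random vector V is Gaussian with mean m and nondegenerate covariance
   matrix C: its nontrivial linear functionals are normal. The second
   parameter of normal_prob is the standard deviation. *)
Definition gaussian_vector (V : T -> plane R) (m : 'cV[R]_2) (C : 'M[R]_2) :
    Prop :=
  measurable_fun setT V /\
  forall a : 'cV[R]_2, a != 0 -> forall B : set R, measurable B ->
    P [set w | B (dot a (V w))] =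
    normal_prob (dot a m) (Num.sqrt (dot a (C *m a))) B.

Definition natural_filtration X (s : R) : set (set T) :=
  <<s [set A | exists u (B : set (plane R)),
        [/\ 0 <= u, u <= s, measurable B & A = X u @^-1` B]] >>.

(* The initial law X 0 is arbitrary. *)
Definition brownian_motion (Sigma : 'M[R]_2) (mu : 'cV[R]_2) X : Prop :=
  [/\ continuous_paths X,
      forall t, 0 <= t -> measurable_fun setT (X t),
      forall s t, 0 <= s -> s < t ->
        gaussian_vector (fun w => X t w - X s w)
          ((t - s) *: mu) ((t - s) *: Sigma) &
      forall s t, 0 <= s -> s < t ->
        forall A (B : set (plane R)), natural_filtration X s A ->
          measurable B ->
          let C := [set w | B (X t w - X s w)] in
          (P (A `&` C) = P A * P C)%E].

Definition SRBM (Sigma : 'M[R]_2) (mu : 'cV[R]_2) (Rm : 'M[R]_2) F Z : Prop :=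
  [/\ is_filtration F, continuous_paths Z, adapted F Z &
    exists X Y,
      [/\ brownian_motion Sigma mu X,
          martingale F (fun t w => X t w - X 0 w - t *: mu),
          adapted F Y,
          continuous_paths Y &
          forall w, reflected Rm (X ^~ w) (Y ^~ w) (Z ^~ w)]].

End Processes.

(* nu is a stationary distribution if some SRBM has law nu at every time. *)
Definition stationary_distribution (R : realType) (Sigma : 'M[R]_2)
    (mu : 'cV[R]_2) (Rm : 'M[R]_2) (nu : probability (plane R) R) : Prop :=
  exists (d : measure_display) (T : measurableType d) (P : probability T R)
    (F : R -> set (set T)) (Z : R -> T -> plane R),
    SRBM P Sigma mu Rm F Z /\
    forall t, 0 <= t -> forall B : set (plane R), measurable B ->
      P (Z t @^-1` B) = nu B.

Definition mgf (R : realType) (nu : probability (plane R) R)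
    (theta : 'cV[R]_2) : \bar R :=
  ('E_nu[fun z => expR (dot theta z)])%E.

Definition mgf_domain (R : realType) (nu : probability (plane R) R) :
    set 'cV[R]_2 :=
  interior [set theta | (mgf nu theta < +oo)%E].

(* Main.v *)
Require Import Defs.
From HB Require Import structures.
From mathcomp Require Import all_boot all_order all_algebra.
From mathcomp Require Import all_classical all_reals all_analysis.
From mathcomp Require Import measurable_realfun.
From mathcomp Require Import ring lra.
Set Implicit Arguments.
Unset Strict Implicit.
Unset Printing Implicit Defensive.
Import Order.TTheory GRing.Theory Num.Theory.
Import numFieldNormedType.Exports.
Local Open Scope classical_set_scope.
Local Open Scope ring_scope.
(* Part (a). Ito's formula for smooth functions of <theta, Z>, obtained from Riemann sums along equal partitions,
   gives in stationarity the basic adjoint relation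
     gamma(theta) phi(theta) = sum_i gamma_i(theta) phi_i(theta_j)
   for bounded truncations of the exponential, phi_i being the boundary transforms. Truncation is removed by
   monotone convergence, and the domain of phi is then found by convexity in the plane: at each corner theta^(i,Gamma)
   either the boundary transform has to blow up (corner on the ray gamma_j = 0) or the vertical tangent of the
   ellipse contradicts a Lipschitz bound (corner at the rightmost point).

   Part (b). The running cost L(u) = <u - mu, Sigma^-1 (u - mu)> / 2 is the Legendre dual of gamma, so that
   <theta, x(t) - x(s)> is bounded by the cost on [s, t] for every theta with gamma(theta) >= 0. While z_i > 0 the
   process y_i is flat, and near an axis theta may be traded for a point with gamma_j <= 0; this makes
   <theta, z> minus the cost (or the minimum of two such functions) locally nonincreasing away from the origin.
   The bound is attained by straight rays and by paths with two pieces, one along an axis and one across the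
   interior, whose velocities are normals -grad gamma to the ellipse. Absolutely continuous paths enter only
   through their a.e. derivatives, by Radon-Nikodym applied to the variation function. *)

(** * Moments of increments and conditional orthogonality *)

(** The increments of [X] are independent only of its own past, while [Z] and [Y] are adapted to a
    larger filtration [F] for which [X] is merely a martingale. The conditional variance given [F]
    therefore has to be proved: sums of squared increments converge in L2, a statement about the
    small filtration, and the martingale property transports it to [F]. Integrability of [Y 1] is
    likewise earned, from a deterministic oscillation bound and a chaining bound for Brownian paths.
    In the plane, the two alternatives for theta^(i,Gamma) are handled together by the
    complementarity [l2 * pgy = 0], and the determinant of [Rm] enters above all as the fact that
    the two corners cannot lie across each other. The case distinction on [tau] becomes the position
    of the point whose coordinates are those of the two corners: it equals [tau] as soon as it lies
    in [Gamma]. Regulations are only right continuous with left limits, so continuity of [z] has to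
    be derived before last zeros can be used. *)

Section gaussian_moments.
Context {R : realType} (m s : R).
Hypothesis s_neq0 : s != 0.
Local Notation p := (normal_pdf m s).

Lemma is_derive_normal_pdf (x : R) :
  is_derive x (1:R) (p : R -> R) (- ((x - m) / s ^+ 2) * p x).
Proof.
rewrite normal_pdfE// /normal_fun.
have s20 : s ^+ 2 *+ 2 != 0 by rewrite mulrn_eq0/= expf_eq0 (negbTE s_neq0).
have H : is_derive x (1:R) (fun x : R => - (x - m) ^+ 2 / (s ^+ 2 *+ 2)) (- ((x - m) / s ^+ 2)).
  apply: is_derive_eq.
  rewrite !scaler0 ?addr0 ?add0r /GRing.scale/=.
  field.
  by [].
have H2 := is_deriveZ (normal_peak s) (is_derive1_comp (is_derive_expR _) H).
apply: is_derive_eq.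
rewrite /GRing.scale/=. ring.
Qed.

(** Integration by parts: since [p' = - (x - m) / s^2 * p], the product [u * p] is an antiderivative
    of [(v - c) * p]. A moment is obtained by choosing [u] so that [c] is its value. *)
Lemma normal_moment_trunc (u du v : R -> R) (c a b : R) : a < b ->
  (forall x, is_derive x (1:R) u (du x)) ->
  (forall x, v x = du x - u x * (x - m) / s ^+ 2 + c) -> continuous v ->
  (\int[lebesgue_measure]_(x in `[a, b]) (v x * p x)%:E =
   c%:E * \int[lebesgue_measure]_(x in `[a, b]) (p x)%:E + (u b * p b - u a * p a)%:E)%E.
Proof.
move=> ab du_ vE cv.
have cp : continuous p by exact: continuous_normal_pdf.
have dF x : is_derive x (1:R) (fun x => u x * p x) ((v x - c) * p x).
  have := is_deriveM (du_ x) (is_derive_normal_pdf x).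
  move=> H; apply: is_derive_eq; rewrite /GRing.scale/= vE; ring.
have intp (f : R -> R) : continuous f -> lebesgue_measure.-integrable `[a, b] (EFin \o f).
  move=> cf; apply: continuous_compact_integrable; first exact: segment_compact.
  exact: continuous_subspaceT.
have cvp : continuous (fun x => (v x - c) * p x).
  move=> x; apply: cvgM; last exact: cp.
  by apply: cvgB; [exact: cv|exact: cvg_cst].
rewrite EFinB -(@continuous_FTC2 _ (fun x => (v x - c) * p x) (fun x => u x * p x) a b)//; last 3 first.
- exact: continuous_subspaceT.
- have cF : continuous (fun x => u x * p x).
    by move=> x; apply: differentiable_continuous; apply/derivable1_diffP; case: (dF x).
  split.
  + by move=> x _; case: (dF x).
  + apply: cvg_at_right_filter; exact: cF.
  + apply: cvg_at_left_filter; exact: cF.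
- by move=> x _; rewrite derive1E; apply: derive_val.
rewrite -integralZl//; last exact: intp.
rewrite -integralD//=; last 2 first.
- apply: (intp (fun x => c * p x)).
  by move=> x; apply: cvgM; [exact: cvg_cst|exact: cp].
- exact: intp.
by apply: eq_integral => x _; rewrite -EFinD; congr _%:E; ring.
Qed.
End gaussian_moments.

Section normal_integral.
Context {R : realType} (m s : R).
Hypothesis s_neq0 : s != 0.
Local Notation p := (normal_pdf m s).

Lemma ge0_integral_normal_prob (f : R -> R) : (forall x, 0 <= f x) ->
  measurable_fun setT f ->
  (\int[normal_prob m s]_x (f x)%:E =
   \int[lebesgue_measure]_x (f x * p x)%:E)%E.
Proof.
move=> f0 mf.
have dom := normal_prob_dominates m s.
have /measurable_EFinP mp := measurable_normal_pdf m s.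
rewrite -(@Radon_Nikodym_SigmaFinite.change_of_variables _ _ _ _ _ dom)//; last first.
  exact/measurable_EFinP.
under [RHS]eq_integral do rewrite EFinM.
apply: ae_eq_integral => //.
- apply: emeasurable_funM; first exact/measurable_EFinP.
  exact: measurable_int (Radon_Nikodym_SigmaFinite.f_integrable dom).
- by apply: emeasurable_funM; first exact/measurable_EFinP.
apply: ae_eqe_mul2l.
apply: integral_ae_eq => //.
- exact: (Radon_Nikodym_SigmaFinite.f_integrable dom).
- by move=> A _ mA; rewrite -(Radon_Nikodym_SigmaFinite.f_integral dom).
Qed.

Lemma ge0_integral_itvNn_cvg (f : R -> R) : (forall x, 0 <= f x) ->
  measurable_fun setT f ->
  (\int[lebesgue_measure]_(x in `[(- n%:R)%R, n%:R%R]) (f x)%:E)%E @[n --> \oo] -->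
   (\int[lebesgue_measure]_x (f x)%:E)%E.
Proof.
move=> f0 mf.
have -> : [set: R] = \bigcup_n `[- n%:R, n%:R]%classic.
  apply/esym/seteqP; split => // x _.
  exists (Num.truncn `|x|).+1 => //=; rewrite in_itv/= -ler_norml ltW//.
  exact: truncnS_gt.
apply: ge0_nondecreasing_set_cvg_integral => //.
- apply/nondecreasing_seqP => n; apply/subsetPset => x /=; rewrite !in_itv/= => /andP[x1 x2].
  by rewrite (le_trans _ x1) ?(le_trans x2)// ?lerN2 ler_nat.
- by move=> n; apply: measurable_funTS; exact/measurable_EFinP.
- by move=> n x _; rewrite lee_fin.
Qed.

(** An upper bound suffices, and beyond [|m|] both boundary terms of [u * p] have the favourable
    sign, so they are dropped without any decay estimate. *)
Lemma normal_moment4 :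
  (\int[normal_prob m s]_x ((x - m) ^+ 4)%:E <= (3 * s ^+ 4)%:E)%E.
Proof.
have p0 x : 0 <= p x by exact: normal_pdf_ge0.
have s2 : 0 < s ^+ 2 by rewrite exprn_even_gt0.
have mf : measurable_fun setT (fun x : R => (x - m) ^+ 4).
  by apply: measurable_funX; apply: measurable_funB.
have f0 x : 0 <= (x - m) ^+ 4 by exact: exprn_even_ge0.
rewrite ge0_integral_normal_prob//.
have mfp : measurable_fun setT (fun x : R => (x - m) ^+ 4 * p x).
  by apply: measurable_funM => //; exact: measurable_normal_pdf.
have /cvg_lim <- // := ge0_integral_itvNn_cvg (fun x => mulr_ge0 (f0 x) (p0 x)) mfp.
apply: lime_le.
  apply: cvgP; exact: (ge0_integral_itvNn_cvg (fun x => mulr_ge0 (f0 x) (p0 x)) mfp).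
exists (Num.truncn `|m|).+1 => // n /= mn.
have nm : `|m| < n%:R.
  by rewrite (lt_le_trans (truncnS_gt _))// ler_nat.
(* Solves [u' - u (x - m) / s^2 = (x - m)^4 - 3 s^4]. *)
pose u (x : R) := - (s ^+ 2 * (x - m) ^+ 3 + 3 * s ^+ 4 * (x - m)).
have du x : is_derive x (1:R) u (- (3 * s ^+ 2 * (x - m) ^+ 2 + 3 * s ^+ 4)).
  rewrite /u; apply: is_derive_eq.
  by rewrite /GRing.scale/=; ring.
have vE x : (x - m) ^+ 4 = - (3 * s ^+ 2 * (x - m) ^+ 2 + 3 * s ^+ 4) -
    u x * (x - m) / s ^+ 2 + 3 * s ^+ 4.
  by rewrite /u; field.
have cv : continuous (fun x : R => (x - m) ^+ 4).
  move=> x; apply: differentiable_continuous; apply/derivable1_diffP; exact: ex_derive.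
have n0 : 0 < n%:R :> R by rewrite (le_lt_trans _ nm).
have ab : - n%:R < n%:R :> R by lra.
rewrite (normal_moment_trunc s_neq0 ab du vE cv).
rewrite -[leRHS]adde0; apply: leeD.
  rewrite -[leRHS]mule1; apply: lee_wpmul2l.
    by rewrite lee_fin mulr_ge0// exprn_even_ge0.
  rewrite -[leRHS](integral_normal_pdf m s).
  apply: ge0_subset_integral => //.
    by apply/measurable_EFinP; exact: measurable_normal_pdf.
  by move=> x _; rewrite lee_fin.
have s4 : 0 <= s ^+ 4 by exact: exprn_even_ge0.
rewrite lee_fin subr_le0; apply: (@le_trans _ _ 0).
  rewrite mulr_le0_ge0// /u oppr_le0.
  have H : 0 <= n%:R - m by move: nm; rewrite ltr_norml => /andP[_]; lra.
  apply: addr_ge0; apply: mulr_ge0 => //; [exact: ltW|exact: exprn_ge0|].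
  by apply: mulr_ge0.
rewrite mulr_ge0// /u oppr_ge0.
have H : - n%:R - m <= 0 by move: nm; rewrite ltr_norml => /andP[+ _]; lra.
rewrite -[leRHS]addr0 lerD//.
  rewrite mulr_ge0_le0 ?(ltW s2)//.
  by rewrite exprSr mulr_ge0_le0// exprn_even_ge0.
by rewrite mulr_ge0_le0// mulr_ge0.
Qed.

Lemma normal_pdf_decay (x : R) : x != m ->
  `|(x - m) * p x| <= normal_peak s * (2 * s ^+ 2) / `|x - m|.
Proof.
move=> xm; have s2 : 0 < s ^+ 2 by rewrite exprn_even_gt0.
have w0 : 0 < `|x - m| by rewrite normr_gt0 subr_eq0.
have pk := normal_peak_gt0 s_neq0.
rewrite normrM (ger0_norm (normal_pdf_ge0 _ _ _)) normal_pdfE// /normal_fun.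
rewrite -mulrA mulrCA ler_pM2l//.
set e := (- (x - m) ^+ 2 / _).
have eE : e = - (`|x - m| ^+ 2 / (2 * s ^+ 2)).
  by rewrite /e real_normK ?num_real//; field.
rewrite ler_pdivlMr// mulrAC -expr2 eE.
have v0 : 0 < `|x - m| ^+ 2 by rewrite exprn_gt0.
move: (`|x - m| ^+ 2) v0 => v v0.
rewrite expRN ler_pdivrMr ?expR_gt0//.
apply: (@le_trans _ _ (2 * s ^+ 2 * (1 + v / (2 * s ^+ 2)))).
  have -> : 2 * s ^+ 2 * (1 + v / (2 * s ^+ 2)) = 2 * s ^+ 2 + v by field.
  by rewrite lerDr mulr_ge0 ?(ltW s2).
by apply: ler_wpM2l; [rewrite mulr_ge0 ?(ltW s2)|exact: expR_ge1Dx].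
Qed.

(** Equality is required here, because the quadratic variation must be exact; the boundary terms are
    shown to vanish by [normal_pdf_decay]. *)
Lemma normal_moment2 :
  (\int[normal_prob m s]_x ((x - m) ^+ 2)%:E = (s ^+ 2)%:E)%E.
Proof.
have p0 x : 0 <= p x by exact: normal_pdf_ge0.
have s2 : 0 < s ^+ 2 by rewrite exprn_even_gt0.
have mf : measurable_fun setT (fun x : R => (x - m) ^+ 2).
  by apply: measurable_funX; apply: measurable_funB.
have f0 x : 0 <= (x - m) ^+ 2 by exact: sqr_ge0.
rewrite ge0_integral_normal_prob//.
have mfp : measurable_fun setT (fun x : R => (x - m) ^+ 2 * p x).
  by apply: measurable_funM => //; exact: measurable_normal_pdf.
have := ge0_integral_itvNn_cvg (fun x => mulr_ge0 (f0 x) (p0 x)) mfp.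
pose u (x : R) := - (s ^+ 2 * (x - m)).
have du x : is_derive x (1:R) u (- (s ^+ 2)).
  rewrite /u; apply: is_derive_eq.
  by rewrite /GRing.scale/=; ring.
have vE x : (x - m) ^+ 2 = - (s ^+ 2) - u x * (x - m) / s ^+ 2 + s ^+ 2.
  by rewrite /u; field.
have cv : continuous (fun x : R => (x - m) ^+ 2).
  move=> x; apply: differentiable_continuous; apply/derivable1_diffP; exact: ex_derive.
have := ge0_integral_itvNn_cvg p0 (measurable_normal_pdf m s).
rewrite integral_normal_pdf => Hp Hq.
suff H : (\int[lebesgue_measure]_(x in `[(- n%:R)%R, n%:R%R]) ((x - m) ^+ 2 * p x)%:E)%E
    @[n --> \oo] --> (s ^+ 2)%:E.
  exact: (cvg_unique _ Hq H).
have pk := normal_peak_gt0 s_neq0.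
pose c := normal_peak s * (2 * s ^+ 2) * s ^+ 2 * 2.
have Z : (u n%:R * p n%:R - u (- n%:R) * p (- n%:R)) @[n --> \oo] --> (0 : R).
  apply/norm_cvg0P.
  have Q : (fun n : nat => c * (n%:R - `|m|)^-1) @ \oo --> (0 : R).
    rewrite -(mulr0 c); apply: cvgM; first exact: cvg_cst.
    apply/gtr0_cvgV0.
      exists (Num.truncn `|m|).+1 => // n /= mn; rewrite subr_gt0.
      by rewrite (lt_le_trans (truncnS_gt _))// ler_nat.
    apply/cvgryPge => A; exists (Num.truncn `|A + `|m| |).+1 => // n /= mn.
    rewrite lerBrDr (le_trans (ler_norm _))// ltW//.
    by rewrite (lt_le_trans (truncnS_gt _))// ler_nat.
  apply: squeeze_cvgr (cvg_cst 0) Q.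
  exists (Num.truncn `|m|).+1 => // n /= mn.
  have nm : `|m| < n%:R by rewrite (lt_le_trans (truncnS_gt _))// ler_nat.
  rewrite normr_ge0/=.
  have D (y : R) : `|y| = n%:R -> `|u y * p y| <= normal_peak s * (2 * s ^+ 2) * s ^+ 2 / (n%:R - `|m|).
    move=> yn.
    have ym : n%:R - `|m| <= `|y - m| by rewrite -yn lerB_dist.
    have nm0 : 0 < n%:R - `|m| by rewrite subr_gt0.
    have yn0 : y != m by rewrite -subr_eq0 -normr_gt0 (lt_le_trans nm0).
    have -> : u y * p y = - s ^+ 2 * ((y - m) * p y) by rewrite /u; ring.
    have -> : normal_peak s * (2 * s ^+ 2) * s ^+ 2 / (n%:R - `|m|) =
      s ^+ 2 * (normal_peak s * (2 * s ^+ 2) / (n%:R - `|m|)) by ring.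
    rewrite normrM normrN (gtr0_norm s2) ler_pM2l//.
    apply: (le_trans (normal_pdf_decay yn0)).
    apply: ler_wpM2l; first by apply: mulr_ge0; [exact: ltW|apply: mulr_ge0 => //; exact: ltW].
    by rewrite lef_pV2// posrE// (lt_le_trans nm0).
  apply: (le_trans (ler_normB _ _)).
  have -> : c / (n%:R - `|m|) = normal_peak s * (2 * s ^+ 2) * s ^+ 2 / (n%:R - `|m|) +
    normal_peak s * (2 * s ^+ 2) * s ^+ 2 / (n%:R - `|m|) by rewrite /c; ring.
  by apply: lerD; apply: D; rewrite ?normrN ger0_norm.
have H1 : ((s ^+ 2)%:E * \int[lebesgue_measure]_(x in `[(- n%:R)%R, n%:R%R]) (p x)%:E +
   (u n%:R * p n%:R - u (- n%:R) * p (- n%:R))%:E)%E @[n --> \oo] --> (s ^+ 2)%:E.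
  rewrite -[X in _ --> X](_ : (s ^+ 2)%:E * 1 + 0%:E = _)%E; last by rewrite mule1 adde0.
  apply: cvgeD => //.
  - apply: cvgeZl => //.
  - by apply: cvg_EFin => //; exact: nearW.
apply: cvg_trans H1; apply: near_eq_cvg; exists 1%N => // n /= n1.
rewrite (@normal_moment_trunc _ m s s_neq0 _ _ _ _ _ _ _ du vE cv)//.
have : 1 <= n%:R :> R by rewrite (ler_nat R 1 n).
by move=> ?; lra.
Qed.
End normal_integral.

Section real_dominated_convergence.
Context {d : measure_display} {T : measurableType d} {R : realType}
  (P : {measure set T -> \bar R}).
Implicit Types f g : T -> R.

Lemma integrable_le f g : measurable_fun setT f ->
  P.-integrable setT (EFin \o g) -> (forall w, `|f w| <= g w) ->
  P.-integrable setT (EFin \o f).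
Proof.
move=> mf ig fg; apply: (le_integrable measurableT _ _ ig).
  exact/measurable_EFinP.
by move=> w _ /=; rewrite lee_fin (le_trans (fg w))// ler_norm.
Qed.

Lemma Rintegral_dominated_cvg (f_ : nat -> T -> R) f g :
  (forall n, measurable_fun setT (f_ n)) ->
  (forall w, f_ n w @[n --> \oo] --> f w) ->
  P.-integrable setT (EFin \o g) -> (forall n w, `|f_ n w| <= g w) ->
  P.-integrable setT (EFin \o f) /\
  (\int[P]_w f_ n w) @[n --> \oo] --> \int[P]_w f w.
Proof.
move=> mf cf ig fg.
have mlim : measurable_fun setT f.
  apply: (measurable_fun_cvg mf) => w _; exact: cf.
have [|||||fi _ +] := @dominated_convergence _ _ _ P setT measurableT
  (fun n => EFin \o f_ n) (EFin \o f) (EFin \o g).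
- by move=> n; apply/measurable_EFinP.
- exact/measurable_EFinP.
- by apply: aeW => w _; apply: cvg_EFin; [exact: nearW|exact: cf].
- exact: ig.
- by apply: aeW => w n _ /=; rewrite lee_fin.
move=> H; split => //; apply: fine_cvg.
rewrite fineK//; exact: integrable_fin_num.
Qed.
End real_dominated_convergence.

Section sub_sigma_algebra.
Context {d : measure_display} {T : measurableType d} {R : realType}
  (P : probability T R).
Implicit Types (G : set (set T)) (f g D : T -> R).

(** Several sigma-algebras live on the same type [T], so measurability is stated by preimages;
    [meas_wrtP] passes to the type [g_sigma_algebraType G]. *)
Definition meas_wrt G f := forall B : set R, measurable B -> G (f @^-1` B).

Lemma meas_wrtP G f : sigma_algebra setT G -> meas_wrt G f <->
  @measurable_fun _ _ (g_sigma_algebraType G) R setT f.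
Proof.
move=> sG; split.
  by move=> mf _ B mB; rewrite setTI; apply: sub_gen_smallest; exact: mf.
move=> mf B mB; have := mf measurableT B mB; rewrite setTI.
by rewrite /measurable/= sigma_algebra_id.
Qed.

Lemma meas_wrtS G f : G `<=` measurable -> meas_wrt G f -> measurable_fun setT f.
Proof. by move=> GT mf _ B mB; rewrite setTI; apply: GT; exact: mf. Qed.

Variables (G : set (set T)) (D : T -> R).
Hypotheses (sG : sigma_algebra setT G) (GT : G `<=` measurable)
  (iD : P.-integrable setT (EFin \o D))
  (D0 : forall A, G A -> (\int[P]_(w in A) (D w)%:E = 0)%E).

Import HBNNSimple.

(** Stands in for conditional expectation: a variable [D] with zero integral over every event of [G]
    is orthogonal to all [G]-measurable weights, first simple ones and then their limits. *)
Lemma integral_mul_meas_wrt_ge0 (g : T -> R) : meas_wrt G g ->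
  (forall w, 0 <= g w) -> P.-integrable setT (fun w => (g w * D w)%:E) ->
  (\int[P]_w (g w * D w)%:E = 0)%E.
Proof.
move=> mg g0 igD.
have mg' := (meas_wrtP g sG).1 mg.
have mg2 : @measurable_fun _ _ (g_sigma_algebraType G) (\bar R) setT (EFin \o g).
  exact/measurable_EFinP.
(* The approximation is taken over the small sigma-algebra, so that its level sets belong to [G]. *)
pose h := nnsfun_approx (measurableT : @measurable _ (g_sigma_algebraType G) setT) mg2.
have hg n w : h n w <= g w.
  have c : (EFin \o h^~ w) @ \oo --> (g w)%:E.
    have g0' x : [set: g_sigma_algebraType G] x -> (0 <= (EFin \o g) x)%E by rewrite lee_fin.
    exact: (cvg_nnsfun_approx _ _ g0').
  have nd : nondecreasing_seq (EFin \o h^~ w).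
    by move=> a b ab /=; rewrite lee_fin; exact/lefP/nd_nnsfun_approx.
  rewrite -lee_fin -(cvg_unique (@ereal_hausdorff R) (ereal_nondecreasing_cvgn nd) c).
  by apply: ereal_sup_ubound; exists n.
have mh n : measurable_fun setT (h n : T -> R).
  apply: (@meas_wrtS G) => //; apply/meas_wrtP => //.
have Gh n y : G (h n @^-1` [set y]).
  have : meas_wrt G (h n) by apply/meas_wrtP.
  by apply; exact: measurable_set1.
have Z n : (\int[P]_w (h n w * D w)%:E = 0)%E.
  under eq_integral => w _.
    rewrite (fimfunEord (h n)) big_distrl/= -sumEFin; over.
  have iD' y : P.-integrable setT (fun w => (\1_(h n @^-1` [set y]) w * D w)%:E).
    apply: (@integrableMr _ _ _ P setT measurableT (\1_(h n @^-1` [set y])) (EFin \o D)) => //.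
    - apply: measurable_indic; exact: GT.
    - exists 1; split => [|x xk w _]; first exact: num_real.
      rewrite /= (le_trans _ (ltW xk))// indicE.
      by case: (_ \in _); rewrite /= ?normr1 ?normr0.
  rewrite integral_sum//; last first.
    move=> k; under eq_fun do rewrite -mulrA EFinM; apply: integrableZl => //.
  rewrite big1// => k _; move: (_`_k) => y.
  under eq_integral do rewrite -mulrA EFinM.
  rewrite integralZl//.
  under eq_integral do rewrite EFinM muleC.
  rewrite (_ : (fun x => _) = (EFin \o D) \_ (h n @^-1` [set y])); last first.
    by rewrite epatch_indic; apply/funext.
  by rewrite -integral_mkcond D0 ?mule0.
have mD : measurable_fun setT D by apply/measurable_EFinP; exact: measurable_int iD.
have [|||||_ _] := @dominated_convergence _ _ _ P setT measurableT
  (fun n w => (h n w * D w)%:E) (fun w => (g w * D w)%:E) (fun w => `|g w * D w|%:E).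
- by move=> n; apply/measurable_EFinP; apply: measurable_funM.
- exact: measurable_int igD.
- apply: aeW => w _; apply: cvg_EFin; first exact: nearW.
  have g0' x : [set: g_sigma_algebraType G] x -> (0 <= (EFin \o g) x)%E by rewrite lee_fin.
  have /fine_cvg c := cvg_nnsfun_approx measurableT mg2 g0' (I : setT w).
  by apply: cvgM; [exact: c|exact: cvg_cst].
- exact: integrable_abse igD.
- apply: aeW => w n _ /=; rewrite lee_fin !normrM ler_wpM2r//.
  by rewrite !ger0_norm.
under eq_fun do rewrite Z.
by move=> /(cvg_lim (@ereal_hausdorff R)); rewrite lim_cst//; exact: ereal_hausdorff.
Qed.

Lemma integral_mul_meas_wrt (g : T -> R) : meas_wrt G g ->
  P.-integrable setT (fun w => (g w * D w)%:E) ->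
  \int[P]_w (g w * D w) = 0.
Proof.
move=> mg igD; rewrite /Rintegral (_ : integral _ _ _ = 0%E)//.
have mD : measurable_fun setT D by apply/measurable_EFinP; exact: measurable_int iD.
have mgT := meas_wrtS GT mg.
have mpos : meas_wrt G (g^\+)%R.
  by apply/meas_wrtP => //; apply: measurable_funrpos; apply/meas_wrtP.
have mneg : meas_wrt G (g^\-)%R.
  by apply/meas_wrtP => //; apply: measurable_funrneg; apply/meas_wrtP.
have le_int f : meas_wrt G f -> (forall w, `|f w| <= `|g w|) ->
    P.-integrable setT (fun w => (f w * D w)%:E).
  move=> mf fg; apply: (le_integrable measurableT _ _ igD).
    by apply/measurable_EFinP; apply: measurable_funM => //; exact: (meas_wrtS GT).
  by move=> w _ /=; rewrite lee_fin !normrM ler_wpM2r.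
have ip : P.-integrable setT (fun w => ((g^\+)%R w * D w)%:E).
  apply: le_int => // w; rewrite ger0_norm ?funrpos_ge0// /funrpos.
  by rewrite ge_max normr_ge0 ler_norm.
have im : P.-integrable setT (fun w => ((g^\-)%R w * D w)%:E).
  apply: le_int => // w; rewrite ger0_norm ?funrneg_ge0// /funrneg.
  by rewrite ge_max normr_ge0 -normrN ler_norm.
rewrite (_ : (fun w => _) = (fun w => ((g^\+)%R w * D w)%:E - ((g^\-)%R w * D w)%:E)%E).
  rewrite integralB// (integral_mul_meas_wrt_ge0 mpos)//.
  by rewrite (integral_mul_meas_wrt_ge0 mneg)// sube0.
apply/funext => w; rewrite -EFinB -mulrBl; congr (_ * _)%:E.
by rewrite /funrpos /funrneg /Order.max; case: ltP => h1; case: ltP => h2; lra.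
Qed.
End sub_sigma_algebra.

Section square_integrable.
Context {d : measure_display} {T : measurableType d} {R : realType}
  (P : probability T R).
Implicit Types f g : T -> R.

Definition L2 f := measurable_fun setT f /\
  P.-integrable setT (fun w => (f w ^+ 2)%:E).

Lemma integrable_cstP (c : R) : P.-integrable setT (EFin \o (fun=> c)).
Proof. exact: finite_measure_integrable_cst. Qed.

Lemma Rintegral_cstP (c : R) : \int[P]_w c = c.
Proof.
rewrite [LHS](_ : _ = \int[P]_w (cst c) w)// Rintegral_cst//=.
have -> : fine (P [set: T]) = 1 by rewrite probability_setT.
by rewrite mulr1.
Qed.

Lemma L2_mul f g : L2 f -> L2 g -> P.-integrable setT (EFin \o (fun w => f w * g w)).
Proof.
move=> [mf if_] [mg ig].
apply: (@integrable_le _ _ _ P _ (fun w => f w ^+ 2 + g w ^+ 2)).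
- exact: measurable_funM.
- exact: (integrableD measurableT if_ ig).
- by move=> w; rewrite ler_norml; apply/andP; split; nra.
Qed.

Lemma L2_cst c : L2 (fun=> c).
Proof. by split => //; exact: integrable_cstP. Qed.

Lemma L2_integrable f : L2 f -> P.-integrable setT (EFin \o f).
Proof.
move=> Lf; have := L2_mul Lf (L2_cst 1).
by apply: eq_integrable => // w _ /=; rewrite mulr1.
Qed.

Lemma L2_le f g : measurable_fun setT f -> L2 g -> (forall w, `|f w| <= `|g w|) -> L2 f.
Proof.
move=> mf [mg ig] fg; split => //.
apply: (@integrable_le _ _ _ P (fun w => f w ^+ 2) (fun w => g w ^+ 2)) => //.
  exact: measurable_funX.
by move=> w; rewrite normrX -[leRHS]real_normK ?num_real// lerXn2r// nnegrE.
Qed.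

Lemma L2D f g : L2 f -> L2 g -> L2 (fun w => f w + g w).
Proof.
move=> [mf if_] [mg ig]; split; first exact: measurable_funD.
apply: (@integrable_le _ _ _ P (fun w => (f w + g w) ^+ 2) (fun w => 2 * f w ^+ 2 + 2 * g w ^+ 2)).
- by apply: measurable_funX; exact: measurable_funD.
- have h1 := integrableZl measurableT 2 if_.
  have h2 := integrableZl measurableT 2 ig.
  exact: (integrableD measurableT h1 h2).
- move=> w; rewrite ger0_norm ?sqr_ge0// -subr_ge0.
  by have -> : 2 * f w ^+ 2 + 2 * g w ^+ 2 - (f w + g w) ^+ 2 = (f w - g w) ^+ 2; [ring|exact: sqr_ge0].
Qed.

Lemma L2Z c f : L2 f -> L2 (fun w => c * f w).
Proof.
move=> [mf if_]; split; first exact: measurable_funM.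
have := integrableZl measurableT (c ^+ 2) if_.
by apply: eq_integrable => // w _ /=; rewrite exprMn.
Qed.

Lemma L2B f g : L2 f -> L2 g -> L2 (fun w => f w - g w).
Proof.
move=> Lf /(L2Z (-1)) /(L2D Lf).
by congr L2; apply/funext => w; rewrite mulN1r.
Qed.

Lemma L2M_bounded f g c : measurable_fun setT f -> (forall w, `|f w| <= c) -> L2 g ->
  L2 (fun w => f w * g w).
Proof.
move=> mf fc Lg; apply: (@L2_le _ (fun w => c * g w)).
- by apply: measurable_funM => //; case: Lg.
- exact: L2Z.
- by move=> w; rewrite !normrM ler_wpM2r// (le_trans (fc w))// ler_norm.
Qed.

Lemma L2_sum (I : Type) (r : seq I) (F : I -> T -> R) : (forall k, L2 (F k)) ->
  L2 (fun w => \sum_(k <- r) F k w).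
Proof.
move=> LF; elim: r => [|k r IH].
  by under eq_fun do rewrite big_nil; exact: L2_cst.
by under eq_fun do rewrite big_cons; exact: L2D.
Qed.

Lemma L2_bounded f c : measurable_fun setT f -> (forall w, `|f w| <= c) -> L2 f.
Proof.
move=> mf fc; have := L2M_bounded mf fc (L2_cst 1).
by congr L2; apply/funext => w; rewrite mulr1.
Qed.

Lemma Rintegral_sum (I : Type) (r : seq I) (F : I -> T -> R) :
  (forall k, P.-integrable setT (EFin \o F k)) ->
  \int[P]_w (\sum_(k <- r) F k w) = \sum_(k <- r) \int[P]_w F k w /\
  P.-integrable setT (EFin \o (fun w => \sum_(k <- r) F k w)).
Proof.
move=> LF; elim: r => [|k r [IH1 IH2]].
  under eq_fun do rewrite big_nil; rewrite Rintegral_cst// mul0r big_nil; split => //.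
  exact: integrable_cstP.
split.
  by under eq_Rintegral do rewrite big_cons; rewrite RintegralD// IH1 big_cons.
under eq_fun do rewrite big_cons; exact: (integrableD measurableT (LF k) IH2).
Qed.
End square_integrable.

Section meas_wrt_closure.
Context {d : measure_display} {T : measurableType d} {R : realType}.
Implicit Types (G : set (set T)) (f g : T -> R).

Lemma meas_wrt_subset G G' f : G `<=` G' -> meas_wrt G f -> meas_wrt G' f.
Proof. by move=> GG mf B mB; apply: GG; exact: mf. Qed.

Lemma meas_wrtD G f g : sigma_algebra setT G -> meas_wrt G f -> meas_wrt G g ->
  meas_wrt G (fun w => f w + g w).
Proof.
move=> sG /(meas_wrtP _ sG) mf /(meas_wrtP _ sG) mg; apply/meas_wrtP => //.
exact: measurable_funD.
Qed.

Lemma meas_wrtB G f g : sigma_algebra setT G -> meas_wrt G f -> meas_wrt G g ->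
  meas_wrt G (fun w => f w - g w).
Proof.
move=> sG /(meas_wrtP _ sG) mf /(meas_wrtP _ sG) mg; apply/meas_wrtP => //.
exact: measurable_funB.
Qed.

Lemma meas_wrtM G f g : sigma_algebra setT G -> meas_wrt G f -> meas_wrt G g ->
  meas_wrt G (fun w => f w * g w).
Proof.
move=> sG /(meas_wrtP _ sG) mf /(meas_wrtP _ sG) mg; apply/meas_wrtP => //.
exact: measurable_funM.
Qed.

Lemma meas_wrt_cst G c : sigma_algebra setT G -> meas_wrt G (fun=> c : R).
Proof. by move=> sG; apply/meas_wrtP. Qed.

Lemma meas_wrt_sum (I : Type) (r : seq I) G (F : I -> T -> R) : sigma_algebra setT G ->
  (forall k, meas_wrt G (F k)) -> meas_wrt G (fun w => \sum_(k <- r) F k w).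
Proof.
move=> sG mF; elim: r => [|k r IH].
  by under eq_fun do rewrite big_nil; exact: meas_wrt_cst.
by under eq_fun do rewrite big_cons; exact: meas_wrtD.
Qed.

Lemma meas_wrt_comp G f (h : R -> R) : meas_wrt G f -> measurable_fun setT h ->
  meas_wrt G (h \o f).
Proof.
move=> mf mh B mB; rewrite comp_preimage; apply: mf.
by have := mh measurableT B mB; rewrite setTI.
Qed.
End meas_wrt_closure.

(** * Scalar Brownian motion *)

Section scalar_brownian_motion.
Context {d : measure_display} {T : measurableType d} {R : realType}
  (P : probability T R).

(* A Brownian motion with variance [q] for its own filtration [G], which is
   only assumed to be a martingale for the larger filtration [F]. *)
Record scalar_brownian (F G : R -> set (set T)) (q : R) (M : R -> T -> R) : Prop := {
  sb_F : is_filtration F;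
  sb_G : is_filtration G;
  sb_measF : forall t, 0 <= t -> meas_wrt (F t) (M t);
  sb_measG : forall t, 0 <= t -> meas_wrt (G t) (M t);
  sb_mart : forall s t A, 0 <= s -> s <= t -> F s A ->
    (\int[P]_(w in A) (M t w - M s w)%:E = 0)%E;
  sb_L2 : forall s t, 0 <= s -> s <= t -> L2 P (fun w => (M t w - M s w) ^+ 2);
  sb_m2 : forall s t, 0 <= s -> s <= t ->
    \int[P]_w (M t w - M s w) ^+ 2 = (t - s) * q;
  sb_m4 : forall s t, 0 <= s -> s <= t ->
    \int[P]_w (M t w - M s w) ^+ 4 <= 3 * ((t - s) * q) ^+ 2;
  sb_sq : forall s t A, 0 <= s -> s <= t -> G s A ->
    (\int[P]_(w in A) ((M t w - M s w) ^+ 2 - (t - s) * q)%:E = 0)%E }.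

Variables (F G : R -> set (set T)) (q : R) (M : R -> T -> R).
Hypothesis B : scalar_brownian F G q M.

Lemma sb_L2i (s t : R) : 0 <= s -> s <= t -> L2 P (fun w => M t w - M s w).
Proof.
move=> s0 st; have t0 := le_trans s0 st.
have [FF Fm] := sb_F B.
have mM u : 0 <= u -> measurable_fun setT (M u).
  by move=> u0; apply: (meas_wrtS (FF u u0).2); exact: (sb_measF B).
split; first by apply: measurable_funB; exact: mM.
exact: (L2_integrable (sb_L2 B s0 st)).
Qed.

Lemma sb_mul_incr (s t : R) (H : T -> R) : 0 <= s -> s <= t -> meas_wrt (F s) H ->
  P.-integrable setT (EFin \o (fun w => H w * (M t w - M s w))) ->
  \int[P]_w (H w * (M t w - M s w)) = 0.
Proof.
move=> s0 st mH iH; have [FF Fm] := sb_F B.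
have [sF FT] := FF s s0.
apply: (integral_mul_meas_wrt sF FT) => //.
- exact: L2_integrable (sb_L2i s0 st).
- by move=> A FA; exact: (sb_mart B).
Qed.

(** In the expanded square the cross term is an increment after [u] times an [F u]-measurable
    factor, so the martingale property kills it. *)
Lemma sb_cross_F (s u t : R) (H : T -> R) (c : R) : 0 <= s -> s <= u -> u <= t ->
  meas_wrt (F s) H -> (forall w, `|H w| <= c) ->
  \int[P]_w (H w * (M t w - M s w) ^+ 2) =
  \int[P]_w (H w * (M u w - M s w) ^+ 2) + \int[P]_w (H w * (M t w - M u w) ^+ 2).
Proof.
move=> s0 su ut mH Hc; have u0 := le_trans s0 su; have st := le_trans su ut.
have [FF Fmono] := sb_F B.
have mHT := meas_wrtS (FF s s0).2 mH.
have i1 a b : 0 <= a -> a <= b -> P.-integrable setT (EFin \o (fun w => H w * (M b w - M a w) ^+ 2)).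
  by move=> a0 ab; exact: L2_integrable (L2M_bounded mHT Hc (sb_L2 B a0 ab)).
have L1 : L2 P (fun w => H w * (M u w - M s w)) by exact: L2M_bounded mHT Hc (sb_L2i s0 su).
have i2 := L2_mul L1 (sb_L2i u0 ut).
have z : \int[P]_w (H w * (M u w - M s w) * (M t w - M u w)) = 0.
  apply: sb_mul_incr => //.
  apply: meas_wrtM; [exact: (FF u u0).1|exact: meas_wrt_subset (Fmono s u s0 su) mH|].
  apply: meas_wrtB; [exact: (FF u u0).1|exact: (sb_measF B)|].
  by apply: meas_wrt_subset (Fmono s u s0 su) _; exact: (sb_measF B).
transitivity (\int[P]_w ((H w * (M u w - M s w) ^+ 2 + H w * (M t w - M u w) ^+ 2) +
   2 * (H w * (M u w - M s w) * (M t w - M u w)))).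
  by apply: eq_Rintegral => w _; ring.
rewrite RintegralD//; last 2 first.
- exact: (integrableD measurableT (i1 _ _ s0 su) (i1 _ _ u0 ut)).
- exact: (integrableZl measurableT 2 i2).
rewrite RintegralD//; [|exact: i1|exact: i1].
by rewrite RintegralZl// z mulr0 addr0.
Qed.

Section equal_partition.
Variables (s e : R).
Hypotheses (s0 : 0 <= s) (e0 : 0 <= e).
Local Notation tk k := (s + k%:R * e).
Let tk0 k : 0 <= tk k. Proof. by rewrite addr_ge0// mulr_ge0. Qed.
Let tkS k : tk k <= tk k.+1. Proof. by rewrite lerD2l ler_wpM2r// ler_nat. Qed.
Let stk k : s <= tk k. Proof. by rewrite lerDl mulr_ge0. Qed.

Let tkSk k : tk k.+1 - tk k = e. Proof. by rewrite -natr1; ring. Qed.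

Definition sq_dev (n : nat) (w : T) :=
  \sum_(k < n) ((M (tk k.+1) w - M (tk k) w) ^+ 2 - e * q).

Lemma sb_F_sum (H : T -> R) (c : R) n : meas_wrt (F s) H -> (forall w, `|H w| <= c) ->
  \int[P]_w (H w * (M (tk n) w - M s w) ^+ 2) =
  \sum_(k < n) \int[P]_w (H w * (M (tk k.+1) w - M (tk k) w) ^+ 2).
Proof.
move=> mH Hc; elim: n => [|n IH].
  rewrite big_ord0 mul0r addr0; under eq_Rintegral do rewrite subrr expr0n/= mulr0.
  by rewrite Rintegral_cstP.
by rewrite big_ord_recr/= -IH; apply: sb_cross_F.
Qed.

Lemma L2_sq_dev n : L2 P (sq_dev n).
Proof.
apply: L2_sum => k; apply: L2B; last exact: L2_cst.
exact: (sb_L2 B).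
Qed.

Lemma sq_dev_var k : \int[P]_w ((M (tk k.+1) w - M (tk k) w) ^+ 2 - e * q) ^+ 2 <=
  2 * (e * q) ^+ 2.
Proof.
have L := sb_L2 B (tk0 k) (tkS k).
have i4 : P.-integrable setT (EFin \o (fun w => (M (tk k.+1) w - M (tk k) w) ^+ 4)).
  by have := L.2; apply: eq_integrable => // w _ /=; rewrite -exprM.
have i2 := L2_integrable L.
have -> : \int[P]_w ((M (tk k.+1) w - M (tk k) w) ^+ 2 - e * q) ^+ 2 =
  \int[P]_w (((M (tk k.+1) w - M (tk k) w) ^+ 4 + (e * q) ^+ 2) -
    2 * (e * q) * (M (tk k.+1) w - M (tk k) w) ^+ 2).
  by apply: eq_Rintegral => w _; ring.
rewrite RintegralB//; last 2 first.
- exact: (integrableD measurableT i4 (integrable_cstP P _)).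
- exact: (integrableZl measurableT _ i2).
rewrite RintegralD//; last exact: integrable_cstP.
rewrite RintegralZl// Rintegral_cstP (sb_m2 B)// tkSk.
have := sb_m4 B (tk0 k) (tkS k); rewrite tkSk => h.
nra.
Qed.

(** For the small filtration [G] the centred squared increments are martingale differences, so their
    variances add. With [e] of order [1 / n] the bound is of order [1 / n]. *)
Lemma sq_dev_L2 n : \int[P]_w (sq_dev n w) ^+ 2 <= n%:R * (2 * (e * q) ^+ 2).
Proof.
have [GG Gmono] := sb_G B.
elim: n => [|n IH].
  rewrite mul0r; under eq_Rintegral do rewrite /sq_dev big_ord0 expr0n/=.
  by rewrite Rintegral_cstP.
pose D w := (M (tk n.+1) w - M (tk n) w) ^+ 2 - e * q.
have LD : L2 P D by apply: L2B; [exact: (sb_L2 B)|exact: L2_cst].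
have z : \int[P]_w (sq_dev n w * D w) = 0.
  apply: (integral_mul_meas_wrt (GG _ (tk0 n)).1 (GG _ (tk0 n)).2).
  - exact: L2_integrable.
  - move=> A GA; have := sb_sq B (tk0 n) (tkS n) GA; rewrite tkSk; exact.
  - rewrite /sq_dev.
    have mk (k : 'I_n) : meas_wrt (G (tk n)) (fun w => (M (tk k.+1) w - M (tk k) w) ^+ 2 - e * q).
      have sG := (GG _ (tk0 n)).1.
      have mM (j : nat) : (j <= n)%N -> meas_wrt (G (tk n)) (M (tk j)).
        move=> jn; apply: meas_wrt_subset (sb_measG B (tk0 j)).
        by apply: Gmono => //; rewrite lerD2l ler_wpM2r// ler_nat.
      apply: meas_wrtB => //; last exact: meas_wrt_cst.
      by apply: meas_wrtM => //; apply: meas_wrtB => //; apply: mM; [|exact: ltnW|..]; try exact: ltnW.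
    by apply: meas_wrt_sum => //; exact: (GG _ (tk0 n)).1.
  - exact: (L2_mul (L2_sq_dev n) LD).
have -> : \int[P]_w (sq_dev n.+1 w) ^+ 2 =
    \int[P]_w ((sq_dev n w) ^+ 2 + D w ^+ 2 + 2 * (sq_dev n w * D w)).
  by apply: eq_Rintegral => w _; rewrite /sq_dev big_ord_recr/= -/(D w); ring.
have iS := (L2_sq_dev n).2; have iD := LD.2.
have ic := L2_mul (L2_sq_dev n) LD.
rewrite RintegralD//; last 2 first.
- exact: (integrableD measurableT iS iD).
- exact: (integrableZl measurableT _ ic).
rewrite RintegralD// RintegralZl// z mulr0 addr0 -natr1 mulrDl mul1r lerD//.
exact: sq_dev_var.
Qed.
End equal_partition.

(** The conditional variance given [F s]. The weight [H] is not [G]-measurable, so the square is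
    first split along a fine partition ([sb_F_sum], using [F]), and then the sum of squares is
    replaced by its L2 limit ([sq_dev_L2], using [G]). *)
Lemma sb_mul_sq (s t : R) (H : T -> R) (c : R) : 0 <= s -> s <= t ->
  meas_wrt (F s) H -> (forall w, `|H w| <= c) ->
  \int[P]_w (H w * (M t w - M s w) ^+ 2) = (t - s) * q * \int[P]_w H w.
Proof.
move=> s0 st mH Hc; have [FF Fm] := sb_F B.
have mHT := meas_wrtS (FF s s0).2 mH.
have iH : P.-integrable setT (EFin \o H) by exact: L2_integrable (L2_bounded P mHT Hc).
have c0 : 0 <= c by rewrite (le_trans (normr_ge0 _) (Hc point)).
apply/eqP; rewrite -subr_eq0 -normr_le0; apply/ler_addgt0Pl => eps eps0; rewrite addr0.
(* With [n] steps the second moment of [sq_dev] is at most [K / n], which is brought below [a^2];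
   the splitting [c |y| <= c a / 2 + c y^2 / (2 a)] then gives [c a <= eps]. *)
pose K := 2 * ((t - s) * q) ^+ 2.
have K0 : 0 <= K by rewrite mulr_ge0// sqr_ge0.
pose a := eps / (c + 1).
have a0 : 0 < a by rewrite divr_gt0// ltr_wpDl.
have [n n0 nK] : exists2 n : nat, 0 < n%:R :> R & K / a ^+ 2 < n%:R.
  by exists (Num.truncn (K / a ^+ 2)).+1; [rewrite ltr0n|exact: truncnS_gt].
have nn : n%:R != 0 :> R by rewrite gt_eqF.
have aa : a != 0 by rewrite gt_eqF.
pose e := (t - s) / n%:R.
have e0 : 0 <= e by rewrite divr_ge0 ?subr_ge0// ltW.
have tE : s + n%:R * e = t by rewrite /e; field; exact: nn.
have E1 : \int[P]_w (H w * (M t w - M s w) ^+ 2) - (t - s) * q * \int[P]_w H w =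
    \int[P]_w (H w * sq_dev s e n w).
  rewrite -{1}tE (sb_F_sum s0 e0 n mH Hc).
  have -> : \int[P]_w (H w * sq_dev s e n w) =
     \int[P]_w (\sum_(k < n) (H w * ((M (s + k.+1%:R * e) w - M (s + k%:R * e) w) ^+ 2 - e * q))).
    by apply: eq_Rintegral => w _; rewrite /sq_dev big_distrr.
  have ik (k : nat) : P.-integrable setT (EFin \o (fun w =>
      H w * (M (s + k.+1%:R * e) w - M (s + k%:R * e) w) ^+ 2)).
    apply: L2_integrable; apply: L2M_bounded mHT Hc _; apply: (sb_L2 B).
      by rewrite addr_ge0// mulr_ge0.
    by rewrite lerD2l ler_wpM2r// ler_nat.
  rewrite (Rintegral_sum (F := fun k : 'I_n => _) _ _).1; last first.
    move=> k; have := integrableB measurableT (ik k) (integrableZl measurableT (e * q) iH).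
    by apply: eq_integrable => // w _ /=; rewrite mulrBr EFinB (mulrC (H w) (e * q)) EFinM.
  have -> : (t - s) * q * \int[P]_w H w = \sum_(k < n) (e * q * \int[P]_w H w).
    by rewrite sumr_const card_ord -mulr_natl /e; field; exact: nn.
  rewrite -sumrB; apply: eq_bigr => k _.
  rewrite -RintegralZl// -RintegralB//.
    by apply: eq_Rintegral => w _; ring.
  exact: (integrableZl measurableT (e * q) iH).
rewrite E1.
have LS := L2_sq_dev s0 e0 n.
have mS := LS.1.
have iHS : P.-integrable setT (EFin \o (fun w => H w * sq_dev s e n w)).
  exact: L2_integrable (L2M_bounded mHT Hc LS).
apply: (le_trans (le_normr_Rintegral measurableT iHS)).
have bound w : `|H w * sq_dev s e n w| <= c / 2 * a + c / (2 * a) * (sq_dev s e n w) ^+ 2.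
  rewrite normrM; apply: (@le_trans _ _ (c * `|sq_dev s e n w|)); first exact: ler_wpM2r.
  rewrite -[sq_dev s e n w ^+ 2]real_normK ?num_real//.
  have : 0 <= (`|sq_dev s e n w| - a) ^+ 2 by exact: sqr_ge0.
  move: `|sq_dev s e n w| => y hy.
  have -> : c / 2 * a + c / (2 * a) * y ^+ 2 = c * ((y ^+ 2 + a ^+ 2) / (2 * a)).
    by field; exact: aa.
  apply: ler_wpM2l => //; have a2 : 0 < 2 * a by rewrite mulr_gt0.
  rewrite ler_pdivlMr//.
  have E : y ^+ 2 + a ^+ 2 - y * (2 * a) = (y - a) ^+ 2 by ring.
  by rewrite -subr_ge0 E.
have i1 := integrable_cstP P (c / 2 * a).
have i2 := integrableZl measurableT (c / (2 * a)) LS.2.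
apply: (le_trans (le_Rintegral measurableT _ (integrableD measurableT i1 i2) (fun w _ => bound w))).
  exact: (integrable_norm iHS).
rewrite RintegralD// Rintegral_cstP RintegralZl//; last exact: LS.2.
have SL := sq_dev_L2 s0 e0 n.
have : n%:R * (2 * (e * q) ^+ 2) <= a ^+ 2.
  have -> : n%:R * (2 * (e * q) ^+ 2) = K / n%:R by rewrite /K /e; field; exact: nn.
  rewrite ler_pdivrMr// mulrC -ler_pdivrMr ?exprn_gt0//.
  exact: ltW.
move=> /(le_trans SL) h.
apply: (@le_trans _ _ (c / 2 * a + c / (2 * a) * a ^+ 2)).
  by rewrite lerD2l ler_wpM2l// divr_ge0// mulr_ge0// ltW.
have -> : c / 2 * a + c / (2 * a) * a ^+ 2 = eps * (c / (c + 1)).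
  rewrite /a; field; apply/andP; split; rewrite gt_eqF//; lra.
rewrite -[leRHS]mulr1 ler_wpM2l ?(ltW eps0)// ler_pdivrMr ?mul1r ?lerDl//.
by rewrite ltr_wpDl.
Qed.
End scalar_brownian_motion.

(** * Integrability of the supremum of a Brownian path *)

Section chaining.
Context {d : measure_display} {T : measurableType d} {R : realType}
  (P : probability T R).
Variables (F G : R -> set (set T)) (q : R) (M : R -> T -> R).
Hypothesis B : scalar_brownian P F G q M.
Hypothesis cM : forall w, {within `[0, +oo[, continuous (fun t => M t w)}.

Local Notation dy m k := (k%:R / (2 ^ m)%:R : R).
Let rho : R := 9 / 10.

(** Bounds every dyadic increment [x] of level [m], as either [|x| <= rho^m] or
    [|x| <= x^4 / rho^(3 m)]. The second part has mean at most [3 q^2 (1 / (2 rho^3))^m], and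
    [rho = 9 / 10] satisfies [1 <= 2 rho^4], so both parts are summable over the levels. *)
Definition chain_bound (m : nat) (w : T) : R :=
  rho ^+ m + (rho ^- m) ^+ 3 * \sum_(k < 2 ^ m) (M (dy m k.+1) w - M (dy m k) w) ^+ 4.

Let dy0 m k : 0 <= dy m k. Proof. by rewrite divr_ge0. Qed.
Let dyS m k : dy m k <= dy m k.+1. Proof. by rewrite ler_wpM2r ?invr_ge0// ler_nat. Qed.
Let rho_gt0 : 0 < rho. Proof. by rewrite /rho divr_gt0. Qed.

Lemma chain_bound_ge0 m w : 0 <= chain_bound m w.
Proof.
rewrite addr_ge0 ?exprn_ge0 ?(ltW rho_gt0)// mulr_ge0 ?exprn_ge0 ?invr_ge0 ?exprn_ge0 ?(ltW rho_gt0)//.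
by apply: sumr_ge0 => k _; exact: exprn_even_ge0.
Qed.

Lemma chain_bound_step m k w : (k < 2 ^ m)%N ->
  `|M (dy m k.+1) w - M (dy m k) w| <= chain_bound m w.
Proof.
move=> km; set x := M _ w - _.
have e0 : 0 < rho ^+ m by rewrite exprn_gt0.
have xs : x ^+ 4 <= \sum_(k < 2 ^ m) (M (dy m k.+1) w - M (dy m k) w) ^+ 4.
  rewrite (bigD1 (Ordinal km))//= lerDl.
  by apply: sumr_ge0 => j _; exact: exprn_even_ge0.
rewrite /chain_bound; move: (\sum_(k < _) _) xs => S xS.
have S0 : 0 <= S by rewrite (le_trans _ xS)// exprn_even_ge0.
have r0 : 0 <= (rho ^- m) ^+ 3 by rewrite exprn_ge0// invr_ge0 ltW.
have [h|h] := leP `|x| (rho ^+ m).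
  by rewrite (le_trans h)// lerDl mulr_ge0.
rewrite (le_trans (y := (rho ^- m) ^+ 3 * x ^+ 4))//; last first.
  by rewrite -[leLHS]add0r lerD ?(ltW e0)// ler_wpM2l.
have -> : x ^+ 4 = `|x| ^+ 4.
  by rewrite -normrX ger0_norm// exprn_even_ge0.
rewrite exprVn -ler_pdivrMl ?invr_gt0 ?exprn_gt0// invrK [leRHS]exprSr.
have x0 : 0 < `|x| by exact: lt_trans h.
by rewrite ler_pM2r// lerXn2r ?nnegrE ?normr_ge0 ?ltW.
Qed.

(** An even index already belongs to the coarser level, and an odd one is a single step away from an
    even one, so each level contributes one term. *)
Lemma chain_dyadic m j w : (j <= 2 ^ m)%N ->
  `|M (dy m j) w - M 0 w| <= \sum_(l < m.+1) chain_bound l w.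
Proof.
elim: m j => [|m IH] j jm.
  rewrite big_ord1; move: jm; rewrite expn0; case: j => [|[|//]] _.
    by rewrite mul0r subrr normr0 chain_bound_ge0.
  have := @chain_bound_step 0 0 w erefl.
  by rewrite mul0r.
have half i : dy m i = dy m.+1 i.*2.
  rewrite -muln2 expnS natrM [in RHS]natrM; field.
  by rewrite pnatr_eq0 expn_eq0.
rewrite big_ord_recr/=.
have jj : j = (odd j + j./2.*2)%N by rewrite odd_double_half.
have j2 : (j./2 <= 2 ^ m)%N.
  by rewrite -leq_double -[X in (_ <= X)%N]mul2n -expnS (leq_trans _ jm)// {2}jj leq_addl.
case: (boolP (odd j)) => oj.
  have jE : j = (j./2.*2).+1 by rewrite {1}jj oj add1n.
  rewrite jE -(subrK (M (dy m.+1 j./2.*2) w) (M _ w)) -addrA addrC.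
  rewrite (le_trans (ler_normD _ _))// lerD//.
    by rewrite -half; exact: IH.
  apply: chain_bound_step; apply: leq_trans jm.
  by rewrite [X in (_ < X)%N]jE.
rewrite {1}jj (negbTE oj) add0n -half ler_wpDr ?chain_bound_ge0//; exact: IH.
Qed.

Definition chain_sup (w : T) : \bar R := (\sum_(0 <= l <oo) (chain_bound l w)%:E)%E.

Lemma chain_sup_bound w (t : R) : 0 <= t <= 1 -> (`|M t w - M 0 w|%:E <= chain_sup w)%E.
Proof.
move=> /andP[t0 t1].
have dyb m j : (j <= 2 ^ m)%N -> (`|M (dy m j) w - M 0 w|%:E <= chain_sup w)%E.
  move=> jm; apply: (@le_trans _ _ (\sum_(0 <= l < m.+1) (chain_bound l w)%:E)%E).
    by rewrite sumEFin lee_fin big_mkord; exact: chain_dyadic.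
  by apply: nneseries_lim_ge => l _ _; rewrite lee_fin chain_bound_ge0.
pose u (m : nat) : R := dy m (Num.truncn (t * (2 ^ m)%:R)).
have p2 m : 0 < (2 ^ m)%:R :> R by rewrite ltr0n expn_gt0.
have um m : 0 <= u m <= t.
  rewrite /u divr_ge0//= ler_pdivrMr// truncn_le// mulr_ge0//.
have umt m : t - u m <= (2 ^ m)%:R^-1.
  rewrite lerBlDl /u -[X in _ <= _ + X]mul1r -mulrDl ler_pdivlMr// natr1.
  by rewrite ltW// truncnS_gt.
have ucv : u @ \oo --> t.
  apply/cvgrPdist_le => e e0; exists (Num.truncn e^-1).+1 => // m /= em.
  have [_ ut] := andP (um m).
  rewrite ger0_norm ?subr_ge0// (le_trans (umt m))// -[e]invrK lef_pV2// ?posrE ?invr_gt0//.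
  rewrite (le_trans (ltW (truncnS_gt _)))// ler_nat (leq_trans em)// ltnW// ltn_expl//.
have cw : M (u m) w @[m --> \oo] --> M t w.
  have /continuous_within_itvcyP[ct c0] := @cM w.
  move: t0; rewrite le_eqVlt => /predU1P[t0|t0].
    have u0 m : u m = 0 by apply/eqP; rewrite eq_le; have := um m; rewrite -t0 andbC.
    by under eq_fun do rewrite u0; rewrite -t0; exact: cvg_cst.
  apply: (cvg_comp u (fun t => M t w) ucv); apply: ct.
  by rewrite in_itv/= andbT.
have cn : `|M (u m) w - M 0 w|%:E @[m --> \oo] --> `|M t w - M 0 w|%:E.
  apply: cvg_EFin; first exact: nearW.
  by apply: cvg_norm; apply: cvgB => //; exact: cvg_cst.
rewrite -(cvg_lim (@ereal_hausdorff R) cn); apply: lime_le.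
- exact: cvgP cn.
- apply: nearW => m; apply: dyb.
  rewrite -(ler_nat R) (le_trans (y := t * (2 ^ m)%:R))//.
    by rewrite truncn_le// mulr_ge0.
  by rewrite -[leRHS]mul1r ler_pM2r.
Qed.

Lemma chain_sup_integrable : measurable_fun setT chain_sup /\
  (forall w, (0 <= chain_sup w)%E) /\ (\int[P]_w chain_sup w < +oo)%E.
Proof.
have L m k : L2 P (fun w => (M (dy m k.+1) w - M (dy m k) w) ^+ 2) by exact: (sb_L2 B).
have i4 m k : P.-integrable setT (EFin \o (fun w => (M (dy m k.+1) w - M (dy m k) w) ^+ 4)).
  by have := (L m k).2; apply: eq_integrable => // w _ /=; rewrite -exprM.
have ib m : P.-integrable setT (EFin \o chain_bound m).
  have [_ iS] := Rintegral_sum (index_enum 'I_(2 ^ m)) (fun k : 'I_(2 ^ m) => i4 m k).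
  exact: (integrableD measurableT (integrable_cstP P _) (integrableZl measurableT _ iS)).
have mb m : measurable_fun setT (EFin \o chain_bound m) by exact: measurable_int (ib m).
have b0 m w : (0 <= (chain_bound m w)%:E)%E by rewrite lee_fin chain_bound_ge0.
split; first by apply: ge0_emeasurable_sum => *; [exact: b0|exact: mb].
split; first by move=> w; exact: nneseries_ge0.
rewrite integral_nneseries//.
have Eb m : (\int[P]_w (chain_bound m w)%:E <= ((1 + 3 * q ^+ 2) * rho ^+ m)%:E)%E.
  rewrite -[leLHS]fineK; last exact: integrable_fin_num (ib m).
  rewrite lee_fin -/(Rintegral _ _ _).
  have [S1 iS] := Rintegral_sum (index_enum 'I_(2 ^ m)) (fun k : 'I_(2 ^ m) => i4 m k).
  rewrite RintegralD//; last 2 first.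
  - exact: integrable_cstP.
  - exact: (integrableZl measurableT _ iS).
  rewrite Rintegral_cstP RintegralZl// S1 mulrDl mul1r lerD2l.
  have p2 : 0 < (2 ^ m)%:R :> R by rewrite ltr0n expn_gt0.
  apply: (@le_trans _ _ ((rho ^- m) ^+ 3 * \sum_(k < 2 ^ m) (3 * ((2 ^ m)%:R^-1 * q) ^+ 2))).
    apply: ler_wpM2l; first by rewrite exprn_ge0// invr_ge0 exprn_ge0// ltW.
    apply: ler_sum => k _; have := sb_m4 B (dy0 m k) (dyS m k).
    have -> : dy m k.+1 - dy m k = (2 ^ m)%:R^-1 by rewrite -natr1; ring.
    by [].
  rewrite sumr_const card_ord -[X in _ * X <= _]mulr_natl.
  have fE (a r b : R) : a != 0 -> r * (a * (3 * (a^-1 * b) ^+ 2)) = 3 * b ^+ 2 * (r / a).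
    by move=> a0; field.
  rewrite fE ?gt_eqF//.
  apply: ler_wpM2l; first by rewrite mulr_ge0// sqr_ge0.
  rewrite natrX -exprVn -[X in X ^+ 3]exprVn -exprM mulnC exprM -exprMn.
  rewrite lerXn2r ?nnegrE ?mulr_ge0 ?exprn_ge0 ?invr_ge0 ?(ltW rho_gt0)//.
  by rewrite /rho; lra.
have geo n : \sum_(0 <= l < n) rho ^+ l <= 10 - 10 * rho ^+ n.
  elim: n => [|n IH]; first by rewrite big_nil expr0; lra.
  rewrite big_nat_recr//= exprS.
  apply: (le_trans (lerD IH (lexx _))); rewrite /rho; lra.
apply: (@le_lt_trans _ _ ((1 + 3 * q ^+ 2) * 10)%:E); last exact: ltry.
apply: lime_le.
  by apply: is_cvg_nneseries => n _ _; apply: integral_ge0 => w _.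
apply: nearW => n.
apply: (@le_trans _ _ (\sum_(0 <= l < n) ((1 + 3 * q ^+ 2) * rho ^+ l)%:E)%E).
  by apply: lee_sum => l _; exact: Eb.
rewrite sumEFin lee_fin -mulr_sumr ler_wpM2l//.
  by rewrite addr_ge0// mulr_ge0// sqr_ge0.
by rewrite (le_trans (geo n))// gerBl mulr_ge0// exprn_ge0// ltW.
Qed.
End chaining.

(** * Coordinates and inner product in the plane *)

Section dot_lemmas.
Context {R : realType}.
Implicit Types (u v w : 'cV[R]_2) (i : 'I_2).

Lemma neq_rev_ord i : rev_ord i != i.
Proof. by case: i => [[|[|]]]. Qed.

Lemma big_ord2_rev (V : nmodType) (f : 'I_2 -> V) i : \sum_k f k = f i + f (rev_ord i).
Proof.
rewrite (bigD1 i)//= (bigD1 (rev_ord i))//= ?neq_rev_ord// big1 ?addr0// => k.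
by case: i => [[|[|//]]] ?; case: k => [[|[|//]]] ?.
Qed.

Lemma dotE i u v : dot u v = u i 0 * v i 0 + u (rev_ord i) 0 * v (rev_ord i) 0.
Proof. exact: big_ord2_rev. Qed.

Lemma dotC u v : dot u v = dot v u.
Proof. by apply: eq_bigr => k _; rewrite mulrC. Qed.

Lemma dotDr u v w : dot u (v + w) = dot u v + dot u w.
Proof. by rewrite /dot -big_split; apply: eq_bigr => k _; rewrite !mxE mulrDr. Qed.

Lemma dotZr u a v : dot u (a *: v) = a * dot u v.
Proof. by rewrite /dot mulr_sumr; apply: eq_bigr => k _; rewrite !mxE mulrCA. Qed.

Lemma dotNr u v : dot u (- v) = - dot u v.
Proof. by rewrite -scaleN1r dotZr mulN1r. Qed.

Lemma dotBr u v w : dot u (v - w) = dot u v - dot u w.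
Proof. by rewrite dotDr dotNr. Qed.

Lemma dot0r u : dot u 0 = 0.
Proof. by rewrite -(scale0r 0) dotZr mul0r. Qed.

Lemma continuous_coord_cV i : continuous (fun v : 'cV[R]_2 => v i 0 : R).
Proof. exact: coord_continuous. Qed.

Lemma continuous_dot u : continuous (dot u : 'cV[R]_2 -> R).
Proof.
have -> : dot u = fun v => u 0 0 * v 0 0 + u (rev_ord 0) 0 * v (rev_ord 0) 0.
  by apply/funext => v; exact: dotE.
have c k : continuous (fun v : 'cV[R]_2 => u k 0 * v k 0 : R).
  move=> v; exact: (continuous_comp (@continuous_coord_cV k v) (@mulrl_continuous R (u k 0) _)).
by move=> v; exact: (continuousD (c 0 v) (c (rev_ord 0) v)).
Qed.

Lemma continuous_measurable_plane (f : 'cV[R]_2 -> R) : continuous f ->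
  measurable_fun setT (f : plane R -> R).
Proof.
move=> /continuousP cf; apply: (measurability _ (RGenOpens.measurableE R)).
move=> _ [_ [a [b ->] <-]]; rewrite setTI; apply: sub_gen_smallest.
by apply: cf; exact: interval_open.
Qed.

Lemma measurable_dot u : measurable_fun setT (dot u : plane R -> R).
Proof. by apply: continuous_measurable_plane; exact: continuous_dot. Qed.
End dot_lemmas.

(** * Linear functionals of the driving Brownian motion *)

Section scalar_brownian_of_srbm.
Context {R : realType} {d : measure_display} {T : measurableType d}
  (P : probability T R) (F : R -> set (set T)) (Sigma : 'M[R]_2) (mu th : 'cV[R]_2)
  (X : R -> T -> plane R).
Local Notation q := (dot th (Sigma *m th)).
Hypotheses (th_neq0 : th != 0) (q_gt0 : 0 < q) (fF : is_filtration F)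
  (bm : brownian_motion P Sigma mu X)
  (mart : martingale P F (fun t w => X t w - X 0 w - t *: mu)).

Definition scalar_path (t : R) (w : T) : R := dot th (X t w - X 0 w - t *: mu).
Local Notation M := scalar_path.

Lemma natural_filtrationP : is_filtration (natural_filtration X).
Proof.
have [_ mX _ _] := bm; split.
  move=> t t0; split; first exact: smallest_sigma_algebra.
  apply: smallest_sub; first exact: sigma_algebra_measurable.
  move=> _ [u [B [u0 _ mB ->]]].
  by have := mX u u0 measurableT B mB; rewrite setTI.
move=> s t s0 st; apply: sub_smallest2r; first exact: smallest_sigma_algebra.
move=> A [u [B [u0 us mB ->]]]; exists u, B; split => //; exact: le_trans us st.
Qed.

Lemma scalar_path_incr s t w :
  M t w - M s w = dot th (X t w - X s w) - (t - s) * dot th mu.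
Proof. by rewrite /M !dotBr !dotZr; ring. Qed.

Lemma law_incr (s t : R) (f : R -> R) : 0 <= s -> s < t -> (forall x, 0 <= f x) ->
  measurable_fun setT f ->
  measurable_fun setT (fun w => dot th (X t w - X s w)) /\
  (\int[P]_w (f (dot th (X t w - X s w)))%:E =
   \int[normal_prob ((t - s) * dot th mu) (Num.sqrt ((t - s) * q))]_x (f x)%:E)%E.
Proof.
move=> s0 st f0 mf; have [_ _ gau _] := bm.
have [mU law] := gau s t s0 st.
have mU2 : measurable_fun setT (fun w => dot th (X t w - X s w)).
  exact: (measurableT_comp (measurable_dot th) mU).
split => //.
have mU3 : measurable_fun setT ((fun w => dot th (X t w - X s w)) : T -> measurableTypeR R) by exact: mU2.
have H := @ge0_integral_pushforward _ _ _ (measurableTypeR R) R _ mU3 P setT (EFin \o f) measurableT.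
 rewrite -[LHS]/(\int[P]_(w in (fun w => dot th (X t w - X s w)) @^-1` setT) ((EFin \o f) \o (fun w => dot th (X t w - X s w))) w)%E.
rewrite -H//; last 2 first.
- exact/measurable_EFinP.
- by move=> x _; rewrite lee_fin.
apply: eq_measure_integral => A mA _.
rewrite /pushforward/= -dotZr.
have := law th th_neq0 A mA; rewrite -scalemxAl dotZr; exact.
Qed.

Lemma incr_moments (s t : R) : 0 <= s -> s <= t ->
  [/\ measurable_fun setT (fun w => M t w - M s w),
    (\int[P]_w ((M t w - M s w) ^+ 2)%:E = ((t - s) * q)%:E)%E &
    (\int[P]_w ((M t w - M s w) ^+ 4)%:E <= (3 * ((t - s) * q) ^+ 2)%:E)%E].
Proof.
move=> s0; rewrite le_eqVlt => /predU1P[->|st].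
  under eq_fun do rewrite subrr; split => //.
  - by under eq_integral do rewrite subrr expr0n/=; rewrite integral0 subrr mul0r.
  - by under eq_integral do rewrite subrr expr0n/=; rewrite integral0 subrr mul0r expr0n/= mulr0.
have v0 : 0 < (t - s) * q by rewrite mulr_gt0// subr_gt0.
have sq0 : Num.sqrt ((t - s) * q) != 0 by rewrite sqrtr_eq0 -ltNge.
have mp k : measurable_fun setT (fun x : R => (x - (t - s) * dot th mu) ^+ k).
  by apply: measurable_funX; apply: measurable_funB.
under eq_fun do rewrite scalar_path_incr.
have [mU E2] := law_incr s0 st (fun x => sqr_ge0 (x - (t - s) * dot th mu)) (mp 2).
have [_ E4] := law_incr s0 st (fun x => exprn_even_ge0 (x - (t - s) * dot th mu) (isT : ~~ odd 4)) (mp 4).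
split.
- exact: measurable_funB.
- by under eq_integral do rewrite scalar_path_incr; rewrite E2 normal_moment2// sqr_sqrtr// ltW.
- under eq_integral do rewrite scalar_path_incr; rewrite E4.
  by apply: (le_trans (normal_moment4 _ sq0)); rewrite (exprM _ 2 2) sqr_sqrtr// ltW.
Qed.

Lemma incr_L2 (s t : R) : 0 <= s -> s <= t -> L2 P (fun w => (M t w - M s w) ^+ 2).
Proof.
move=> s0 st; have [mU _ E4] := incr_moments s0 st.
split; first exact: measurable_funX.
apply/integrableP; split.
  by apply/measurable_EFinP; apply: measurable_funX; apply: measurable_funX.
apply: (@le_lt_trans _ _ (\int[P]_w ((M t w - M s w) ^+ 4)%:E)%E).
  by apply: ge0_le_integral => //=; [apply/measurable_EFinP; do 3 ?apply: measurableT_comp => //; apply: measurable_funX; apply: measurable_funX|apply/measurable_EFinP; exact: measurable_funX|move=> w _; rewrite ger0_norm ?sqr_ge0// -exprM].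
exact: (le_lt_trans E4 (ltry _)).
Qed.

(** Independence of events is upgraded by [integral_mul_meas_wrt] with the roles exchanged: the
    centred indicator of [A] is the orthogonal variable, and the sigma-algebra is the one generated
    by the increment. *)
Lemma incr_indep (s t : R) A : 0 <= s -> s <= t -> natural_filtration X s A ->
  (\int[P]_(w in A) ((M t w - M s w) ^+ 2 - (t - s) * q)%:E = 0)%E.
Proof.
move=> s0 st GA; have [mU E2 _] := incr_moments s0 st.
have L := incr_L2 s0 st.
move: st; rewrite le_eqVlt => /predU1P[ts|st].
  by rewrite -ts; under eq_integral do rewrite !subrr expr0n/= mul0r subr0; rewrite integral0.
have [_ _ gau ind] := bm.
have [/(_ s s0)[_ GT] _] := natural_filtrationP.
have mA := GT A GA.
pose D (w : T) : R := \1_A w - fine (P A).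
pose U w : R := M t w - M s w.
pose G := preimage_set_system setT U (@measurable _ R).
have sG : sigma_algebra setT G.
  by apply: sigma_algebra_preimage; exact: sigma_algebra_measurable.
have GmT : G `<=` measurable by move=> _ [C mC <-]; exact: mU.
have PA : P A \is a fin_num by exact: fin_num_measure.
have iI : P.-integrable setT (EFin \o \1_A) by exact: integrable_indic.
have iD : P.-integrable setT (EFin \o D).
  exact: (integrableB measurableT iI (integrable_cstP P (fine (P A)))).
have D0 C : G C -> (\int[P]_(w in C) (D w)%:E = 0)%E.
  move=> [B0 mB <-]; rewrite setTI.
  have mC : measurable (U @^-1` B0) by have := mU measurableT B0 mB; rewrite setTI.
  under eq_integral do rewrite EFinB.
  rewrite integralB//; last 2 first.
  - exact: (integrableS measurableT _ _ iI).
  - exact: (integrableS measurableT _ _ (integrable_cstP P (fine (P A)))).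
  rewrite integral_indic// integral_cst//= fineK//.
  have H := ind s t s0 st A ((fun v => dot th v - (t - s) * dot th mu) @^-1` B0) GA.
  have UE : U @^-1` B0 = [set w | ((fun v => dot th v - (t - s) * dot th mu) @^-1` B0) (X t w - X s w)].
    by apply/seteqP; split => w /=; rewrite /U scalar_path_incr.
  rewrite UE H//; first by rewrite subee// fin_numM// fin_num_measure// -UE.
  have mf : measurable_fun setT (fun v : plane R => dot th v - (t - s) * dot th mu).
    by apply: measurable_funB => //; exact: measurable_dot.
  by have := mf measurableT B0 mB; rewrite setTI.
pose g w := U w ^+ 2 - (t - s) * q.
have mg : meas_wrt G g.
  have mu0 : meas_wrt G U by move=> B0 mB; exists B0 => //; rewrite setTI.
  apply: meas_wrtB => //; last exact: meas_wrt_cst.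
  by apply: (meas_wrtM sG mu0 mu0).
have Lg : L2 P g by apply: L2B => //; exact: L2_cst.
have LI : L2 P (\1_A : T -> R).
  apply: (@L2_bounded _ _ _ P _ 1) => [|w]; first exact: measurable_indic.
  by rewrite indicE; case: (_ \in _); rewrite ?normr1 ?normr0.
have LD : L2 P D by apply: L2B => //; exact: L2_cst.
have := integral_mul_meas_wrt sG GmT iD D0 mg (L2_mul Lg LD).
have -> : \int[P]_w (g w * D w) = \int[P]_w (g w * \1_A w - fine (P A) * g w).
  by apply: eq_Rintegral => w _; rewrite /D; ring.
have ig := L2_integrable Lg; have igI := L2_mul Lg LI.
have ig2 := integrableZl measurableT (fine (P A)) ig.
rewrite RintegralB// RintegralZl//.
have -> : \int[P]_w g w = 0.
  rewrite /g RintegralB//; last 2 first.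
  - exact: L2_integrable L.
  - exact: integrable_cstP.
  by rewrite Rintegral_cstP /Rintegral E2/= subrr.
rewrite mulr0 subr0 => H.
have igA : P.-integrable A (EFin \o g) by exact: (integrableS measurableT).
rewrite -[LHS]fineK; last exact: integrable_fin_num igA.
congr _%:E; rewrite -H /Rintegral; congr fine; rewrite [LHS]integral_mkcond.
by apply: eq_integral => w _; rewrite epatch_indic /= EFinM.
Qed.

Lemma scalar_brownian_path : scalar_brownian P F (natural_filtration X) q M.
Proof.
have [_ mX _ _] := bm; have [ad iM mM] := mart.
split => //.
- exact: natural_filtrationP.
- move=> t t0 B mB; apply: (ad t t0 (dot th @^-1` B)).
  by have := measurable_dot th measurableT mB; rewrite setTI.
- move=> t t0; have [/(_ t t0)[sG _] _] := natural_filtrationP.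
  have mXu u : 0 <= u -> u <= t -> meas_wrt (natural_filtration X t) (fun w => dot th (X u w)).
    move=> u0 ut B mB; apply: sub_gen_smallest; exists u, (dot th @^-1` B); split => //.
    by have := measurable_dot th measurableT mB; rewrite setTI.
  have -> : M t = fun w => dot th (X t w) - dot th (X 0 w) - t * dot th mu.
    by apply/funext => w; rewrite /M !dotBr dotZr.
  by apply: meas_wrtB => //; [apply: meas_wrtB => //; exact: mXu|exact: meas_wrt_cst].
- move=> s t A s0 st FA; have t0 := le_trans s0 st.
  have mA : measurable A by have [/(_ s s0)[_ +] _] := fF; exact.
  pose W (u : R) i w : R := (X u w - X 0 w - u *: mu) i 0.
  have iW u i : 0 <= u -> P.-integrable A (EFin \o W u i).
    by move=> u0; apply: (integrableS measurableT) => //; exact: iM.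
  have -> : (\int[P]_(w in A) (M t w - M s w)%:E = \int[P]_(w in A)
      (((th 0 0)%:E * ((W t 0 w)%:E - (W s 0 w)%:E)) +
       ((th (rev_ord 0) 0)%:E * ((W t (rev_ord 0) w)%:E - (W s (rev_ord 0) w)%:E))))%E.
    apply: eq_integral => w _; rewrite -!EFinB -!EFinM -EFinD; congr _%:E.
    rewrite /M !(dotE 0) /W; ring.
  have ib i : P.-integrable A (fun w => (W t i w)%:E - (W s i w)%:E)%E.
    by apply: integrableB => //; exact: iW.
  rewrite integralD//; [|exact: integrableZl|exact: integrableZl].
  rewrite !integralZl// !integralB//; try exact: iW.
  rewrite /W !(mM s t _ A s0 st FA).
  rewrite !subee ?mule0 ?adde0//; apply: integrable_fin_num => //; exact: iW.
- exact: incr_L2.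
- by move=> s t s0 st; have [_ E _] := incr_moments s0 st; rewrite /Rintegral E.
- move=> s t s0 st; have [mU _ E] := incr_moments s0 st.
  rewrite -lee_fin /Rintegral fineK// ge0_fin_numE; first exact: le_lt_trans E (ltry _).
  by apply: integral_ge0 => w _; rewrite lee_fin exprn_even_ge0.
- by move=> s t A; exact: incr_indep.
Qed.
End scalar_brownian_of_srbm.

(** * Stieltjes integrals and oscillation of reflected paths *)

Section stieltjes.
Context {R : realType}.
Implicit Types (f g h : R -> R) (F : cumulative R R).
Local Notation ls := (@lebesgue_stieltjes_measure R).

Lemma ls_itv F (a b : R) : a <= b -> ls F `]a, b]%classic = (F b - F a)%:E.
Proof.
move=> ab; rewrite /lebesgue_stieltjes_measure/= /measure_extension/= measurable_mu_extE/=.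
  by rewrite wlength_itv_bnd.
exact: is_ocitv.
Qed.

Lemma ae_eq0_Stieltjes F g : (forall t, 0 <= t -> 0 <= g t) ->
  measurable_fun (`[0, +oo[ : set R) g -> (\int[ls F]_(t in `[0%R, +oo[) (g t)%:E = 0)%E ->
  ae_eq (ls F) (`[0, +oo[%classic : set R) (EFin \o g) (cst 0%E).
Proof.
move=> g0 mg I0; apply/ae_eq_integral_abs => //.
  exact/measurable_EFinP.
rewrite -[RHS]I0; apply: eq_integral => t; rewrite inE/= in_itv/= andbT => t0.
by rewrite ger0_norm// g0.
Qed.

(** The interval []s, t]] lies in the null set outside which [g] vanishes. Its left end is excluded,
    so [s] may be a zero of [g]. *)
Lemma flat_where_positive g f (s t : R) : stieltjes_integral_eq0 g f ->
  (forall t, 0 <= t -> 0 <= g t) -> measurable_fun (`[0, +oo[ : set R) g ->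
  0 <= s -> s <= t -> (forall u, s < u <= t -> 0 < g u) -> f t = f s.
Proof.
move=> [F [FE I0]] g0 mg s0 st gpos.
have [N [mN N0 sub]] := ae_eq0_Stieltjes g0 mg I0.
have : (ls F `]s, t]%classic <= ls F N)%E.
  apply: le_measure; rewrite ?inE//.
  apply: subset_trans sub => u /=; rewrite in_itv/= => su /(_ _)/=.
  have u0 : 0 <= u by case/andP: su => su _; rewrite (le_trans s0)// ltW.
  rewrite in_itv/= andbT => /(_ u0) /eqP; rewrite eqe => /eqP gu.
  by have := gpos u su; rewrite gu ltxx.
rewrite N0 ls_itv// lee_fin !FE (max_idPr s0) (max_idPr (le_trans s0 st)) subr_le0 => le1.
apply/eqP; rewrite eq_le le1 -subr_ge0.
have : F s <= F t by exact: cumulative_is_nondecreasing.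
by rewrite !FE (max_idPr s0) (max_idPr (le_trans s0 st)) subr_ge0.
Qed.

Lemma last_zero g (a b : R) : a <= b -> {within `[a, b], continuous g} ->
  (exists2 u, a <= u <= b & g u = 0) ->
  exists2 t, a <= t <= b & g t = 0 /\ forall u, t < u <= b -> g u != 0.
Proof.
move=> ab cg [u uab gu].
pose Z := [set t | a <= t <= b /\ g t = 0].
have Zs : has_sup Z by split; [exists u|exists b => t [/andP[_ ->]]].
have cZ : closed Z.
  have -> : Z = `[a, b]%classic `&` (from_subspace `[a, b] g) @^-1` [set 0].
    by apply/seteqP; split => t /=; rewrite in_itv.
  have : closed ((from_subspace `[a, b] g) @^-1` [set 0] : set (subspace `[a, b])).
    by move/continuous_closedP : cg; apply; exact: closed_eq.
  move=> /closed_subspaceP[V cV VE].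
  by rewrite setIC -VE; apply: closedI => //; exact: itv_closed.
have Zsup : Z (sup Z) by rewrite [X in X _](closure_id _).1//; exact: closure_sup Zs.1 Zs.2.
exists (sup Z); first by case: Zsup.
split; first by case: Zsup.
move=> v /andP[sv vb]; apply/negP => /eqP gv.
have Zv : Z v by split => //; rewrite vb andbT (le_trans _ (ltW sv))//; case: Zsup => /andP[].
by have := ub_le_sup Zs.2 Zv; rewrite leNgt sv.
Qed.

Local Notation I01 := (`]0%R, 1%R]%classic : set R).

(** Dominated convergence for step functions on left-open cells, whose measures are the increments
    of [F]. The coefficients need only approach [h u] on the cell containing [u]; this leaves room
    for the difference quotients of the Ito formula. *)
Lemma Riemann_Stieltjes F (v : nat -> nat -> R) h (K : R) :
  (forall N k, `|v N k| <= K) ->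
  (forall u, 0 < u <= 1 -> forall e, 0 < e -> exists N0, forall N, (N0 <= N)%N ->
     forall k, k%:R / N.+1%:R < u <= k.+1%:R / N.+1%:R -> `|v N k - h u| <= e) ->
  (ls F).-integrable I01 (EFin \o h) /\
  \sum_(k < N.+1) v N k * (F (k.+1%:R / N.+1%:R) - F (k%:R / N.+1%:R)) @[N --> \oo] -->
  \int[ls F]_(u in I01) h u.
Proof.
move=> vK vh.
pose C (N k : nat) : set R := `]k%:R / N.+1%:R, k.+1%:R / N.+1%:R]%classic.
pose hN N u : R := \sum_(k < N.+1) v N k * \1_(C N k) u.
have lt01 : (ls F I01 < +oo)%E by rewrite ls_itv// ltry.
have np N : 0 < N.+1%:R :> R by rewrite ltr0n.
have Cuniq N k k' u : C N k u -> C N k' u -> k = k'.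
  rewrite /C/= !in_itv/= => /andP[a1 a2] /andP[b1 b2].
  have := lt_le_trans a1 b2; have := lt_le_trans b1 a2.
  rewrite !ltr_pM2r ?invr_gt0// !ltr_nat !ltnS => h1 h2.
  by apply/eqP; rewrite eqn_leq h1 h2.
have hNE N (k : 'I_N.+1) u : C N k u -> hN N u = v N k.
  move=> Cu; rewrite /hN (bigD1 k)//= big1 => [|j jk].
    by rewrite addr0 indicE mem_set// mulr1.
  rewrite indicE memNset ?mulr0// => Cj; move/eqP : jk; apply.
  by apply: val_inj; exact: Cuniq Cj Cu.
have Cex N u : 0 < u <= 1 -> exists k : 'I_N.+1, C N k u.
  move=> /andP[u0 u1].
  have un : 0 < u * N.+1%:R by rewrite mulr_gt0.
  have [k /andP[k1 k2]] : exists k : nat, k%:R < u * N.+1%:R <= k.+1%:R.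
    have ex : exists n : nat, u * N.+1%:R <= n%:R.
      by exists (Num.truncn (u * N.+1%:R)).+1; rewrite ltW// truncnS_gt.
    case: (ex_minnP ex) => -[|k] hk hmin.
      by move: hk; rewrite leNgt un.
    exists k; rewrite hk andbT ltNge; apply/negP => /hmin.
    by rewrite ltnn.
  have kN : (k < N.+1)%N.
    by rewrite -(ltr_nat R) (lt_le_trans k1)// -[leRHS]mul1r ler_pM2r.
  by exists (Ordinal kN); rewrite /C/= in_itv/= ltr_pdivrMr// ler_pdivlMr// k1.
have mC N k : measurable (C N k) by exact: measurable_itv.
have mhN N : measurable_fun setT (hN N).
  apply: measurable_sum => k; apply: measurable_funM => //; exact: measurable_indic.
have hNK N u : 0 < u <= 1 -> `|hN N u| <= K.
  by move=> u01; have [k Ck] := Cex N u u01; rewrite (hNE _ _ _ Ck).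
have chN u : 0 < u <= 1 -> hN N u @[N --> \oo] --> h u.
  move=> u01; apply/cvgrPdist_le => e e0.
  have [N0 H] := vh u u01 e e0; exists N0 => // N /= NN.
  have [k Ck] := Cex N u u01; rewrite (hNE _ _ _ Ck) distrC.
  by apply: H => //; move: Ck; rewrite /C/= in_itv.
have K0 : 0 <= K by rewrite (le_trans (normr_ge0 _) (vK 0 0)).
have mh : measurable_fun I01 h.
  apply: (measurable_fun_cvg (fun N => measurable_funTS (mhN N))) => u /=.
  by rewrite in_itv/= => ?; exact: chN.
have [|||||ih _ cI] := @dominated_convergence _ _ _ (ls F) I01
  (measurable_itv _) (fun N => EFin \o hN N) (EFin \o h) (EFin \o cst K).
- move=> N; apply/measurable_EFinP.
  exact: (measurable_funTS (mhN N : measurable_fun setT (hN N : measurableTypeR R -> R))).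
- by apply/measurable_EFinP; exact: (mh : measurable_fun I01 (h : measurableTypeR R -> R)).
- by apply: aeW => u /=; rewrite in_itv/= => ?; apply: cvg_EFin; [exact: nearW|exact: chN].
- by apply: measurable_bounded_integrable => //; exists K; split => [|x xK u _ /=]; [exact: num_real|rewrite ger0_norm// ltW].
- by apply: aeW => u N /=; rewrite in_itv/= => ?; rewrite lee_fin hNK.
split => //.
have IE N : (\int[ls F]_(u in I01) (EFin \o hN N) u =
   (\sum_(k < N.+1) v N k * (F (k.+1%:R / N.+1%:R) - F (k%:R / N.+1%:R)))%:E)%E.
  have iC (k : 'I_N.+1) : (ls F).-integrable I01 (EFin \o \1_(C N k)).
    apply: measurable_bounded_integrable => //.
      exact: (measurable_funTS (measurable_indic (mC N k) : measurable_fun setT (\1_(C N k) : measurableTypeR R -> R))).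
    exists 1; split => [|x xk u _ /=]; first exact: num_real.
    by rewrite (le_trans _ (ltW xk))// indicE; case: (_ \in _); rewrite ?normr1 ?normr0.
  under eq_integral do rewrite /hN /= -sumEFin.
  rewrite integral_sum//; last first.
    have mI : measurable (I01 : set (measurableTypeR R)) by exact: measurable_itv.
    by move=> k; exact: (@integrableZl _ _ _ (ls F) _ mI (v N k) _ (iC k)).
  rewrite -sumEFin; apply: eq_bigr => k _.
  transitivity (\int[ls F]_(x in I01) ((v N k)%:E * (EFin \o \1_(C N k)) x))%E => //.
  rewrite integralZl// EFinM; congr (_ * _)%E.
  rewrite integral_indic//; last exact: mC.
  have -> : C N k `&` I01 = C N k.
    apply/setIidPl => u; rewrite /C/= !in_itv/= => /andP[u1 u2].
    rewrite (le_lt_trans _ u1) ?divr_ge0//= (le_trans u2)//.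
    by rewrite ler_pdivrMr// mul1r ler_nat.
  by apply: ls_itv; rewrite ler_pM2r ?invr_gt0// ler_nat.
have := cI; rewrite -[X in _ --> X]fineK; last exact: integrable_fin_num ih.
move=> /fine_cvg; apply: cvg_trans; apply: near_eq_cvg; apply: nearW => N.
by rewrite /= IE.
Qed.
End stieltjes.

Section within_continuity.
Context {R : realType}.

Lemma within_continuous_comp (T U : topologicalType) (A : set R) (f : R -> T) (g : T -> U) :
  continuous g -> {within A, continuous f} -> {within A, continuous (g \o f)}.
Proof.
move=> cg cf x.
exact: (@continuous_comp (subspace A) T U (from_subspace A f) g x (cf x) (cg (f x))).
Qed.

Lemma within_continuous_sub (U : topologicalType) (A B : set R) (f : R -> U) :
  B `<=` A -> {within A, continuous f} -> {within B, continuous f}.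
Proof. exact: continuous_subspaceW. Qed.

Lemma within_cy_sub (U : topologicalType) (a b : R) (f : R -> U) : 0 <= a ->
  {within (`[0, +oo[ : set R), continuous f} -> {within `[a, b], continuous f}.
Proof.
move=> a0; apply: within_continuous_sub => u /=; rewrite !in_itv/= andbT => /andP[+ _].
exact: le_trans.
Qed.

Lemma within_cy_measurable (f : R -> R) :
  {within (`[0, +oo[ : set R), continuous f} -> measurable_fun (`[0, +oo[ : set R) f.
Proof. by move=> cf; apply: subspace_continuous_measurable_fun. Qed.

Lemma within_cy_near (f : R -> R) (u e : R) : {within (`[0, +oo[ : set R), continuous f} ->
  0 <= u -> 0 < e -> exists N0 : nat, forall N, (N0 <= N)%N -> forall s, 0 <= s ->
  `|s - u| <= N.+1%:R^-1 -> `|f s - f u| <= e.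
Proof.
move=> cf u0 e0.
have : f x @[x --> within (`[0, +oo[%classic : set R) (nbhs u)] --> f u.
  have uA : (`[0, +oo[%classic : set R) u by rewrite /= in_itv/= u0.
  rewrite (nbhs_subspace_in uA); exact: (cf u).
move=> /cvgrPdist_le /(_ e e0); rewrite near_withinE => -[r /= r0 H].
exists (Num.truncn r^-1).+1 => N NN s s0 su.
have sr : `|u - s| < r.
  rewrite distrC (le_lt_trans su)// -[r]invrK ltf_pV2 ?posrE ?invr_gt0//.
  by rewrite (lt_le_trans (truncnS_gt _))// ler_nat (leq_trans NN).
by have := H s sr; rewrite /= in_itv/= andbT distrC; exact.
Qed.
End within_continuity.

(** * Bound on the regulator by the oscillation of the driving path *)

Section oscillation.
Context {R : realType}.
Variables (Rm : 'M[R]_2).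
Hypotheses (Rdiag : forall i, 0 < Rm i i)
  (Rdet : forall i, 0 < Rm i i * Rm (rev_ord i) (rev_ord i) - Rm i (rev_ord i) * Rm (rev_ord i) i).

(** Here [a] and [c] are the final values of [y_i] and [y_j], and [e] is the value of [y_j] at the
    earlier of the two last zeros. If [Rm i j >= 0] then [a] is bounded at once and [c] follows.
    Otherwise [e] may be replaced by [c]; then [c] is bounded at once if [Rm j i >= 0], and if both
    off-diagonal entries are negative the inverse matrix is nonnegative. The constant adds up the
    bounds of all cases. *)
Lemma osc_const i : let j := rev_ord i in exists2 C, 0 < C &
  forall a c e b : R, 0 <= a -> 0 <= e -> e <= c -> 0 <= b ->
  Rm j i * a + Rm j j * c <= b -> Rm i i * a + Rm i j * e <= b -> a <= C * b /\ c <= C * b.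
Proof.
move=> j; have ri := Rdiag i; have rj := Rdiag j; have dd := Rdet i.
rewrite -/j in dd; move: (Rm i i) (Rm j j) (Rm i j) (Rm j i) ri rj dd => p s r t p0 s0 dd.
pose C0 := p^-1 + s^-1 + (1 + `|t| / p) / s + (1 + `|r| / s) / p +
  ((s + `|r|) + (p + `|t|)) / (p * s - r * t).
have np (x : R) : 0 <= `|x| by [].
have i1 : 0 < p^-1 by rewrite invr_gt0.
have i2 : 0 < s^-1 by rewrite invr_gt0.
have i3 : 0 <= (1 + `|t| / p) / s by rewrite !(divr_ge0, addr_ge0)// ltW.
have i4 : 0 <= (1 + `|r| / s) / p by rewrite !(divr_ge0, addr_ge0)// ltW.
have i5 : 0 <= ((s + `|r|) + (p + `|t|)) / (p * s - r * t).
  by rewrite divr_ge0 ?(ltW dd)// !addr_ge0// ltW.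
exists C0; first by rewrite /C0; lra.
move=> a c e b a0 e0 ec b0 h1 h2.
have mono (x k : R) : x <= k * b -> k <= C0 -> x <= C0 * b.
  by move=> xk kC; rewrite (le_trans xk)// ler_wpM2r.
have c0 : 0 <= c by exact: le_trans ec.
have [r0|r0] := leP 0 r.
  have ha : a <= p^-1 * b.
    by rewrite ler_pdivlMl// (le_trans _ h2)// lerDl mulr_ge0.
  have hc : c <= (1 + `|t| / p) / s * b.
    rewrite mulrAC ler_pdivlMr//.
    have : `|t| * a <= `|t| * (p^-1 * b) by rewrite ler_wpM2l.
    have : - (t * a) <= `|t| * a by rewrite -mulNr ler_wpM2r// -normrN ler_norm.
    have -> : (1 + `|t| / p) * b = b + `|t| * (p^-1 * b) by ring.
    by move: h1; lra.
  by split; [apply: mono ha _; rewrite /C0; lra|apply: mono hc _; rewrite /C0; lra].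
have h3 : p * a + r * c <= b by rewrite (le_trans _ h2)// lerD2l ler_wnM2l// ltW.
have [t0|t0] := leP 0 t.
  have hc : c <= s^-1 * b.
    by rewrite ler_pdivlMl// (le_trans _ h1)// lerDr mulr_ge0.
  have ha : a <= (1 + `|r| / s) / p * b.
    rewrite mulrAC ler_pdivlMr//.
    have : `|r| * c <= `|r| * (s^-1 * b) by rewrite ler_wpM2l.
    have : - (r * c) <= `|r| * c by rewrite -mulNr ler_wpM2r// -normrN ler_norm.
    have -> : (1 + `|r| / s) * b = b + `|r| * (s^-1 * b) by ring.
    by move: h3; lra.
  by split; [apply: mono ha _; rewrite /C0; lra|apply: mono hc _; rewrite /C0; lra].
have ab k : k <= (s + `|r|) + (p + `|t|) -> k / (p * s - r * t) <= C0.
  move=> kk; have : k / (p * s - r * t) <= ((s + `|r|) + (p + `|t|)) / (p * s - r * t).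
    by rewrite ler_pM2r ?invr_gt0.
  by rewrite /C0; lra.
rewrite (ltr0_norm r0) (ltr0_norm t0) in ab.
have g1 : s * (p * a + r * c) <= s * b by rewrite ler_pM2l.
have g2 : (- r) * (t * a + s * c) <= (- r) * b by rewrite ler_pM2l ?oppr_gt0.
have g3 : (- t) * (p * a + r * c) <= (- t) * b by rewrite ler_pM2l ?oppr_gt0.
have g4 : p * (t * a + s * c) <= p * b by rewrite ler_pM2l.
split.
  apply: (mono _ ((s - r) / (p * s - r * t))); last by apply: ab; lra.
  rewrite mulrAC ler_pdivlMr//.
  have -> : a * (p * s - r * t) = s * (p * a + r * c) + - r * (t * a + s * c) by ring.
  have -> : (s - r) * b = s * b + - r * b by ring.
  exact: lerD.
apply: (mono _ ((p - t) / (p * s - r * t))); last by apply: ab; lra.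
rewrite mulrAC ler_pdivlMr//.
have -> : c * (p * s - r * t) = - t * (p * a + r * c) + p * (t * a + s * c) by ring.
have -> : (p - t) * b = - t * b + p * b by ring.
exact: lerD.
Qed.

Lemma mulmx_coord (y : 'cV[R]_2) i :
  (Rm *m y) i 0 = Rm i i * y i 0 + Rm i (rev_ord i) * y (rev_ord i) 0.
Proof. by rewrite mxE (big_ord2_rev _ i). Qed.

Lemma oscillation : exists2 C, 0 < C & forall (x y z : R -> 'cV[R]_2) (b : R),
  reflected Rm x y z -> {within (`[0, +oo[ : set R), continuous z} ->
  (forall u i, 0 <= u <= 1 -> `|x u i 0 - x 0 i 0| <= b) ->
  forall i, y 1 i 0 <= C * b.
Proof.
have [C1 C10 H1] := osc_const 0.
have [C2 C20 H2] := osc_const (rev_ord 0).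
pose C := C1 + C2 + (Rm 0 0)^-1 + (Rm (rev_ord 0) (rev_ord 0))^-1.
have ri0 i : 0 < (Rm i i)^-1 by rewrite invr_gt0.
have j0 := ri0 0; have j1 := ri0 (rev_ord 0).
have C0 : 0 < C by rewrite /C; lra.
exists C => // x y z b [zxy y0 ymono comp] cz xb.
have ci i := within_continuous_comp (@continuous_coord_cV R i) cz.
have b0 : 0 <= b by apply: le_trans (xb 0 0 _); rewrite // lexx ler01.
have z0 t i : 0 <= t -> 0 <= z t i 0 by move=> t0; have [_] := zxy t t0; apply.
have yp t i : 0 <= t -> 0 <= y t i 0.
  by move=> t0; have := ymono i 0 t (lexx _) t0; rewrite y0 mxE.
have x00 i : 0 <= x 0 i 0.
  by have [+ nn] := zxy 0 (lexx _); rewrite y0 mulmx0 addr0 => <-; exact: nn.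
have last i : y 1 i 0 = 0 \/ exists2 t, 0 <= t <= 1 & z t i 0 = 0 /\ y t i 0 = y 1 i 0.
  have fl := flat_where_positive (comp i) (z0 ^~ i) (within_cy_measurable (ci i)).
  have [ex|nex] := pselect (exists2 u, 0 <= u <= 1 & z u i 0 = 0).
    right; have [t t01 [zt tl]] := last_zero ler01 (within_cy_sub (lexx 0) (ci i)) ex.
    exists t => //; split => //; case/andP: t01 => t0 t1.
    apply/esym/fl => // u /andP[tu u1].
    by rewrite lt_neqAle eq_sym tl ?tu// z0// (le_trans t0 (ltW tu)).
  left; have := fl 0 1 (lexx _) ler01; rewrite y0 mxE; apply => u /andP[u0 u1].
  rewrite lt_neqAle z0 ?(ltW u0)// andbT eq_sym; apply/eqP => zu.
  by apply: nex; exists u => //; rewrite (ltW u0).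
have eqz t i : 0 <= t <= 1 -> z t i 0 = 0 ->
    Rm i i * y t i 0 + Rm i (rev_ord i) * y t (rev_ord i) 0 <= b.
  move=> t01 zt; have t0 : 0 <= t by case/andP: t01.
  have [zE _] := zxy t t0.
  have := xb t i t01; rewrite ler_norml => /andP[+ _].
  have := x00 i; have : z t i 0 = x t i 0 + (Rm *m y t) i 0 by rewrite zE mxE.
  by rewrite zt mulmx_coord; lra.
(* When one component never moves, the row of the other involves its diagonal entry only. *)
have single i : y 1 i 0 = 0 -> forall k, y 1 k 0 <= C * b.
  move=> yi k; have pp : 0 <= C * b by rewrite mulr_ge0// ltW.
  have [->|ki] := eqVneq k i; first by rewrite yi.
  have -> : k = rev_ord i.
    by apply/val_inj; move: ki; case: i yi => [[|[|//]]] ? _; case: k => [[|[|//]]] ?.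
  have [->//|[t t01 [zt yt]]] := last (rev_ord i).
  have := eqz t _ t01 zt; rewrite rev_ordK yt.
  have -> : y t i 0 = 0.
    case/andP: t01 => t0 t1; apply/eqP; rewrite eq_le yp// andbT -yi; exact: ymono.
  rewrite mulr0 addr0 mulrC -ler_pdivlMr// => h; rewrite (le_trans h)// mulrC ler_wpM2r//.
  by case: i {yi ki zt yt h} => [[|[|//]]] Hi; rewrite /C;
    [have -> : rev_ord (Ordinal Hi) = rev_ord 0 by apply/val_inj|
     have -> : rev_ord (Ordinal Hi) = 0 by apply/val_inj]; lra.
have [y00|[t0 t001 [zt0 yt0]]] := last 0; first exact: single y00.
have [y10|[t1 t101 [zt1 yt1]]] := last (rev_ord 0); first exact: single y10.
have fin : y 1 0 0 <= (C1 + C2) * b /\ y 1 (rev_ord 0) 0 <= (C1 + C2) * b.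
  have e1 := eqz t0 0 t001 zt0; have e2 := eqz t1 (rev_ord 0) t101 zt1.
  rewrite rev_ordK yt1 in e2; rewrite yt0 in e1.
  have [/andP[p1 p2] /andP[p3 p4]] := (t001, t101).
  have m1 : C1 * b <= (C1 + C2) * b by rewrite ler_wpM2r//; lra.
  have m2 : C2 * b <= (C1 + C2) * b by rewrite ler_wpM2r//; lra.
  have [t01|t10] := leP t0 t1.
    have ye : y t1 0 0 = y 1 0 0.
      by apply/le_anti/andP; split; [exact: ymono|rewrite -yt0; exact: ymono].
    rewrite ye in e2.
    have [||||||] := H1 (y 1 0 0) (y 1 (rev_ord 0) 0) (y t0 (rev_ord 0) 0) b => //.
    - exact: yp.
    - exact: yp.
    - exact: ymono.
    - by rewrite addrC.
    - by move=> u1 u2; split; [exact: le_trans m1|exact: le_trans m1].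
  have ye : y t0 (rev_ord 0) 0 = y 1 (rev_ord 0) 0.
    by apply/le_anti/andP; split; [exact: ymono|rewrite -yt1; apply: ymono => //; exact: ltW].
  rewrite ye in e1.
  have [||||||] := H2 (y 1 (rev_ord 0) 0) (y 1 0 0) (y t1 0 0) b => //; rewrite ?rev_ordK//.
  - exact: yp.
  - exact: yp.
  - exact: ymono.
  - by rewrite addrC.
  - by move=> u1 u2; split; [exact: le_trans m2|exact: le_trans m2].
have m3 : (C1 + C2) * b <= C * b by rewrite ler_wpM2r// /C; lra.
case: fin => f1 f2 i; case: i => [[|[|//]]] Hi.
  have -> : Ordinal Hi = 0 by apply/val_inj.
  exact: le_trans m3.
have -> : Ordinal Hi = rev_ord 0 by apply/val_inj.
exact: le_trans m3.
Qed.
End oscillation.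

(** * The expected Ito formula *)

Section test_functions.
Context {R : realType}.

(** In [tf_mvt] the slope is taken at a third point [c]: the difference quotients start from a point
    shifted by the martingale increment and are compared with [psi] at an intermediate time. *)
Record test_function (Psi psi psi1 : R -> R) (K : R) : Prop := {
  tf_K : 0 <= K;
  tf_b0 : forall u, `|Psi u| <= K;
  tf_b1 : forall u, `|psi u| <= K;
  tf_b2 : forall u, `|psi1 u| <= K;
  tf_lip : forall a b, `|Psi b - Psi a| <= K * `|b - a|;
  tf_lip1 : forall a b, `|psi b - psi a| <= K * `|b - a|;
  tf_mvt : forall a b c, `|Psi b - Psi a - psi c * (b - a)| <=
    K * (`|a - c| + `|b - c|) * `|b - a|;
  tf_taylor : forall a h, `|Psi (a + h) - Psi a - psi a * h - psi1 a * h ^+ 2 / 2| <=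
    K * `|h| ^+ 3;
  tf_m0 : measurable_fun setT Psi;
  tf_m1 : measurable_fun setT psi;
  tf_m2 : measurable_fun setT psi1 }.

(** The value [psi a] on the diagonal keeps the quotient close to [psi] when the endpoints
    coincide. *)
Definition diff_quot (Psi psi : R -> R) (a b : R) : R :=
  if a == b then psi a else (Psi b - Psi a) / (b - a).

Variables (Psi psi psi1 : R -> R) (K : R).
Hypothesis tf : test_function Psi psi psi1 K.

Lemma diff_quotE a b : Psi b - Psi a = diff_quot Psi psi a b * (b - a).
Proof.
rewrite /diff_quot; case: eqVneq => [->|ab]; first by rewrite !subrr mulr0.
by rewrite divfK// subr_eq0 eq_sym.
Qed.

Lemma diff_quot_bound a b : `|diff_quot Psi psi a b| <= K.
Proof.
rewrite /diff_quot; case: eqVneq => [_|ab]; first exact: (tf_b1 tf).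
have ba : 0 < `|b - a| by rewrite normr_gt0 subr_eq0 eq_sym.
by rewrite normrM normrV ?unitfE -?normr_gt0// ler_pdivrMr// (tf_lip tf).
Qed.

Lemma diff_quot_near a b c : `|diff_quot Psi psi a b - psi c| <= K * (`|a - c| + `|b - c|).
Proof.
rewrite /diff_quot; case: eqVneq => [<-|ab].
  rewrite (le_trans (tf_lip1 tf _ _))// ler_wpM2l ?(tf_K tf)// lerDl//.
have ba : 0 < `|b - a| by rewrite normr_gt0 subr_eq0 eq_sym.
have ba' : b - a != 0 by rewrite -normr_gt0.
have -> : (Psi b - Psi a) / (b - a) - psi c = (Psi b - Psi a - psi c * (b - a)) / (b - a).
  by field.
by rewrite normrM normrV ?unitfE// ler_pdivrMr// (tf_mvt tf).
Qed.
End test_functions.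

(** * Integrability of the boundary processes *)

Section generator_increments.
Context {R : realType} (Sigma Rm : 'M[R]_2) (mu : 'cV[R]_2).
Hypotheses (Rdiag : forall i, 0 < Rm i i)
  (Rdet : forall i, 0 < Rm i i * Rm (rev_ord i) (rev_ord i) - Rm i (rev_ord i) * Rm (rev_ord i) i)
  (Sigma_pd : positive_definite Sigma).
Context {d : measure_display} {T : measurableType d} (P : probability T R)
  (F : R -> set (set T)) (X Y Z : R -> T -> plane R) (nu : probability (plane R) R).
Hypotheses (fF : is_filtration F) (cZ : continuous_paths Z) (aZ : adapted F Z)
  (bm : brownian_motion P Sigma mu X)
  (mart : martingale P F (fun t w => X t w - X 0 w - t *: mu))
  (aY : adapted F Y) (cY : continuous_paths Y)
  (refl : forall w, reflected Rm (X ^~ w) (Y ^~ w) (Z ^~ w))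
  (stat : forall t, 0 <= t -> forall B : set (plane R), measurable B ->
      P (Z t @^-1` B) = nu B).
Local Notation Rp := (`[0, +oo[%classic : set R).
Local Notation I01 := (`]0%R, 1%R]%classic : set R).

Lemma scalar_pathP (th : 'cV[R]_2) : th != 0 ->
  scalar_brownian P F (natural_filtration X) (dot th (Sigma *m th)) (scalar_path mu th X) /\
  forall w, {within Rp, continuous (fun t => scalar_path mu th X t w)}.
Proof.
move=> th0; split; first by apply: scalar_brownian_path => //; exact: Sigma_pd.
move=> w; have [cX _ _ _] := bm.
have cdX := within_continuous_comp (@continuous_dot R th) (cX w).
have -> : (fun t => scalar_path mu th X t w) =
    (fun t => dot th (X t w) - (dot th (X 0 w) + t * dot th mu)).
  by apply/funext => t; rewrite /scalar_path !dotBr dotZr; ring.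
move=> t; apply: cvgB; first exact: (cdX t).
have c2 : continuous (fun t : R => dot th (X 0 w) + t * dot th mu).
  move=> u; apply: cvgD; first exact: cvg_cst.
  by apply: cvgM; [exact: cvg_id|exact: cvg_cst].
exact: (continuous_subspaceT c2).
Qed.

Lemma Y_ge0 (t : R) w i : 0 <= t -> 0 <= Y t w i 0.
Proof.
move=> t0; have [_ y0 ymono _] := refl w.
have y00 : Y 0 w = 0 by exact: y0.
by have := ymono i 0 t (lexx _) t0; rewrite /= y00 mxE.
Qed.

Lemma measurable_adapted (W : R -> T -> plane R) (f : 'cV[R]_2 -> R) (t : R) :
  adapted F W -> 0 <= t -> continuous f ->
  meas_wrt (F t) (fun w => f (W t w)).
Proof.
move=> aW t0 cf B mB.
have mf := continuous_measurable_plane cf.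
have := aW t t0 (f @^-1` B); apply.
by have := mf measurableT B mB; rewrite setTI.
Qed.

Lemma measurable_Y (t : R) i : 0 <= t -> measurable_fun setT (fun w => Y t w i 0 : R).
Proof.
move=> t0; apply: (meas_wrtS (fF.1 t t0).2).
exact: (measurable_adapted aY t0 (@continuous_coord_cV R i)).
Qed.

(** Pathwise, [oscillation] bounds [Y 1] by the largest displacement of the coordinates of [X] on
    the unit interval; [chain_sup] dominates the martingale part of each, and [m] the drift. *)
Lemma integrable_Y1 i : P.-integrable setT (fun w => (Y 1%R w i 0%R)%:E).
Proof.
have [C C0 osc] := oscillation Rdiag Rdet.
pose e (k : 'I_2) : 'cV[R]_2 := delta_mx k 0.
have e0 k : e k != 0.
  by apply/eqP => /matrixP /(_ k 0); rewrite !mxE !eqxx => /eqP; rewrite oner_eq0.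
have dote k v : dot (e k) v = v k 0.
  rewrite (dotE k) !mxE !eqxx/= mul1r.
  by rewrite (negbTE (neq_rev_ord k)) mul0r addr0.
pose W k := chain_sup (scalar_path mu (e k) X).
have Wp k := chain_sup_integrable (scalar_pathP (e0 k)).1.
pose m : R := `|mu 0 0| + `|mu (rev_ord 0) 0|.
have bound w : ((Y 1%R w i 0%R)%:E <= C%:E * (W 0%R w + W (rev_ord 0%R) w + m%:E))%E.
  have W10 := (Wp (rev_ord 0)).2.1 w; have W0' := (Wp 0).2.1 w.
  have [wf|wf] := boolP ((W 0%R w + W (rev_ord 0%R) w)%E \is a fin_num); last first.
    have -> : (W 0%R w + W (rev_ord 0%R) w = +oo)%E.
      move: wf; rewrite ge0_fin_numE ?adde_ge0//.
      by rewrite ltey negbK => /eqP.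
    by rewrite addye ?ltNyr// gt0_muley ?lte_fin// leey.
  rewrite -(fineK wf) -EFinD -EFinM lee_fin.
  apply: (osc (X ^~ w) (Y ^~ w) (Z ^~ w)) => // u k u01.
  have u0 : 0 <= u by case/andP: u01.
  have h : (`|scalar_path mu (e k) X u w|%:E <= W 0%R w + W (rev_ord 0%R) w)%E.
    have := chain_sup_bound (scalar_pathP (e0 k)).2 w u01.
    have -> : scalar_path mu (e k) X 0 w = 0 by rewrite /scalar_path subrr scale0r subr0 dot0r.
    rewrite subr0 => /le_trans; apply.
    case: k => [[|[|//]]] Hk.
      have -> : Ordinal Hk = 0 by apply/val_inj.
      by rewrite leeDl.
    have -> : Ordinal Hk = rev_ord 0 by apply/val_inj.
    by rewrite leeDr.
  rewrite -(fineK wf) lee_fin /scalar_path !dotBr dotZr !dote in h.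
  have mk : `|u * mu k 0| <= m.
    rewrite normrM; apply: (@le_trans _ _ (`|mu k 0|)).
      by rewrite -[leRHS]mul1r ler_wpM2r// ger0_norm//; case/andP: u01.
    rewrite /m; case: k h => [[|[|//]]] Hk _.
      by have -> : Ordinal Hk = 0 by [apply/val_inj]; rewrite lerDl.
    by have -> : Ordinal Hk = rev_ord 0 by [apply/val_inj]; rewrite lerDr.
  rewrite -[X in `|X|](subrK (u * mu k 0)).
  exact: le_trans (ler_normD _ _) (lerD h mk).
apply/integrableP; split.
  by apply/measurable_EFinP; exact: measurable_Y.
have mW k : measurable_fun setT (W k) := (Wp k).1.
have mS : measurable_fun setT (fun w => W 0%R w + W (rev_ord 0%R) w)%E.
  by apply: emeasurable_funD.
have mSm : measurable_fun setT (fun w => W 0%R w + W (rev_ord 0%R) w + m%:E)%E.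
  by apply: emeasurable_funD.
have m0 : (0 <= m%:E)%E by rewrite lee_fin addr_ge0.
have W0 k w : (0 <= W k w)%E := (Wp k).2.1 w.
apply: (@le_lt_trans _ _ (\int[P]_w (C%:E * (W 0%R w + W (rev_ord 0%R) w + m%:E)))%E).
  apply: ge0_le_integral => //.
  - apply: measurableT_comp => //; apply/measurable_EFinP; exact: measurable_Y.
  - exact: emeasurable_funM.
  - by move=> w _; rewrite /= ger0_norm ?Y_ge0.
rewrite ge0_integralZl//; last 2 first.
- by move=> w _; rewrite !adde_ge0.
- by rewrite lee_fin ltW.
rewrite ge0_integralD//; last by move=> w _; rewrite adde_ge0.
have E1 : (\int[P]_w (W 0%R w + W (rev_ord 0%R) w) = \int[P]_w W 0%R w + \int[P]_w W (rev_ord 0%R) w)%E.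
  exact: ge0_integralD.
have E2 : (\int[P]__ m%:E < +oo)%E.
  by apply: integrable_lty => //; exact: (integrable_cstP P m).
rewrite E1; apply: lte_mul_pinfty => //; first by rewrite lee_fin ltW.
apply: lte_add_pinfty => //; apply: lte_add_pinfty.
- exact: (Wp 0).2.2.
- exact: (Wp (rev_ord 0)).2.2.
Qed.
End generator_increments.

(** * Riemann sums along the stationary process *)

Section expected_ito.
Context {R : realType} (Sigma Rm : 'M[R]_2) (mu : 'cV[R]_2).
Hypotheses (Rdiag : forall i, 0 < Rm i i)
  (Rdet : forall i, 0 < Rm i i * Rm (rev_ord i) (rev_ord i) - Rm i (rev_ord i) * Rm (rev_ord i) i)
  (Sigma_pd : positive_definite Sigma).
Context {d : measure_display} {T : measurableType d} (P : probability T R)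
  (F : R -> set (set T)) (X Y Z : R -> T -> plane R) (nu : probability (plane R) R).
Hypotheses (fF : is_filtration F) (cZ : continuous_paths Z) (aZ : adapted F Z)
  (bm : brownian_motion P Sigma mu X)
  (mart : martingale P F (fun t w => X t w - X 0 w - t *: mu))
  (aY : adapted F Y) (cY : continuous_paths Y)
  (refl : forall w, reflected Rm (X ^~ w) (Y ^~ w) (Z ^~ w))
  (stat : forall t, 0 <= t -> forall B : set (plane R), measurable B ->
      P (Z t @^-1` B) = nu B).
Variable cum : 'I_2 -> T -> cumulative R R.
Hypothesis cumE : forall i w t, cum i w t = Y (Num.max 0 t) w i 0.
Local Notation Rp := (`[0, +oo[%classic : set R).
Local Notation I01 := (`]0%R, 1%R]%classic : set R).
Local Notation ls := (@lebesgue_stieltjes_measure R).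
Variables (th : 'cV[R]_2) (Psi psi psi1 : R -> R) (K : R).
Hypotheses (th0 : th != 0) (tf : test_function Psi psi psi1 K).
Local Notation q := (dot th (Sigma *m th)).
Local Notation m := (dot th mu).
Local Notation gam i := (gamma_ Rm i th).
Let xi (t : R) (w : T) : R := dot th (Z t w).
Let M := scalar_path mu th X.
Let tk (N k : nat) : R := k%:R / N.+1%:R.

Let tk0 N k : 0 <= tk N k. Proof. by rewrite divr_ge0. Qed.
Let tkS N k : tk N k <= tk N k.+1. Proof. by rewrite ler_pM2r ?invr_gt0// ler_nat. Qed.
Let tkd N k : tk N k.+1 - tk N k = N.+1%:R^-1.
Proof. by rewrite /tk -[k.+1%:R]natr1; ring. Qed.
Let tk00 N : tk N 0 = 0. Proof. by rewrite /tk mul0r. Qed.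
Let tkN N : tk N N.+1 = 1. Proof. by rewrite /tk divff// pnatr_eq0. Qed.

Lemma dot_mulmx (y : 'cV[R]_2) : dot th (Rm *m y) = \sum_i gam i * y i 0.
Proof.
rewrite (big_ord2_rev _ 0) /gamma_ !(dotE 0) !mulmx_coord !mxE rev_ordK; ring.
Qed.

Lemma xi_incr (s t : R) w : 0 <= s -> 0 <= t ->
  xi t w - xi s w = M t w - M s w + ((t - s) * m + \sum_i gam i * (Y t w i 0 - Y s w i 0)).
Proof.
move=> s0 t0; have [H _ _ _] := refl w.
have [zt _] := H t t0; have [zs _] := H s s0.
have zt' : Z t w = X t w + Rm *m Y t w :> 'cV[R]_2 := zt.
have zs' : Z s w = X s w + Rm *m Y s w :> 'cV[R]_2 := zs.
rewrite /xi zt' zs' !dotDr !dot_mulmx /M scalar_path_incr !dotBr.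
under [X in _ = _ + (_ + X)]eq_bigr do rewrite mulrBr.
rewrite sumrB; ring.
Qed.

Lemma cont_xi w : {within Rp, continuous (fun t => xi t w)}.
Proof.
have H := within_continuous_comp (@continuous_dot R th) (@cZ w).
by move=> t; exact: (H t).
Qed.

Lemma meas_xi (t : R) : 0 <= t -> meas_wrt (F t) (xi t).
Proof. by move=> t0; exact: (measurable_adapted aZ t0 (@continuous_dot R th)). Qed.

Lemma meas_xiT (t : R) : 0 <= t -> measurable_fun setT (xi t).
Proof. by move=> t0; apply: (meas_wrtS (fF.1 t t0).2); exact: meas_xi. Qed.

Lemma stationary_expectation (t : R) (f : R -> R) : 0 <= t -> measurable_fun setT f ->
  (forall u, `|f u| <= K) ->
  \int[P]_w f (xi t w) = \int[nu]_z f (dot th z).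
Proof.
move=> t0 mf fK.
have mZ : measurable_fun setT (Z t).
  move=> _ B mB; rewrite setTI; apply: (fF.1 t t0).2; exact: aZ.
have mg : measurable_fun setT (fun z : plane R => f (dot th z)).
  exact: (measurableT_comp mf (measurable_dot th)).
have ig : P.-integrable setT (EFin \o (fun w => f (xi t w))).
  apply: L2_integrable; apply: (L2_bounded P _ (fun w => fK (xi t w))).
  exact: (measurableT_comp mf (meas_xiT t0)).
rewrite /Rintegral; congr fine.
transitivity (\int[pushforward P (Z t)]_z (f (dot th z))%:E)%E; last first.
  by apply: eq_measure_integral => A mA _; exact: stat.
rewrite (integral_pushforward mZ)//.
by apply/measurable_EFinP.
Qed.

Let dq N k w := diff_quot Psi psi (xi (tk N k) w + (M (tk N k.+1) w - M (tk N k) w))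
  (xi (tk N k.+1) w).

(** Each step moves first by the martingale increment and then by the drift and the regulator. [VN]
    collects the second moves, less the first-order effect of the drift; it converges pathwise to
    the boundary integrals, while the martingale moves are treated in expectation. *)
Let VN (N : nat) (w : T) : R := \sum_(k < N.+1)
  (Psi (xi (tk N k.+1) w) - Psi (xi (tk N k) w + (M (tk N k.+1) w - M (tk N k) w))
   - psi (xi (tk N k) w) * (N.+1%:R^-1 * m)).

Let V (w : T) : R := \sum_i gam i * \int[ls (cum i w)]_(u in I01) psi (xi u w).

Lemma VNE N w : VN N w =
  m * (\sum_(k < N.+1) (dq N k w - psi (xi (tk N k) w)) *
    ((idfun : cumulative R R) (tk N k.+1) - (idfun : cumulative R R) (tk N k))) +
  \sum_i gam i * (\sum_(k < N.+1) dq N k w * (cum i w (tk N k.+1) - cum i w (tk N k))).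
Proof.
rewrite mulr_sumr.
under [X in _ = _ + X]eq_bigr do rewrite mulr_sumr.
rewrite exchange_big/= -big_split/=; apply: eq_bigr => k _.
rewrite (diff_quotE Psi psi) -/(dq N k w).
have -> : xi (tk N k.+1) w - (xi (tk N k) w + (M (tk N k.+1) w - M (tk N k) w)) =
   N.+1%:R^-1 * m + \sum_i gam i * (Y (tk N k.+1) w i 0 - Y (tk N k) w i 0).
  by rewrite opprD addrA (xi_incr w (tk0 N k) (tk0 N k.+1)) tkd addrC addKr.
rewrite tkd.
under [X in _ = _ + X]eq_bigr do rewrite !cumE !(max_idPr (tk0 _ _)) mulrCA.
rewrite -mulr_sumr; ring.
Qed.

Lemma dq_near w (u : R) : 0 < u <= 1 -> forall e, 0 < e -> exists N0, forall N, (N0 <= N)%N ->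
  forall k, tk N k < u <= tk N k.+1 ->
  `|dq N k w - psi (xi u w)| <= e /\ `|psi (xi (tk N k) w) - psi (xi u w)| <= e.
Proof.
move=> /andP[u0 u1] e e0.
have K0 := tf_K tf.
pose e' := e / (4 * (K + 1)).
have K1 : 0 < 4 * (K + 1) by rewrite mulr_gt0// ltr_wpDl.
have e'0 : 0 < e' by rewrite divr_gt0.
have eE : K * (4 * e') <= e.
  have -> : e = (K + 1) * (4 * e') by rewrite /e'; field; rewrite gt_eqF// ltr_wpDl.
  by apply: ler_wpM2r; [rewrite mulr_ge0 ?(ltW e'0)|rewrite lerDl].
have [N1 H1] := within_cy_near (@cont_xi w) (ltW u0) e'0.
have cM : {within Rp, continuous (fun t => M t w)}.
  exact: (scalar_pathP Sigma_pd fF bm mart th0).2.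
have [N2 H2] := within_cy_near cM (ltW u0) e'0.
exists (maxn N1 N2) => N; rewrite geq_max => /andP[NN1 NN2] k /andP[k1 k2].
have d1 : `|tk N k - u| <= N.+1%:R^-1.
  by rewrite distrC ger0_norm ?subr_ge0 ?(ltW k1)// -(tkd N k) lerD2r.
have d2 : `|tk N k.+1 - u| <= N.+1%:R^-1.
  by rewrite ger0_norm ?subr_ge0// -(tkd N k) lerD2l lerN2 ltW.
have a1 := H1 N NN1 _ (tk0 N k) d1.
have a2 := H1 N NN1 _ (tk0 N k.+1) d2.
have b1 := H2 N NN2 _ (tk0 N k) d1.
have b2 := H2 N NN2 _ (tk0 N k.+1) d2.
split.
  apply: (le_trans (diff_quot_near tf _ _ _)); apply: (le_trans _ eE); apply: ler_wpM2l => //.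
  have : `|xi (tk N k) w + (M (tk N k.+1) w - M (tk N k) w) - xi u w| <= e' + (e' + e').
    have -> : xi (tk N k) w + (M (tk N k.+1) w - M (tk N k) w) - xi u w =
      (xi (tk N k) w - xi u w) + ((M (tk N k.+1) w - M u w) - (M (tk N k) w - M u w)) by ring.
    apply: (le_trans (ler_normD _ _)); apply: lerD => //.
    by apply: (le_trans (ler_normB _ _)); apply: lerD.
  by lra.
apply: (le_trans (tf_lip1 tf _ _)); apply: (le_trans _ eE); apply: ler_wpM2l => //; lra.
Qed.

Lemma VN_cvg w : VN N w @[N --> \oo] --> V w.
Proof.
have K0 := tf_K tf.
under eq_fun do rewrite VNE.
(* Lebesgue measure is treated as the Stieltjes measure of [idfun]; the limiting integrand is
   zero. *)
have Z1 : \sum_(k < N.+1) (dq N k w - psi (xi (tk N k) w)) *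
    ((idfun : cumulative R R) (tk N k.+1) - (idfun : cumulative R R) (tk N k))
    @[N --> \oo] --> (0 : R).
  have := (@Riemann_Stieltjes R idfun (fun N k => dq N k w - psi (xi (tk N k) w)) (fun=> 0) (2 * K) _ _).2.
  rewrite [X in _ -> _ -> _ --> X](_ : _ = 0); last by rewrite /Rintegral integral0.
  apply.
    move=> N k; apply: (le_trans (ler_normB _ _)).
    by rewrite mulr_natl mulr2n; apply: lerD; [exact: (diff_quot_bound tf)|exact: (tf_b1 tf)].
  move=> u u01 e e0; have e2 : 0 < e / 2 by rewrite divr_gt0.
  have [N0 H] := dq_near w u01 e2; exists N0 => N NN k /(H N NN)[h1 h2].
  rewrite subr0 -[X in `|X - _|](subrK (psi (xi u w))) -addrA.
  rewrite (le_trans (ler_normD _ _))// [leRHS]splitr lerD//.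
  by rewrite distrC.
rewrite -[V w]add0r; apply: cvgD.
  rewrite -[X in _ --> X](mulr0 m); apply: cvgM; [exact: cvg_cst|exact: Z1].
have E2 (f : 'I_2 -> R) : \sum_i f i = f 0 + f (lift ord0 ord0).
  by rewrite !big_ord_recl big_ord0 addr0.
rewrite /V E2; under eq_fun do rewrite E2.
have S i : gam i * (\sum_(k < N.+1) dq N k w * (cum i w (tk N k.+1) - cum i w (tk N k)))
   @[N --> \oo] --> gam i * \int[ls (cum i w)]_(u in I01) psi (xi u w); last by apply: cvgD; exact: S.
apply: cvgM; first exact: cvg_cst.
apply: (@Riemann_Stieltjes R (cum i w) (fun N k => dq N k w) (fun u => psi (xi u w)) K _ _).2.
  by move=> N k; exact: (diff_quot_bound tf).
move=> u u01 e e0; have [N0 H] := dq_near w u01 e0.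
by exists N0 => N NN k /(H N NN)[].
Qed.

Lemma VN_bound N w : `|VN N w| <= 2 * K * `|m| + \sum_i (`|gam i| * K) * Y 1 w i 0.
Proof.
have K0 := tf_K tf.
rewrite VNE; apply: (le_trans (ler_normD _ _)); apply: lerD.
  rewrite normrM mulrC; apply: ler_wpM2r => //.
  apply: (le_trans (ler_norm_sum _ _ _)).
  apply: (@le_trans _ _ (\sum_(k < N.+1) 2 * K * N.+1%:R^-1)).
    apply: ler_sum => k _; rewrite tkd normrM [`|N.+1%:R^-1|]ger0_norm//.
    apply: ler_wpM2r => //; apply: (le_trans (ler_normB _ _)).
    by rewrite mulr_natl mulr2n; apply: lerD; [exact: (diff_quot_bound tf)|exact: (tf_b1 tf)].
  by rewrite sumr_const card_ord -[_ *+ _]mulr_natr divfK// pnatr_eq0.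
apply: (le_trans (ler_norm_sum _ _ _)); apply: ler_sum => i _.
rewrite normrM -mulrA; apply: ler_wpM2l => //.
apply: (le_trans (ler_norm_sum _ _ _)).
apply: (@le_trans _ _ (\sum_(k < N.+1) K * (cum i w (tk N k.+1) - cum i w (tk N k)))).
  apply: ler_sum => k _; rewrite normrM; apply: ler_pM => //; first exact: (diff_quot_bound tf).
  rewrite ger0_norm// subr_ge0; exact: cumulative_is_nondecreasing.
rewrite -mulr_sumr ler_wpM2l//.
have -> : \sum_(k < N.+1) (cum i w (tk N k.+1) - cum i w (tk N k)) =
    cum i w (tk N N.+1) - cum i w (tk N 0).
  by rewrite -(big_mkord xpredT (fun k => cum i w (tk N k.+1) - cum i w (tk N k))) telescope_sumr.
rewrite tkN tk00 !cumE maxxx (max_idPr ler01) gerBl.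
exact: (Y_ge0 refl).
Qed.

(** Stationarity cancels the telescoped increment of [Psi], the martingale property removes the
    first-order term, and [sb_mul_sq] evaluates the second-order one. The parameter [e] weighs
    second against fourth moments in the cubic remainder. *)
Lemma VN_expectation (N : nat) (e : R) : 0 < e ->
  `|\int[P]_w VN N w + (q / 2 * \int[nu]_z psi1 (dot th z) + m * \int[nu]_z psi (dot th z))| <=
  K * (e * q + 3 * q ^+ 2 / (N.+1%:R * e)) / 2.
Proof.
move=> e0; have K0 := tf_K tf.
have B := (scalar_pathP Sigma_pd fF bm mart th0).1; rewrite -/M in B.
pose D k w := M (tk N k.+1) w - M (tk N k) w.
have LD k : L2 P (D k) by exact: (sb_L2i B).
have LD2 k : L2 P (fun w => D k w ^+ 2) by exact: (sb_L2 B).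
have mxi k : measurable_fun setT (xi (tk N k)) by exact: meas_xiT.
have bd (f : R -> R) k : measurable_fun setT f -> (forall u, `|f u| <= K) ->
    L2 P (fun w => f (xi (tk N k) w)).
  move=> mf fK; apply: (L2_bounded P _ (fun w => fK (xi (tk N k) w))).
  exact: (measurableT_comp mf (mxi k)).
have Lp k := L2_integrable (bd Psi k (tf_m0 tf) (tf_b0 tf)).
have Lp0 k := L2_integrable (bd psi k (tf_m1 tf) (tf_b1 tf)).
have mxD k : measurable_fun setT (fun w => xi (tk N k) w + D k w).
  by apply: measurable_funD => //; case: (LD k).
have LpD k : P.-integrable setT (EFin \o (fun w => Psi (xi (tk N k) w + D k w))).
  apply: L2_integrable; apply: (L2_bounded P _ (fun w => tf_b0 tf (xi (tk N k) w + D k w))).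
  exact: (measurableT_comp (tf_m0 tf) (mxD k)).
have L1 k : P.-integrable setT (EFin \o (fun w => psi (xi (tk N k) w) * D k w)).
  exact: L2_mul (bd psi k (tf_m1 tf) (tf_b1 tf)) (LD k).
have L2' k : P.-integrable setT (EFin \o (fun w => psi1 (xi (tk N k) w) * D k w ^+ 2)).
  exact: L2_mul (bd psi1 k (tf_m2 tf) (tf_b2 tf)) (LD2 k).
pose rem k w := Psi (xi (tk N k) w + D k w) - Psi (xi (tk N k) w) - psi (xi (tk N k) w) * D k w
  - psi1 (xi (tk N k) w) * D k w ^+ 2 / 2.
have irem k : P.-integrable setT (EFin \o rem k).
  have h1 := integrableB measurableT (LpD k) (Lp k).
  have h2 := integrableB measurableT h1 (L1 k).
  have h3 := integrableZr measurableT 2^-1 (L2' k).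
  exact: (integrableB measurableT h2 h3).
have E1 k : \int[P]_w (psi (xi (tk N k) w) * D k w) = 0.
  apply: (sb_mul_incr B (tk0 N k) (tkS N k) _ (L1 k)).
  exact: meas_wrt_comp (meas_xi (tk0 N k)) (tf_m1 tf).
have E2 k : \int[P]_w (psi1 (xi (tk N k) w) * D k w ^+ 2) =
    N.+1%:R^-1 * q * \int[nu]_z psi1 (dot th z).
  rewrite -(stationary_expectation (tk0 N k) (tf_m2 tf) (tf_b2 tf)) -(tkd N k).
  apply: (sb_mul_sq B (tk0 N k) (tkS N k) _ (fun w => tf_b2 tf _)).
  exact: meas_wrt_comp (meas_xi (tk0 N k)) (tf_m2 tf).
pose S w := (Psi (xi 1 w) - Psi (xi 0 w)) - \sum_(k < N.+1)
  (psi (xi (tk N k) w) * D k w + psi1 (xi (tk N k) w) * D k w ^+ 2 / 2 + rem k w +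
   psi (xi (tk N k) w) * (N.+1%:R^-1 * m)).
have VS w : VN N w = S w.
  rewrite /S /VN; have -> : Psi (xi 1 w) - Psi (xi 0 w) =
      \sum_(k < N.+1) (Psi (xi (tk N k.+1) w) - Psi (xi (tk N k) w)).
    rewrite -(big_mkord xpredT (fun k => Psi (xi (tk N k.+1) w) - Psi (xi (tk N k) w))).
    by rewrite telescope_sumr// tkN tk00.
  rewrite -sumrB; apply: eq_bigr => k _; rewrite /rem /D; ring.
under eq_Rintegral do rewrite VS.
have iP1 : P.-integrable setT (EFin \o (fun w => Psi (xi 1 w))) by rewrite -(tkN N); exact: Lp.
have iP0 : P.-integrable setT (EFin \o (fun w => Psi (xi 0 w))) by rewrite -(tk00 N); exact: Lp.
pose sm k w := psi (xi (tk N k) w) * D k w + psi1 (xi (tk N k) w) * D k w ^+ 2 / 2 + rem k w +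
   psi (xi (tk N k) w) * (N.+1%:R^-1 * m).
have i3 k := integrableZr measurableT 2^-1 (L2' k).
have i4 k := integrableZr measurableT (N.+1%:R^-1 * m) (Lp0 k).
have i12 k := integrableD measurableT (L1 k) (i3 k).
have i123 k := integrableD measurableT (i12 k) (irem k).
have ism k : P.-integrable setT (EFin \o sm k) := integrableD measurableT (i123 k) (i4 k).
have [SS iSS] := Rintegral_sum (index_enum 'I_N.+1) (fun k : 'I_N.+1 => ism k).
rewrite RintegralB//; last exact: (integrableB measurableT iP1 iP0).
rewrite RintegralB// !(stationary_expectation _ (tf_m0 tf) (tf_b0 tf))// subrr sub0r SS.
have smE k : \int[P]_w sm k w = N.+1%:R^-1 * (q / 2 * \int[nu]_z psi1 (dot th z) +
    m * \int[nu]_z psi (dot th z)) + \int[P]_w rem k w.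
  have d4 : \int[P]_w sm k w = _ := RintegralD measurableT (i123 k) (i4 k).
  have d3 : _ = \int[P]_w _ + \int[P]_w rem k w := RintegralD measurableT (i12 k) (irem k).
  have d2 := RintegralD measurableT (L1 k) (i3 k).
  rewrite d4 d3 d2 E1 !RintegralZr// E2 (stationary_expectation (tk0 N k) (tf_m1 tf) (tf_b1 tf)).
  ring.
under eq_bigr do rewrite smE.
rewrite big_split/= sumr_const card_ord -[X in - (X + _)]mulr_natr.
rewrite mulrAC mulVf ?pnatr_eq0// mul1r opprD addrAC addNr add0r normrN.
apply: (le_trans (ler_norm_sum _ _ _)).
have N1 : N.+1%:R != 0 :> R by rewrite pnatr_eq0.
have rb (k : 'I_N.+1) : `|\int[P]_w rem k w| <=
    K * (e * (N.+1%:R^-1 * q) + 3 * (N.+1%:R^-1 * q) ^+ 2 / e) / 2.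
  apply: (le_trans (le_normr_Rintegral measurableT (irem k))).
  have i2 := L2_integrable (LD2 k).
  have i4' := (LD2 k).2.
  have rw w : `|rem k w| <= K / 2 * e * D k w ^+ 2 + K / 2 / e * (D k w ^+ 2) ^+ 2.
    apply: (le_trans (tf_taylor tf _ _)).
    have -> : D k w ^+ 2 = `|D k w| ^+ 2 by rewrite real_normK ?num_real.
    move: (normr_ge0 (D k w)); move: `|D k w| => y y0.
    (* Young's inequality [y^3 <= (e y^2 + y^4 / e) / 2], written as a completed square. *)
    have -> : K / 2 * e * y ^+ 2 + K / 2 / e * (y ^+ 2) ^+ 2 =
       K * y ^+ 3 + K / (2 * e) * (y * (y - e)) ^+ 2 by field; rewrite gt_eqF.
    by rewrite lerDl mulr_ge0 ?sqr_ge0// divr_ge0// mulr_ge0// ltW.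
  have ia := integrableZl measurableT (K / 2 * e) i2.
  have ib := integrableZl measurableT (K / 2 / e) i4'.
  apply: (le_trans (le_Rintegral measurableT (integrable_norm (irem k)) (integrableD measurableT ia ib) (fun w _ => rw w))).
  rewrite RintegralD// !RintegralZl//.
  have m2 := sb_m2 B (tk0 N k) (tkS N k); have m4 := sb_m4 B (tk0 N k) (tkS N k).
  rewrite tkd in m2 m4; rewrite /D m2.
  have -> : \int[P]_w ((M (tk N k.+1) w - M (tk N k) w) ^+ 2) ^+ 2 =
      \int[P]_w (M (tk N k.+1) w - M (tk N k) w) ^+ 4.
    by apply: eq_Rintegral => w _; rewrite -exprM.
  apply: (@le_trans _ _ (K / 2 * e * (N.+1%:R^-1 * q) + K / 2 / e * (3 * (N.+1%:R^-1 * q) ^+ 2))).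
    by rewrite lerD2l; apply: ler_wpM2l m4; rewrite divr_ge0 ?(ltW e0)// divr_ge0.
  rewrite le_eqVlt; apply/orP; left; apply/eqP; ring.
apply: (le_trans (ler_sum _ (fun k _ => rb k))).
rewrite sumr_const card_ord -[_ *+ _]mulr_natr le_eqVlt; apply/orP; left; apply/eqP.
move: N1; move: (N.+1%:R : R) => n1 N1; field; by rewrite N1 gt_eqF.
Qed.

Lemma expected_ito : P.-integrable setT (EFin \o V) /\
  q / 2 * \int[nu]_z psi1 (dot th z) + m * \int[nu]_z psi (dot th z) + \int[P]_w V w = 0.
Proof.
have K0 := tf_K tf.
have B := (scalar_pathP Sigma_pd fF bm mart th0).1; rewrite -/M in B.
have mVN N : measurable_fun setT (VN N).
  have mP u : 0 <= u -> measurable_fun setT (xi u) by exact: meas_xiT.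
  apply: measurable_sum => k.
  apply: measurable_funB; last first.
    apply: measurable_funM => //; exact: (measurableT_comp (tf_m1 tf) (mP _ (tk0 N k))).
  apply: measurable_funB; first exact: (measurableT_comp (tf_m0 tf) (mP _ (tk0 N k.+1))).
  apply: (measurableT_comp (tf_m0 tf)); apply: measurable_funD; first exact: mP.
  by case: (sb_L2i B (tk0 N k) (tkS N k)).
have iY i : P.-integrable setT (EFin \o (fun w => (`|gam i| * K) * Y 1 w i 0)).
  exact: (integrableZl measurableT (`|gam i| * K) (integrable_Y1 Rdiag Rdet Sigma_pd fF cZ bm mart aY refl i)).
have iG : P.-integrable setT (EFin \o (fun w => 2 * K * `|m| + \sum_i (`|gam i| * K) * Y 1 w i 0)).
  exact: (integrableD measurableT (integrable_cstP P _) (Rintegral_sum (index_enum 'I_2) iY).2).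
have [iV cV] := Rintegral_dominated_cvg mVN VN_cvg iG VN_bound.
split => //.
set c := q / 2 * _ + _.
have q0 : 0 < q by exact: Sigma_pd.
apply/eqP; rewrite addrC -normr_le0; apply/ler_addgt0Pl => eta eta0; rewrite addr0.
(* This choice keeps the second-moment part of the error below [eta / 2]; the fourth-moment part, of
   order [1 / (N e)], is then removed by taking [N] large. *)
pose e := eta / (K * q + 1).
have Kq : 0 <= K * q by rewrite mulr_ge0// ltW.
have e0 : 0 < e by rewrite divr_gt0// ltr_wpDl.
have [N0 _ HN] := (cvgrPdist_le _ _).1 cV (eta / 4) (divr_gt0 eta0 (ltr0n _ 4)).
pose b := 3 * q ^+ 2 * K / e.
pose N := maxn N0 (Num.truncn (b / (eta / 4))).+1.
have h1 := HN N (leq_maxl _ _).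
have h2 := VN_expectation N e0.
have h3 : K * (e * q + 3 * q ^+ 2 / (N.+1%:R * e)) / 2 <= eta / 2 + eta / 8.
  have N1 : N.+1%:R != 0 :> R by rewrite pnatr_eq0.
  have -> : K * (e * q + 3 * q ^+ 2 / (N.+1%:R * e)) / 2 = e * (K * q) / 2 + b / N.+1%:R / 2.
    rewrite /b; move: N1 (lt0r_neq0 e0).
    by move: (N.+1%:R : R) (e : R) => n1 e1 N1 e1n; field; rewrite N1 e1n.
  apply: lerD.
    rewrite ler_pM2r// /e mulrAC ler_pdivrMr ?ltr_wpDl//.
    by apply: ler_wpM2l; [exact: ltW|rewrite lerDl].
  have : b / N.+1%:R <= eta / 4.
    rewrite ler_pdivrMr ?ltr0n// mulrC -ler_pdivrMr ?divr_gt0//.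
    by rewrite (le_trans (ltW (truncnS_gt _)))// ler_nat ltnW// ltnS leq_maxr.
  by move: (b / N.+1%:R : R) (eta : R) => u v; lra.
have -> : \int[P]_w V w + c = (\int[P]_w V w - \int[P]_w VN N w) + (\int[P]_w VN N w + c) by ring.
apply: (le_trans (ler_normD _ _)).
have := le_trans h2 h3; rewrite -/c; lra.
Qed.
End expected_ito.

(** * Truncated exponentials and the adjoint relation *)

Section smooth_test_function.
Context {R : realType}.
Implicit Types (f g : R -> R).

(** Parametrised by the segment, so that the order of [a] and [b] is irrelevant. *)
Lemma mean_value f f' : (forall x : R, is_derive x 1 f (f' x)) ->
  forall a b, exists2 t, 0 <= t <= 1 & f b - f a = f' (a + t * (b - a)) * (b - a).
Proof.
move=> df a b; pose g (t : R) := f (a + t * (b - a)).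
have dg (t : R) : is_derive t 1 g (f' (a + t * (b - a)) * (b - a)).
  by apply: is_derive_eq; rewrite /GRing.scale/=; ring.
have cg : continuous g by move=> x; apply/differentiable_continuous/derivable1_diffP; case: (dg x).
have [t t01] := MVT_segment (ler01 : 0 <= 1 :> R) (fun x _ => dg x) (continuous_subspaceT cg).
rewrite /g mul1r mul0r addr0 (addrC a) subrK subr0 mulr1 => E.
by exists t; first by move: t01; rewrite in_itv.
Qed.

Lemma lipschitz_of_derive f f' (K : R) : (forall x : R, is_derive x 1 f (f' x)) ->
  (forall x, `|f' x| <= K) -> forall a b, `|f b - f a| <= K * `|b - a|.
Proof.
move=> df f'K a b; have [c _ ->] := mean_value df a b.
by rewrite normrM; apply: ler_wpM2r.
Qed.

Lemma test_function_derive3 (f f1 f2 f3 : R -> R) (K : R) :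
  (forall x : R, is_derive x 1 f (f1 x)) -> (forall x : R, is_derive x 1 f1 (f2 x)) ->
  (forall x : R, is_derive x 1 f2 (f3 x)) ->
  (forall x, `|f x| <= K) -> (forall x, `|f1 x| <= K) -> (forall x, `|f2 x| <= K) ->
  (forall x, `|f3 x| <= K) -> test_function f f1 f2 K.
Proof.
move=> d0 d1 d2 b0 b1 b2 b3.
have K0 : 0 <= K := le_trans (normr_ge0 _) (b0 0).
have mf (g g' : R -> R) : (forall x : R, is_derive x 1 g (g' x)) -> measurable_fun setT g.
  move=> dg; apply: continuous_measurable_fun => x.
  by apply/differentiable_continuous/derivable1_diffP; case: (dg x).
have tn (t u : R) : 0 <= t <= 1 -> `|t * u| <= `|u|.
  by move=> /andP[t0 t1]; rewrite normrM (ger0_norm t0) -[leRHS]mul1r; apply: ler_wpM2r.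
split=> //; [exact: lipschitz_of_derive d0 b1|exact: lipschitz_of_derive d1 b2| | |
  exact: mf d0|exact: mf d1|exact: mf d2].
- move=> a b c; have [t t01 ->] := mean_value d0 a b.
  rewrite -mulrBl normrM; apply: ler_wpM2r => //.
  apply: (le_trans (lipschitz_of_derive d1 b2 c _)); apply: ler_wpM2l => //.
  have -> : a + t * (b - a) - c = (1 - t) * (a - c) + t * (b - c) by ring.
  apply: (le_trans (ler_normD _ _)); apply: lerD; apply: tn => //.
  by case/andP: t01 => t0 t1; rewrite subr_ge0 t1 gerBl.
- move=> a h.
  pose r (u : R) := f (a + u) - f a - f1 a * u - f2 a * u ^+ 2 / 2.
  have dr (u : R) : is_derive u 1 r (f1 (a + u) - f1 a - f2 a * u).
    have da : is_derive u 1 (fun u : R => f (a + u)) (f1 (a + u)).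
      by apply: is_derive_eq; rewrite /GRing.scale/=; ring.
    by apply: is_derive_eq; rewrite /GRing.scale/=; field.
  have [t t01] := mean_value dr 0 h.
  rewrite {1 2}/r addr0 subrr mulr0 expr0n/= mulr0 mul0r !subr0 add0r => -> .
  rewrite normrM (exprSr _ 2) [leRHS]mulrA; apply: ler_wpM2r => //.
  have [s s01] := mean_value d1 a (a + t * h).
  rewrite [a + t * h - a]addrC addKr => ->.
  rewrite -mulrBl normrM expr2 [leRHS]mulrA; apply: ler_pM; rewrite ?tn//.
  apply: (le_trans (lipschitz_of_derive d2 b3 a _)); apply: ler_wpM2l => //.
  rewrite addrC addKr; exact: le_trans (tn _ _ s01) (tn _ _ t01).
Qed.

(** A logistic function: it solves [f' = f (1 - f / n)], so all its derivatives are polynomials in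
    [f] and bounded. Moreover [0 < f' <= exp], [f'] increases to [exp] with [n], and [|f''| <= f'];
    the last property is what keeps a usable inequality on [Gamma] before the limit. *)
Definition trunc_exp (n u : R) : R := n * expR u / (n + expR u).
Definition trunc_exp1 (n u : R) : R := trunc_exp n u * (1 - trunc_exp n u / n).
Definition trunc_exp2 (n u : R) : R := trunc_exp1 n u * (1 - 2 * trunc_exp n u / n).

Variable n : R.
Hypothesis n0 : 0 < n.

Lemma is_derive_trunc_exp (x : R) : is_derive x 1 (trunc_exp n) (trunc_exp1 n x).
Proof.
have e0 := expR_gt0 x.
have ne : n + expR x != 0 by rewrite gt_eqF// addr_gt0.
have H : is_derive x 1 (fun u => n + expR u) (expR x).
  by apply: is_derive_eq; rewrite /GRing.scale/=; ring.
have H2 := @is_deriveV R (fun u => n + expR u) x _ 1 ne H.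
apply: is_derive_eq; rewrite /trunc_exp1 /trunc_exp /GRing.scale/=.
by field; rewrite ne gt_eqF.
Qed.

Lemma trunc_exp_bounds (u : R) : 0 < trunc_exp n u < n.
Proof.
have e0 := expR_gt0 u; have ne := addr_gt0 n0 e0.
rewrite /trunc_exp divr_gt0 ?mulr_gt0//= ltr_pdivrMr// ltr_pM2l//.
by rewrite ltrDr.
Qed.

Lemma trunc_exp1E (u : R) : trunc_exp1 n u = expR u * (n / (n + expR u)) ^+ 2.
Proof.
have e0 := expR_gt0 u; have ne := addr_gt0 n0 e0.
by rewrite /trunc_exp1 /trunc_exp; field; rewrite !gt_eqF.
Qed.

Lemma trunc_exp1_gt0 (u : R) : 0 < trunc_exp1 n u.
Proof.
by rewrite trunc_exp1E mulr_gt0 ?expR_gt0// exprn_gt0// divr_gt0// addr_gt0 ?expR_gt0.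
Qed.

Lemma trunc_exp1_le (u : R) : trunc_exp1 n u <= expR u.
Proof.
have e0 := expR_gt0 u; have ne := addr_gt0 n0 e0.
rewrite trunc_exp1E -[leRHS]mulr1 ler_pM2l//.
by rewrite expr_le1 ?divr_ge0 ?(ltW n0) ?(ltW ne)// ler_pdivrMr// mul1r lerDl ltW.
Qed.

Lemma norm_trunc_exp2 (u : R) : `|trunc_exp2 n u| <= trunc_exp1 n u.
Proof.
rewrite /trunc_exp2 normrM (gtr0_norm (trunc_exp1_gt0 u)) -[leRHS]mulr1.
apply: ler_wpM2l; first exact: ltW (trunc_exp1_gt0 u).
have /andP[a b] := trunc_exp_bounds u.
have : 0 <= trunc_exp n u / n <= 1 by rewrite divr_ge0 ?(ltW a) ?(ltW n0)//= ler_pdivrMr// mul1r ltW.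
rewrite -mulrA; move: (trunc_exp n u / n) => v /andP[v0 v1].
by rewrite ler_norml; apply/andP; split; lra.
Qed.

(** The constant comes from the third derivative, whose two terms are bounded by [n] and [2 * n]. *)
Lemma trunc_exp_test_function :
  test_function (trunc_exp n) (trunc_exp1 n) (trunc_exp2 n) (3 * n).
Proof.
have n00 : n != 0 by rewrite gt_eqF.
have b (u : R) := trunc_exp_bounds u.
have b1 (u : R) : 0 < trunc_exp1 n u <= n.
  rewrite trunc_exp1_gt0/= /trunc_exp1 -[leRHS]mulr1.
  have /andP[u0 un] := b u; apply: ler_pM; [exact: ltW| |exact: ltW|].
    by rewrite subr_ge0 ler_pdivrMr// mul1r ltW.
  by rewrite gerBl divr_ge0// ltW.
have d1 (x : R) : is_derive x 1 (trunc_exp1 n) (trunc_exp2 n x).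
  have h := is_derive_trunc_exp x.
  by apply: is_derive_eq; rewrite /trunc_exp2 /trunc_exp1 /GRing.scale/=; field.
have d2 (x : R) : is_derive x 1 (trunc_exp2 n)
    (trunc_exp2 n x * (1 - 2 * trunc_exp n x / n) - 2 * trunc_exp1 n x ^+ 2 / n).
  have h := is_derive_trunc_exp x; have h1 := d1 x.
  by apply: is_derive_eq; rewrite /GRing.scale/=; field.
apply: (test_function_derive3 is_derive_trunc_exp d1 d2) => x.
- by case/andP: (b x) => a c; rewrite gtr0_norm//; lra.
- by case/andP: (b1 x) => a c; rewrite gtr0_norm//; lra.
- apply: (le_trans (norm_trunc_exp2 x)); case/andP: (b1 x) => a c; lra.
- have /andP[a c] := b1 x; have /andP[a0 c0] := b x.
  apply: (le_trans (ler_normB _ _)).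
  have h1 : `|trunc_exp2 n x * (1 - 2 * trunc_exp n x / n)| <= n.
    rewrite normrM -[leRHS]mulr1; apply: ler_pM => //.
      exact: le_trans (norm_trunc_exp2 x) c.
    have : 0 <= trunc_exp n x / n <= 1.
      by rewrite divr_ge0 ?(ltW a0) ?(ltW n0)//= ler_pdivrMr// mul1r ltW.
    rewrite -mulrA; move: (trunc_exp n x / n) => v /andP[v0 v1].
    by rewrite ler_norml; apply/andP; split; lra.
  have h2 : `|2 * trunc_exp1 n x ^+ 2 / n| <= 2 * n.
    rewrite ger0_norm; last by rewrite divr_ge0 ?(ltW n0)// mulr_ge0// sqr_ge0.
    rewrite -mulrA ler_pM2l// ler_pdivrMr// -expr2 lerXn2r// ?nnegrE ltW//.
  lra.
Qed.
End smooth_test_function.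

Lemma trunc_exp1_le_n {R : realType} (n m u : R) : 0 < n -> n <= m ->
  trunc_exp1 n u <= trunc_exp1 m u.
Proof.
move=> n0 nm; have m0 := lt_le_trans n0 nm; have e0 := expR_gt0 u.
have ne := addr_gt0 n0 e0; have me := addr_gt0 m0 e0.
rewrite !trunc_exp1E//; apply: ler_wpM2l; first exact: ltW.
have n0' := ltW n0; have m0' := ltW m0; have ne' := ltW ne; have me' := ltW me.
rewrite lerXn2r ?nnegrE ?divr_ge0//.
rewrite ler_pdivrMr// mulrAC ler_pdivlMr// !mulrDr mulrC lerD2l.
by apply: ler_wpM2r => //; exact: ltW.
Qed.

Lemma trunc_ratio_cvg {R : realType} (u : R) :
  (k.+1%:R : R) / (k.+1%:R + expR u) @[k --> \oo] --> (1 : R).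
Proof.
have -> : (fun k : nat => (k.+1%:R : R) / (k.+1%:R + expR u)) =
    (fun k => (1 + expR u * harmonic k)^-1).
  apply/funext => k; rewrite /harmonic/=.
  have k0 : k.+1%:R != 0 :> R by rewrite pnatr_eq0.
  have e0 := expR_gt0 u.
  have ke : (k.+1%:R : R) + expR u != 0 by rewrite gt_eqF// ltr_wpDl.
  move: k0 ke; move: (k.+1%:R : R) => n n0 ne.
  by field; rewrite n0 ne ?andbT/=.
have H : (1 + expR u * harmonic k : R) @[k --> \oo] --> (1 : R).
  rewrite -[X in _ --> X](addr0 1); apply: cvgD; first exact: cvg_cst.
  rewrite -[X in _ --> X](mulr0 (expR u)); apply: cvgM; first exact: cvg_cst.
  exact: cvg_harmonic.
rewrite -[X in _ --> X]invr1.
by apply: cvgV => //; rewrite oner_neq0.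
Qed.

Lemma trunc_exp1_cvg {R : realType} (u : R) :
  trunc_exp1 (k.+1%:R : R) u @[k --> \oo] --> expR u.
Proof.
rewrite [X in _ --> X](_ : expR u = expR u * (1 * 1)); last by rewrite !mulr1.
under eq_fun do rewrite trunc_exp1E// expr2.
apply: cvgM; first exact: cvg_cst.
by apply: cvgM; exact: trunc_ratio_cvg.
Qed.

Lemma trunc_exp2_cvg {R : realType} (u : R) :
  trunc_exp2 (k.+1%:R : R) u @[k --> \oo] --> expR u.
Proof.
have -> : (fun k : nat => trunc_exp2 (k.+1%:R : R) u) =
    (fun k => trunc_exp1 k.+1%:R u * (2 * (k.+1%:R / (k.+1%:R + expR u)) - 1)).
  apply/funext => k; rewrite /trunc_exp2 /trunc_exp; congr (_ * _).
  have k0 : k.+1%:R != 0 :> R by rewrite pnatr_eq0.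
  have ke : (k.+1%:R : R) + expR u != 0 by rewrite gt_eqF// ltr_wpDl// expR_gt0.
  move: k0 ke; move: (k.+1%:R : R) => n n0 ne.
  by field; rewrite ne n0.
rewrite -[X in _ --> X]mulr1; apply: cvgM; first exact: trunc_exp1_cvg.
rewrite [X in _ --> X](_ : 1 = 2 * 1 - 1); last by ring.
apply: cvgB; last exact: cvg_cst.
by apply: cvgM; [exact: cvg_cst|exact: trunc_ratio_cvg].
Qed.

Lemma monotone_integral_cvg {R : realType} {d} {T : measurableType d}
    (mu : {measure set T -> \bar R}) (D : set T) (g : nat -> T -> \bar R) (f : T -> \bar R) :
  measurable D -> (forall n, measurable_fun D (g n)) -> (forall n x, D x -> (0 <= g n x)%E) ->
  (forall x, D x -> nondecreasing_seq (g ^~ x)) ->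
  (forall x, D x -> g n x @[n --> \oo] --> f x) ->
  (\int[mu]_(x in D) g n x)%E @[n --> \oo] --> (\int[mu]_(x in D) f x)%E.
Proof.
move=> mD mg g0 ndg gf.
have -> : (\int[mu]_(x in D) f x = \int[mu]_(x in D) limn (g^~ x))%E.
  by apply: eq_integral => x; rewrite inE => Dx; apply/esym/cvg_lim => //; exact: gf.
exact: cvg_monotone_convergence.
Qed.

(** * Boundary transforms, truncated and full *)

Section boundary.
Context {R : realType} (Sigma Rm : 'M[R]_2) (mu : 'cV[R]_2).
Hypotheses (Rdiag : forall i, 0 < Rm i i)
  (Rdet : forall i, 0 < Rm i i * Rm (rev_ord i) (rev_ord i) - Rm i (rev_ord i) * Rm (rev_ord i) i)
  (Sigma_pd : positive_definite Sigma).
Context {d : measure_display} {T : measurableType d} (P : probability T R)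
  (F : R -> set (set T)) (X Y Z : R -> T -> plane R) (nu : probability (plane R) R).
Hypotheses (fF : is_filtration F) (cZ : continuous_paths Z) (aZ : adapted F Z)
  (bm : brownian_motion P Sigma mu X)
  (mart : martingale P F (fun t w => X t w - X 0 w - t *: mu))
  (aY : adapted F Y) (cY : continuous_paths Y)
  (refl : forall w, reflected Rm (X ^~ w) (Y ^~ w) (Z ^~ w))
  (stat : forall t, 0 <= t -> forall B : set (plane R), measurable B ->
      P (Z t @^-1` B) = nu B).
Variable cum : 'I_2 -> T -> cumulative R R.
Hypothesis cumE : forall i w t, cum i w t = Y (Num.max 0 t) w i 0.
Local Notation Rp := (`[0, +oo[%classic : set R).
Local Notation I01 := (`]0%R, 1%R]%classic : set R).
Local Notation ls := (@lebesgue_stieltjes_measure R).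
Hypothesis cumI : forall i w, (\int[ls (cum i w)]_(t in `[0%R, +oo[) (Z t w i 0%R)%:E = 0)%E.

Let I01p (u : R) : I01 u -> Rp u.
Proof. by rewrite /= !in_itv/= andbT => /andP[/ltW]. Qed.

Lemma Z_ge0 (t : R) w i : 0 <= t -> 0 <= Z t w i 0.
Proof. by move=> t0; have [H _ _ _] := refl w; case: (H t t0) => _ /(_ i). Qed.

Lemma within_cont_Z i (x : R) w : {within Rp, continuous (fun t => x * Z t w i 0)}.
Proof.
have cf : continuous (fun v : 'cV[R]_2 => x * v i 0).
  move=> v; apply: (@continuous_comp _ _ _ (fun v : 'cV[R]_2 => v i 0) (fun r : R => x * r)).
    exact: continuous_coord_cV.
  exact: mulrl_continuous.
have H := within_continuous_comp cf (@cZ w).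
by move=> t; exact: (H t).
Qed.

Lemma measurable_comp_Z (f : R -> R) i x w : measurable_fun setT f ->
  measurable_fun I01 (fun t => f (x * Z t w i 0)).
Proof.
move=> mf; apply: (measurable_funS _ I01p) => //.
exact: (measurableT_comp mf (within_cy_measurable (@within_cont_Z i x w))).
Qed.

Definition bdry_term (k : nat) i (x : R) w : R :=
  \int[ls (cum i w)]_(u in I01) trunc_exp1 k.+1%:R (x * Z u w (rev_ord i) 0).

Let kpos (k : nat) : 0 < k.+1%:R :> R. Proof. by rewrite ltr0n. Qed.
Let tfk k := trunc_exp_test_function (kpos k).

Lemma bdry_term_cvg k i x w :
  (ls (cum i w)).-integrable I01
    (EFin \o (fun u => trunc_exp1 k.+1%:R (x * Z u w (rev_ord i) 0))) /\
  \sum_(l < N.+1) trunc_exp1 k.+1%:R (x * Z (l.+1%:R / N.+1%:R) w (rev_ord i) 0) *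
    (Y (l.+1%:R / N.+1%:R) w i 0 - Y (l%:R / N.+1%:R) w i 0) @[N --> \oo] --> bdry_term k i x w.
Proof.
pose v (N l : nat) := trunc_exp1 k.+1%:R (x * Z (l.+1%:R / N.+1%:R) w (rev_ord i) 0) : R.
have H := @Riemann_Stieltjes R (cum i w) v
  (fun u => trunc_exp1 k.+1%:R (x * Z u w (rev_ord i) 0)) (3 * k.+1%:R).
case: H => [N l|u /andP[u0 u1] e e0|I C]; first exact: (tf_b1 (tfk k)).
  have K0 : 0 < 3 * k.+1%:R :> R by rewrite mulr_gt0.
  have [N0 H] := within_cy_near (@within_cont_Z (rev_ord i) x w) (ltW u0) (divr_gt0 e0 K0).
  exists N0 => N NN l /andP[l1 l2].
  apply: (le_trans (tf_lip1 (tfk k) _ _)); rewrite mulrC -ler_pdivlMr//.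
  apply: (H _ NN); first by rewrite divr_ge0.
  rewrite ger0_norm ?subr_ge0//.
  have -> : l.+1%:R / N.+1%:R = l%:R / N.+1%:R + N.+1%:R^-1 :> R by rewrite -natr1; ring.
  by rewrite lerBlDl lerD2r ltW.
split => //; move: C; rewrite /v.
under eq_fun do under eq_bigr do rewrite !cumE !(max_idPr _) ?divr_ge0//.
exact.
Qed.

(** The measure of integration itself depends on [w]; the Riemann sums of [bdry_term_cvg] show that
    the dependence is measurable. *)
Lemma measurable_bdry_term k i x : measurable_fun setT (bdry_term k i x).
Proof.
apply: (measurable_fun_cvg _ (fun w _ => (bdry_term_cvg k i x w).2)) => N.
have d0 (l : nat) : 0 <= l%:R / N.+1%:R :> R by rewrite divr_ge0.
apply: measurable_sum => l; apply: measurable_funM; last first.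
  by apply: measurable_funB; exact: (measurable_Y fF aY).
apply: (measurableT_comp (tf_m1 (tfk k))).
apply: measurable_funM => //.
apply: (meas_wrtS (fF.1 _ (d0 _)).2).
exact: (measurable_adapted aZ (d0 _) (@continuous_coord_cV R _)).
Qed.

Lemma ls_unit_interval i w : ls (cum i w) I01 = (Y 1%R w i 0%R)%:E.
Proof.
have -> : ls (cum i w) I01 = (cum i w 1 - cum i w 0)%:E by apply: ls_itv.
have [_ y0 _ _] := refl w; rewrite !cumE maxxx (max_idPr ler01).
have -> : Y 0 w = 0 by exact: y0.
by rewrite mxE subr0.
Qed.

Lemma bdry_term_bounds k i x w : 0 <= bdry_term k i x w <= 3 * k.+1%:R * Y 1 w i 0.
Proof.
have [I _] := bdry_term_cvg k i x w.
apply/andP; split.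
  by apply: Rintegral_ge0 => u _; apply: ltW; exact: trunc_exp1_gt0.
have Y1 (c : R) : (\int[ls (cum i w)]_(u in I01) c%:E = (c * Y 1%R w i 0%R)%:E)%E.
  have mI : measurable I01 by [].
  rewrite EFinM -(ls_unit_interval i w); exact: (integral_cst (ls (cum i w)) mI c%:E).
have I2 : (ls (cum i w)).-integrable I01 (EFin \o cst (3 * k.+1%:R)).
  apply/integrableP; split; first by apply/measurable_EFinP.
  rewrite (_ : (fun u => _) = cst (3 * k.+1%:R)%:E); last first.
    by apply/funext => u /=; rewrite ger0_norm.
  by rewrite Y1 ltry.
apply: (le_trans (le_Rintegral _ I I2 _)) => //.
  by move=> u _; apply: (le_trans (ler_norm _)); exact: (tf_b1 (tfk k)).
by rewrite /Rintegral Y1.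
Qed.

Lemma integrable_bdry_term k i x : P.-integrable setT (EFin \o bdry_term k i x).
Proof.
have iY := integrable_Y1 Rdiag Rdet Sigma_pd fF cZ bm mart aY refl i.
apply: (integrable_le (measurable_bdry_term k i x)
  (integrableZl measurableT (3 * k.+1%:R) iY)) => w.
have /andP[a b] := bdry_term_bounds k i x w.
by rewrite ger0_norm.
Qed.

(* Y_i grows only where Z_i = 0, so only the other coordinate matters. *)
Lemma bdry_term_dot k i th w :
  \int[ls (cum i w)]_(u in I01) trunc_exp1 k.+1%:R (dot th (Z u w)) =
  bdry_term k i (th (rev_ord i) 0) w.
Proof.
rewrite /bdry_term /Rintegral; congr fine.
have cZi : {within Rp, continuous (fun t => Z t w i 0)}.
  rewrite (_ : (fun t => Z t w i 0) = (fun t => 1 * Z t w i 0)); last first.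
    by apply/funext => u; rewrite mul1r.
  exact: within_cont_Z.
have Z0 := ae_eq0_Stieltjes (fun t (t0 : 0 <= t) => Z_ge0 w i t0)
   (within_cy_measurable cZi) (cumI i w).
have md : measurable_fun I01 (fun t => trunc_exp1 k.+1%:R (dot th (Z t w))).
  have H := within_continuous_comp (@continuous_dot R th) (@cZ w).
  apply: (measurable_funS _ I01p) => //.
  exact: (measurableT_comp (tf_m1 (tfk k)) (within_cy_measurable H)).
apply: ge0_ae_eq_integral => //.
- exact/measurable_EFinP.
- by apply/measurable_EFinP; apply: measurable_comp_Z; exact: (tf_m1 (tfk k)).
- by move=> u _; rewrite lee_fin ltW// trunc_exp1_gt0.
- by move=> u _; rewrite lee_fin ltW// trunc_exp1_gt0.
apply: filterS Z0 => u /(_ _)/=.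
move=> H Iu; have [] := H (I01p Iu) => E.
by rewrite (dotE i) E mulr0 add0r.
Qed.

Definition bdry_path i (x : R) w : \bar R :=
  (\int[ls (cum i w)]_(u in I01) (expR (x * Z u w (rev_ord i) 0%R))%:E)%E.

Lemma bdry_path_cvg i x w : (bdry_term k i x w)%:E @[k --> \oo] --> bdry_path i x w.
Proof.
have -> : (fun k => (bdry_term k i x w)%:E) = (fun k => \int[ls (cum i w)]_(u in I01)
    (trunc_exp1 k.+1%:R (x * Z u w (rev_ord i) 0%R))%:E)%E.
  apply/funext => k; rewrite /bdry_term /Rintegral fineK//.
  exact: (integrable_fin_num _ (bdry_term_cvg k i x w).1).
apply: monotone_integral_cvg => //.
- by move=> k; apply/measurable_EFinP; apply: measurable_comp_Z; exact: (tf_m1 (tfk k)).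
- by move=> k u _; rewrite lee_fin ltW// trunc_exp1_gt0.
- by move=> u _ k l kl; rewrite lee_fin trunc_exp1_le_n// ler_nat.
- by move=> u _; apply: cvg_EFin; [exact: nearW|exact: trunc_exp1_cvg].
Qed.

Lemma measurable_bdry_path i x : measurable_fun setT (bdry_path i x).
Proof.
apply: (emeasurable_fun_cvg (fun k => EFin \o bdry_term k i x)) => [k|w _].
  by apply/measurable_EFinP; exact: measurable_bdry_term.
exact: bdry_path_cvg.
Qed.

Lemma bdry_path_ge0 i x w : (0 <= bdry_path i x w)%E.
Proof. by apply: integral_ge0 => u _; rewrite lee_fin expR_ge0. Qed.
End boundary.

Lemma ord2_neq (l i : 'I_2) : l != i -> l = rev_ord i.
Proof.
by case: i => [[|[|//]]] Hi; case: l => [[|[|//]]] Hl //= _; exact/val_inj.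
Qed.

Lemma expR_convex {R : realType} (t a b : R) : 0 <= t <= 1 ->
  expR (t * a + (1 - t) * b) <= t * expR a + (1 - t) * expR b.
Proof.
move=> /andP[t0 t1]; set c := t * a + (1 - t) * b.
have tangent x : expR c * (1 + (x - c)) <= expR x.
  rewrite -[X in _ <= expR X](subrKC c) [leRHS]expRD.
  by apply: ler_wpM2l; [exact: expR_ge0|exact: expR_ge1Dx].
have t1' : 0 <= 1 - t by rewrite subr_ge0.
apply: (le_trans _ (lerD (ler_wpM2l t0 (tangent a)) (ler_wpM2l t1' (tangent b)))).
by rewrite le_eqVlt; apply/orP; left; apply/eqP; rewrite /c; ring.
Qed.

(* [phi] is the moment generating function and [B i] the transform of the boundary measure carried by axis [i]. *)
Lemma cvg_le_sup {R : realType} (u : nat -> \bar R) l : nondecreasing_seq u ->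
  u n @[n --> \oo] --> l -> forall n, (u n <= l)%E.
Proof.
move=> nd ul n; have := ereal_nondecreasing_cvgn nd => /cvg_unique H.
have -> : l = ereal_sup (range u) by apply/esym/H => //; exact: ereal_hausdorff.
by apply: ereal_sup_ubound; exists n.
Qed.

(** The interface between probability and geometry: the domain is determined from these properties
    alone. [bs_left] expresses monotone convergence from the left, and [bs_phi_fin] and [bs_next]
    are what the truncated relation yields on [Gamma], where finiteness of [phi] is not known
    beforehand. *)
Record boundary_system {R : realType} (Sigma Rm : 'M[R]_2) (mu : 'cV[R]_2)
    (phi : 'cV[R]_2 -> \bar R) (B : 'I_2 -> R -> \bar R) : Prop := {
  bs_pos : forall i x, (0 < B i x)%E;
  bs_le : forall i (x y : R), x <= y -> (B i x <= B i y)%E;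
  bs_fin0 : forall i, (B i 0%R < +oo)%E;
  bs_conv : forall i (t x y : R), 0 <= t <= 1 ->
    (B i (t * x + (1 - t) * y)%R <= t%:E * B i x + (1 - t)%:E * B i y)%E;
  bs_left : forall i (x C : R), (forall y, y < x -> (B i y <= C%:E)%E) -> (B i x <= C%:E)%E;
  bs_phi_pos : forall th, (0 < phi th)%E;
  bs_phi_le : forall th th' : 'cV[R]_2, (forall i, th i 0 <= th' i 0) -> (phi th <= phi th')%E;
  bs_fin : forall i (th : 'cV[R]_2), (phi th < +oo)%E -> (B i (th i 0%R) < +oo)%E;
  bs_bar : forall th, (phi th < +oo)%E ->
    gamma Sigma mu th * fine (phi th) =
    \sum_i gamma_ Rm (rev_ord i) th * fine (B i (th i 0%R));
  bs_phi_fin : forall th : 'cV[R]_2, Gamma Sigma mu th -> (forall i, (B i (th i 0%R) < +oo)%E) ->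
    (phi th < +oo)%E;
  bs_next : forall i (th : 'cV[R]_2), Gamma Sigma mu th -> gamma_ Rm (rev_ord i) th < 0 ->
    (B (rev_ord i) (th (rev_ord i) 0%R) < +oo)%E -> (B i (th i 0%R) < +oo)%E }.

(** * The adjoint relation and finiteness in stationarity *)

Section boundary_expectation.
Context {R : realType} (Sigma Rm : 'M[R]_2) (mu : 'cV[R]_2).
Hypotheses (Rdiag : forall i, 0 < Rm i i)
  (Rdet : forall i, 0 < Rm i i * Rm (rev_ord i) (rev_ord i) - Rm i (rev_ord i) * Rm (rev_ord i) i)
  (Sigma_pd : positive_definite Sigma).
Context {d : measure_display} {T : measurableType d} (P : probability T R)
  (F : R -> set (set T)) (X Y Z : R -> T -> plane R) (nu : probability (plane R) R).
Hypotheses (fF : is_filtration F) (cZ : continuous_paths Z) (aZ : adapted F Z)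
  (bm : brownian_motion P Sigma mu X)
  (mart : martingale P F (fun t w => X t w - X 0 w - t *: mu))
  (aY : adapted F Y) (cY : continuous_paths Y)
  (refl : forall w, reflected Rm (X ^~ w) (Y ^~ w) (Z ^~ w))
  (stat : forall t, 0 <= t -> forall B : set (plane R), measurable B ->
      P (Z t @^-1` B) = nu B).
Variable cum : 'I_2 -> T -> cumulative R R.
Hypothesis cumE : forall i w t, cum i w t = Y (Num.max 0 t) w i 0.
Local Notation Rp := (`[0, +oo[%classic : set R).
Local Notation I01 := (`]0%R, 1%R]%classic : set R).
Local Notation ls := (@lebesgue_stieltjes_measure R).
Hypothesis cumI : forall i w, (\int[ls (cum i w)]_(t in `[0%R, +oo[) (Z t w i 0%R)%:E = 0)%E.

Hypothesis Rdrift : forall i,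
  Rm (rev_ord i) (rev_ord i) * mu i 0 - Rm i (rev_ord i) * mu (rev_ord i) 0 < 0.
Local Notation term := (bdry_term Z cum).
Local Notation path := (bdry_path Z cum).
Let kpos (k : nat) : 0 < k.+1%:R :> R. Proof. by rewrite ltr0n. Qed.
Let tfk k := trunc_exp_test_function (kpos k).

Let b k i x : R := \int[P]_w term k i x w.
Let A i x : \bar R := (\int[P]_w path i x w)%E.
Let a k (th : 'cV[R]_2) : R := \int[nu]_z trunc_exp1 k.+1%:R (dot th z).
Let a1 k (th : 'cV[R]_2) : R := \int[nu]_z trunc_exp2 k.+1%:R (dot th z).

Let it k i x : P.-integrable setT (EFin \o term k i x).
Proof. exact: (integrable_bdry_term Rdiag Rdet Sigma_pd fF cZ aZ bm mart aY refl). Qed.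

Let bE k i x : (b k i x)%:E = (\int[P]_w (term k i x w)%:E)%E.
Proof. rewrite /b /Rintegral fineK//; exact: (integrable_fin_num measurableT (it k i x)). Qed.

Lemma bdry_term_le k l i x w : (k <= l)%N -> term k i x w <= term l i x w.
Proof.
move=> kl; apply: le_Rintegral => //.
- exact: (bdry_term_cvg cZ cumE k i x w).1.
- exact: (bdry_term_cvg cZ cumE l i x w).1.
- by move=> u _; rewrite trunc_exp1_le_n// ler_nat.
Qed.

Let b_cvg i x : (b k i x)%:E @[k --> \oo] --> A i x.
Proof.
under eq_fun do rewrite bE.
apply: monotone_integral_cvg => //.
- by move=> k; case/integrableP : (it k i x).
- by move=> k w _; rewrite lee_fin; case/andP: (bdry_term_bounds cZ refl cumE k i x w).
- by move=> w _ k l kl; rewrite lee_fin bdry_term_le.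
- by move=> w _; exact: (bdry_path_cvg cZ cumE).
Qed.

Let b_le k i x : ((b k i x)%:E <= A i x)%E.
Proof.
apply: (cvg_le_sup (u := fun k => (b k i x)%:E)) => [m l ml|]; last exact: b_cvg.
rewrite lee_fin; apply: le_Rintegral => //= w _; exact: bdry_term_le.
Qed.

Let b_ge0 k i x : 0 <= b k i x.
Proof.
by apply: Rintegral_ge0 => // w _; case/andP: (bdry_term_bounds cZ refl cumE k i x w).
Qed.

Let mnu (f : R -> R) th : measurable_fun setT f ->
  measurable_fun setT (fun z : plane R => f (dot th z)).
Proof. by move=> mf; exact: (measurableT_comp mf (measurable_dot th)). Qed.

Let inu k th : nu.-integrable setT (EFin \o (fun z : plane R => trunc_exp1 k.+1%:R (dot th z))).
Proof.
apply: L2_integrable; apply: (L2_bounded nu _ (fun z => tf_b1 (tfk k) (dot th z))).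
exact: mnu (tf_m1 (tfk k)).
Qed.

Let inu2 k th : nu.-integrable setT (EFin \o (fun z : plane R => trunc_exp2 k.+1%:R (dot th z))).
Proof.
apply: L2_integrable; apply: (L2_bounded nu _ (fun z => tf_b2 (tfk k) (dot th z))).
exact: mnu (tf_m2 (tfk k)).
Qed.

Let phi (th : 'cV[R]_2) : \bar R := (\int[nu]_z (expR (dot th z))%:E)%E.

Let mexp th : measurable_fun setT (fun z : plane R => (expR (dot th z))%:E).
Proof. by apply/measurable_EFinP; exact: (mnu th (@measurable_expR R)). Qed.

Let a_cvg th : (a k th)%:E @[k --> \oo] --> phi th.
Proof.
have -> : (fun k => (a k th)%:E) = (fun k => \int[nu]_z (trunc_exp1 k.+1%:R (dot th z))%:E)%E.
  apply/funext => k; rewrite /a /Rintegral fineK//.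
  exact: (integrable_fin_num measurableT (inu k th)).
apply: monotone_integral_cvg => //.
- by move=> k; case/integrableP : (inu k th).
- by move=> k z _; rewrite lee_fin ltW// trunc_exp1_gt0.
- by move=> z _ k l kl; rewrite lee_fin trunc_exp1_le_n// ler_nat.
- by move=> z _; apply: cvg_EFin; [exact: nearW|exact: trunc_exp1_cvg].
Qed.

Let a_le k th : ((a k th)%:E <= phi th)%E.
Proof.
apply: (cvg_le_sup (u := fun k => (a k th)%:E)) => [m l ml|]; last exact: a_cvg.
rewrite lee_fin; apply: le_Rintegral => //= z _.
by rewrite trunc_exp1_le_n// ler_nat.
Qed.

Let a1_le k th : `|a1 k th| <= a k th.
Proof.
apply: (le_trans (le_normr_Rintegral measurableT (inu2 k th))).
apply: le_Rintegral => //=; first exact: integrable_norm (inu2 k th).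
by move=> z _; exact: norm_trunc_exp2.
Qed.

Let phiP th : phi th = (\int[P]_w (expR (dot th (Z 0%R w)))%:E)%E.
Proof.
have mZ : measurable_fun setT (Z 0).
  move=> _ B mB; rewrite setTI; apply: (fF.1 0 (lexx _)).2; exact: aZ.
transitivity (\int[pushforward P (Z 0%R)]_z (expR (dot th z))%:E)%E.
  by apply/esym; apply: eq_measure_integral => C mC _; exact: stat.
by rewrite (ge0_integral_pushforward mZ)// => z _; rewrite lee_fin expR_ge0.
Qed.

Let phi_pos th : (0 < phi th)%E.
Proof.
rewrite lt_neqAle; apply/andP; split; last by apply: integral_ge0 => z _; rewrite lee_fin expR_ge0.
apply/eqP => /esym phi0.
have := (ae_eq_integral_abs nu measurableT (mexp th)).1.
rewrite (_ : (fun x => `|(expR (dot th x))%:E|)%E = (fun x => (expR (dot th x))%:E)); last first.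
  by apply/funext => z; rewrite gee0_abs// lee_fin expR_ge0.
move=> /(_ phi0)[N [mN N0 sub]].
have : (nu setT <= nu N)%E.
  apply: le_measure; rewrite ?inE//; apply: subset_trans sub => z _ /= /(_ Logic.I) [].
  by apply/eqP; rewrite gt_eqF// expR_gt0.
by rewrite N0 probability_setT lee_fin ler10.
Qed.

Let phi_le (th th' : 'cV[R]_2) : (forall i, th i 0 <= th' i 0) -> (phi th <= phi th')%E.
Proof.
move=> thth'; rewrite !phiP.
have mZ : measurable_fun setT (Z 0).
  move=> _ B mB; rewrite setTI; apply: (fF.1 0 (lexx _)).2; exact: aZ.
apply: ge0_le_integral => //.
- exact (measurableT_comp (mexp th) mZ).
- exact (measurableT_comp (mexp th') mZ).
- move=> w _; rewrite lee_fin ler_expR !(dotE 0).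
  by apply: lerD; apply: ler_wpM2r => //; exact: (Z_ge0 refl).
Qed.

(* The basic adjoint relation, tested against a bounded truncation of the exponential. *)
Lemma truncated_adjoint_relation k i th : th != 0 ->
  dot th (Sigma *m th) / 2 * a1 k th + dot th mu * a k th +
  (gamma_ Rm i th * b k i (th (rev_ord i) 0) +
   gamma_ Rm (rev_ord i) th * b k (rev_ord i) (th i 0)) = 0.
Proof.
move=> th0.
have [iV <-] := expected_ito Rdiag Rdet Sigma_pd fF cZ aZ bm mart aY refl stat cumE th0 (tfk k).
congr (_ + _).
transitivity (\int[P]_w (gamma_ Rm i th * term k i (th (rev_ord i) 0) w +
   gamma_ Rm (rev_ord i) th * term k (rev_ord i) (th i 0) w)).
  rewrite RintegralD// ?RintegralZl//.
  - exact: (integrableZl measurableT (gamma_ Rm i th) (it k i (th (rev_ord i) 0))).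
  - exact: (integrableZl measurableT (gamma_ Rm (rev_ord i) th) (it k (rev_ord i) (th i 0))).
apply: eq_Rintegral => w _; rewrite (big_ord2_rev _ i) !(bdry_term_dot cZ refl cumI).
by rewrite rev_ordK.
Qed.

Let A_ge0 i x : (0 <= A i x)%E.
Proof. by apply: integral_ge0 => w _; exact: bdry_path_ge0. Qed.

Let mA i x : measurable_fun setT (path i x).
Proof. exact: (measurable_bdry_path fF cZ aZ aY cumE). Qed.

Let le_b_fin i x (C : R) : (forall k, b k i x <= C) -> (A i x <= C%:E)%E.
Proof.
move=> bC; rewrite -(cvg_lim (@ereal_hausdorff R) (@b_cvg i x)).
apply: lime_le; first by apply/cvg_ex; eexists; exact: (@b_cvg i x).
by apply: nearW => k; rewrite lee_fin.
Qed.

Let A_fin i x : (A i x < +oo)%E -> A i x = (fine (A i x))%:E.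
Proof. by move=> fA; rewrite fineK// ge0_fin_numE. Qed.

Let phi_fin th : (phi th < +oo)%E -> phi th = (fine (phi th))%:E.
Proof. by move=> fA; rewrite fineK// ge0_fin_numE// ltW. Qed.

Let b_lefin k i x : (A i x < +oo)%E -> b k i x <= fine (A i x).
Proof. by move=> fA; rewrite -lee_fin -(A_fin fA). Qed.

Let a_lefin k th : (phi th < +oo)%E -> a k th <= fine (phi th).
Proof. by move=> fA; rewrite -lee_fin -(phi_fin fA). Qed.

Let a_ge0 k th : 0 <= a k th.
Proof. by apply: Rintegral_ge0 => // z _; rewrite ltW// trunc_exp1_gt0. Qed.

Let le_a_fin th (C : R) : (forall k, a k th <= C) -> (phi th <= C%:E)%E.
Proof.
move=> aC; rewrite -(cvg_lim (@ereal_hausdorff R) (@a_cvg th)).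
apply: lime_le; first by apply/cvg_ex; eexists; exact: (@a_cvg th).
by apply: nearW => k; rewrite lee_fin.
Qed.

Let A_le i x y : x <= y -> (A i x <= A i y)%E.
Proof.
move=> xy; apply: ge0_le_integral => //; first by move=> w _; exact: bdry_path_ge0.
move=> w _; apply: ge0_le_integral => //.
- by apply/measurable_EFinP; apply: (measurable_comp_Z cZ); exact: measurable_expR.
- by apply/measurable_EFinP; apply: (measurable_comp_Z cZ); exact: measurable_expR.
- move=> u; rewrite /= in_itv/= => /andP[u0 _]; rewrite lee_fin ler_expR.
  by apply: ler_wpM2r => //; exact: (Z_ge0 refl _ _ (ltW u0)).
Qed.

Let A_fin0 i : (A i 0%R < +oo)%E.
Proof.
have iY := integrable_Y1 Rdiag Rdet Sigma_pd fF cZ bm mart aY refl i.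
have E w : path i 0 w = (Y 1%R w i 0%R)%:E.
  rewrite /bdry_path (eq_integral (cst 1%E)); last by move=> u _; rewrite mul0r expR0.
  rewrite integral_cst// mul1e; exact: (ls_unit_interval refl cumE).
rewrite /A; under eq_integral do rewrite E.
apply: integrable_lty => //; exact: iY.
Qed.

Let A_le0 i x : x <= 0 -> (A i x < +oo)%E.
Proof. by move=> x0; exact: le_lt_trans (A_le i x0) (A_fin0 i). Qed.

Let A_conv i (t x y : R) : 0 <= t <= 1 ->
  (A i (t * x + (1 - t) * y)%R <= t%:E * A i x + (1 - t)%:E * A i y)%E.
Proof.
move=> t01; have /andP[t0 t1] := t01.
have t1' : 0 <= 1 - t by rewrite subr_ge0.
have me z w : measurable_fun I01 (fun u => (expR (z * Z u w (rev_ord i) 0))%:E).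
  by apply/measurable_EFinP; apply: (measurable_comp_Z cZ); exact: measurable_expR.
have p0 z w := bdry_path_ge0 Z cum i z w.
rewrite /A -!ge0_integralZl// ?lee_fin//.
rewrite -ge0_integralD//; last 4 first.
- by move=> w _; rewrite mule_ge0// lee_fin.
- exact: measurable_funeM.
- by move=> w _; rewrite mule_ge0// lee_fin.
- exact: measurable_funeM.
apply: ge0_le_integral => //.
- by apply: emeasurable_funD; exact: measurable_funeM.
move=> w _; rewrite /bdry_path -!ge0_integralZl// ?lee_fin//; try exact: me.
rewrite -ge0_integralD//; last 4 first.
- by move=> u _; rewrite mule_ge0// lee_fin// expR_ge0.
- by apply: measurable_funeM; exact: me.
- by move=> u _; rewrite mule_ge0// lee_fin// expR_ge0.
- by apply: measurable_funeM; exact: me.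
apply: ge0_le_integral => //; first exact: me.
- by apply: emeasurable_funD; apply: measurable_funeM; exact: me.
- by move=> u _; rewrite lee_fin mulrDl -!mulrA; exact: expR_convex.
Qed.

Let A_left i (x C : R) : (forall y, y < x -> (A i y <= C%:E)%E) -> (A i x <= C%:E)%E.
Proof.
move=> AC; pose y (n : nat) : R := x - harmonic n.
have ym : {homo y : m n / (m <= n)%N >-> m <= n}.
  by move=> m n mn; rewrite /y lerD2l lerN2 lef_pV2 ?posrE// ler_nat.
have yx n : y n < x by rewrite /y /harmonic/= ltrBlDr ltrDl invr_gt0 ltr0n.
have yc (z : R) : y n * z @[n --> \oo] --> x * z.
  apply: cvgM; last exact: cvg_cst.
  rewrite -[X in _ --> X]subr0; apply: cvgB; [exact: cvg_cst|exact: cvg_harmonic].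
have me z w : measurable_fun I01 (fun u => (expR (z * Z u w (rev_ord i) 0))%:E).
  by apply/measurable_EFinP; apply: (measurable_comp_Z cZ); exact: measurable_expR.
have mono w u : I01 u -> {homo (fun n => y n * Z u w (rev_ord i) 0) : m n / (m <= n)%N >-> m <= n}.
  rewrite /= in_itv/= => /andP[u0 _] m n mn.
  by apply: ler_wpM2r; [exact: (Z_ge0 refl _ _ (ltW u0))|exact: ym].
have H1 w : path i (y n) w @[n --> \oo] --> path i x w.
  apply: monotone_integral_cvg => //.
  - by move=> n; exact: me.
  - by move=> u Iu m n mn; rewrite lee_fin ler_expR; exact: mono.
  - move=> u _; apply: cvg_EFin; first exact: nearW.
    apply: (continuous_cvg _ (@continuous_expR R _)); exact: yc.
have H2 : A i (y n) @[n --> \oo] --> A i x.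
  apply: monotone_integral_cvg => //; first by move=> n w _; exact: bdry_path_ge0.
  move=> w _ m n mn; apply: ge0_le_integral => //; try exact: me.
  - by move=> u Iu; rewrite lee_fin ler_expR; exact: mono.
rewrite -(cvg_lim (@ereal_hausdorff R) H2).
apply: lime_le; first by apply/cvg_ex; eexists; exact: H2.
by apply: nearW => n; exact: AC.
Qed.

Let gammaE th : gamma Sigma mu th = - (dot th (Sigma *m th) / 2) - dot th mu.
Proof. by rewrite /gamma (dotC mu) mulrC. Qed.

Let Gamma_neq0 th : Gamma Sigma mu th -> th != 0.
Proof.
rewrite /Gamma/=; apply: contraTneq => ->.
by rewrite gammaE mulmx0 dot0r (dotC 0) dot0r mul0r !oppr0 addr0 ltxx.
Qed.

Let q_ge0 th : 0 <= dot th (Sigma *m th).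
Proof.
have [->|th0] := eqVneq th 0; first by rewrite mulmx0 dot0r.
by rewrite ltW// Sigma_pd.
Qed.

(* gamma th <= 0 in Gamma is turned into a bound on the mgf. *)
Let gamma_a_le k i th : Gamma Sigma mu th -> gamma Sigma mu th * a k th <=
  gamma_ Rm i th * b k i (th (rev_ord i) 0) +
   gamma_ Rm (rev_ord i) th * b k (rev_ord i) (th i 0).
Proof.
move=> Gth; have := truncated_adjoint_relation k i (Gamma_neq0 Gth).
have := a1_le k th; rewrite ler_norml => /andP[_ h].
have := ler_wpM2l (q_ge0 th) h; rewrite gammaE.
move: (dot th (Sigma *m th)) (dot th mu) (a k th) (a1 k th) (gamma_ Rm i th * b k i (th (rev_ord i) 0))
  (gamma_ Rm (rev_ord i) th * b k (rev_ord i) (th i 0)) => q m x y s1 s2.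
lra.
Qed.

(** If the transform vanished, [Y_i] would almost surely not move before time 1 and every truncated
    term of index [i] would be zero. At a point of [Gamma] with [gamma_j = 0] the relation would
    then force [phi <= 0]. *)
Let A_pos i x : (0 < A i x)%E.
Proof.
rewrite lt_neqAle A_ge0 andbT; apply/eqP => /esym A0.
have [+ _] := ae_eq_integral_abs P measurableT (mA i x).
rewrite (eq_integral (path i x)); last by move=> w _; rewrite gee0_abs ?bdry_path_ge0.
move=> /(_ A0) ae0.
have Y0 : {ae P, forall w, Y 1 w i 0 = 0}.
  apply: filterS ae0 => w /(_ Logic.I) pw0.
  have me : measurable_fun I01 (fun u => (expR (x * Z u w (rev_ord i) 0))%:E).
    by apply/measurable_EFinP; apply: (measurable_comp_Z cZ); exact: measurable_expR.
  have mI : measurable I01 by [].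
  have [|N [mN N0 sub]] := (ae_eq_integral_abs (ls (cum i w)) mI me).1.
    rewrite -[RHS]pw0; apply: eq_integral => u _.
    by rewrite gee0_abs// lee_fin expR_ge0.
  have : (ls (cum i w) I01 <= ls (cum i w) N)%E.
    apply: le_measure; rewrite ?inE//; apply: subset_trans sub => u Iu /= /(_ Iu) [].
    by apply/eqP; rewrite gt_eqF// expR_gt0.
  rewrite N0 (ls_unit_interval refl cumE) lee_fin => Y10.
  by apply/eqP; rewrite eq_le Y10 (Y_ge0 refl).
have b0 k z : b k i z = 0.
  apply/eqP; rewrite eq_le b_ge0 andbT -lee_fin bE.
  have -> : (\int[P]_w (term k i z w)%:E = \int[P]_w cst 0%E w)%E; last by rewrite integral0.
  have m1 : measurable_fun setT (EFin \o term k i z) by case/integrableP: (it k i z).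
  apply: ae_eq_integral => //; apply: filterS Y0 => w Yw _.
  have := bdry_term_bounds cZ refl cumE k i z w; rewrite Yw mulr0 => /andP[h1 h2].
  by congr EFin; apply/eqP; rewrite eq_le h1 h2.
pose j := rev_ord i.
(* The direction of the line [gamma_j = 0]; the drift condition makes [gamma] increase along it from
   the origin, and [e] is a short enough step. *)
pose u : 'cV[R]_2 := \col_l (if l == i then Rm j j else - Rm i j).
have ui : u i 0 = Rm j j by rewrite mxE eqxx.
have uj : u j 0 = - Rm i j by rewrite mxE (negbTE (neq_rev_ord i)).
have gju : gamma_ Rm j u = 0.
  by rewrite /gamma_ (dotE i) -/j ui uj 2!mxE; ring.
have um : dot u mu < 0 by have := Rdrift i; rewrite (dotE i) -/j ui uj; lra.
pose e := - dot u mu / (dot u (Sigma *m u) + 1).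
have q1 : 0 < dot u (Sigma *m u) + 1 by rewrite ltr_wpDl// q_ge0.
have e0 : 0 < e by rewrite divr_gt0// oppr_gt0.
have Ge : Gamma Sigma mu (e *: u).
  rewrite /Gamma/= gammaE -scalemxAr dotZr !(dotC (e *: u)) !dotZr (dotC mu) (dotC _ u).
  have E : dot u mu = - (e * (dot u (Sigma *m u) + 1)) by rewrite /e divfK ?gt_eqF// opprK.
  have q0 := q_ge0 u; move: E e0 q0; move: (dot u mu) (dot u (Sigma *m u)) (e) => m q f -> f0 q0.
  have -> : - (f * (f * q) / 2) - f * - (f * (q + 1)) = f * f * (q / 2 + 1) by field.
  by rewrite !mulr_gt0// ltr_wpDl// divr_ge0.
suff : (phi (e *: u) <= 0)%E by rewrite leNgt phi_pos.
apply: le_a_fin => k.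
have := gamma_a_le k i Ge.
have -> : gamma_ Rm (rev_ord i) (e *: u) = 0 by rewrite /gamma_ dotZr -/(gamma_ Rm j u) gju mulr0.
by rewrite b0 mulr0 mul0r addr0 pmulr_rle0.
Qed.

(** [A i] sees only the other coordinate, so coordinate [i] may be lowered to [- M]: [phi] remains
    finite, [gamma_i] becomes negative, and the other transform has a nonpositive argument. The
    truncated relation then bounds [A i]. *)
Let fin_A i th : (phi th < +oo)%E -> (A i (th (rev_ord i) 0%R) < +oo)%E.
Proof.
move=> fphi; pose j := rev_ord i; rewrite -/j.
pose M := `|th i 0| + (`|Rm j i * th j 0| + 1) / Rm i i.
have M1 : 0 < (`|Rm j i * th j 0| + 1) / Rm i i by rewrite divr_gt0// ltr_wpDl.
pose t : 'cV[R]_2 := \col_l (if l == i then - M else th j 0).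
have ti : t i 0 = - M by rewrite mxE eqxx.
have tj : t j 0 = th j 0 by rewrite mxE (negbTE (neq_rev_ord i)).
have tth : (phi t <= phi th)%E.
  apply: phi_le => l; rewrite mxE; case: eqP => [->|/eqP li].
    rewrite /M lerNl; have := ler_norm (- th i 0); rewrite normrN; lra.
    by rewrite (ord2_neq li).
have ft := le_lt_trans tth fphi.
have gi : gamma_ Rm i t < 0.
  rewrite /gamma_ (dotE i) !mxE -/j eqxx (negbTE (neq_rev_ord i)) /M mulrN mulrDr.
  rewrite [X in - (_ + X)]mulrC divfK ?gt_eqF//.
  have := ler_norm (Rm j i * th j 0); have := mulr_ge0 (ltW (Rdiag i)) (normr_ge0 (th i 0)); lra.
have t0 : t != 0.
  by apply: contraTneq gi => ->; rewrite /gamma_ dot0r ltxx.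
have M0 : - M <= 0 by rewrite oppr_le0 addr_ge0// ltW.
have fj : (A j (t i 0%R) < +oo)%E by rewrite ti A_le0.
pose C := (dot t (Sigma *m t) / 2 + `|dot t mu|) * fine (phi t) +
   `|gamma_ Rm j t| * fine (A j (t i 0)).
suff : (A i (t j 0%R) <= (C / - gamma_ Rm i t)%:E)%E.
  by rewrite tj => /le_lt_trans; apply; exact: ltry.
apply: le_b_fin => k; rewrite ler_pdivlMr ?oppr_gt0//.
have := truncated_adjoint_relation k i t0; rewrite -/j => E.
have a1k := a1_le k t; have ak := a_lefin k ft; have bk := b_lefin k fj.
have q0 : 0 <= dot t (Sigma *m t) / 2 by rewrite divr_ge0// q_ge0.
have h1 : dot t (Sigma *m t) / 2 * a1 k t <= dot t (Sigma *m t) / 2 * fine (phi t).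
  by apply: ler_wpM2l => //; exact: le_trans (ler_norm _) (le_trans a1k ak).
have h2 : dot t mu * a k t <= `|dot t mu| * fine (phi t).
  apply: (le_trans (ler_norm _)); rewrite normrM; apply: ler_wpM2l => //.
  by rewrite ger0_norm.
have h3 : gamma_ Rm j t * b k j (t i 0) <= `|gamma_ Rm j t| * fine (A j (t i 0)).
  apply: (le_trans (ler_norm _)); rewrite normrM; apply: ler_wpM2l => //.
  by rewrite ger0_norm.
rewrite /C mulrDl; move: E h1 h2 h3.
move: (dot t (Sigma *m t) / 2 * a1 k t) (dot t mu * a k t) (gamma_ Rm j t * b k j (t i 0))
  (dot t (Sigma *m t) / 2 * fine (phi t)) (`|dot t mu| * fine (phi t))
  (`|gamma_ Rm j t| * fine (A j (t i 0))) (gamma_ Rm i t) (b k i (t j 0)).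
move=> s1 s2 s3 u1 u2 u3 g c; rewrite mulrN [c * g]mulrC; move: (g * c) => y; lra.
Qed.

(** With [phi th] finite the truncated relation passes to the limit: monotonically for the first
    derivatives, and under the domination [|f''| <= exp] for the second. *)
Let bar th i : (phi th < +oo)%E -> gamma Sigma mu th * fine (phi th) =
  gamma_ Rm i th * fine (A i (th (rev_ord i) 0)) +
  gamma_ Rm (rev_ord i) th * fine (A (rev_ord i) (th i 0)).
Proof.
move=> fphi; have [->|th0] := eqVneq th 0.
  have g0 : gamma Sigma mu 0 = 0 by rewrite gammaE mulmx0 dot0r (dotC 0) dot0r mul0r !oppr0 addr0.
  have gi0 l : gamma_ Rm l 0 = 0 by exact: dot0r.
  have H l m (p u v : R) : gamma Sigma mu 0 * p = gamma_ Rm l 0 * u + gamma_ Rm m 0 * v.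
    by rewrite g0 !gi0 !mul0r addr0.
  exact: H.
have fAi := fin_A i fphi; have fAj := fin_A (rev_ord i) fphi; rewrite rev_ordK in fAj.
have ca : a k th @[k --> \oo] --> fine (phi th).
  by have := @a_cvg th; rewrite {1}(phi_fin fphi) => /fine_cvgP[].
have cb l x : (A l x < +oo)%E -> b k l x @[k --> \oo] --> fine (A l x).
  by move=> fA; have := @b_cvg l x; rewrite {1}(A_fin fA) => /fine_cvgP[].
have ca1 : a1 k th @[k --> \oo] --> fine (phi th).
  apply: (Rintegral_dominated_cvg (g := fun z : plane R => expR (dot th z)) _ _ _ _).2.
  - by move=> k; exact: mnu (tf_m2 (tfk k)).
  - by move=> z; exact: trunc_exp2_cvg.
  - apply/integrableP; split; first exact: mexp.
    apply: le_lt_trans fphi; rewrite le_eqVlt; apply/orP; left; apply/eqP.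
    by apply: eq_integral => z _ /=; rewrite ger0_norm// expR_ge0.
  - by move=> k z; apply: (le_trans (norm_trunc_exp2 _ _)) => //; exact: trunc_exp1_le.
have c0 : dot th (Sigma *m th) / 2 * a1 k th + dot th mu * a k th +
  (gamma_ Rm i th * b k i (th (rev_ord i) 0) +
   gamma_ Rm (rev_ord i) th * b k (rev_ord i) (th i 0)) @[k --> \oo] -->
   dot th (Sigma *m th) / 2 * fine (phi th) + dot th mu * fine (phi th) +
  (gamma_ Rm i th * fine (A i (th (rev_ord i) 0)) +
   gamma_ Rm (rev_ord i) th * fine (A (rev_ord i) (th i 0))).
  by apply: cvgD; apply: cvgD; apply: cvgM; [exact: cvg_cst| |exact: cvg_cst| |exact: cvg_cst|exact: cb|exact: cvg_cst|exact: cb].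
have := cvg_unique (@Rhausdorff R) c0.
under eq_fun do rewrite truncated_adjoint_relation//.
move=> /(_ _ 0 (cvg_cst _)); rewrite gammaE.
move: (fine (phi th)) (gamma_ Rm i th * fine (A i (th (rev_ord i) 0)))
  (gamma_ Rm (rev_ord i) th * fine (A (rev_ord i) (th i 0))) => p u v; lra.
Qed.

Let phi_finite th i : Gamma Sigma mu th -> (A i (th (rev_ord i) 0%R) < +oo)%E ->
  (A (rev_ord i) (th i 0%R) < +oo)%E -> (phi th < +oo)%E.
Proof.
move=> Gth fi fj; pose C := `|gamma_ Rm i th| * fine (A i (th (rev_ord i) 0)) +
   `|gamma_ Rm (rev_ord i) th| * fine (A (rev_ord i) (th i 0)).
apply: (@le_lt_trans _ _ (C / gamma Sigma mu th)%:E); last exact: ltry.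
apply: le_a_fin => k; rewrite ler_pdivlMr// mulrC.
apply: (le_trans (gamma_a_le k i Gth)); apply: lerD.
- apply: (le_trans (ler_norm _)); rewrite normrM; apply: ler_wpM2l => //.
  by rewrite ger0_norm// b_lefin.
- apply: (le_trans (ler_norm _)); rewrite normrM; apply: ler_wpM2l => //.
  by rewrite ger0_norm// b_lefin.
Qed.

(** On [Gamma] the interior term is nonnegative, so the negative term [gamma_i * b_i] is controlled
    by the other boundary term, uniformly in the truncation. *)
Let A_next th i : Gamma Sigma mu th -> gamma_ Rm i th < 0 ->
  (A (rev_ord i) (th i 0%R) < +oo)%E -> (A i (th (rev_ord i) 0%R) < +oo)%E.
Proof.
move=> Gth gi fj; pose C := `|gamma_ Rm (rev_ord i) th| * fine (A (rev_ord i) (th i 0)).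
apply: (@le_lt_trans _ _ (C / - gamma_ Rm i th)%:E); last exact: ltry.
apply: le_b_fin => k; rewrite ler_pdivlMr ?oppr_gt0// mulrN mulrC lerNl.
have h1 := gamma_a_le k i Gth.
have h2 : 0 <= gamma Sigma mu th * a k th by rewrite mulr_ge0// ltW.
have h3 : gamma_ Rm (rev_ord i) th * b k (rev_ord i) (th i 0) <= C.
  apply: (le_trans (ler_norm _)); rewrite normrM; apply: ler_wpM2l => //.
  by rewrite ger0_norm// b_lefin.
rewrite -subr_ge0 opprK -[_ + C]addr0; apply: (le_trans h2); apply: (le_trans h1).
by rewrite addr0 lerD2l.
Qed.

Lemma boundary_system_exists : exists B, boundary_system Sigma Rm mu phi B.
Proof.
(* [A] is indexed by the component of [Y] that grows, [B] by the coordinate on which the transform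
   depends. *)
exists (fun i => A (rev_ord i)); split.
- by move=> i x; exact: A_pos.
- by move=> i x y; exact: A_le.
- by move=> i; exact: A_fin0.
- by move=> i t x y; exact: A_conv.
- by move=> i x C; exact: A_left.
- by move=> th; exact: phi_pos.
- by move=> th th'; exact: phi_le.
- by move=> i th fphi; have := fin_A (rev_ord i) fphi; rewrite rev_ordK.
- move=> th fphi; rewrite (big_ord2_rev _ (rev_ord 0)); have := bar 0 fphi.
  by rewrite rev_ordK.
- move=> th Gth f; have f0 := f 0; have f1 := f (rev_ord 0); rewrite rev_ordK in f1.
  exact: (phi_finite Gth f1 f0).
- by move=> i th Gth gi fB; have := @A_next th (rev_ord i) Gth gi fB; rewrite rev_ordK.
Qed.
End boundary_expectation.

Lemma stationary_boundary_system {R : realType} (Sigma Rm : 'M[R]_2) (mu : 'cV[R]_2)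
    (nu : probability (plane R) R) : positive_definite Sigma ->
  (forall i, 0 < Rm i i) ->
  (forall i, 0 < Rm i i * Rm (rev_ord i) (rev_ord i) - Rm i (rev_ord i) * Rm (rev_ord i) i) ->
  (forall i, Rm (rev_ord i) (rev_ord i) * mu i 0 - Rm i (rev_ord i) * mu (rev_ord i) 0 < 0) ->
  stationary_distribution Sigma mu Rm nu ->
  exists B, boundary_system Sigma Rm mu (mgf nu) B.
Proof.
move=> Sigma_pd Rdiag Rdet Rdrift [d [T [P [F [Z [[fF cZ aZ [X [Y [bm mart aY cY refl]]]] stat]]]]]].
have /choice[cum cumP] : forall iw : 'I_2 * T, exists G : cumulative R R,
    (forall t, G t = Y (Num.max 0 t) iw.2 iw.1 0) /\
    (\int[lebesgue_stieltjes_measure G]_(t in `[0%R, +oo[) (Z t iw.2 iw.1 0%R)%:E = 0)%E.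
  by move=> [i w] /=; have [_ _ _ /(_ i)[G [GE GI]]] := refl w; exists G.
have [B HB] := @boundary_system_exists R Sigma Rm mu Rdiag Rdet Sigma_pd d T P F X Y Z nu
  fF cZ aZ bm mart aY refl stat (fun i w => cum (i, w)) (fun i w => (cumP (i, w)).1)
  (fun i w => (cumP (i, w)).2) Rdrift.
exists B; have -> // : mgf nu = fun th => (\int[nu]_z (expR (dot th z))%:E)%E.
by apply/funext => th; rewrite /mgf unlock.
Qed.

(** * Planar geometry of the ellipse *)

Section planar.
Context {R : realType}.

(* The coordinate [i] is [x] and [rev_ord i] is [y]; [pg] is gamma, [pgx] and [pgy] are its partial derivatives,
   [pq h k] is <(h,k), Sigma (h,k)>, and [l1], [l2] are gamma_i and gamma_(rev_ord i). *)
Record planar_data := PlanarData {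
  s1 : R; s2 : R; s12 : R; m1 : R; m2 : R; r11 : R; r12 : R; r21 : R; r22 : R }.

(** Exchange of the two axes. Statements are proved for the first corner and transferred to the
    second. *)
Definition swap_data (D : planar_data) := PlanarData (s2 D) (s1 D) (s12 D) (m2 D) (m1 D)
  (r22 D) (r21 D) (r12 D) (r11 D).

Implicit Types (D : planar_data) (x y h k a b c : R).

Definition pg D x y := - ((s1 D * x ^+ 2 + 2 * s12 D * x * y + s2 D * y ^+ 2) / 2)
  - m1 D * x - m2 D * y.
Definition pgx D x y := - s1 D * x - s12 D * y - m1 D.
Definition pgy D x y := - s12 D * x - s2 D * y - m2 D.
Definition pq D h k := s1 D * h ^+ 2 + 2 * s12 D * h * k + s2 D * k ^+ 2.
Definition l1 D x y := r11 D * x + r21 D * y.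
Definition l2 D x y := r12 D * x + r22 D * y.
Definition pdet D := r11 D * r22 D - r12 D * r21 D.

Record planar_ok D : Prop := {
  ok_s1 : 0 < s1 D; ok_s2 : 0 < s2 D; ok_s : 0 < s1 D * s2 D - s12 D ^+ 2;
  ok_r11 : 0 < r11 D; ok_r22 : 0 < r22 D; ok_det : 0 < pdet D;
  ok_m1 : r22 D * m1 D - r12 D * m2 D < 0; ok_m2 : r11 D * m2 D - r21 D * m1 D < 0 }.

Lemma swap_ok D : planar_ok D -> planar_ok (swap_data D).
Proof.
case=> *; split => //=; first by rewrite mulrC.
by rewrite /pdet/= mulrC [r21 D * _]mulrC.
Qed.

Lemma swap_dataK D : swap_data (swap_data D) = D.
Proof. by case: D. Qed.

Lemma pg_swap D x y : pg (swap_data D) y x = pg D x y.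
Proof. by rewrite /pg/=; ring. Qed.
Lemma pgx_swap D x y : pgx (swap_data D) y x = pgy D x y.
Proof. by rewrite /pgx/pgy/=; ring. Qed.
Lemma pgy_swap D x y : pgy (swap_data D) y x = pgx D x y.
Proof. by rewrite /pgx/pgy/=; ring. Qed.
Lemma l1_swap D x y : l1 (swap_data D) y x = l2 D x y.
Proof. by rewrite /l1/l2/=; ring. Qed.
Lemma l2_swap D x y : l2 (swap_data D) y x = l1 D x y.
Proof. by rewrite /l1/l2/=; ring. Qed.

Lemma pgD D x y h k :
  pg D (x + h) (y + k) = pg D x y + pgx D x y * h + pgy D x y * k - pq D h k / 2.
Proof. by rewrite /pg /pgx /pgy /pq; field. Qed.

Lemma pgB D x y h k : pg D h k =
  pg D x y + pgx D x y * (h - x) + pgy D x y * (k - y) - pq D (h - x) (k - y) / 2.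
Proof. by rewrite -pgD !(addrC _ (_ - _)) !subrK. Qed.

Lemma pg00 D : pg D 0 0 = 0.
Proof. by rewrite /pg; field. Qed.

Lemma pqZ D t h k : pq D (t * h) (t * k) = t ^+ 2 * pq D h k.
Proof. by rewrite /pq; ring. Qed.

(** The vector [(l1, l2)] is the transpose of the reflection matrix applied to the point, so
    determinants of pairs of points are multiplied by [pdet]. *)
Lemma cross_lines D x y h k :
  l2 D x y * l1 D h k - l2 D h k * l1 D x y = pdet D * (y * h - x * k).
Proof. by rewrite /l1 /l2 /pdet; ring. Qed.

Lemma det_x D x y : pdet D * x = r22 D * l1 D x y - r21 D * l2 D x y.
Proof. by rewrite /l1 /l2 /pdet; ring. Qed.

Lemma det_y D x y : pdet D * y = r11 D * l2 D x y - r12 D * l1 D x y.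
Proof. by rewrite /l1 /l2 /pdet; ring. Qed.

Lemma small_positive (A C : R) : 0 < A ->
  exists2 e, 0 < e & forall t, 0 < t <= e -> 0 < t * A - t ^+ 2 * C.
Proof.
move=> A0; have C1 : 0 < `|C| + 1 by rewrite ltr_wpDl.
exists (A / (`|C| + 1) / 2); first by rewrite !divr_gt0.
move=> t /andP[t0 tA]; rewrite expr2 -mulrA -mulrBr mulr_gt0// subr_gt0.
apply: (@le_lt_trans _ _ (t * (`|C| + 1))).
  by apply: ler_wpM2l; [exact: ltW|rewrite (le_trans (ler_norm C))// lerDl].
rewrite -ltr_pdivlMr//; apply: (le_lt_trans tA).
by rewrite ltr_pdivrMr// ltr_pMr ?divr_gt0// ltrDl.
Qed.

Variable D : planar_data.
Hypothesis ok : planar_ok D.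

Lemma pq_gt0 h k : (h != 0) || (k != 0) -> 0 < pq D h k.
Proof.
have [p1 p2 p3 _ _ _ _ _] := ok.
have E : s1 D * pq D h k = (s1 D * h + s12 D * k) ^+ 2 + (s1 D * s2 D - s12 D ^+ 2) * k ^+ 2.
  by rewrite /pq; ring.
move=> hk; rewrite -(pmulr_rgt0 _ p1) E.
have [k0|k0] := eqVneq k 0; last first.
  by rewrite ltr_wpDl ?sqr_ge0// mulr_gt0// exprn_even_gt0.
rewrite k0 eqxx orbF in hk *; rewrite mulr0 addr0 expr0n/= mulr0 addr0.
by rewrite exprn_even_gt0//= mulf_neq0// gt_eqF.
Qed.

Lemma pq_ge0 h k : 0 <= pq D h k.
Proof.
have [/pq_gt0/ltW//|] := boolP ((h != 0) || (k != 0)).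
rewrite negb_or !negbK => /andP[/eqP-> /eqP->]; rewrite /pq; lra.
Qed.

(* An ellipse point sees the origin, another ellipse point, in an ascent direction. *)
Lemma toward_origin x y : pg D x y = 0 -> pgx D x y * x + pgy D x y * y = - (pq D x y / 2).
Proof.
move=> g0; have := pgB D x y 0 0; rewrite pg00 g0 !sub0r.
have -> : pq D (- x) (- y) = pq D x y by rewrite /pq; ring.
by move: (pq D x y) (pgx D x y) (pgy D x y) => *; lra.
Qed.

Lemma Gamma_segment x y h k t : 0 <= t <= 1 -> 0 <= pg D x y -> 0 <= pg D h k ->
  t * (1 - t) * pq D (h - x) (k - y) / 2 <= pg D ((1 - t) * x + t * h) ((1 - t) * y + t * k).
Proof.
move=> /andP[t0 t1] g1 g2.
have -> : pg D ((1 - t) * x + t * h) ((1 - t) * y + t * k) =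
   (1 - t) * pg D x y + t * pg D h k + t * (1 - t) * pq D (h - x) (k - y) / 2.
  by rewrite /pg /pq; field.
by rewrite lerDr addr_ge0// mulr_ge0// subr_ge0.
Qed.

(** The direction [(d, 1)] is used with [d] so small that the horizontal slope costs at most half of
    [pgy]. *)
Lemma dominate_y x y e : 0 <= pg D x y -> 0 < pgy D x y -> 0 < e ->
  exists h k, [/\ 0 < h < e, 0 < k < e & 0 < pg D (x + h) (y + k)].
Proof.
move=> g0 gy0 e0; pose d := pgy D x y / (2 * (`|pgx D x y| + 1)).
have n1 : 0 < `|pgx D x y| + 1 by rewrite ltr_wpDl.
have d0 : 0 < d by rewrite divr_gt0// mulr_gt0.
have A0 : 0 < pgx D x y * d + pgy D x y.
  have : - (pgx D x y * d) <= pgy D x y / 2.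
    apply: (le_trans (ler_norm _)); rewrite normrN normrM (gtr0_norm d0).
    apply: (@le_trans _ _ ((`|pgx D x y| + 1) * d)).
      by apply: ler_wpM2r; [exact: ltW|rewrite lerDl].
    by rewrite le_eqVlt /d; apply/orP; left; apply/eqP; field; rewrite gt_eqF.
  by move: (pgx D x y * d) (pgy D x y) gy0 => u v; lra.
have [e1 e10 H] := small_positive (pq D d 1 / 2) A0.
pose t := Num.min e1 (Num.min (e / (2 * d)) (e / 2)).
have t0 : 0 < t by rewrite !lt_min e10 !divr_gt0// mulr_gt0.
have te : t <= e1 by rewrite ge_min lexx.
have td : t * d <= e / 2.
  have h : t <= e / (2 * d) by rewrite !ge_min lexx orbT.
  have -> : e / 2 = e / (2 * d) * d by field; rewrite gt_eqF.
  by apply: ler_wpM2r => //; exact: ltW.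
have t2 : t <= e / 2 by rewrite !ge_min lexx !orbT.
exists (t * d), (t * 1); rewrite mulr1 mulr_gt0// t0/=.
have ee : e / 2 < e by rewrite ltr_pdivrMr// ltr_pMr// ltr1n.
rewrite (le_lt_trans td ee) (le_lt_trans t2 ee); split => //.
have t01 : 0 < t <= e1 by rewrite t0 te.
have E := pgD D x y (t * d) (t * 1); rewrite pqZ !mulr1 in E.
rewrite E; apply: (lt_le_trans (H t t01)).
move: g0; move: (pg D x y) (pgx D x y) (pgy D x y) (pq D d 1) => u v w z u0.
by rewrite -subr_ge0 [X in 0 <= X](_ : _ = u)//; field.
Qed.

(* theta^(i,Gamma) is either the rightmost point of the ellipse ([pgy = 0]) or lies on the ray [l2 = 0]. *)
Definition corner a y := [/\ pg D a y = 0, 0 < a, l2 D a y <= 0, 0 <= pgy D a y &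
  l2 D a y * pgy D a y = 0].

Lemma corner_max a y : corner a y -> pgy D a y = 0 -> pgx D a y < 0.
Proof.
move=> [g0 a0 _ _ _] gy0; have := toward_origin g0.
rewrite gy0 mul0r addr0 => E.
have : pgx D a y * a < 0 by rewrite E oppr_lt0 divr_gt0// pq_gt0// gt_eqF.
by rewrite pmulr_llt0.
Qed.

Lemma corner_r a y : corner a y -> pgy D a y != 0 ->
  [/\ 0 < pgy D a y, l2 D a y = 0 & 0 < l1 D a y].
Proof.
move=> [g0 a0 _ gy0 E] gyN.
have l20 : l2 D a y = 0 by move/eqP: E; rewrite mulf_eq0 (negbTE gyN) orbF => /eqP.
split => //; first by rewrite lt_neqAle eq_sym gyN.
have := det_x D a y; rewrite l20 mulr0 subr0 => E2.
by rewrite -(pmulr_rgt0 _ (ok_r22 ok)) -E2 mulr_gt0// ok_det.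
Qed.

(* Points of [Gamma_1] just below the chord from the origin to the corner. *)
Lemma corner_chord a y t e : corner a y -> 0 < t < 1 -> 0 < e ->
  exists2 d, 0 < d < e & 0 < pg D (t * a) (t * y - d) /\ l2 D (t * a) (t * y - d) < 0.
Proof.
move=> [g0 a0 l20 _ _] /andP[t0 t1] e0.
have G0 : 0 < pg D (t * a) (t * y).
  have t01 : 0 <= t <= 1 by rewrite !ltW.
  have := @Gamma_segment 0 0 a y t t01; rewrite pg00 g0 => /(_ (lexx _) (lexx _)).
  rewrite !mulr0 !add0r !subr0; apply: lt_le_trans.
  by rewrite divr_gt0// !mulr_gt0 ?subr_gt0// pq_gt0// gt_eqF.
have [c c0 Hc] : exists2 c, 0 < c & forall d, 0 < d <= c -> 0 < pg D (t * a) (t * y - d).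
  have [c c0 H] := small_positive (s2 D / 2) G0.
  pose M := `|pgy D (t * a) (t * y)| + s2 D / 2 + 1.
  have M0 : 0 < M by rewrite ltr_wpDl// addr_ge0// divr_ge0// ltW// ok_s2.
  exists (Num.min 1 (pg D (t * a) (t * y) / M)); first by rewrite lt_min ltr01 divr_gt0.
  move=> d /andP[d0]; rewrite le_min => /andP[d1 dM].
  rewrite -[t * a]addr0 pgD mulr0 addr0 -/(_ - d).
  have -> : pq D 0 (- d) = s2 D * d * d by rewrite /pq; ring.
  have h1 : d * M <= pg D (t * a) (t * y) by rewrite -ler_pdivlMr.
  have h2 : pgy D (t * a) (t * y) * d <= `|pgy D (t * a) (t * y)| * d.
    by apply: ler_wpM2r; [exact: ltW|exact: ler_norm].
  have h3 : s2 D * d * d <= s2 D * d.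
    by rewrite -[leRHS]mulr1; apply: ler_wpM2l => //; rewrite mulr_ge0// ltW// ok_s2.
  move: h1 h2 h3; rewrite /M mulrN.
  move: (pg D (t * a) (t * y)) (pgy D (t * a) (t * y)) (s2 D) => u v w h1 h2 h3.
  move: h1; rewrite !mulrDr mulr1; move: (`|v|) h2 => n h2 h1; lra.
exists (Num.min (e / 2) c).
  rewrite lt_min divr_gt0// c0/= gt_min; apply/orP; left.
  by rewrite ltr_pdivrMr// ltr_pMr// ltr1n.
have m0 : 0 < Num.min (e / 2) c by rewrite lt_min divr_gt0.
split; first by apply: Hc; rewrite m0 ge_min lexx orbT.
have -> : l2 D (t * a) (t * y - Num.min (e / 2) c) = t * l2 D a y - r22 D * Num.min (e / 2) c.
  by rewrite /l2; ring.
have h1 : t * l2 D a y <= 0 by rewrite pmulr_rle0.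
have h2 : 0 < r22 D * Num.min (e / 2) c by rewrite mulr_gt0// ok_r22.
by rewrite subr_lt0; exact: le_lt_trans h1 h2.
Qed.

(** [corner_chord] near the end of the chord: the corner is a limit of points of [Gamma_1] lying
    strictly to its left. *)
Lemma corner_approach a y e : corner a y -> 0 < e -> exists x' y',
  [/\ a - e < x' < a, `|y' - y| < e, 0 < pg D x' y' & l2 D x' y' < 0].
Proof.
move=> C e0; have [_ a0 _ _ _] := C.
pose M := a + `|y| + 1.
have M0 : 0 < M by rewrite ltr_wpDl// addr_ge0// ltW.
pose u := Num.min (1 / 2) (e / (2 * M)).
have u0 : 0 < u by rewrite lt_min !divr_gt0// mulr_gt0.
have u1 : u < 1 by rewrite gt_min; apply/orP; left; rewrite ltr_pdivrMr// mul1r ltr1n.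
have uM : u * M <= e / 2.
  have : u <= e / (2 * M) by rewrite ge_min lexx orbT.
  rewrite ler_pdivlMr ?mulr_gt0// => h; rewrite ler_pdivlMr//; apply: le_trans h.
  by rewrite mulrCA mulrC.
have t01 : 0 < 1 - u < 1 by rewrite subr_gt0 u1 gtrBl.
have [d /andP[d0 de] [G L]] := corner_chord C t01 (divr_gt0 e0 (ltr0n _ 2)).
have uaM : u * a <= u * M by apply: ler_wpM2l; [exact: ltW|rewrite /M -addrA lerDl addr_ge0].
have uyM : u * `|y| + u * a <= u * M.
  by rewrite -mulrDr; apply: ler_wpM2l; [exact: ltW|rewrite /M addrC lerDl].
have ua0 := mulr_gt0 u0 a0; have uy0 := mulr_ge0 (ltW u0) (normr_ge0 y).
exists ((1 - u) * a), ((1 - u) * y - d); split => //.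
  by apply/andP; split; move: uaM uM ua0; rewrite mulrBl mul1r; move: (u * a) (u * M) => *; lra.
have -> : (1 - u) * y - d - y = - (u * y + d) by ring.
rewrite normrN; apply: (le_lt_trans (ler_normD _ _)); rewrite normrM (gtr0_norm u0) (gtr0_norm d0).
by move: uyM uM ua0; move: (u * a) (u * M) (u * `|y|) => *; lra.
Qed.
End planar.

(** * The domain of the moment generating function *)

Section planar_system.
Context {R : realType}.
Implicit Types (D : @planar_data R) (x y h k a c : R).

(* [b1] and [b2] are the boundary transforms, finite on [fin1] and [fin2]; [pfin] is the finiteness of phi. *)
Record planar_system D (fin1 fin2 : R -> Prop) (b1 b2 : R -> R) (pfin : R -> R -> Prop) : Prop := {
  ps_pos1 : forall x, fin1 x -> 0 < b1 x;
  ps_pos2 : forall y, fin2 y -> 0 < b2 y;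
  ps_le1 : forall x x', x <= x' -> fin1 x' -> fin1 x /\ b1 x <= b1 x';
  ps_le2 : forall y y', y <= y' -> fin2 y' -> fin2 y /\ b2 y <= b2 y';
  ps_zero1 : fin1 0;
  ps_zero2 : fin2 0;
  ps_conv1 : forall (t x x' : R), 0 <= t <= 1 -> fin1 x -> fin1 x' ->
    b1 (t * x + (1 - t) * x') <= t * b1 x + (1 - t) * b1 x';
  ps_conv2 : forall (t y y' : R), 0 <= t <= 1 -> fin2 y -> fin2 y' ->
    b2 (t * y + (1 - t) * y') <= t * b2 y + (1 - t) * b2 y';
  ps_left1 : forall x C, (forall x', x' < x -> fin1 x' /\ b1 x' <= C) -> fin1 x;
  ps_left2 : forall y C, (forall y', y' < y -> fin2 y' /\ b2 y' <= C) -> fin2 y;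
  ps_pfin_le : forall x y x' y', x <= x' -> y <= y' -> pfin x' y' -> pfin x y;
  ps_fin1 : forall x y, pfin x y -> fin1 x;
  ps_fin2 : forall x y, pfin x y -> fin2 y;
  ps_bar : forall x y, pfin x y -> pg D x y = 0 -> l2 D x y * b1 x + l1 D x y * b2 y = 0;
  ps_pfin : forall x y, 0 < pg D x y -> fin1 x -> fin2 y -> pfin x y;
  ps_next1 : forall x y, 0 < pg D x y -> l2 D x y < 0 -> fin2 y -> fin1 x;
  ps_next2 : forall x y, 0 < pg D x y -> l1 D x y < 0 -> fin1 x -> fin2 y }.

Lemma swap_system D fin1 fin2 b1 b2 pfin : planar_system D fin1 fin2 b1 b2 pfin ->
  planar_system (swap_data D) fin2 fin1 b2 b1 (fun y x => pfin x y).
Proof.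
case=> p1 p2 q1 q2 z1 z2 c1 c2 f1 f2 pl pf1 pf2 bar pf n1 n2; split => //.
- by move=> x y x' y' xx yy; exact: pl.
- by move=> x y; exact: pf2.
- by move=> x y; exact: pf1.
- by move=> x y fxy; rewrite pg_swap l1_swap l2_swap addrC; exact: bar.
- by move=> x y; rewrite pg_swap => *; exact: pf.
- by move=> x y; rewrite pg_swap l2_swap; exact: n2.
- by move=> x y; rewrite pg_swap l1_swap; exact: n1.
Qed.

Variables (D : @planar_data R) (fin1 fin2 : R -> Prop) (b1 b2 : R -> R) (pfin : R -> R -> Prop).
Hypotheses (ok : planar_ok D) (sys : planar_system D fin1 fin2 b1 b2 pfin).

(** Where the gradient points upward, an ellipse point is dominated by a nearby point of [Gamma]
    with finite transforms, and finiteness of [phi] passes down. *)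
Lemma pfin_boundary x y X Y : pg D x y = 0 -> 0 < pgy D x y -> x < X -> fin1 X ->
  y < Y -> fin2 Y -> pfin x y.
Proof.
move=> g0 gy0 xX fX yY fY.
have g0' : 0 <= pg D x y by rewrite g0.
have e0 : 0 < Num.min (X - x) (Y - y) by rewrite lt_min !subr_gt0 xX.
have [h [k [/andP[h0 hX] /andP[k0 kY] G]]] := dominate_y g0' gy0 e0.
move: hX kY; rewrite !lt_min => /andP[hX _] /andP[_ kY].
have hX' : x + h <= X by rewrite -lerBrDl ltW.
have kY' : y + k <= Y by rewrite -lerBrDl ltW.
apply: (ps_pfin_le sys (x' := x + h) (y' := y + k)); rewrite ?lerDl ?(ltW h0) ?(ltW k0)//.
apply: (ps_pfin sys G); [exact: (ps_le1 sys hX' fX).1|exact: (ps_le2 sys kY' fY).1].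
Qed.

Lemma pfin_boundary_swap x y X Y : pg D x y = 0 -> 0 < pgx D x y -> x < X -> fin1 X ->
  y < Y -> fin2 Y -> pfin x y.
Proof.
move=> g0 gx0 xX fX yY fY.
have g0' : 0 <= pg (swap_data D) y x by rewrite pg_swap g0.
have gx0' : 0 < pgy (swap_data D) y x by rewrite pgy_swap.
have e0 : 0 < Num.min (X - x) (Y - y) by rewrite lt_min !subr_gt0 xX.
have [k [h [/andP[k0 kY] /andP[h0 hX] G]]] := dominate_y g0' gx0' e0.
rewrite pg_swap in G; move: hX kY; rewrite !lt_min => /andP[hX _] /andP[_ kY].
have hX' : x + h <= X by rewrite -lerBrDl ltW.
have kY' : y + k <= Y by rewrite -lerBrDl ltW.
apply: (ps_pfin_le sys (x' := x + h) (y' := y + k)); rewrite ?lerDl ?(ltW h0) ?(ltW k0)//.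
apply: (ps_pfin sys G); [exact: (ps_le1 sys hX' fX).1|exact: (ps_le2 sys kY' fY).1].
Qed.

(** Positive transforms in the boundary relation force opposite signs; [l1] and [l2] vanish together
    only at the origin, since [pdet] is nonzero. *)
Lemma opposite_signs x y : pfin x y -> pg D x y = 0 -> (x != 0) || (y != 0) ->
  (0 < l1 D x y /\ l2 D x y < 0) \/ (l1 D x y < 0 /\ 0 < l2 D x y).
Proof.
move=> fxy g0 xy; have E := ps_bar sys fxy g0.
have p1 := ps_pos1 sys (ps_fin1 sys fxy); have p2 := ps_pos2 sys (ps_fin2 sys fxy).
have [l1n|l1p|l10] := ltgtP (l1 D x y) 0.
- right; split => //; have : l1 D x y * b2 y < 0 by rewrite nmulr_rlt0.
  by rewrite -(pmulr_lgt0 _ p1); move: E; move: (_ * b1 x) (_ * b2 y) => *; lra.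
- left; split => //; have : 0 < l1 D x y * b2 y by rewrite pmulr_rgt0.
  by rewrite -(pmulr_llt0 _ p1); move: E; move: (_ * b1 x) (_ * b2 y) => *; lra.
- move: E; rewrite l10 mul0r addr0 => /eqP; rewrite mulf_eq0 (gt_eqF p1) orbF => /eqP l20.
  have d0 : pdet D != 0 by rewrite gt_eqF// (ok_det ok).
  have := det_x D x y; have := det_y D x y; rewrite l10 l20 !mulr0 !subr0.
  move=> /eqP; rewrite mulf_eq0 (negbTE d0)/= => /eqP y0.
  move=> /eqP; rewrite mulf_eq0 (negbTE d0)/= => /eqP x0.
  by move: xy; rewrite x0 y0 eqxx.
Qed.

(** The point is compared with the ellipse point vertically below it. Both satisfy the boundary
    relation with the same [b1 x], and monotonicity of [b2] gives an inequality between products of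
    [l1] and [l2] whose sign [cross_lines] contradicts for [x > 0]. *)
Lemma NE_arc_half x y : pfin x y -> pg D x y = 0 -> pgx D x y < 0 -> pgy D x y < 0 ->
  ~ (0 < l1 D x y /\ l2 D x y < 0).
Proof.
move=> fxy g0 gx0 gy0 [L1 L2].
have s20 := ok_s2 ok; have r22p := ok_r22 ok; have r11p := ok_r11 ok.
have x0 : 0 < x.
  have := det_x D x y => E; have d0 := ok_det ok.
  rewrite -(pmulr_rgt0 _ d0) E.
  have [r21p|r21n] := leP 0 (r21 D).
    by rewrite subr_gt0; apply: (le_lt_trans (_ : _ <= 0)); [rewrite mulr_ge0_le0// ltW|rewrite mulr_gt0].
  have [xp|xn] := ltP 0 x; first by rewrite -E mulr_gt0.
  exfalso.
  have y0 : y < 0.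
    have : r21 D * y > 0.
      have := mulr_ge0_le0 (ltW r11p) xn; move: L1; rewrite /l1.
      by move: (r11 D * x) (r21 D * y) => *; lra.
    by rewrite nmulr_rgt0.
  have := toward_origin g0; have q0 : 0 < pq D x y by rewrite pq_gt0// (lt_eqF y0) orbT.
  have := mulr_le0 (ltW gx0) xn; have := mulr_le0 (ltW gy0) (ltW y0).
  by move: (_ * x) (_ * y) q0 => *; lra.
(* Length of the vertical chord of the ellipse at abscissa [x]. *)
pose k := - 2 * pgy D x y / s2 D.
have k0 : 0 < k by rewrite divr_gt0// mulNr oppr_gt0 pmulr_rlt0.
have yk : y - k <= y by rewrite gerBl ltW.
have fP : pfin x (y - k) by exact: (ps_pfin_le sys (lexx x) yk fxy).
have gP : pg D x (y - k) = 0.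
  have := pgD D x y 0 (- k); rewrite addr0 g0 => ->.
  by rewrite /pq /k; field; rewrite gt_eqF.
have L2P : l2 D x (y - k) < 0.
  have -> : l2 D x (y - k) = l2 D x y - r22 D * k by rewrite /l2; ring.
  by have := mulr_gt0 r22p k0; move: (_ * k) (l2 D x y) L2 => *; lra.
have xn0 : (x != 0) || (y - k != 0) by rewrite gt_eqF.
have L1P : 0 < l1 D x (y - k).
  by case: (opposite_signs fP gP xn0) => [[//]|[_ /lt_trans/(_ L2P)]]; rewrite ltxx.
have E1 := ps_bar sys fxy g0; have E2 := ps_bar sys fP gP.
have bP := (ps_le2 sys yk (ps_fin2 sys fxy)).2.
have p1 := ps_pos1 sys (ps_fin1 sys fxy).
have E := cross_lines D x y x (y - k).
have h : l1 D x y * l1 D x (y - k) * b2 (y - k) <= l1 D x y * l1 D x (y - k) * b2 y.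
  by apply: ler_wpM2l => //; rewrite mulr_ge0// ltW.
have : 0 <= (l2 D x (y - k) * l1 D x y - l2 D x y * l1 D x (y - k)) * b1 x.
  have -> : (l2 D x (y - k) * l1 D x y - l2 D x y * l1 D x (y - k)) * b1 x =
    l1 D x y * (l2 D x (y - k) * b1 x) - l1 D x (y - k) * (l2 D x y * b1 x) by ring.
  have -> : l2 D x (y - k) * b1 x = - (l1 D x (y - k) * b2 (y - k)).
    by apply/eqP; rewrite -addr_eq0 E2.
  have -> : l2 D x y * b1 x = - (l1 D x y * b2 y) by apply/eqP; rewrite -addr_eq0 E1.
  move: h; move: (b2 y) (b2 (y - k)) (l1 D x y) (l1 D x (y - k)) => u v p q h.
  rewrite -subr_ge0 in h; apply: (le_trans h); rewrite le_eqVlt; apply/orP; left; apply/eqP; ring.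
rewrite pmulr_lge0// -opprB E oppr_ge0 pmulr_rle0 ?(ok_det ok)//.
have -> : y * x - x * (y - k) = x * k by ring.
by rewrite leNgt mulr_gt0.
Qed.

(* Below the chord to the corner, [Gamma_1] transfers finiteness from [y] to [x]. *)
Lemma corner_slope a y c x0 : corner D a y -> fin2 c -> ~ fin1 x0 -> x0 < a -> c * a <= x0 * y.
Proof.
move=> C fc nf x0a; have [_ a0 _ _ _] := C.
have x00 : 0 < x0 by rewrite ltNge; apply/negP => /(ps_le1 sys) /(_ (ps_zero1 sys))[].
rewrite leNgt; apply/negP => lt; apply: nf.
have t01 : 0 < x0 / a < 1 by rewrite divr_gt0// ltr_pdivrMr// mul1r.
have [d /andP[d0 _] []] := corner_chord ok C t01 ltr01.
rewrite divfK ?gt_eqF// => G L; apply: (ps_next1 sys G L).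
have ty : x0 / a * y - d <= c.
  apply: (@le_trans _ _ (x0 / a * y)); first by rewrite gerBl ltW.
  by rewrite mulrAC ler_pdivrMr// ltW.
exact: (ps_le2 sys ty fc).1.
Qed.

(* At a corner on the line [l2 = 0] the transform [b1] must blow up at [a]; this contradicts the
   relation [l2 * b1 + l1 * b2 = 0] near the opposite point of the ellipse. *)
Lemma blow_up_contradiction a y : corner D a y -> pgy D a y != 0 ->
  (forall x, x < a -> fin1 x) -> fin2 (y + 2 * pgy D a y / s2 D) ->
  0 <= pgx D a (y + 2 * pgy D a y / s2 D) -> False.
Proof.
move=> C gyN fa; have [gy0 l20 l10] := corner_r ok C gyN.
have [g0 a0 _ _ _] := C.
have s20 := ok_s2 ok; have r22p := ok_r22 ok.
set w := 2 * pgy D a y / s2 D.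
have w0 : 0 < w by rewrite divr_gt0// mulr_gt0.
set y' := y + w => fy' gx'.
have yy' : y < y' by rewrite ltrDl.
(* If [b1] were finite at [a], so would be [phi] at the corner, where the relation reduces to
   [l1 * b2 = 0], a product of positive numbers. *)
have nfin : ~ fin1 a.
  move=> fa'.
  have [e e0 H] := small_positive (s2 D / 2) gy0.
  pose t := Num.min e w.
  have t0 : 0 < t by rewrite lt_min e0.
  have te : 0 < t <= e by rewrite t0 ge_min lexx.
  have tw : y + t <= y' by rewrite lerD2l ge_min lexx orbT.
  have G : 0 < pg D a (y + t).
    have := pgD D a y 0 t; rewrite addr0 g0 => ->; apply: (lt_le_trans (H t te)).
    by rewrite /pq le_eqVlt; apply/orP; left; apply/eqP; field.
  have ft := ps_pfin sys G fa' (ps_le2 sys tw fy').1.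
  have yt : y <= y + t by rewrite lerDl ltW.
  have fp := ps_pfin_le sys (lexx a) yt ft.
  have := ps_bar sys fp g0; rewrite l20 mul0r add0r => /eqP.
  by rewrite mulf_eq0 !gt_eqF// (ps_pos2 sys (ps_fin2 sys fp)).
have g'0 : pg D a y' = 0.
  have := pgD D a y 0 w; rewrite addr0 g0 => ->.
  by rewrite /pq /w; field; rewrite gt_eqF.
have gy' : pgy D a y' < 0.
  have -> : pgy D a y' = - pgy D a y by rewrite /y' /w /pgy; field; rewrite gt_eqF.
  by rewrite oppr_lt0.
have l2' : l2 D a y' = r22 D * w by have : l2 D a y' = l2 D a y + r22 D * w by [rewrite /l2 /y'; ring]; rewrite l20 add0r.
set X := pgx D a y' in gx'; set Y := pgy D a y' in gy'.
(* the chord through the opposite point with direction (-1, u e), parametrised by e *)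
pose u e := (X + e) / Y.
pose k e := 2 * e / pq D (-1) (u e).
have qp e : 0 < pq D (-1) (u e) by rewrite pq_gt0// oppr_eq0 oner_eq0.
have kp e : 0 < e -> 0 < k e by move=> e0; rewrite divr_gt0// mulr_gt0.
have u0 e : 0 < e -> u e < 0 by move=> e0; rewrite /u pmulr_rlt0 ?invr_lt0// ltr_wpDl.
have gP e : pg D (a - k e) (y' + k e * u e) = 0.
  have := pgD D a y' (k e * -1) (k e * u e); rewrite pqZ g'0 mulrN1 => ->.
  rewrite -/X -/Y; have := qp e; rewrite /k; move: (pq D (-1) (u e)) => q q0.
  by rewrite /u; field; rewrite (gt_eqF q0) (lt_eqF gy').
have gxP e : pgx D (a - k e) (y' + k e * u e) = X + k e * (s1 D - s12 D * u e).
  by rewrite /X /pgx; ring.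
have l2P e : l2 D (a - k e) (y' + k e * u e) = r22 D * w - k e * (r12 D - r22 D * u e).
  by rewrite -l2' /l2; ring.
(* The minimum of [pq D (-1)] over all slopes, so that [k e] is of order [e] uniformly. *)
pose q0 := (s1 D * s2 D - s12 D ^+ 2) / s2 D.
have q00 : 0 < q0 by rewrite divr_gt0// (ok_s ok).
have qlow e : q0 <= pq D (-1) (u e).
  rewrite /q0 ler_pdivrMr//.
  have -> : pq D (-1) (u e) * s2 D = (s2 D * u e - s12 D) ^+ 2 + (s1 D * s2 D - s12 D ^+ 2).
    by rewrite /pq; ring.
  by rewrite lerDr sqr_ge0.
have kq e : 0 < e -> k e <= 2 * e / q0.
  move=> e0; rewrite /k ler_pM2l ?mulr_gt0//.
  by rewrite lef_pV2 ?posrE.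
have nY : 0 < - Y by rewrite oppr_gt0.
pose U := (X + 1) / - Y.
have X1 : 0 < X + 1 by rewrite ltr_wpDl.
have U0 : 0 < U by rewrite divr_gt0.
have uU e : 0 < e <= 1 -> `|u e| <= U.
  move=> /andP[e0 e1]; rewrite ltr0_norm ?u0// /u /U invrN mulrN lerN2.
  by apply: ler_wnM2r; [rewrite invr_le0 ltW|rewrite lerD2l].
pose L := r11 D * (a + 2 / q0) + `|r21 D| * (`|y'| + 2 / q0 * U).
pose n := `|s12 D| + 1.
have n0 : 0 < n by rewrite ltr_wpDl.
pose p := `|r12 D| + r22 D * U + 1.
have p0 : 0 < p by rewrite ltr_wpDl// addr_ge0// mulr_ge0// ltW.
(* The entries respectively bound the slope [u e], keep [pgx] positive on the chord points (two
   entries), and keep [l2] above half its value at the opposite point. *)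
pose e1 := Num.min 1 (Num.min (q0 * - Y / (2 * n)) (Num.min (- Y * s1 D / n / 2) (q0 * (r22 D * w) / (4 * p)))).
have s10 := ok_s1 ok.
have rw0 : 0 < r22 D * w by rewrite mulr_gt0.
have e10 : 0 < e1.
  rewrite !lt_min ltr01/=; apply/and3P; split; apply: divr_gt0 => //.
  - exact: mulr_gt0.
  - exact: mulr_gt0.
  - by rewrite divr_gt0// mulr_gt0.
  - exact: mulr_gt0.
  - exact: mulr_gt0.
pose C0 := 2 * (L * b2 y') / (r22 D * w).
(* The relation gives [b1 = - l1 * b2 / l2], with [l2] bounded away from zero; hence no blow-up as
   the abscissa tends to [a]. *)
have bound e : 0 < e <= e1 -> b1 (a - k e) <= C0.
  move=> /andP[e0]; rewrite !le_min => /and4P[ea eb ec ed].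
  have e01 : 0 < e <= 1 by rewrite e0.
  have k0 := kp e e0; have kk := kq e e0; have un := u0 e e0; have uu := uU e e01.
  have k2 : k e <= 2 / q0.
    apply: (le_trans kk); rewrite ler_pM2r ?invr_gt0//.
    by rewrite -[leRHS]mulr1 ler_pM2l.
  have gx0 : 0 < pgx D (a - k e) (y' + k e * u e).
    rewrite gxP.
    have h1 : k e * n <= - Y.
      apply: (@le_trans _ _ (2 * e / q0 * n)); first by rewrite ler_pM2r.
      move: eb; rewrite ler_pdivlMr ?mulr_gt0// => eb.
      have -> : 2 * e / q0 * n = e * (2 * n) / q0 by ring.
      by rewrite ler_pdivrMr// [leRHS]mulrC.
    have h2 : e * n < - Y * s1 D.
      move: ec; rewrite ler_pdivlMr// ler_pdivlMr// => ec; apply: lt_le_trans ec.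
      by rewrite mulrAC; have := mulr_gt0 e0 n0; move: (e * n) => z; lra.
    have uE : s12 D * u e <= n * ((X + e) / - Y).
      have -> : s12 D * u e = - s12 D * ((X + e) / - Y) by rewrite /u invrN; ring.
      apply: ler_wpM2r; first by apply: divr_ge0; [apply: addr_ge0 => //; exact: ltW|exact: ltW].
      by rewrite (le_trans (ler_norm _))// normrN /n lerDl.
    have : 0 < - Y * (X + k e * (s1 D - n * ((X + e) / - Y))).
      have -> : - Y * (X + k e * (s1 D - n * ((X + e) / - Y))) =
        X * (- Y - k e * n) + k e * (- Y * s1 D - e * n) by field; rewrite (lt_eqF gy').
      rewrite ltr_wpDl//; first by rewrite mulr_ge0// subr_ge0.
      by rewrite mulr_gt0// subr_gt0.
    rewrite pmulr_rgt0// => h; apply: (lt_le_trans h); rewrite lerD2l.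
    by apply: ler_wpM2l; [exact: ltW|rewrite lerD2l lerN2].
  have l2p : r22 D * w / 2 <= l2 D (a - k e) (y' + k e * u e).
    rewrite l2P.
    have : k e * (r12 D - r22 D * u e) <= r22 D * w / 2.
      apply: (@le_trans _ _ (k e * p)).
        apply: ler_wpM2l; first exact: ltW.
        rewrite /p -addrA; apply: lerD; first exact: ler_norm.
        apply: (@le_trans _ _ (r22 D * U)); last by rewrite lerDl.
        rewrite -mulrN; apply: ler_wpM2l; first exact: ltW.
        by rewrite (le_trans _ uu)// -normrN ler_norm.
      apply: (@le_trans _ _ (2 * e / q0 * p)); first by rewrite ler_pM2r.
      move: ed; rewrite ler_pdivlMr ?mulr_gt0// => ed.
      have -> : 2 * e / q0 * p = 2 * e * p / q0 by ring.
      rewrite ler_pdivrMr//.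
      have -> : r22 D * w / 2 * q0 = q0 * (r22 D * w) / 2 by ring.
      rewrite ler_pdivlMr//; apply: le_trans ed.
      by rewrite le_eqVlt; apply/orP; left; apply/eqP; ring.
    by move: (k e * _) (r22 D * w) => *; lra.
  have yk : y' + k e * u e < y' by rewrite gtrDl pmulr_rlt0.
  have ak : a - k e / 2 < a by rewrite gtrBl divr_gt0.
  have ak2 : a - k e < a - k e / 2 by rewrite ltrD2l ltrN2 ltr_pdivrMr// ltr_pMr// ltr1n.
  have fP : pfin (a - k e) (y' + k e * u e).
    apply: (pfin_boundary_swap (gP e) gx0 ak2 _ yk fy'); exact: fa.
  have E := ps_bar sys fP (gP e).
  have fk := ps_fin1 sys fP.
  have by' := ps_le2 sys (ltW yk) fy'.
  have l1n : - l1 D (a - k e) (y' + k e * u e) <= L.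
    apply: (le_trans (ler_norm _)); rewrite normrN /l1.
    apply: (le_trans (ler_normD _ _)); rewrite !normrM (gtr0_norm (ok_r11 ok)).
    apply: lerD; apply: ler_wpM2l => //; first exact: ltW (ok_r11 ok).
      apply: (le_trans (ler_normB _ _)); rewrite (gtr0_norm a0) (gtr0_norm k0).
      by rewrite lerD2l.
    apply: (le_trans (ler_normD _ _)); rewrite lerD2l normrM (gtr0_norm k0).
    by apply: ler_pM => //; exact: ltW.
  have L0 : 0 <= L.
    have q2 : 0 <= 2 / q0 by rewrite divr_ge0// ltW.
    apply: addr_ge0; apply: mulr_ge0 => //; first exact: ltW (ok_r11 ok).
      by apply: addr_ge0 => //; exact: ltW.
    by apply: addr_ge0 => //; apply: mulr_ge0 => //; exact: ltW.
  have bp := ps_pos2 sys by'.1; have bk := ps_pos1 sys fk.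
  rewrite /C0 ler_pdivlMr//.
  have : r22 D * w / 2 * b1 (a - k e) <= L * b2 y'.
    apply: (@le_trans _ _ (l2 D (a - k e) (y' + k e * u e) * b1 (a - k e))).
      by rewrite ler_pM2r.
    apply: (@le_trans _ _ (L * b2 (y' + k e * u e))); last first.
      by apply: ler_wpM2l => //; exact: by'.2.
    have -> : l2 D (a - k e) (y' + k e * u e) * b1 (a - k e) =
       - l1 D (a - k e) (y' + k e * u e) * b2 (y' + k e * u e).
      by rewrite mulNr; apply/eqP; rewrite -addr_eq0 E.
    by rewrite ler_pM2r.
  rewrite mulrAC [b1 _ * _]mulrC.
  by move: (r22 D * w * b1 (a - k e)) (L * b2 y') => *; lra.
apply: nfin; apply: (ps_left1 sys (C := C0)) => x xa; split; first exact: fa.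
pose e := Num.min e1 (q0 * (a - x) / 2).
have e0 : 0 < e by rewrite lt_min e10 divr_gt0// mulr_gt0// subr_gt0.
have ee : 0 < e <= e1 by rewrite e0 ge_min lexx.
have ke : k e <= a - x.
  apply: (le_trans (kq e e0)); rewrite ler_pdivrMr// mulrC.
  have : e <= q0 * (a - x) / 2 by rewrite ge_min lexx orbT.
  by rewrite ler_pdivlMr// mulrC [leRHS]mulrC.
have xk : x <= a - k e by rewrite lerBrDr addrC -lerBrDr.
have fk : fin1 (a - k e) by apply: fa; rewrite gtrBl kp.
exact: le_trans (ps_le1 sys xk fk).2 (bound e ee).
Qed.
End planar_system.

(** Packages the choice of one sufficiently small parameter for a finite list of requirements. *)
Lemma common_scale {R : realType} (l : seq (R * R)) : all (fun p => 0 < p.1) l ->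
  exists2 t : R, 0 < t <= 1 & all (fun p => t * p.2 <= p.1) l.
Proof.
elim: l => [_|[A B] l IH /= /andP[A0 l0]]; first by exists 1; rewrite ?ltr01 ?lexx.
have [t /andP[t0 t1] tl] := IH l0.
have B1 : 0 < `|B| + 1 by rewrite ltr_wpDl.
have n0 : 0 < 1 + (`|B| + 1) / A by rewrite addr_gt0// divr_gt0.
pose u := t / (1 + (`|B| + 1) / A).
have u0 : 0 < u by rewrite divr_gt0.
have ut : u <= t by rewrite ler_pdivrMr// ler_peMr ?(ltW t0)// lerDl divr_ge0// ltW.
exists u; first by rewrite u0 (le_trans ut t1).
apply/andP; split.
  rewrite /= (le_trans (ler_wpM2l (ltW u0) (ler_norm B)))// /u mulrAC ler_pdivrMr//.
  have -> : A * (1 + (`|B| + 1) / A) = `|B| + (A + 1) by field; rewrite gt_eqF.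
  apply: (@le_trans _ _ `|B|); first by rewrite -[leRHS]mul1r ler_wpM2r.
  by rewrite lerDl addr_ge0// ltW.
apply/allP => -[A' B'] Al /=; have /= h := allP tl _ Al; have /= A'0 := allP l0 _ Al.
have [b0|b0] := leP 0 B'; first exact: le_trans (ler_wpM2r b0 ut) h.
by rewrite (le_trans _ (ltW A'0))// mulr_ge0_le0// ltW.
Qed.

(** * A corner at the rightmost point of the ellipse *)

Section corner_bounds.
Context {R : realType}.
Implicit Types (D : @planar_data R) (x y h k a c : R).
Variables (D : @planar_data R) (fin1 fin2 : R -> Prop) (b1 b2 : R -> R) (pfin : R -> R -> Prop).
Hypotheses (ok : planar_ok D) (sys : planar_system D fin1 fin2 b1 b2 pfin).

(** The slope of a convex function is at most that of the chord ending at [b]; the positive value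
    [b1 x] is dropped from it. *)
Lemma convex_increment x x' b : x <= x' -> x' < b -> fin1 b ->
  b1 x' - b1 x <= (x' - x) * (b1 b / (b - x)).
Proof.
move=> xx' x'b fb; have xb := le_lt_trans xx' x'b.
have fx := (ps_le1 sys (ltW xb) fb).1; have p := ps_pos1 sys fx.
have bx : 0 < b - x by rewrite subr_gt0.
pose t := (b - x') / (b - x).
have t01 : 0 <= t <= 1.
  rewrite divr_ge0 ?subr_ge0 ?(ltW x'b) ?(ltW xb)//=.
  by rewrite ler_pdivrMr// mul1r lerD2l lerN2.
have := ps_conv1 sys t01 fx fb.
have -> : t * x + (1 - t) * b = x' by rewrite /t; field; rewrite gt_eqF.
have t1 : 1 - t = (x' - x) / (b - x) by rewrite /t; field; rewrite gt_eqF.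
have t0 : 0 <= 1 - t by rewrite subr_ge0; case/andP: t01.
have -> : (x' - x) * (b1 b / (b - x)) = (1 - t) * b1 b by rewrite t1; ring.
move=> h; rewrite lerBlDr addrC; apply: (le_trans h); rewrite lerD2r.
by rewrite -[leRHS]mul1r; apply: ler_wpM2r; [exact: ltW|case/andP: t01].
Qed.

(* Near the rightmost point the ellipse is vertical: [y] moves at first order in [t] while [x]
   moves at second order, too little for a Lipschitz [b1]. *)
Lemma rightmost_contradiction a y b c : corner D a y -> pgy D a y = 0 -> a < b -> fin1 b ->
  y < c -> fin2 c -> False.
Proof.
move=> C gy0 ab fb yc fc; have [g0 a0 l20 _ _] := C.
have := corner_max ok C gy0; set G' := pgx D a y; rewrite -oppr_gt0; set G := - G' => G0.
have s10 := ok_s1 ok; have s20 := ok_s2 ok; have r22p := ok_r22 ok; have d0 := ok_det ok.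
have beta0 := ps_pos1 sys (ps_zero1 sys); set beta := b1 0 in beta0.
have bb0 := ps_pos1 sys fb.
have bma : 0 < b - a by rewrite subr_gt0.
pose Lam := (`|r12 D| * a + r22 D * (`|y| + 1)) * (`|r11 D| * a + `|r21 D| * (`|y| + 1)).
have y1p : 0 <= `|y| + 1 by rewrite addr_ge0.
have Lam0 : 0 <= Lam.
  by rewrite mulr_ge0// addr_ge0// mulr_ge0// ltW.
pose c0 := pdet D * (a / 2) * beta.
have c00 : 0 < c0 by rewrite !mulr_gt0.
pose K := pdet D * (`|y| + 1) * b1 b + Lam * (b1 b / (b - a)).
have K0 : 0 <= K.
  have bb := ltW bb0; have dd := ltW d0; have bm := ltW bma.
  by apply: addr_ge0; [apply: mulr_ge0 => //; exact: mulr_ge0|apply: mulr_ge0 => //; exact: divr_ge0].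
(* In order: [q] stays comparable to [s2] (two entries), [l2] stays negative, [k <= 1], the abscissa
   stays above [a / 2], and the final inequality [c0 <= 4 * K * t] becomes false. *)
have [|t /andP[t0 t1] /= /and5P[e1 e2 e3 e4 /and3P[e5 e6 _]]] := @common_scale R
  [:: (s2 D, 4 * `|s12 D|); (s2 D, 4 * s1 D); (r22 D, 2 * `|r12 D|); (s2 D, 4 * G);
      (a * s2 D, 8 * G); (c0, 4 * K + 1 + c0)].
  by rewrite /= s20 r22p !mulr_gt0.
pose q (u : R) := pq D u 1.
have qE u : q u = s2 D + 2 * s12 D * u + s1 D * u ^+ 2 by rewrite /q /pq; ring.
have q0 u : 0 < q u by rewrite /q pq_gt0// oner_eq0 orbT.
pose k u := 2 * G * u / q u.
have su u : 0 <= u <= t -> `|s12 D| * u <= s2 D / 4 /\ s1 D * u ^+ 2 <= s2 D / 4.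
  move=> /andP[u0 ut]; split.
    apply: (@le_trans _ _ (t * `|s12 D|)); first by rewrite mulrC ler_wpM2r.
    by move: e1; move: (`|s12 D|) (s2 D) => *; lra.
  apply: (@le_trans _ _ (t * s1 D)); last by move: e2; move: (s1 D) (s2 D) => *; lra.
  rewrite mulrC; apply: ler_wpM2r; first exact: ltW.
  rewrite expr2; apply: (@le_trans _ _ (t * 1)); last by rewrite mulr1.
  by apply: ler_pM => //; exact: le_trans ut t1.
have ss u : 0 <= u -> - (`|s12 D| * u) <= s12 D * u <= `|s12 D| * u.
  move=> u0; apply/andP; split; last by apply: ler_wpM2r => //; exact: ler_norm.
  by rewrite lerNl -mulNr; apply: ler_wpM2r => //; rewrite -normrN ler_norm.
have qlow u : 0 <= u <= t -> s2 D / 2 <= q u.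
  move=> ut; have [h1 _] := su u ut; have /andP[u0 _] := ut; have /andP[h3 _] := ss u u0.
  have h4 : 0 <= s1 D * u ^+ 2 by rewrite mulr_ge0 ?sqr_ge0// ltW.
  rewrite qE; move: h1 h3 h4; rewrite -mulrA.
  by move: (`|s12 D| * u) (s12 D * u) (s1 D * u ^+ 2) (s2 D) => *; lra.
have k0 u : 0 < u -> 0 < k u by move=> u0; rewrite divr_gt0// !mulr_gt0.
have kle u : 0 < u <= t -> k u <= 4 * G * t / s2 D.
  move=> /andP[u0 ut]; have ut' : 0 <= u <= t by rewrite ltW.
  rewrite ler_pdivlMr// /k.
  have -> : 2 * G * u / q u * s2 D = 2 * (G * u * s2 D) / q u by ring.
  rewrite ler_pdivrMr//.
  have -> : 4 * G * t * q u = 4 * (G * t * q u) by ring.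
  have h := qlow u ut'; have h2 : G * u <= G * t by rewrite ler_pM2l.
  have h3 := ler_wpM2l (mulr_ge0 (ltW G0) (ltW t0)) h; rewrite mulrA in h3.
  have h4 := ler_wpM2r (ltW s20) h2.
  by move: h3 h4; move: (G * t * q u) (G * t * s2 D) (G * u * s2 D) => *; lra.
have k1 u : 0 < u <= t -> k u <= 1.
  move=> ut; apply: (le_trans (kle u ut)); rewrite ler_pdivrMr// mul1r; apply: le_trans e4.
  by rewrite mulrC.
have ka u : 0 < u <= t -> u * k u <= a / 2.
  move=> ut; have /andP[u0 ut'] := ut.
  apply: (@le_trans _ _ (1 * k u)); first by rewrite ler_wpM2r ?(ltW (k0 u u0))// (le_trans ut').
  rewrite mul1r; apply: (le_trans (kle u ut)); rewrite ler_pdivrMr//.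
  move: e5; have -> : t * (8 * G) = 8 * (G * t) by ring.
  have -> : a / 2 * s2 D = a * s2 D / 2 by ring.
  by rewrite -mulrA; move: (G * t) (a * s2 D) => *; lra.
have P u : 0 < u <= t -> [/\ pfin (a - u * k u) (y - k u),
   0 < l1 D (a - u * k u) (y - k u) & l2 D (a - u * k u) (y - k u) < 0] /\
   pg D (a - u * k u) (y - k u) = 0.
  move=> ut; have /andP[u0 ut'] := ut; have kp := k0 u u0.
  have g : pg D (a - u * k u) (y - k u) = 0.
    have := pgD D a y (k u * - u) (k u * -1); rewrite pqZ g0 gy0 mul0r addr0 add0r.
    rewrite !mulrN mulr1 mulrC => ->.
    have -> : pq D (- u) (-1) = q u by rewrite /q /pq; ring.
    by rewrite -/G' /k -(opprK G') -/G; move: (q0 u); move: (q u) => z z0; field; rewrite gt_eqF.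
  have gy : 0 < pgy D (a - u * k u) (y - k u).
    have -> : pgy D (a - u * k u) (y - k u) = pgy D a y + k u * (s12 D * u + s2 D).
      by rewrite /pgy; ring.
    rewrite gy0 add0r mulr_gt0//.
    have ut2 : 0 <= u <= t by rewrite (ltW u0).
    have [h _] := su u ut2.
    have /andP[h' _] := ss u (ltW u0).
    by move: h h' s20; move: (`|s12 D| * u) (s12 D * u) (s2 D) => *; lra.
  have xb : a - u * k u < b by apply: le_lt_trans ab; rewrite gerBl mulr_ge0// ltW.
  have yc' : y - k u < c by apply: le_lt_trans yc; rewrite gerBl ltW.
  have f := pfin_boundary sys g gy xb fb yc' fc.
  have L2 : l2 D (a - u * k u) (y - k u) < 0.
    have -> : l2 D (a - u * k u) (y - k u) = l2 D a y - k u * (r12 D * u + r22 D).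
      by rewrite /l2; ring.
    have h : 0 < r12 D * u + r22 D.
      have : - (r12 D * u) <= r22 D / 2.
        apply: (@le_trans _ _ (`|r12 D| * t)).
          rewrite -mulNr; apply: (le_trans (ler_wpM2r (ltW u0) (ler_norm _))).
          by rewrite normrN ler_wpM2l.
        by move: e3; rewrite mulrCA [t * _]mulrC; move: (`|r12 D| * t) (r22 D) => *; lra.
      by move: r22p; move: (r12 D * u) (r22 D) => *; lra.
    have := mulr_gt0 kp h; move: l20; move: (l2 D a y) (k u * _) => *; lra.
  split => //; split => //.
  have n0 : (a - u * k u != 0) || (y - k u != 0).
    have : a / 2 <= a - u * k u by have := ka u ut; move: (u * k u) => *; lra.
    by move=> /(lt_le_trans (divr_gt0 a0 (ltr0n _ 2))) /gt_eqF ->.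
  by case: (opposite_signs ok sys f g n0) => [[//]|[_ /lt_trans/(_ L2)]]; rewrite ltxx.
have tt : 0 < t <= t by rewrite t0 lexx.
have t20 : 0 < t / 2 by rewrite divr_gt0.
have tt2 : 0 < t / 2 <= t by rewrite t20/= ler_pdivrMr// ler_pMr// ler1n.
have [[f L1 L2] g] := P t tt; have [[f' L1' L2'] g'] := P (t / 2) tt2.
have kt := k0 t t0; have kt2 := k0 _ t20.
(* Halving [u] almost halves [k], so the two points remain at least [k t / 4] apart in ordinate. *)
have k34 : k (t / 2) <= 3 / 4 * k t.
  have -> : 3 / 4 * k t = 3 / 4 * (2 * G * t) / q t by rewrite /k; ring.
  rewrite /k ler_pdivrMr//.
  have -> : 3 / 4 * (2 * G * t) / q t * q (t / 2) = 3 / 4 * (2 * G * t) * q (t / 2) / q t by ring.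
  rewrite ler_pdivlMr//.
  have h : q t <= 3 / 2 * q (t / 2).
    have t2 : 0 <= t <= t by rewrite (ltW t0) lexx.
    have [h1 h2] := su t t2.
    have /andP[_ h3] := ss t (ltW t0); rewrite !qE.
    move: h1 h2 h3; rewrite -!mulrA.
    have -> : s12 D * (t / 2) = s12 D * t / 2 by ring.
    have -> : s1 D * (t / 2) ^+ 2 = s1 D * t ^+ 2 / 4 by field.
    by move: (`|s12 D| * t) (s12 D * t) (s1 D * t ^+ 2) (s2 D) s20 => *; lra.
  have h2 := ler_wpM2l (mulr_ge0 (ltW G0) (ltW t0)) h.
  move: h2; have -> : G * t * (3 / 2 * q (t / 2)) = 3 / 4 * (2 * G * t) * q (t / 2) by field.
  have -> : 2 * G * (t / 2) * q t = G * t * q t by field.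
  by [].
pose x := a - t * k t; pose x' := a - t / 2 * k (t / 2).
pose v := y - k t; pose v' := y - k (t / 2).
rewrite -/x -/x' -/v -/v' in f L1 L2 g f' L1' L2' g'.
have xx' : x <= x'.
  rewrite lerD2l lerN2; apply: ler_pM; rewrite ?(ltW t20) ?(ltW kt2)//; first by case/andP: tt2.
  by apply: (le_trans k34); rewrite -[leRHS]mul1r ler_pM2r// ler_pdivrMr// mul1r ler_nat.
have vv' : k t / 4 <= v' - v by rewrite /v /v'; move: k34; move: (k t) (k (t / 2)) => *; lra.
have vv : v <= v' by rewrite -subr_ge0; apply: le_trans vv'; rewrite divr_ge0// ltW.
have xxt : x' - x <= t * k t.
  have := mulr_gt0 t20 kt2; rewrite /x /x'; move: (t / 2 * _) (t * k t) => *; lra.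
have x'a : x' <= a by rewrite gerBl mulr_ge0// ltW.
have xa := le_trans xx' x'a; have x'b := le_lt_trans x'a ab.
have x2 : a / 2 <= x by have := ka t tt; rewrite /x; move: (t * k t) => *; lra.
have x0 : 0 < x by apply: lt_le_trans x2; rewrite divr_gt0.
have x0' := lt_le_trans x0 xx'.
have fx := ps_fin1 sys f; have fx' := ps_fin1 sys f'.
have fv := ps_fin2 sys f; have fv' := ps_fin2 sys f'.
have inc := convex_increment xx' x'b fb.
have bx0 : beta <= b1 x := (ps_le1 sys (ltW x0) fx).2.
have bxb : b1 x <= b1 b := (ps_le1 sys (le_trans xa (ltW ab)) fb).2.
have bvv := (ps_le2 sys vv fv').2.
have E := ps_bar sys f g; have E' := ps_bar sys f' g'.
have key : l2 D x' v' * l1 D x v * b1 x' <= l2 D x v * l1 D x' v' * b1 x.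
  have h : l1 D x v * l1 D x' v' * b2 v <= l1 D x v * l1 D x' v' * b2 v'.
    by apply: ler_wpM2l => //; rewrite mulr_ge0// ltW.
  have -> : l2 D x' v' * l1 D x v * b1 x' = l1 D x v * (l2 D x' v' * b1 x') by ring.
  have -> : l2 D x v * l1 D x' v' * b1 x = l1 D x' v' * (l2 D x v * b1 x) by ring.
  have -> : l2 D x v * b1 x = - (l1 D x v * b2 v) by apply/eqP; rewrite -addr_eq0 E.
  have -> : l2 D x' v' * b1 x' = - (l1 D x' v' * b2 v') by apply/eqP; rewrite -addr_eq0 E'.
  by rewrite !mulrN lerN2 mulrA [leRHS]mulrA [l1 D x' v' * _]mulrC.
have vy u : 0 < u <= t -> `|y - k u| <= `|y| + 1.
  move=> ut; apply: (le_trans (ler_normB _ _)); rewrite lerD2l.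
  by rewrite ger0_norm ?k1//; case/andP: ut => u0 _; exact: ltW (k0 u u0).
have lam : - (l2 D x' v' * l1 D x v) <= Lam.
  apply: (le_trans (ler_norm _)); rewrite normrN normrM; apply: ler_pM => //.
    apply: (le_trans (ler_normD _ _)); rewrite !normrM (gtr0_norm r22p) (gtr0_norm x0').
    by apply: lerD; apply: ler_wpM2l => //; [exact: ltW|exact: vy].
  apply: (le_trans (ler_normD _ _)); rewrite !normrM (gtr0_norm x0).
  by apply: lerD; apply: ler_wpM2l => //; exact: vy.
have dx : 0 <= x' - x by rewrite subr_ge0.
have bdec : b1 x' - b1 x <= (x' - x) * (b1 b / (b - a)).
  apply: (le_trans inc); apply: ler_wpM2l => //; apply: ler_wpM2l; first exact: ltW.
  by rewrite lef_pV2 ?posrE ?subr_gt0 ?(le_lt_trans xa ab)// lerD2l lerN2.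
have mono := (ps_le1 sys xx' fx').2.
(* [cross_lines] isolates the ordinate gap on the left; what remains is proportional to the abscissa
   gap, the increment of [b1] being so by convexity. *)
have main : pdet D * x * (v' - v) * b1 x <= K * (x' - x).
  have -> : K * (x' - x) = pdet D * (`|y| + 1) * b1 b * (x' - x) + Lam * ((x' - x) * (b1 b / (b - a))).
    by rewrite /K; ring.
  apply: (@le_trans _ _ (pdet D * v * b1 x * (x' - x) - l2 D x' v' * l1 D x v * (b1 x' - b1 x))).
    have cl := cross_lines D x v x' v'.
    rewrite -subr_ge0 in key; rewrite -subr_ge0.
    have -> : pdet D * v * b1 x * (x' - x) - l2 D x' v' * l1 D x v * (b1 x' - b1 x) -
       pdet D * x * (v' - v) * b1 x =
       pdet D * (v * x' - x * v') * b1 x - l2 D x' v' * l1 D x v * (b1 x' - b1 x) by ring.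
    rewrite -cl.
    by have -> : (l2 D x v * l1 D x' v' - l2 D x' v' * l1 D x v) * b1 x -
      l2 D x' v' * l1 D x v * (b1 x' - b1 x) =
      l2 D x v * l1 D x' v' * b1 x - l2 D x' v' * l1 D x v * b1 x' by ring.
  apply: lerD.
    apply: ler_wpM2r => //.
    apply: (@le_trans _ _ (pdet D * (`|y| + 1) * b1 x)).
      apply: ler_wpM2r; first exact: ltW (ps_pos1 sys fx).
      apply: ler_wpM2l; first exact: ltW.
      by rewrite (le_trans (ler_norm _))// vy.
    by apply: ler_wpM2l => //; rewrite mulr_ge0// ltW.
  rewrite -mulNr; apply: (@le_trans _ _ (Lam * (b1 x' - b1 x))).
    by apply: ler_wpM2r => //; rewrite subr_ge0.
  exact: ler_wpM2l.
have low : c0 * (k t / 4) <= pdet D * x * (v' - v) * b1 x.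
  have -> : c0 * (k t / 4) = pdet D * (a / 2) * (k t / 4) * beta by rewrite /c0; ring.
  have k4 : 0 <= k t / 4 by rewrite divr_ge0// ltW.
  have da : 0 <= pdet D * (a / 2).
    by apply: mulr_ge0; [exact: ltW|apply: divr_ge0 => //; exact: ltW].
  apply: ler_pM => //; [exact: mulr_ge0|exact: ltW|apply: ler_pM => //].
  by apply: ler_wpM2l => //; exact: ltW.
have h1 : c0 * (k t / 4) <= K * (t * k t).
  by apply: (le_trans low); apply: (le_trans main); exact: ler_wpM2l.
have h2 : c0 <= 4 * K * t.
  rewrite -(ler_pM2r kt); move: h1.
  have -> : K * (t * k t) = K * t * k t by ring.
  have -> : 4 * K * t * k t = 4 * (K * t * k t) by ring.
  have -> : c0 * (k t / 4) = c0 * k t / 4 by ring.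
  by move: (c0 * k t) (K * t * k t) => *; lra.
have h3 : 0 < t * c0 by rewrite mulr_gt0.
move: e6 h2; have -> : t * (4 * K + 1 + c0) = 4 * K * t + t + t * c0 by ring.
by move: h3 t0; move: (4 * K * t) (t * c0) (c0 : R) => p1 p2 p3 *; lra.
Qed.
End corner_bounds.

Lemma le_mul_right_limit {R : realType} (T a C y : R) : T < a -> 0 <= y ->
  (forall x, T < x < a -> C <= x * y) -> C <= T * y.
Proof.
move=> Ta y0 H; rewrite leNgt; apply/negP => lt.
have [y00|yn0] := eqVneq y 0.
  have Tm : T < (T + a) / 2 < a by apply/andP; split; lra.
  by have := H _ Tm; move: lt; rewrite y00 !mulr0 ltNge => /negP.
have yp : 0 < y by rewrite lt_neqAle eq_sym yn0.
have Tz : T < C / y by rewrite ltr_pdivlMr.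
pose x := Num.min ((T + a) / 2) ((T + C / y) / 2).
have xT : T < x by rewrite lt_min; apply/andP; split; [lra|move: (C / y) Tz => z; lra].
have xa : x < a by rewrite gt_min; apply/orP; left; lra.
have := H x; rewrite xT xa => /(_ isT); rewrite -ler_pdivrMr// => Cx.
have : x <= (T + C / y) / 2 by rewrite ge_min lexx orbT.
by move: (C / y) Tz Cx => z *; lra.
Qed.

(** * Convexity and particular points of Gamma *)

Section gamma_points.
Context {R : realType}.
Implicit Types (x y h k a c : R).
Variables (D : @planar_data R).
Hypotheses (ok : planar_ok D).

Lemma Gamma_convex x y h k t : 0 <= t <= 1 -> 0 < pg D x y -> 0 < pg D h k ->
  0 < pg D ((1 - t) * x + t * h) ((1 - t) * y + t * k).
Proof.
move=> /andP[t0 t1] g1 g2.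
have -> : pg D ((1 - t) * x + t * h) ((1 - t) * y + t * k) =
   (1 - t) * pg D x y + t * pg D h k + t * (1 - t) * pq D (h - x) (k - y) / 2.
  by rewrite /pg /pq; field.
have t1' : 0 <= 1 - t by rewrite subr_ge0.
have q := pq_ge0 ok (h - x) (k - y).
apply: ltr_wpDr; first by rewrite divr_ge0// !mulr_ge0.
have [->|tn] := eqVneq t 0; first by rewrite mul0r addr0 subr0 mul1r.
by rewrite ltr_wpDl ?mulr_ge0 ?(ltW g1)// mulr_gt0// lt_neqAle eq_sym tn.
Qed.

Lemma Gamma_between_y x y y' z : 0 <= pg D x y -> 0 <= pg D x y' -> y < z < y' -> 0 < pg D x z.
Proof.
move=> g1 g2 /andP[yz zy]; have yy : 0 < y' - y by rewrite subr_gt0 (lt_trans yz).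
pose t := (z - y) / (y' - y).
have t0 : 0 < t by rewrite divr_gt0// subr_gt0.
have t1 : t < 1 by rewrite ltr_pdivrMr// mul1r ltrD2r.
have t01 : 0 <= t <= 1 by rewrite !ltW.
have := Gamma_segment t01 g1 g2.
have -> : (1 - t) * x + t * x = x by ring.
have -> : (1 - t) * y + t * y' = z by rewrite /t; field; rewrite gt_eqF.
apply: lt_le_trans; rewrite divr_gt0// !mulr_gt0 ?subr_gt0//.
  by rewrite invr_gt0.
by rewrite pq_gt0// (gt_eqF yy) orbT.
Qed.

(** A short step along the segment toward [(x', y')] goes strictly left, stays in [Gamma] by
    convexity, and keeps the ordinate between [L] and [U]. *)
Lemma Gamma_shift_left a M x' y' L U : 0 < pg D a M -> 0 < pg D x' y' -> x' < a ->
  L < M < U -> exists x y, [/\ 0 < pg D x y, x' < x < a & L < y < U].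
Proof.
move=> g1 g2 xa /andP[LM MU].
have [|t /andP[t0 t1] /= /and4P[c1 c2 c3 _]] := @common_scale R
  [:: (M - L, 2 * (M - y')); (U - M, 2 * (y' - M)); (1, 2)].
  by rewrite /= !subr_gt0 LM MU ltr01.
have t01 : 0 <= t <= 1 by rewrite ltW.
exists ((1 - t) * a + t * x'), ((1 - t) * M + t * y'); split; first exact: Gamma_convex.
- have -> : (1 - t) * a + t * x' = a - t * (a - x') by ring.
  have h : 0 < t * (a - x') by rewrite mulr_gt0// subr_gt0.
  have h2 : t * (a - x') <= (a - x') / 2.
    rewrite mulrC; apply: ler_wpM2l; first by rewrite subr_ge0 ltW.
    by move: c3; lra.
  by apply/andP; split; move: h h2; move: (t * _) => *; lra.
- have -> : (1 - t) * M + t * y' = M - t * (M - y') by ring.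
  move: c1 c2; have -> : t * (2 * (M - y')) = 2 * (t * (M - y')) by ring.
  have -> : t * (2 * (y' - M)) = - 2 * (t * (M - y')) by ring.
  by move: (t * _) => s *; apply/andP; split; lra.
Qed.

(** The product of the two drift inequalities would contradict the sign of the determinant. It keeps
    the origin off the north-east arc. *)
Lemma not_both_drifts_gt0 : ~ (0 < m1 D /\ 0 < m2 D).
Proof.
move=> [p1 p2]; have h1 := ok_m1 ok; have h2 := ok_m2 ok; have d := ok_det ok.
have p11 := ok_r11 ok; have p22 := ok_r22 ok.
have e1 : r22 D * m1 D < r12 D * m2 D by rewrite -subr_lt0.
have e2 : r11 D * m2 D < r21 D * m1 D by rewrite -subr_lt0.
have := ltr_pM (ltW (mulr_gt0 p22 p1)) (ltW (mulr_gt0 p11 p2)) e1 e2.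
have -> : r22 D * m1 D * (r11 D * m2 D) = r11 D * r22 D * (m1 D * m2 D) by ring.
have -> : r12 D * m2 D * (r21 D * m1 D) = r12 D * r21 D * (m1 D * m2 D) by ring.
rewrite ltr_pM2r ?mulr_gt0// => h; move: d; rewrite /pdet subr_gt0 => /lt_trans /(_ h).
by rewrite ltxx.
Qed.

(** Provides the first extension of [fin1] beyond zero, where only [fin2 0] is available. The
    direction is [(r22, - r12)] when [0 <= r12], ascending by the drift condition, and [(1, 0)]
    otherwise; a small downward tilt [d] makes [l2] negative. *)
Lemma Gamma_axis_point : 0 <= r12 D \/ m1 D < 0 ->
  exists x y, [/\ 0 < x, y <= 0, 0 < pg D x y & l2 D x y < 0].
Proof.
have p22 := ok_r22 ok.
move=> H; have [u [v [u0 v0 uv A0]]] : exists u v, [/\ 0 < u, 0 <= v,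
   r12 D * u - r22 D * v <= 0 & 0 < - m1 D * u + m2 D * v].
  have [r0|r0] := leP 0 (r12 D).
    exists (r22 D), (r12 D); split => //; first by rewrite mulrC subrr.
    have := ok_m1 ok; rewrite -oppr_gt0; congr (0 < _); ring.
  have {H} m0 : m1 D < 0 by case: H => //; rewrite leNgt r0.
  by exists 1, 0; rewrite !mulr0 !mulr1 subr0 addr0 oppr_gt0; split => //; exact: ltW.
set A := - m1 D * u + _ in A0.
pose d := A / (2 * (`|m2 D| + 1)).
have n0 : 0 < `|m2 D| + 1 by rewrite ltr_wpDl.
have d0 : 0 < d by rewrite divr_gt0// mulr_gt0.
have A1 : 0 < A + m2 D * d.
  have : - (m2 D * d) <= A / 2.
    apply: (le_trans (ler_norm _)); rewrite normrN normrM (gtr0_norm d0).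
    apply: (@le_trans _ _ ((`|m2 D| + 1) * d)).
      by apply: ler_wpM2r; [exact: ltW|rewrite lerDl].
    by rewrite le_eqVlt /d; apply/orP; left; apply/eqP; field; rewrite gt_eqF.
  by move: (m2 D * d) A0 => *; lra.
have [t t0 /(_ t)] := small_positive (pq D u (- v - d) / 2) A1.
rewrite t0 lexx => /(_ isT) H2.
exists (t * u), (t * (- v - d)); split.
- exact: mulr_gt0.
- by rewrite pmulr_rle0// subr_le0 (le_trans _ (ltW d0))// oppr_le0.
- have := pgD D 0 0 (t * u) (t * (- v - d)); rewrite !add0r pg00 pqZ => ->.
  apply: (lt_le_trans H2); rewrite le_eqVlt; apply/orP; left; apply/eqP.
  by rewrite /A /pgx /pgy; field.
- have -> : l2 D (t * u) (t * (- v - d)) = t * (r12 D * u - r22 D * v - r22 D * d).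
    by rewrite /l2; ring.
  rewrite pmulr_rlt0//; have := mulr_gt0 p22 d0.
  by move: uv; move: (r12 D * u - _) (r22 D * d) => *; lra.
Qed.
End gamma_points.

(** * Relative position of the corners and bounds on finiteness *)

Section two_corners.
Context {R : realType}.
Implicit Types (x y h k a c : R).
Variables (D : @planar_data R) (fin1 fin2 : R -> Prop) (b1 b2 : R -> R) (pfin : R -> R -> Prop).
Hypotheses (ok : planar_ok D) (sys : planar_system D fin1 fin2 b1 b2 pfin).
Variables (a1 y1 a2 x2 : R).
Hypotheses (C1 : corner D a1 y1) (C2 : corner (swap_data D) a2 x2).
Let ok' := swap_ok ok.
Let sys' := swap_system sys.

Let a10 : 0 < a1. Proof. by case: C1. Qed.
Let a20 : 0 < a2. Proof. by case: C2. Qed.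
Let g1 : pg D a1 y1 = 0. Proof. by case: C1. Qed.
Let g2 : pg D x2 a2 = 0. Proof. by case: C2; rewrite pg_swap. Qed.

(** The corner conditions bound [y1 / a1] by [- r12 / r22] and [x2 / a2] by [- r21 / r11];
    multiplying them would give [r11 r22 <= r12 r21]. *)
Lemma corners_cross : ~ [/\ 0 < y1, 0 < x2 & a1 * a2 <= y1 * x2].
Proof.
move=> [y10 x20 le]; case: C1 => _ _ h1 _ _; case: C2 => _ _ h2 _ _.
rewrite l2_swap in h2.
have p11 := ok_r11 ok; have p22 := ok_r22 ok; have d := ok_det ok.
have e1 : r22 D * y1 <= - r12 D * a1 by move: h1; rewrite /l2 mulNr; move: (_ * a1) (_ * y1) => *; lra.
have e2 : r11 D * x2 <= - r21 D * a2 by move: h2; rewrite /l1 mulNr; move: (_ * a2) (_ * x2) => *; lra.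
have := ler_pM (ltW (mulr_gt0 p22 y10)) (ltW (mulr_gt0 p11 x20)) e1 e2.
have -> : r22 D * y1 * (r11 D * x2) = r11 D * r22 D * (y1 * x2) by ring.
have -> : - r12 D * a1 * (- r21 D * a2) = r12 D * r21 D * (a1 * a2) by ring.
move=> e3; have := le_trans (ler_wpM2l (ltW (mulr_gt0 p11 p22)) le) e3.
by rewrite ler_pM2r ?mulr_gt0// leNgt -subr_gt0 d.
Qed.

(** Suppose [b > a1]. If [b2] is finite somewhere above [y1], the first corner gives the
    contradiction. Otherwise [b2] is finite exactly below a level between [a2] and [y1], the second
    corner must lie on its ray, and the blow-up argument applies there. *)
Lemma corner_bound b : fin1 b -> b <= a1.
Proof.
move=> fb; rewrite leNgt; apply/negP => ab.
have [[c fc yc]|nc] := pselect (exists2 c, fin2 c & y1 < c).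
  have [gy|gy] := eqVneq (pgy D a1 y1) 0.
    exact: (rightmost_contradiction ok sys C1 gy ab fb yc fc).
  have [gy0 l20 l10] := corner_r ok C1 gy.
  have f := pfin_boundary sys g1 gy0 ab fb yc fc.
  have := ps_bar sys f g1; rewrite l20 mul0r add0r => /eqP.
  by rewrite mulf_eq0 !gt_eqF// (ps_pos2 sys (ps_fin2 sys f)).
have {}nc c : fin2 c -> c <= y1.
  by move=> fc; rewrite leNgt; apply/negP => yc; apply: nc; exists c.
(* A gap below [a2] would, through [corner_slope] for the swapped data, put the two corners across
   each other. *)
have fa y : y < a2 -> fin2 y.
  move=> ya; apply: contrapT => nf.
  have y0 : 0 < y by rewrite ltNge; apply/negP => /(ps_le2 sys) /(_ (ps_zero2 sys))[].
  have h := corner_slope ok' sys' C2 fb nf ya.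
  have b0 : 0 < b := lt_trans a10 ab.
  have x20 : 0 < x2 by rewrite -(pmulr_rgt0 _ y0) (lt_le_trans _ h)// mulr_gt0.
  suff key : b * a2 <= y1 * x2.
    have y10 : 0 < y1 by rewrite -(pmulr_lgt0 _ x20) (lt_le_trans _ key)// mulr_gt0.
    apply: corners_cross; split => //; apply: le_trans key.
    by rewrite ler_pM2r// ltW.
  have [yy|yy] := leP y y1; first by apply: (le_trans h); rewrite ler_pM2r.
  apply: (le_mul_right_limit yy (ltW x20)) => z /andP[z1 z2].
  apply: (corner_slope ok' sys' C2 fb); last exact: lt_trans z2 ya.
  by move=> /nc; rewrite leNgt z1.
have a2y : a2 <= y1.
  rewrite leNgt; apply/negP => lt; have m : (y1 + a2) / 2 < a2 by lra.
  by have := nc _ (fa _ m); lra.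
have y10 := lt_le_trans a20 a2y.
have x2a : x2 < a1.
  rewrite ltNge; apply/negP => ax; apply: corners_cross; split => //.
    exact: lt_le_trans ax.
  by rewrite mulrC; apply: ler_pM => //; exact: ltW.
have gx2 : pgy (swap_data D) a2 x2 != 0.
  apply/eqP => gx; have := corner_max ok' C2 gx; rewrite pgx_swap => gy.
  rewrite pgy_swap in gx; have := pgB D x2 a2 a1 y1; rewrite g1 g2 gx mul0r add0r add0r.
  have := @pq_gt0 _ _ ok (a1 - x2) (y1 - a2); rewrite subr_eq0 (gt_eqF x2a) => /(_ isT).
  have : pgy D x2 a2 * (y1 - a2) <= 0 by rewrite nmulr_rle0// subr_ge0.
  by move: (_ * (y1 - a2)) (pq _ _ _) => *; lra.
have [gx0 _ _] := corner_r ok' C2 gx2; rewrite pgy_swap in gx0.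
pose w := 2 * pgx D x2 a2 / s1 D.
have s10 := ok_s1 ok; have s20 := ok_s2 ok.
have g2' : pg D (x2 + w) a2 = 0.
  have := pgD D x2 a2 w 0; rewrite addr0 g2 => ->.
  by rewrite /pq /w; field; rewrite gt_eqF.
case: C1 => _ _ _ gy1 _.
have gx1 : pgx D a1 y1 < 0.
  have := toward_origin g1; have q0 := @pq_gt0 _ _ ok a1 y1; rewrite (gt_eqF a10) in q0.
  have := mulr_ge0 gy1 (ltW y10); move: (q0 isT) => {}q0 h1 h2.
  rewrite -(pmulr_llt0 _ a10); move: q0 h1 h2.
  by move: (_ * a1) (_ * y1) (pq _ _ _) => *; lra.
have x2a' : x2 + w <= a1.
  have := pgB D a1 y1 (x2 + w) a2; rewrite g1 g2' add0r.
  have := pq_ge0 ok (x2 + w - a1) (a2 - y1).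
  have : pgy D a1 y1 * (a2 - y1) <= 0 by rewrite mulr_ge0_le0// subr_le0.
  rewrite -(subr_le0 a1) -(nmulr_rge0 (x2 + w - a1) gx1).
  by move: (pgx D a1 y1 * _) (_ * (a2 - y1)) (pq _ _ _) => *; lra.
apply: (blow_up_contradiction ok' sys' C2 gx2 fa); rewrite pgy_swap -/w.
  exact: (ps_le1 sys (le_trans x2a' (ltW ab)) fb).1.
rewrite pgx_swap; have [E|N] := boolP ((a1 - (x2 + w) != 0) || (y1 - a2 != 0)); last first.
  move: N; rewrite negb_or !negbK !subr_eq0 => /andP[/eqP <- /eqP <-]; exact: gy1.
have q0 := pq_gt0 ok E.
have gx' : pgx D (x2 + w) a2 < 0.
  have -> : pgx D (x2 + w) a2 = - pgx D x2 a2 by rewrite /w /pgx; field; rewrite gt_eqF.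
  by rewrite oppr_lt0.
rewrite leNgt; apply/negP => gy'.
have := pgB D (x2 + w) a2 a1 y1; rewrite g1 g2' add0r.
have : pgx D (x2 + w) a2 * (a1 - (x2 + w)) <= 0 by rewrite nmulr_rle0// subr_ge0.
have : pgy D (x2 + w) a2 * (y1 - a2) <= 0 by rewrite nmulr_rle0// subr_ge0.
by move: q0; move: (pgx _ _ _ * _) (_ * (y1 - a2)) (pq _ _ _) => *; lra.
Qed.
End two_corners.

(** * Upper bound for the domain *)

Section domain_bounds.
Context {R : realType}.
Implicit Types (x y h k c : R).
Variables (D : @planar_data R) (fin1 fin2 : R -> Prop) (b1 b2 : R -> R) (pfin : R -> R -> Prop).
Hypotheses (ok : planar_ok D) (sys : planar_system D fin1 fin2 b1 b2 pfin).
Variables (a1 y1 a2 x2 : R).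
Hypotheses (C1 : corner D a1 y1) (C2 : corner (swap_data D) a2 x2).
Let ok' := swap_ok ok.
Let sys' := swap_system sys.
Let C1' : corner (swap_data (swap_data D)) a1 y1. Proof. by rewrite swap_dataK. Qed.

Let a10 : 0 < a1. Proof. by case: C1. Qed.
Let a20 : 0 < a2. Proof. by case: C2. Qed.
Let g1 : pg D a1 y1 = 0. Proof. by case: C1. Qed.
Let g2 : pg D x2 a2 = 0. Proof. by case: C2; rewrite pg_swap. Qed.

Lemma NE_arc x y : pfin x y -> pg D x y = 0 -> pgx D x y < 0 -> pgy D x y < 0 -> False.
Proof.
move=> f g0 gx0 gy0.
have n0 : (x != 0) || (y != 0).
  apply/negPn/negP; rewrite negb_or !negbK => /andP[/eqP x0 /eqP y0].
  apply: (not_both_drifts_gt0 ok); move: gx0 gy0; rewrite x0 y0 /pgx /pgy !mulr0 !subr0 !sub0r.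
  by rewrite !oppr_lt0.
have [H|[H1 H2]] := opposite_signs ok sys f g0 n0; first exact: (NE_arc_half ok sys f g0 gx0 gy0).
have := @NE_arc_half _ _ _ _ _ _ _ ok' sys' y x f; rewrite pg_swap pgx_swap pgy_swap l1_swap l2_swap.
by move=> /(_ g0 gy0 gx0); apply.
Qed.

(** Assume no such point exists. If [x2 < a1], the upper ellipse point at abscissa [t1 + e / 2] lies
    on the north-east arc and still has finite [phi]. If [a1 <= x2], the first corner lies on its
    ray, its opposite ellipse point is at height at most [t2], and the blow-up argument applies. *)
Lemma domain_upper_bound t1 t2 e : 0 < e -> pfin (t1 + e) (t2 + e) ->
  exists x y, [/\ 0 < pg D x y, t1 < x, t2 < y & x < a1].
Proof.
move=> e0 f.
have f1 := ps_fin1 sys f; have f2 := ps_fin2 sys f.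
have te1 := corner_bound ok sys C1 C2 f1.
have te2 : t2 + e <= a2 := corner_bound ok' sys' C2 C1' f2.
apply: contrapT => N0.
have N x y : 0 < pg D x y -> t1 < x -> x < a1 -> y <= t2.
  by move=> G tx xa; rewrite leNgt; apply/negP => ty; apply: N0; exists x, y.
have ta1 : t1 < a1 by apply: lt_le_trans te1; rewrite ltrDl.
have ta2 : t2 < a2 by apply: lt_le_trans te2; rewrite ltrDl.
have yt : y1 <= t2.
  rewrite leNgt; apply/negP => ty.
  have d0 : 0 < Num.min (a1 - t1) (y1 - t2) by rewrite lt_min !subr_gt0 ta1.
  have [x' [y' [/andP[h1 h2] h3 G _]]] := corner_approach ok C1 d0.
  have m1 : Num.min (a1 - t1) (y1 - t2) <= a1 - t1 by rewrite ge_min lexx.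
  have m2 : Num.min (a1 - t1) (y1 - t2) <= y1 - t2 by rewrite ge_min lexx orbT.
  have := N x' y' G _ h2; move: h3; rewrite ltr_norml => /andP[h3 _].
  by move: (Num.min _ _) m1 m2 h1 h3 => z *; lra.
have [x2a|ax2] := ltP x2 a1.
  have xt : x2 <= t1.
    rewrite leNgt; apply/negP => tx.
    pose d := Num.min (a2 - t2) (Num.min (x2 - t1) (a1 - x2)).
    have d0 : 0 < d by rewrite !lt_min !subr_gt0 ta2 tx.
    have [y' [x' [/andP[h1 h2] h3 G _]]] := corner_approach ok' C2 d0.
    rewrite pg_swap in G.
    have m1 : d <= a2 - t2 by rewrite ge_min lexx.
    have m2 : d <= x2 - t1 by rewrite !ge_min lexx !orbT.
    have m3 : d <= a1 - x2 by rewrite !ge_min lexx !orbT.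
    have := N x' y' G; move: h3; rewrite ltr_norml => /andP[h3 h4].
    by move: d m1 m2 m3 h1 h3 h4 {d0} => d *; lra.
  pose x := t1 + e / 2.
  have tx : t1 < x by rewrite ltrDl divr_gt0.
  have xte : x <= t1 + e by rewrite lerD2l ler_pdivrMr// ler_pMr// ler1n.
  have xa : x < a1 by apply: lt_le_trans te1; rewrite ltrD2l ltr_pdivrMr// ltr_pMr// ltr1n.
  have xx2 := le_lt_trans xt tx.
  have ax : 0 < a1 - x2 by rewrite subr_gt0.
  pose s := (x - x2) / (a1 - x2).
  have s0 : 0 < s by rewrite divr_gt0// subr_gt0.
  have s1' : s < 1 by rewrite ltr_pdivrMr// mul1r ltrD2r.
  pose ys := (1 - s) * a2 + s * y1.
  have Gs : 0 < pg D x ys.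
    have s01 : 0 <= s <= 1 by rewrite !ltW.
    have := Gamma_segment s01 (_ : 0 <= pg D x2 a2) (_ : 0 <= pg D a1 y1).
    rewrite g1 g2 lexx => /(_ isT isT).
    have -> : (1 - s) * x2 + s * a1 = x by rewrite /s; field; rewrite gt_eqF.
    rewrite -/ys; apply: lt_le_trans; apply: divr_gt0 => //; apply: mulr_gt0.
      by rewrite mulr_gt0// subr_gt0.
    by rewrite pq_gt0// (gt_eqF ax).
  have s20 := ok_s2 ok.
  (* Discriminant of [pg] on the vertical line at [x]; [k] is the height of the upper ellipse point
     above [ys]. *)
  pose dl := pgy D x ys ^+ 2 + 2 * s2 D * pg D x ys.
  have dl0 : 0 < dl by rewrite ltr_wpDl ?sqr_ge0// !mulr_gt0.
  pose k := (pgy D x ys + Num.sqrt dl) / s2 D.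
  have sq : Num.sqrt dl ^+ 2 = dl by rewrite sqr_sqrtr// ltW.
  have sq0 : 0 < Num.sqrt dl by rewrite sqrtr_gt0.
  have k0 : 0 < k.
    rewrite divr_gt0//.
    have : `|pgy D x ys| < Num.sqrt dl.
      by rewrite -sqrtr_sqr ltr_sqrt// ltrDl !mulr_gt0.
    by have := ler_norm (- pgy D x ys); rewrite normrN; move: (`|_|) => *; lra.
  pose u := ys + k.
  have gu : pg D x u = 0.
    have := pgD D x ys 0 k; rewrite addr0 => ->.
    have -> : pq D 0 k = s2 D * k ^+ 2 by rewrite /pq; ring.
    rewrite /k mulr0 addr0.
    have -> : pg D x ys = (Num.sqrt dl ^+ 2 - pgy D x ys ^+ 2) / (2 * s2 D).
      by rewrite sq /dl; field; rewrite gt_eqF.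
    move: (pgy D x ys) (Num.sqrt dl) => p r.
    by field; rewrite gt_eqF.
  have gyu : pgy D x u < 0.
    have -> : pgy D x u = - Num.sqrt dl.
      have -> : pgy D x u = pgy D x ys - s2 D * k by rewrite /u /pgy; ring.
      by rewrite /k; move: (pgy D x ys) (Num.sqrt dl) => p r; field; rewrite gt_eqF.
    by rewrite oppr_lt0.
  have ut : u <= t2.
    rewrite leNgt; apply/negP => tu.
    pose M := (Num.max ys t2 + u) / 2.
    have yu : ys < u by rewrite ltrDl.
    have mu : Num.max ys t2 < u by rewrite gt_max yu.
    have m1 : ys <= Num.max ys t2 by rewrite le_max lexx.
    have m2 : t2 <= Num.max ys t2 by rewrite le_max lexx orbT.
    have Mu : ys < M < u by rewrite /M; move: (Num.max _ _) mu m1 m2 => z *; apply/andP; split; lra.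
    have G := Gamma_between_y ok (ltW Gs) (_ : 0 <= pg D x u) Mu.
    have := N x M (G _) tx xa; rewrite gu lexx => /(_ isT).
    by rewrite /M; move: (Num.max _ _) mu m1 m2 => z *; lra.
  have fu : pfin x u.
    by apply: (ps_pfin_le sys xte _ f); apply: (le_trans ut); rewrite lerDl ltW.
  apply: (NE_arc fu gu _ gyu).
  have := pgB D x u x2 a2; rewrite g2 gu add0r.
  have q0 := @pq_ge0 _ _ ok (x2 - x) (a2 - u).
  have h : pgy D x u * (a2 - u) < 0 by rewrite nmulr_rlt0// subr_gt0 (le_lt_trans ut).
  have x20 : x2 - x < 0 by rewrite subr_lt0.
  rewrite -(nmulr_lgt0 (pgx D x u) x20); move: q0 h.
  by move: (pgx _ _ _ * _) (_ * (a2 - u)) (pq _ _ _) => *; lra.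
have ay : 0 < a2 - y1 by rewrite subr_gt0 (le_lt_trans yt).
have gyN : pgy D a1 y1 != 0.
  apply/eqP => gy; have gx := corner_max ok C1 gy.
  have := pgB D a1 y1 x2 a2; rewrite g1 g2 gy mul0r addr0 add0r.
  have := @pq_gt0 _ _ ok (x2 - a1) (a2 - y1); rewrite (gt_eqF ay) orbT => /(_ isT).
  have : pgx D a1 y1 * (x2 - a1) <= 0 by rewrite nmulr_rle0// subr_ge0.
  by move: (pgx _ _ _ * _) (pq _ _ _) => *; lra.
have [gy0 l20 l10] := corner_r ok C1 gyN.
have fa x : x < a1 -> fin1 x.
  move=> xa; apply: contrapT => nf.
  have x0 : 0 < x by rewrite ltNge; apply/negP => /(ps_le1 sys) /(_ (ps_zero1 sys))[].
  have := corner_slope ok sys C1 (ps_zero2 sys) nf xa; rewrite mul0r pmulr_rge0// => y10.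
  have h := corner_slope ok sys C1 f2 nf xa.
  have : (t2 + e) * a1 <= y1 * a1.
    by apply: (le_trans h); rewrite mulrC; apply: ler_wpM2l => //; exact: ltW.
  by rewrite ler_pM2r//; lra.
have s20 := ok_s2 ok.
pose w := 2 * pgy D a1 y1 / s2 D.
have w0 : 0 < w by rewrite divr_gt0// mulr_gt0.
have gw : pg D a1 (y1 + w) = 0.
  have := pgD D a1 y1 0 w; rewrite addr0 g1 => ->.
  by rewrite /pq /w; field; rewrite gt_eqF.
have wt : y1 + w <= t2.
  rewrite leNgt; apply/negP => tw.
  have M1 : y1 < (t2 + (y1 + w)) / 2 < y1 + w by apply/andP; split; lra.
  have G := Gamma_between_y ok (_ : 0 <= pg D a1 y1) (_ : 0 <= pg D a1 (y1 + w)) M1.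
  rewrite g1 gw lexx in G; have {}G := G isT isT.
  have d0 : 0 < a1 - t1 by rewrite subr_gt0.
  have [x' [y' [/andP[h1 h2] _ G' _]]] := corner_approach ok C1 d0.
  have LU : t2 < (t2 + (y1 + w)) / 2 < y1 + w by apply/andP; split; lra.
  have [x [y [Gxy /andP[x1 x3] /andP[y2 _]]]] := Gamma_shift_left ok G G' h2 LU.
  have := N x y Gxy _ x3; lra.
have fw : fin2 (y1 + w) by apply: (ps_le2 sys _ f2).1; lra.
apply: (blow_up_contradiction ok sys C1 gyN fa fw); rewrite -/w.
have gy' : pgy D a1 (y1 + w) < 0.
  have -> : pgy D a1 (y1 + w) = - pgy D a1 y1 by rewrite /w /pgy; field; rewrite gt_eqF.
  by rewrite oppr_lt0.
have aw : 0 < a2 - (y1 + w) by lra.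
have := pgB D a1 (y1 + w) x2 a2; rewrite g2 gw add0r.
have := @pq_gt0 _ _ ok (x2 - a1) (a2 - (y1 + w)); rewrite (gt_eqF aw) orbT => /(_ isT).
have h : pgy D a1 (y1 + w) * (a2 - (y1 + w)) < 0 by rewrite nmulr_rlt0.
move=> q0 E; rewrite leNgt; apply/negP => gx.
have : pgx D a1 (y1 + w) * (x2 - a1) <= 0 by rewrite nmulr_rle0// subr_ge0.
by move: E q0 h; move: (pgx _ _ _ * _) (_ * (a2 - _)) (pq _ _ _) => *; lra.
Qed.
End domain_bounds.

(** * Lower bound for the domain *)

Section lower_bound.
Context {R : realType}.
Implicit Types (x y h k c : R).
Variables (D : @planar_data R) (fin1 fin2 : R -> Prop) (b1 b2 : R -> R) (pfin : R -> R -> Prop).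
Hypotheses (ok : planar_ok D) (sys : planar_system D fin1 fin2 b1 b2 pfin).
Variables (a1 y1 a2 x2 : R).
Hypotheses (C1 : corner D a1 y1) (C2 : corner (swap_data D) a2 x2).
Let ok' := swap_ok ok.
Let sys' := swap_system sys.

Let a10 : 0 < a1. Proof. by case: C1. Qed.
Let a20 : 0 < a2. Proof. by case: C2. Qed.
Let g1 : pg D a1 y1 = 0. Proof. by case: C1. Qed.
Let g2 : pg D x2 a2 = 0. Proof. by case: C2; rewrite pg_swap. Qed.

(* A dominating pair of points of the ellipse, one for each abscissa bound, can be traded for a
   single one satisfying both bounds. *)
Lemma Gamma_below_corners t1 t2 x' y' x'' y'' :
  0 < pg D x' y' -> t1 < x' -> t2 < y' -> x' < a1 ->
  0 < pg D x'' y'' -> t1 < x'' -> t2 < y'' -> y'' < a2 ->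
  exists x y, [/\ 0 < pg D x y, t1 < x < a1 & t2 < y < a2].
Proof.
move=> G' tx' ty' xa' G'' tx'' ty'' ya''.
have [ya'|ya'] := ltP y' a2; first by exists x', y'; rewrite tx' ty' xa' ya'.
have [xa''|xa''] := ltP x'' a1; first by exists x'', y''; rewrite tx'' ty'' xa'' ya''.
have xx : 0 < x'' - x' by rewrite subr_gt0 (lt_le_trans xa').
pose s := (a1 - x') / (x'' - x').
have s0 : 0 < s by rewrite divr_gt0// subr_gt0.
have s1' : s <= 1 by rewrite ler_pdivrMr// mul1r lerD2r.
have s01 : 0 <= s <= 1 by rewrite (ltW s0).
pose ys := (1 - s) * y' + s * y''.
have Gs := Gamma_convex ok s01 G' G''; rewrite -/ys in Gs.
have E : (1 - s) * x' + s * x'' = a1 by rewrite /s; field; rewrite gt_eqF.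
rewrite E in Gs.
have ty : t2 < ys.
  have h : s * t2 < s * y'' by rewrite ltr_pM2l.
  have h2 : (1 - s) * t2 <= (1 - s) * y' by apply: ler_wpM2l; [rewrite subr_ge0|exact: ltW].
  by rewrite /ys; move: h h2; rewrite !mulrBl !mul1r; move: (s * t2) (s * y'') (s * y') => *; lra.
have ta1 := lt_trans tx' xa'; have ta2 := lt_trans ty'' ya''.
have from_x M : 0 < pg D a1 M -> t2 < M < a2 ->
    exists x y, [/\ 0 < pg D x y, t1 < x < a1 & t2 < y < a2].
  move=> GM tM; have [x [y [Gxy /andP[x1 x3] yy]]] := Gamma_shift_left ok GM G' xa' tM.
  by exists x, y; rewrite (lt_trans tx' x1) x3 yy.
have from_y M : 0 < pg D M a2 -> t1 < M < a1 ->
    exists x y, [/\ 0 < pg D x y, t1 < x < a1 & t2 < y < a2].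
  rewrite -pg_swap => GM tM; have := G''; rewrite -pg_swap => G3.
  have [y [x [Gxy /andP[x1 x3] yy]]] := Gamma_shift_left ok' GM G3 ya'' tM.
  rewrite pg_swap in Gxy.
  by exists x, y; rewrite (lt_trans ty'' x1) x3 yy.
have [ysa|ysa] := ltP ys a2; first by apply: (from_x ys Gs); rewrite ty.
have [ya|ya] := ltP y1 a2.
  pose M := (Num.max y1 t2 + a2) / 2.
  have m0 : Num.max y1 t2 < a2 by rewrite gt_max ya.
  have m1 : y1 <= Num.max y1 t2 by rewrite le_max lexx.
  have m2 : t2 <= Num.max y1 t2 by rewrite le_max lexx orbT.
  have tM : t2 < M < a2 by rewrite /M; move: (Num.max _ _) m0 m1 m2 => z *; apply/andP; split; lra.
  apply: (from_x M) => //; apply: (Gamma_between_y ok (_ : 0 <= pg D a1 y1) (ltW Gs)).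
    by rewrite g1.
  by rewrite /M; move: (Num.max _ _) m0 m1 m2 => z *; apply/andP; split; lra.
have xa : x2 < a1.
  rewrite ltNge; apply/negP => ax; apply: (corners_cross ok C1 C2); split.
  - exact: lt_le_trans ya.
  - exact: lt_le_trans ax.
  - by rewrite mulrC; apply: ler_pM => //; exact: ltW.
have yy : 0 < ys - y'' by rewrite subr_gt0 (lt_le_trans ya'').
pose r := (ys - a2) / (ys - y'').
have r0 : 0 <= r by rewrite divr_ge0 ?(ltW yy)// subr_ge0.
have r1 : r <= 1 by rewrite ler_pdivrMr// mul1r lerD2l lerN2 ltW.
have r01 : 0 <= r <= 1 by rewrite r0.
have Gr := Gamma_convex ok r01 Gs G''.
have E2 : (1 - r) * ys + r * y'' = a2 by rewrite /r; field; rewrite gt_eqF.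
rewrite E2 in Gr; set xs := (1 - r) * a1 + r * x'' in Gr.
have axs : a1 <= xs.
  have : r * a1 <= r * x'' by rewrite ler_wpM2l.
  by rewrite /xs mulrBl mul1r; move: (r * a1) (r * x'') => *; lra.
pose M := (Num.max x2 t1 + a1) / 2.
have m0 : Num.max x2 t1 < a1 by rewrite gt_max xa.
have m1 : x2 <= Num.max x2 t1 by rewrite le_max lexx.
have m2 : t1 <= Num.max x2 t1 by rewrite le_max lexx orbT.
have tM : t1 < M < a1 by rewrite /M; move: (Num.max _ _) m0 m1 m2 => z *; apply/andP; split; lra.
apply: (from_y M) => //; rewrite -pg_swap.
apply: (Gamma_between_y ok' (y := x2) (y' := xs)); rewrite ?pg_swap ?g2//; first exact: ltW.
by rewrite /M; move: (Num.max _ _) m0 m1 m2 => z *; apply/andP; split; lra.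
Qed.

(** With [T1] and [T2] the endpoints of finiteness, [corner_slope] gives [T2 a1 <= T1 y1] and
    [T1 a2 <= T2 x2], whose product violates [corners_cross] unless both endpoints are zero. In that
    case [Gamma_axis_point] extends one of them; the signs that would exclude both extensions
    contradict the drift condition. *)
Lemma not_both_short : (exists2 x0, x0 < a1 & ~ fin1 x0) -> (exists2 y0, y0 < a2 & ~ fin2 y0) ->
  False.
Proof.
move=> [x0 xa nx] [y0 ya ny].
have lx x : fin1 x -> x <= x0.
  by move=> fx; rewrite leNgt; apply/negP => /ltW/(ps_le1 sys)/(_ fx)[].
have ly y : fin2 y -> y <= y0.
  by move=> fy; rewrite leNgt; apply/negP => /ltW/(ps_le2 sys)/(_ fy)[].
have hx : has_sup (fin1 : set R) by split; [exists 0; exact: (ps_zero1 sys)|exists x0 => x; exact: lx].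
have hy : has_sup (fin2 : set R) by split; [exists 0; exact: (ps_zero2 sys)|exists y0 => y; exact: ly].
set T1 := sup (fin1 : set R); set T2 := sup (fin2 : set R).
have u1 x : fin1 x -> x <= T1 by move=> fx; exact: (sup_upper_bound hx).
have u2 y : fin2 y -> y <= T2 by move=> fy; exact: (sup_upper_bound hy).
have T10 : 0 <= T1 by apply: u1; exact: (ps_zero1 sys).
have T20 : 0 <= T2 by apply: u2; exact: (ps_zero2 sys).
have T1x : T1 <= x0 by apply: sup_le_ub; [case: hx|move=> x; exact: lx].
have T2y : T2 <= y0 by apply: sup_le_ub; [case: hy|move=> y; exact: ly].
have ad1 e : 0 < e -> exists2 c, fin1 c & T1 - e < c by move=> e0; exact: sup_adherent e0 hx.
have ad2 e : 0 < e -> exists2 c, fin2 c & T2 - e < c by move=> e0; exact: sup_adherent e0 hy.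
have Ta1 := le_lt_trans T1x xa; have Ta2 := le_lt_trans T2y ya.
have nf1 x : T1 < x -> ~ fin1 x by move=> Tx /u1; rewrite leNgt Tx.
have nf2 y : T2 < y -> ~ fin2 y by move=> Ty /u2; rewrite leNgt Ty.
have x00 : 0 < x0 by rewrite ltNge; apply/negP => /(ps_le1 sys) /(_ (ps_zero1 sys))[].
have y00 : 0 < y0 by rewrite ltNge; apply/negP => /(ps_le2 sys) /(_ (ps_zero2 sys))[].
have y10 : 0 <= y1.
  by have := corner_slope ok sys C1 (ps_zero2 sys) nx xa; rewrite mul0r pmulr_rge0.
have x20 : 0 <= x2.
  by have := corner_slope ok' sys' C2 (ps_zero1 sys) ny ya; rewrite mul0r pmulr_rge0.
have s1' : T2 * a1 <= T1 * y1.
  apply: (le_mul_right_limit Ta1 y10) => x /andP[Tx xa'].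
  rewrite leNgt; apply/negP => lt.
  have e0 : 0 < T2 - x * y1 / a1 by rewrite subr_gt0 ltr_pdivrMr.
  have [c fc] := ad2 _ e0; rewrite subKr => hc.
  have := corner_slope ok sys C1 fc (nf1 x Tx) xa'; rewrite leNgt => /negP; apply.
  by rewrite -ltr_pdivrMr.
have s2' : T1 * a2 <= T2 * x2.
  apply: (le_mul_right_limit Ta2 x20) => y /andP[Ty ya'].
  rewrite leNgt; apply/negP => lt.
  have e0 : 0 < T1 - y * x2 / a2 by rewrite subr_gt0 ltr_pdivrMr.
  have [c fc] := ad1 _ e0; rewrite subKr => hc.
  have := corner_slope ok' sys' C2 fc (nf2 y Ty) ya'; rewrite leNgt => /negP; apply.
  by rewrite -ltr_pdivrMr.
have [T1z|T1n] := eqVneq T1 0; last first.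
  have T1p : 0 < T1 by rewrite lt_neqAle eq_sym T1n.
  have h : 0 < T2 * x2 by apply: lt_le_trans s2'; rewrite mulr_gt0.
  have T2p : 0 < T2 by rewrite lt_neqAle eq_sym T20 andbT; apply: contraTneq h => ->; rewrite mul0r ltxx.
  have x2p : 0 < x2 by rewrite -(pmulr_rgt0 _ T2p).
  have y1p : 0 < y1 by rewrite -(pmulr_rgt0 _ T1p); apply: lt_le_trans s1'; rewrite mulr_gt0.
  apply: (corners_cross ok C1 C2); split => //.
  have := ler_pM (mulr_ge0 T20 (ltW a10)) (mulr_ge0 T10 (ltW a20)) s1' s2'.
  have -> : T2 * a1 * (T1 * a2) = T1 * T2 * (a1 * a2) by ring.
  have -> : T1 * y1 * (T2 * x2) = T1 * T2 * (y1 * x2) by ring.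
  by rewrite ler_pM2l// mulr_gt0.
have T2z : T2 = 0.
  apply/eqP; rewrite eq_le T20 andbT -(pmulr_lle0 _ a10).
  by apply: (le_trans s1'); rewrite T1z mul0r.
have n1 : ~ (0 <= r12 D \/ m1 D < 0).
  move=> /(Gamma_axis_point ok)[x [y [xp yn G L]]].
  apply: (nf1 x); first by rewrite T1z.
  exact: (ps_next1 sys G L (ps_le2 sys yn (ps_zero2 sys)).1).
have n2 : ~ (0 <= r21 D \/ m2 D < 0).
  move=> /(Gamma_axis_point ok')[y [x [yp xn]]]; rewrite pg_swap l2_swap => G L.
  apply: (nf2 y); first by rewrite T2z.
  exact: (ps_next2 sys G L (ps_le1 sys xn (ps_zero1 sys)).1).
have m10 : 0 <= m1 D by rewrite leNgt; apply/negP => m; apply: n1; right.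
have m20 : 0 <= m2 D by rewrite leNgt; apply/negP => m; apply: n2; right.
have r0 : r12 D < 0 by rewrite ltNge; apply/negP => m; apply: n1; left.
have := ok_m1 ok; rewrite ltNge => /negP; apply; rewrite subr_ge0.
apply: (@le_trans _ _ 0); first by rewrite mulr_le0_ge0// ltW.
by rewrite mulr_ge0// ltW// (ok_r22 ok).
Qed.

(** By [not_both_short] the other transform is finite all the way to [a2]. A failure of finiteness
    at [x] puts [(x, y)] above the line [l2 = 0], and the slope of the corner then forces
    [y >= a2]. *)
Lemma domain_lower_half t1 t2 x y : (exists2 x0, x0 < a1 & ~ fin1 x0) ->
  0 < pg D x y -> t1 < x -> t2 < y -> y < a2 -> fin1 x /\ fin2 y.
Proof.
move=> [x0 xa nx] G tx ty ya.
have fa c : c < a2 -> fin2 c.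
  by move=> ca; apply: contrapT => nc; apply: not_both_short; [exists x0|exists c].
split; last exact: fa.
apply: contrapT => nfx.
have [x3 [x3x x3a nx3]] : exists x3, [/\ x3 <= x, x3 < a1 & ~ fin1 x3].
  by have [xa1|xa1] := ltP x a1; [exists x|exists x0; split => //; exact: le_trans (ltW xa) xa1].
have L : 0 <= l2 D x y.
  rewrite leNgt; apply/negP => L; apply: nfx; exact: (ps_next1 sys G L (fa _ ya)).
have x30 : 0 < x3 by rewrite ltNge; apply/negP => /(ps_le1 sys) /(_ (ps_zero1 sys))[].
have h : a2 * a1 <= x3 * y1.
  rewrite leNgt; apply/negP => lt.
  have lt' : x3 * y1 / a1 < a2 by rewrite ltr_pdivrMr.
  have m1 : (x3 * y1 / a1 + a2) / 2 < a2 by move: (x3 * y1 / a1) lt' => z *; lra.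
  have := corner_slope ok sys C1 (fa _ m1) nx3 x3a.
  rewrite -ler_pdivlMr//; move: (x3 * y1 / a1) lt' => z *; lra.
have y10 : 0 < y1 by rewrite -(pmulr_rgt0 _ x30); apply: lt_le_trans h; rewrite mulr_gt0.
have h2 : a2 * a1 <= x * y1 by apply: (le_trans h); rewrite ler_pM2r.
have p22 := ok_r22 ok.
have L1 : l2 D a1 y1 <= 0 by case: C1.
have x0' : 0 < x := lt_le_trans x30 x3x.
(* slopes: -r12/r22 >= y1/a1, while (x, y) lies above the line l2 = 0 *)
have e1 : r22 D * (y1 * x) <= - r12 D * (a1 * x).
  rewrite !mulrA ler_pM2r//; move: L1; rewrite /l2 mulNr; move: (r12 D * a1) (r22 D * y1) => *; lra.
have e2 : - r12 D * (a1 * x) <= r22 D * (y * a1).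
  have -> : - r12 D * (a1 * x) = - r12 D * x * a1 by ring.
  rewrite mulrA ler_pM2r//; move: L; rewrite /l2 mulNr; move: (r12 D * x) (r22 D * y) => *; lra.
have := le_trans e1 e2; rewrite ler_pM2l// => h3.
have := le_trans h2 (_ : x * y1 <= y * a1); rewrite mulrC => /(_ h3).
by rewrite ler_pM2r// leNgt ya.
Qed.
End lower_bound.

Lemma domain_lower_bound {R : realType} (D : @planar_data R) (fin1 fin2 : R -> Prop)
    (b1 b2 : R -> R) (pfin : R -> R -> Prop) (a1 y1 a2 x2 t1 t2 x' y' x'' y'' : R) :
  planar_ok D -> planar_system D fin1 fin2 b1 b2 pfin ->
  corner D a1 y1 -> corner (swap_data D) a2 x2 ->
  0 < pg D x' y' -> t1 < x' -> t2 < y' -> x' < a1 ->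
  0 < pg D x'' y'' -> t1 < x'' -> t2 < y'' -> y'' < a2 ->
  exists x y, [/\ pfin x y, t1 < x & t2 < y].
Proof.
move=> ok sys C1 C2 G' tx' ty' xa' G'' tx'' ty'' ya''.
have ok' := swap_ok ok; have sys' := swap_system sys.
have C1' : corner (swap_data (swap_data D)) a1 y1 by rewrite swap_dataK.
have [s1'|n1] := pselect (exists2 x0, x0 < a1 & ~ fin1 x0).
  have [f1 f2] := domain_lower_half ok sys C1 C2 s1' G'' tx'' ty'' ya''.
  by exists x'', y''; split => //; exact: (ps_pfin sys).
have [s2'|n2] := pselect (exists2 y0, y0 < a2 & ~ fin2 y0).
  have G3 : 0 < pg (swap_data D) y' x' by rewrite pg_swap.
  have [f2 f1] := domain_lower_half ok' sys' C2 C1' s2' G3 ty' tx' xa'.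
  by exists x', y'; split => //; exact: (ps_pfin sys).
have fa1 c : c < a1 -> fin1 c by move=> ca; apply: contrapT => nc; apply: n1; exists c.
have fa2 c : c < a2 -> fin2 c by move=> ca; apply: contrapT => nc; apply: n2; exists c.
have [x [y [G /andP[tx xa] /andP[ty ya]]]] :=
  Gamma_below_corners ok C1 C2 G' tx' ty' xa' G'' tx'' ty'' ya''.
by exists x, y; split => //; apply: (ps_pfin sys G); [exact: fa1|exact: fa2].
Qed.

(** * The rightmost point and the ray point of the ellipse *)

Section rightmost_point.
Context {R : realType}.
Variable D : @planar_data R.
Hypothesis ok : planar_ok D.

Lemma rightmost_exists : exists x y, [/\ pg D x y = 0, pgy D x y = 0, pgx D x y < 0 & 0 < x].
Proof.
have p1 := ok_s1 ok; have p2 := ok_s2 ok; have p := ok_s ok.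
set d := s1 D * s2 D - s12 D ^+ 2 in p.
(* Eliminating [y] through [pgy = 0] turns [pg = 0] into [- d x^2 + 2 b x + m2^2 = 0]; [(b + r) / d]
   is its larger root. *)
pose b := s12 D * m2 D - s2 D * m1 D.
pose r := Num.sqrt (b ^+ 2 + d * m2 D ^+ 2).
have q0 : 0 <= b ^+ 2 + d * m2 D ^+ 2.
  by rewrite addr_ge0 ?sqr_ge0// mulr_ge0 ?sqr_ge0// ltW.
have r2 : r ^+ 2 = b ^+ 2 + d * m2 D ^+ 2 by rewrite sqr_sqrtr.
have r0 : 0 <= r by exact: sqrtr_ge0.
have br0 : 0 < b + r /\ 0 < r.
  have [m20|m2n] := eqVneq (m2 D) 0.
    have m10 : m1 D < 0.
      by have := ok_m1 ok; rewrite m20 mulr0 subr0 pmulr_rlt0// (ok_r22 ok).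
    have b0 : 0 < b by rewrite /b m20 mulr0 sub0r oppr_gt0 pmulr_rlt0.
    have rb : r = b by rewrite /r m20 expr0n/= mulr0 addr0 sqrtr_sqr gtr0_norm.
    by rewrite rb addr_gt0.
  have h : `|b| < r.
    have dm : 0 < d * m2 D ^+ 2 by rewrite mulr_gt0// exprn_even_gt0.
    by rewrite -sqrtr_sqr ltr_sqrt ?ltrDl// ltr_wpDl ?sqr_ge0.
  have := ler_norm (- b); rewrite normrN; have := normr_ge0 b.
  by move: (`|b|) h => n *; split; lra.
case: br0 => br0 rp.
exists ((b + r) / d), (- (s12 D * ((b + r) / d) + m2 D) / s2 D).
have dn : d != 0 by rewrite gt_eqF.
have sn : s2 D != 0 by rewrite gt_eqF.
set X := (b + r) / d; set Y := - (s12 D * X + m2 D) / s2 D.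
have gy : pgy D X Y = 0 by rewrite /pgy /Y; field.
have gx : pgx D X Y = - r / s2 D.
  have -> : pgx D X Y = (b - d * X) / s2 D by rewrite /pgx /Y /b /d; field.
  by rewrite /X; field; rewrite sn dn.
split => //; last by rewrite divr_gt0.
  have -> : pg D X Y = (- d * X ^+ 2 + 2 * b * X + m2 D ^+ 2) / (2 * s2 D).
    by rewrite /pg /Y /b /d; field.
  have -> : - d * X ^+ 2 + 2 * b * X + m2 D ^+ 2 = (b ^+ 2 + d * m2 D ^+ 2 - r ^+ 2) / d.
    by rewrite /X; field.
  by rewrite r2 subrr !mul0r.
by rewrite gx mulNr oppr_lt0 divr_gt0.
Qed.

(** The expansion at [(x, y)] has no vertical first-order term, so [pgx * (x' - x)] equals half of a
    positive definite form. *)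
Lemma rightmost_unique x y x' y' : pg D x y = 0 -> pgy D x y = 0 -> pgx D x y < 0 ->
  pg D x' y' = 0 -> x' <= x /\ (x <= x' -> x' = x /\ y' = y).
Proof.
move=> g gy gx g'; have := pgB D x y x' y'; rewrite g g' gy mul0r addr0 add0r => /esym/eqP.
rewrite subr_eq0 => /eqP E; have q := pq_ge0 ok (x' - x) (y' - y).
have xx : x' <= x.
  by rewrite -subr_le0 -(nmulr_rge0 _ gx) E divr_ge0.
split => // xx'; have {xx xx'} x0 : x' = x by apply/eqP; rewrite eq_le xx.
split => //; apply/eqP; rewrite -subr_eq0; apply/negPn/negP => yn.
have := @pq_gt0 _ _ ok (x' - x) (y' - y); rewrite yn orbT => /(_ isT).
by move: E; rewrite x0 subrr mulr0 => /esym/eqP; rewrite mulf_eq0 invr_eq0 pnatr_eq0 orbF => /eqP ->; rewrite ltxx.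
Qed.

(** The nonzero parameter at which the line spanned by [(r22, - r12)], that is [l2 = 0], meets the
    ellipse. *)
Definition ray_point : R := - 2 * (r22 D * m1 D - r12 D * m2 D) / pq D (r22 D) (- r12 D).

Lemma ray_point_gt0 : 0 < ray_point.
Proof.
rewrite divr_gt0 ?mulNr ?oppr_gt0 ?pmulr_rlt0 ?(ok_m1 ok)//.
by rewrite pq_gt0// gt_eqF// (ok_r22 ok).
Qed.

Lemma ray_pointP x y : [/\ pg D x y = 0, (x != 0) || (y != 0) & l2 D x y = 0] <->
  x = ray_point * r22 D /\ y = - (ray_point * r12 D).
Proof.
have p22 := ok_r22 ok; have sn := ray_point_gt0.
have q0 : 0 < pq D (r22 D) (- r12 D) by rewrite pq_gt0// gt_eqF.
have gE t : pg D (t * r22 D) (- (t * r12 D)) =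
    - (t / 2) * (t - ray_point) * pq D (r22 D) (- r12 D).
  rewrite /ray_point; move: q0; move E : (pq D (r22 D) (- r12 D)) => q q0.
  have -> : - (t / 2) * (t - - 2 * (r22 D * m1 D - r12 D * m2 D) / q) * q =
    - (t / 2) * (t * q + 2 * (r22 D * m1 D - r12 D * m2 D)) by field; rewrite gt_eqF.
  by rewrite -E /pg /pq; field.
split=> [[g xy l]|[-> ->]]; last first.
  split; [by rewrite gE subrr mulr0 mul0r| |by rewrite /l2; ring].
  by rewrite mulf_neq0 // gt_eqF.
pose t := x / r22 D.
have xE : x = t * r22 D by rewrite /t divfK// gt_eqF.
have yE : y = - (t * r12 D).
  move: l; rewrite /l2 => /eqP; rewrite addrC addr_eq0 => /eqP h.
  have -> : y = r22 D * y / r22 D by field; rewrite gt_eqF.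
  by rewrite h /t; field; rewrite gt_eqF.
have tn : t != 0.
  by apply: contraTneq xy => t0; rewrite xE yE t0 !mul0r oppr0 eqxx.
move: g; rewrite xE yE gE => /eqP; rewrite !mulf_eq0 (gt_eqF q0) orbF oppr_eq0 mulf_eq0 (negbTE tn)/=.
by rewrite invr_eq0 pnatr_eq0/= subr_eq0 => /eqP ->.
Qed.

Lemma corner_at_max x y : pg D x y = 0 -> pgy D x y = 0 -> 0 < x -> l2 D x y <= 0 -> corner D x y.
Proof. by move=> g gy x0 l; split; rewrite ?gy ?mulr0. Qed.

(** The displacement to [(u, v)] is [al] times [(x, y)] plus a positive vertical part [be]. The
    first part does not ascend, by [toward_origin], yet the total first-order change is positive, so
    [be * pgy] is positive. *)
Lemma ray_gy_gt0 x y u v : pg D x y = 0 -> 0 < x -> l2 D x y = 0 ->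
  pg D u v = 0 -> x <= u -> 0 < l2 D u v -> 0 < pgy D x y.
Proof.
move=> g x0 l g' xu l'; have p22 := ok_r22 ok.
have := pgB D x y u v; rewrite g g' add0r => E.
have n0 : (u - x != 0) || (v - y != 0).
  apply/negPn/negP; rewrite negb_or !negbK !subr_eq0 => /andP[/eqP ux /eqP vy].
  by move: l'; rewrite ux vy l ltxx.
have q0 := pq_gt0 ok n0.
have q1 : 0 < pq D x y by rewrite pq_gt0// gt_eqF.
have T := toward_origin g.
pose al := u / x - 1; pose be := l2 D u v / r22 D.
have al0 : 0 <= al by rewrite subr_ge0 ler_pdivlMr// mul1r.
have be0 : 0 < be by rewrite divr_gt0.
have e1 : u - x = al * x by rewrite /al; field; rewrite gt_eqF.
have e2 : v - y = al * y + be.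
  have yE : y = - (r12 D * x) / r22 D.
    by move: l; rewrite /l2 => /eqP; rewrite addrC addr_eq0 => /eqP <-; field; rewrite gt_eqF.
  by rewrite /al /be yE /l2; field; rewrite !gt_eqF.
have h : pgx D x y * (u - x) + pgy D x y * (v - y) = be * pgy D x y - al * (pq D x y / 2).
  rewrite e1 e2 -mulrN -T; ring.
rewrite -(pmulr_rgt0 _ be0).
have := mulr_ge0 al0 (ltW (divr_gt0 q1 (ltr0n R 2))).
move: E; rewrite h; move: (be * _) (al * _) q0; move: (pq _ _ _) => *; lra.
Qed.
End rightmost_point.

(** * From matrices to planar coordinates *)

Section instance.
Context {R : realType} (Sigma Rm : 'M[R]_2) (mu : 'cV[R]_2).
Hypotheses (Sigma_sym : Sigma^T = Sigma) (Sigma_pd : positive_definite Sigma)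
  (Rdiag : forall i, 0 < Rm i i)
  (Rdet : forall i, 0 < Rm i i * Rm (rev_ord i) (rev_ord i) - Rm i (rev_ord i) * Rm (rev_ord i) i)
  (Rdrift : forall i,
    Rm (rev_ord i) (rev_ord i) * mu i 0 - Rm i (rev_ord i) * mu (rev_ord i) 0 < 0).
Implicit Types (i : 'I_2) (th : 'cV[R]_2).

Definition data i : @planar_data R := let j := rev_ord i in
  PlanarData (Sigma i i) (Sigma j j) (Sigma i j) (mu i 0) (mu j 0)
    (Rm i i) (Rm i j) (Rm j i) (Rm j j).

Definition vec i (x y : R) : 'cV[R]_2 := \col_l (if l == i then x else y).

Lemma vec_l i x y : vec i x y i 0 = x. Proof. by rewrite mxE eqxx. Qed.
Lemma vec_r i x y : vec i x y (rev_ord i) 0 = y.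
Proof. by rewrite mxE (negbTE (neq_rev_ord i)). Qed.

Lemma eq_vec i th : th = vec i (th i 0) (th (rev_ord i) 0).
Proof.
apply/colP => l; rewrite mxE; case: eqVneq => [->//|/ord2_neq ->//].
Qed.

Lemma eq_cV2 i th th' : th i 0 = th' i 0 -> th (rev_ord i) 0 = th' (rev_ord i) 0 -> th = th'.
Proof. by move=> h1 h2; rewrite (eq_vec i th) (eq_vec i th') h1 h2. Qed.

Lemma vec_rev i x y : vec (rev_ord i) y x = vec i x y.
Proof.
apply: (eq_cV2 (i := i)); last by rewrite vec_r vec_l.
by have := vec_r (rev_ord i) y x; rewrite rev_ordK vec_l.
Qed.

Lemma Sigma_symE i j : Sigma i j = Sigma j i.
Proof. by rewrite -{1}Sigma_sym mxE. Qed.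

Lemma data_swap i : swap_data (data i) = data (rev_ord i).
Proof. by rewrite /data /swap_data/= rev_ordK (Sigma_symE i). Qed.

Lemma quadratic_form i u v : dot u (Sigma *m v) =
  u i 0 * (Sigma i i * v i 0 + Sigma i (rev_ord i) * v (rev_ord i) 0) +
  u (rev_ord i) 0 * (Sigma i (rev_ord i) * v i 0 + Sigma (rev_ord i) (rev_ord i) * v (rev_ord i) 0).
Proof.
rewrite (dotE i) !mxE !(big_ord2_rev _ i) (Sigma_symE (rev_ord i) i); ring.
Qed.

Lemma gammaE i th : gamma Sigma mu th = pg (data i) (th i 0) (th (rev_ord i) 0).
Proof. by rewrite /gamma (quadratic_form i) (dotE i) /pg/=; field. Qed.

Lemma ellipseE i th : ellipse Sigma mu th =
  (pg (data i) (th i 0) (th (rev_ord i) 0) = 0).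
Proof. by rewrite /ellipse /mkset/= (gammaE i). Qed.

Lemma GammaE i th : Gamma Sigma mu th =
  (0 < pg (data i) (th i 0) (th (rev_ord i) 0)) :> Prop.
Proof. by rewrite /Gamma /mkset/= (gammaE i). Qed.

Lemma gamma_iE i th : gamma_ Rm i th = l1 (data i) (th i 0) (th (rev_ord i) 0).
Proof. by rewrite /gamma_ (dotE i) !mxE. Qed.

Lemma gamma_jE i th : gamma_ Rm (rev_ord i) th = l2 (data i) (th i 0) (th (rev_ord i) 0).
Proof. by rewrite /gamma_ (dotE i) !mxE. Qed.

Lemma data_ok i : planar_ok (data i).
Proof.
have pq_pos (x y : R) : (x != 0) || (y != 0) -> 0 < pq (data i) x y.
  move=> xy; have vn : vec i x y != 0.
    apply: contraTneq xy => v0; have := vec_l i x y; have := vec_r i x y.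
    by rewrite v0 !mxE => <- <-; rewrite eqxx.
  have := Sigma_pd vn; rewrite (quadratic_form i) vec_l vec_r; congr (0 < _).
  by rewrite /pq/=; ring.
have s11 : 0 < Sigma i i.
  have := pq_pos 1 0; rewrite oner_eq0 => /(_ isT); congr (0 < _).
  by rewrite /pq/=; ring.
split => //=.
- have := pq_pos 0 1; rewrite oner_eq0 orbT => /(_ isT); congr (0 < _).
  by rewrite /pq/=; ring.
- have := pq_pos (- Sigma i (rev_ord i)) (Sigma i i); rewrite (gt_eqF s11) orbT => /(_ isT).
  have -> : pq (data i) (- Sigma i (rev_ord i)) (Sigma i i) =
    Sigma i i * (Sigma i i * Sigma (rev_ord i) (rev_ord i) - Sigma i (rev_ord i) ^+ 2).
    by rewrite /pq/=; ring.
  by rewrite pmulr_rgt0.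
- exact: Rdet.
- by have := Rdrift (rev_ord i); rewrite rev_ordK.
Qed.

Lemma theta_maxP i : [/\ pg (data i) (theta_max Sigma mu i i 0) (theta_max Sigma mu i (rev_ord i) 0) = 0,
  pgy (data i) (theta_max Sigma mu i i 0) (theta_max Sigma mu i (rev_ord i) 0) = 0,
  pgx (data i) (theta_max Sigma mu i i 0) (theta_max Sigma mu i (rev_ord i) 0) < 0 &
  0 < theta_max Sigma mu i i 0].
Proof.
have ok := data_ok i.
have [x [y [g gy gx x0]]] := rightmost_exists ok.
pose A := [set theta | ellipse Sigma mu theta /\
    forall theta', ellipse Sigma mu theta' -> theta' i 0 <= theta i 0].
have Av : A (vec i x y).
  split; first by rewrite (ellipseE i) vec_l vec_r.
  move=> t' /=; rewrite (ellipseE i) => /(rightmost_unique ok g gy gx)[h _].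
  by rewrite vec_l.
have [E H] : A (theta_max Sigma mu i) := getPex (ex_intro _ _ Av).
have := H _ Av.1; rewrite vec_l => h; move: E; rewrite (ellipseE i) => E.
have [_ /(_ h)[-> ->]] := rightmost_unique ok g gy gx E.
by [].
Qed.

Lemma theta_rP i : theta_r Sigma mu Rm i = vec i (ray_point (data i) * Rm (rev_ord i) (rev_ord i))
  (- (ray_point (data i) * Rm i (rev_ord i))).
Proof.
have ok := data_ok i.
pose A := [set theta |
    [/\ ellipse Sigma mu theta, theta != 0 & gamma_ Rm (rev_ord i) theta = 0]].
have AE theta : A theta <-> [/\ pg (data i) (theta i 0) (theta (rev_ord i) 0) = 0,
   (theta i 0 != 0) || (theta (rev_ord i) 0 != 0) & l2 (data i) (theta i 0) (theta (rev_ord i) 0) = 0].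
  rewrite /A/= (ellipseE i) gamma_jE.
  split=> -[g n l]; split => //.
    apply/negPn/negP; rewrite negb_or !negbK => /andP[/eqP h1 /eqP h2].
    by move/eqP: n; apply; apply: (eq_cV2 (i := i)); rewrite !mxE ?h1 ?h2.
  by apply: contraTneq n => ->; rewrite !mxE eqxx.
set v := vec _ _ _.
have Av : A v by apply/AE; apply/(ray_pointP ok); rewrite vec_l vec_r.
have /AE/(ray_pointP ok)[h1 h2] : A (theta_r Sigma mu Rm i) := getPex (ex_intro _ _ Av).
by apply: (eq_cV2 (i := i)); rewrite ?vec_l ?vec_r ?h1 ?h2.
Qed.

Lemma theta_r_ray i : [/\ pg (data i) (theta_r Sigma mu Rm i i 0) (theta_r Sigma mu Rm i (rev_ord i) 0) = 0,
  0 < theta_r Sigma mu Rm i i 0 & l2 (data i) (theta_r Sigma mu Rm i i 0) (theta_r Sigma mu Rm i (rev_ord i) 0) = 0].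
Proof.
have ok := data_ok i; rewrite theta_rP vec_l vec_r.
have [|g _ l] := (ray_pointP ok (ray_point (data i) * Rm (rev_ord i) (rev_ord i))
  (- (ray_point (data i) * Rm i (rev_ord i)))).2; first by [].
by split => //; rewrite mulr_gt0// (ray_point_gt0 ok).
Qed.

Lemma near_cV (th : 'cV[R]_2) (B : set 'cV[R]_2) i : nbhs th B -> exists2 e : R, 0 < e &
  forall x y, `|x - th i 0| < e -> `|y - th (rev_ord i) 0| < e -> B (vec i x y).
Proof.
move=> /nbhs_ballP[e /= e0 sub]; exists e => // x y hx hy; apply: sub; split => // k l.
by rewrite ord1 mxE /ball/= distrC; case: eqVneq => [->//|/ord2_neq ->].
Qed.

(** If [gamma_j] is positive at the point, it is positive nearby and [Gamma_i] stays away. If not,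
    the point is a corner and [corner_approach] supplies the approximating points. *)
Lemma theta_max_boundary i : (theta_max Sigma mu i \in topological_boundary (Gamma_ Sigma mu Rm i)) =
  (l2 (data i) (theta_max Sigma mu i i 0) (theta_max Sigma mu i (rev_ord i) 0) <= 0).
Proof.
have ok := data_ok i; have [g gy gx x0] := theta_maxP i.
set t := theta_max Sigma mu i in g gy gx x0 *.
apply/idP/idP; rewrite inE.
  move=> [cl _]; rewrite leNgt; apply/negP => l.
  have l' : 0 < gamma_ Rm (rev_ord i) t by rewrite gamma_jE.
  have nt : nbhs t [set th | 0 < gamma_ Rm (rev_ord i) th].
    have /cvgrPdist_lt/(_ _ l') := @continuous_dot R (col (rev_ord i) Rm) t.
    apply: filterS => th; rewrite /= -/(gamma_ Rm (rev_ord i) th) -/(gamma_ Rm (rev_ord i) t).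
    by rewrite ltr_norml => /andP[_]; rewrite ltrBlDr ltrDl.
  have [th [[_ h1] h2]] := cl _ nt.
  by move: (lt_trans h1 h2); rewrite ltxx.
move=> l; have C := corner_at_max g gy x0 l.
split; last first.
  by move=> /interior_subset[]; rewrite (GammaE i) g ltxx.
move=> B /(near_cV i)[e e0 H].
have [x' [y' [/andP[h1 h2] h3 G L]]] := corner_approach ok C e0.
exists (vec i x' y'); split; last first.
  apply: H => //; rewrite ltr_norml; apply/andP; split; move: (t i 0) h1 h2 => z; lra.
by rewrite /Gamma_/= (GammaE i) gamma_jE vec_l vec_r.
Qed.

Lemma theta_Gamma_corner i : corner (data i) (theta_Gamma Sigma mu Rm i i 0)
  (theta_Gamma Sigma mu Rm i (rev_ord i) 0).
Proof.
have ok := data_ok i; have [g gy gx x0] := theta_maxP i; have [g' x0' l'] := theta_r_ray i.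
rewrite /theta_Gamma theta_max_boundary; case: leP => l; first exact: corner_at_max.
have [h _] := rightmost_unique ok g gy gx g'.
have gy' := ray_gy_gt0 ok g' x0' l' g h l.
by split => //; rewrite ?l' ?mul0r// ltW.
Qed.

(** * Identification of the domain *)

Section domain.
Variables (nu : probability (plane R) R) (B : 'I_2 -> R -> \bar R).
Hypothesis bs : boundary_system Sigma Rm mu (mgf nu) B.

Lemma planar_system_data i : let j := rev_ord i in planar_system (data i)
  (fun x => (B i x < +oo)%E) (fun y => (B j y < +oo)%E) (fine \o B i) (fine \o B j)
  (fun x y => (mgf nu (vec i x y) < +oo)%E).
Proof.
move=> j.
have pos k x : (B k x < +oo)%E -> 0 < fine (B k x).
  by move=> f; rewrite fine_gt0// (bs_pos bs).
have Bf k x : (B k x < +oo)%E -> B k x = (fine (B k x))%:E.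
  by move=> f; rewrite fineK// ge0_fin_numE// ltW// (bs_pos bs).
have le k (x x' : R) : x <= x' -> (B k x' < +oo)%E -> (B k x < +oo)%E /\ fine (B k x) <= fine (B k x').
  move=> xx f; have f' := le_lt_trans (bs_le bs k xx) f; split => //.
  by rewrite -lee_fin -(Bf _ _ f) -(Bf _ _ f') (bs_le bs).
have conv k (t x x' : R) : 0 <= t <= 1 -> (B k x < +oo)%E -> (B k x' < +oo)%E ->
    fine (B k (t * x + (1 - t) * x')) <= t * fine (B k x) + (1 - t) * fine (B k x').
  move=> t01 f f'; have := bs_conv bs k x x' t01.
  rewrite (Bf _ _ f) (Bf _ _ f') -!EFinM -EFinD => h.
  have f3 := le_lt_trans h (ltry _); by rewrite -lee_fin -(Bf _ _ f3).
have left k (x C : R) : (forall x', x' < x -> (B k x' < +oo)%E /\ fine (B k x') <= C) -> (B k x < +oo)%E.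
  move=> H; apply: le_lt_trans (ltry C); apply: (bs_left bs) => y /H[f h].
  by rewrite (Bf _ _ f) lee_fin.
split.
- exact: pos.
- exact: pos.
- exact: le.
- exact: le.
- exact: (bs_fin0 bs).
- exact: (bs_fin0 bs).
- exact: conv.
- exact: conv.
- exact: left.
- exact: left.
- move=> x y x' y' xx yy; apply: le_lt_trans; apply: (bs_phi_le bs) => l; rewrite !mxE.
  by case: ifP.
- by move=> x y /(bs_fin bs i); rewrite vec_l.
- by move=> x y /(bs_fin bs j); rewrite vec_r.
- move=> x y f g; have := bs_bar bs f; rewrite (gammaE i) vec_l vec_r g mul0r => /esym.
  by rewrite (big_ord2_rev _ i) rev_ordK gamma_jE gamma_iE !vec_l vec_r.
- move=> x y G f1 f2; apply: (bs_phi_fin bs); first by rewrite (GammaE i) vec_l vec_r.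
  by move=> l; have [->|/ord2_neq ->] := eqVneq l i; rewrite ?vec_l ?vec_r.
- move=> x y G L f; have := @bs_next _ _ _ _ _ _ bs i (vec i x y).
  by rewrite (GammaE i) gamma_jE vec_l vec_r; apply.
- move=> x y G L f; have := @bs_next _ _ _ _ _ _ bs j (vec i x y).
  rewrite (GammaE i) rev_ordK gamma_iE vec_l vec_r; exact.
Qed.

(** Interior points have finite transform at a strictly dominating point, as the upper bound
    requires. Conversely, a strictly dominating point of finiteness has a whole neighbourhood of
    [th] below it. *)
Lemma mgf_domain_eq i : mgf_domain nu = D_ Sigma mu Rm i `&` D_ Sigma mu Rm (rev_ord i).
Proof.
have C k := theta_Gamma_corner k.
have C2 k : corner (swap_data (data k)) (theta_Gamma Sigma mu Rm (rev_ord k) (rev_ord k) 0)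
    (theta_Gamma Sigma mu Rm (rev_ord k) k 0).
  by have := C (rev_ord k); rewrite data_swap rev_ordK.
apply/seteqP; split => th.
  move=> /(near_cV i)[e e0 H].
  have up k : D_ Sigma mu Rm k th.
    pose f := e / 2; have f0 : 0 < f by rewrite divr_gt0.
    have fth : (mgf nu (vec k (th k 0%R + f)%R (th (rev_ord k) 0%R + f)%R) < +oo)%E.
      have fe : `|f| < e by rewrite gtr0_norm// ltr_pdivrMr// ltr_pMr// ltr1n.
      have := H (th i 0 + f) (th (rev_ord i) 0 + f); rewrite !(addrC _ f) !addrK => /(_ fe fe) /=.
      have [->|/ord2_neq ->] := eqVneq k i; first by rewrite !(addrC f).
      by rewrite rev_ordK vec_rev.
    have [x [y [G tx ty xa]]] := domain_upper_bound (data_ok k) (planar_system_data k) (C k) (C2 k) f0 fth.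
    exists (vec k x y); split.
    - by rewrite (GammaE k) vec_l vec_r.
    - by move=> l; have [->|/ord2_neq ->] := eqVneq l k; rewrite ?vec_l ?vec_r.
    - by rewrite vec_l.
  by split; exact: up.
move=> [[t' [G' l' a']] [t'' [G'' l'' a'']]].
move: G' G''; rewrite !(GammaE i) => G' G''.
have [x [y [f tx ty]]] := domain_lower_bound (data_ok i) (planar_system_data i) (C i) (C2 i)
  G' (l' i) (l' (rev_ord i)) a' G'' (l'' i) (l'' (rev_ord i)) a''.
rewrite /mgf_domain /interior/=; apply/nbhs_ballP.
exists (Num.min (x - th i 0) (y - th (rev_ord i) 0)); first by rewrite /= lt_min !subr_gt0 tx.
move=> v /= [_ bv]; apply: le_lt_trans f; apply: (bs_phi_le bs) => l.
have [->|/ord2_neq ->] := eqVneq l i; rewrite ?vec_l ?vec_r.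
  have := bv i 0; rewrite /ball/= lt_min => /andP[+ _]; rewrite ltr_norml => /andP[+ _].
  by move: (v i 0) (th i 0) => *; lra.
have := bv (rev_ord i) 0; rewrite /ball/= lt_min => /andP[_ +]; rewrite ltr_norml => /andP[+ _].
by move: (v (rev_ord i) 0) (th (rev_ord i) 0) => *; lra.
Qed.
End domain.
End instance.

(** * Absolutely continuous functions *)

Section ac_intervals.
Context {R : realType}.
Implicit Types (f : R -> R) (l : seq (R * R)).

(** Ordered lists of non-overlapping intervals replace indexed disjoint families, because they can
    be concatenated and refined. *)
Definition chain_in (a b : R) l :=
  all (fun p => [&& a <= p.1, p.1 <= p.2 & p.2 <= b]) l && pairwise (fun p q : R * R => p.2 <= q.1) l.

Definition ac_real (a b : R) f := forall e : R, 0 < e -> exists2 d : R, 0 < d & forall l,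
  chain_in a b l -> \sum_(p <- l) (p.2 - p.1) < d -> \sum_(p <- l) `|f p.2 - f p.1| < e.

Lemma ac_real_coord (a b : R) (x : R -> 'cV[R]_2) i : absolutely_continuous_on a b x ->
  ac_real a b (fun t => x t i 0).
Proof.
move=> ac e e0; have [d d0 H] := ac e e0; exists d => // l /andP[la lp] ld.
have nthb k : (k < size l)%N -> [/\ a <= (nth (0, 0) l k).1,
    (nth (0, 0) l k).1 <= (nth (0, 0) l k).2 & (nth (0, 0) l k).2 <= b].
  by move=> kl; have := all_nthP (0, 0) la k kl => /and3P.
have := H (size l) (fun k : 'I__ => (nth (0, 0) l k).1) (fun k => (nth (0, 0) l k).2).
move=> /(_ (fun k => nthb k (ltn_ord k))) H1.
have {}H1 := H1 _ _.
apply: le_lt_trans (H1 _ _).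
- rewrite (big_nth (0, 0)) big_mkord; apply: ler_sum => k _.
  have -> : x (nth (0, 0) l k).2 i 0 - x (nth (0, 0) l k).1 i 0 =
    (x (nth (0, 0) l k).2 - x (nth (0, 0) l k).1) i 0 by rewrite !mxE.
  move: (_ - _) => v; rewrite [leRHS](_ : _ = mx_norm v)// mx_normrE.
  exact: (le_bigmax _ (fun ij : 'I_2 * 'I_1 => `|v ij.1 ij.2|) (i, 0)).
- have disj (k1 k2 : 'I_(size l)) : (k1 < k2)%N ->
      `](nth (0, 0) l k1).1, (nth (0, 0) l k1).2[%classic `&`
      `](nth (0, 0) l k2).1, (nth (0, 0) l k2).2[%classic = set0 :> set R.
    move=> kk; have h : (nth (0, 0) l k1).2 <= (nth (0, 0) l k2).1.
      by apply: (pairwiseP (0, 0) lp); rewrite ?inE.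
    by apply/seteqP; split => // u /=; rewrite !in_itv/= => -[/andP[_ h1] /andP[h2 _]]; lra.
  move=> k1 k2 _ _ [u]; have [kk|kk|/val_inj//] := ltngtP k1 k2.
    by rewrite disj.
  by rewrite setIC disj.
- by move: ld; rewrite (big_nth (0, 0)) big_mkord.
Qed.

Fixpoint pairs_of (a : R) (s : seq R) : seq (R * R) :=
  if s is x :: s' then (a, x) :: pairs_of x s' else [::].

Lemma pairs_of_chain a s : path <%R a s -> chain_in a (last a s) (pairs_of a s) /\
  \sum_(p <- pairs_of a s) (p.2 - p.1) = last a s - a.
Proof.
elim: s a => [|x s IH] a /=; first by rewrite /chain_in/= big_nil subrr.
move=> /andP[ax xs]; have [/andP[C1 C2] E] := IH x xs.
have xl : x <= last x s.
  by move: xs {IH C1 C2 E}; elim: s x {ax} => //= y s IH x /andP[xy ys]; exact: le_trans (ltW xy) (IH y ys).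
split; last by rewrite big_cons E/=; ring.
rewrite /chain_in/= lexx (ltW ax) xl/= C2 andbT.
apply/andP; split; apply/allP => p pl; have /and3P[h1 h2 h3] := allP C1 p pl => //=.
by rewrite (le_trans (ltW ax) h1) h2 h3.
Qed.

Lemma variation_pairs_of f (a b : R) s :
  variation a b f s = \sum_(p <- pairs_of a s) `|f p.2 - f p.1|.
Proof.
rewrite /variation; elim: s a => [|x s IH] a /=; first by rewrite big_nil /index_iota/= big_nil.
by rewrite big_nat_recl// big_cons/= -IH.
Qed.

Lemma ac_realD (a b : R) f g c : ac_real a b f -> ac_real a b g ->
  ac_real a b (fun t => f t + c * g t).
Proof.
move=> af ag e e0.
have c1 : 0 < `|c| + 1 by rewrite ltr_wpDl.
have [d d0 H] := af (e / 2) (divr_gt0 e0 (ltr0n _ 2)).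
have [d' d'0 H'] := ag (e / 2 / (`|c| + 1)) (divr_gt0 (divr_gt0 e0 (ltr0n _ 2)) c1).
exists (Num.min d d'); first by rewrite lt_min d0.
move=> l cl; rewrite lt_min => /andP[ld ld'].
have h := H l cl ld; have h' := H' l cl ld'.
rewrite ltr_pdivlMr// in h'.
apply: (@le_lt_trans _ _ (\sum_(p <- l) `|f p.2 - f p.1| +
   (\sum_(p <- l) `|g p.2 - g p.1|) * (`|c| + 1))).
  rewrite mulr_suml -big_split/=; apply: ler_sum => p _.
  have -> : f p.2 + c * g p.2 - (f p.1 + c * g p.1) =
    (f p.2 - f p.1) + c * (g p.2 - g p.1) by ring.
  apply: (le_trans (ler_normD _ _)); rewrite lerD2l normrM mulrC.
  by apply: ler_wpM2l => //; rewrite lerDl.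
by rewrite [ltRHS]splitr ltrD.
Qed.

Variables (T : R) (f : R -> R).
Hypotheses (T0 : 0 <= T) (acf : ac_real 0 T f).
Local Notation TV := total_variation.

Lemma TV_small (a b d e : R) : (forall l, chain_in 0 T l -> \sum_(p <- l) (p.2 - p.1) < d ->
    \sum_(p <- l) `|f p.2 - f p.1| < e) -> 0 <= a -> a <= b -> b <= T -> b - a < d ->
  (TV a b f <= e%:E)%E.
Proof.
move=> H a0 ab bT bad; apply: ub_ereal_sup => _ [_ [s [ps /eqP ls <-] <-]].
have [/andP[C1 C2] E] := pairs_of_chain ps; rewrite ls in C1 E.
rewrite lee_fin variation_pairs_of ltW// H ?E//.
apply/andP; split => //; apply/allP => p pl; have /and3P[h1 h2 h3] := allP C1 p pl.
by rewrite (le_trans a0 h1) h2 (le_trans h3 bT).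
Qed.

(** Each step of length [d / 2] contributes variation at most 1. *)
Lemma TV_fin t : 0 <= t <= T -> (TV 0 t f < +oo)%E.
Proof.
have [d d0 H] := acf ltr01.
have d20 : 0 < d / 2 by rewrite divr_gt0.
suff IH n u : 0 <= u <= T -> u <= n%:R * (d / 2) -> (TV 0 u f < +oo)%E.
  move=> tT; apply: (IH (Num.truncn (t / (d / 2))).+1) => //.
  by rewrite -ler_pdivrMr// ltW// truncnS_gt.
elim: n u => [|n IH] u /andP[u0 uT].
  rewrite mul0r => u0'; have -> : u = 0 by apply/eqP; rewrite eq_le u0' u0.
  by rewrite total_variationxx.
move=> un; have [h|h] := leP u (d / 2).
  apply: le_lt_trans (ltry 1); apply: (TV_small H) => //.
  by rewrite subr0 (le_lt_trans h)// ltr_pdivrMr// ltr_pMr// ltr1n.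
have v0 : 0 <= u - d / 2 by rewrite subr_ge0 ltW.
have vu : u - d / 2 <= u by rewrite gerBl ltW.
rewrite (total_variationD f v0 vu); apply: lte_add_pinfty.
  apply: IH; first by rewrite v0 (le_trans vu).
  by move: un; rewrite -natr1 mulrDl mul1r; move: (n%:R * _) => z; lra.
apply: le_lt_trans (ltry 1); apply: (TV_small H) => //.
by rewrite opprB addrC subrK ltr_pdivrMr// ltr_pMr// ltr1n.
Qed.

Let V t := fine (TV 0 t f).

Lemma TV_incr s t : 0 <= s -> s <= t -> t <= T -> (V t - V s)%:E = TV s t f.
Proof.
move=> s0 st tT; have t0 := le_trans s0 st; have sT := le_trans st tT.
have fin u : 0 <= u -> u <= T -> TV 0 u f \is a fin_num.
  by move=> u0 uT; rewrite ge0_fin_numE ?total_variation_ge0// TV_fin// u0.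
have E := total_variationD f s0 st.
rewrite EFinB /V !fineK ?fin// E [X in (X - _)%E]addeC addeK// fin//.
Qed.

Lemma TV_mono s t : 0 <= s -> s <= t -> t <= T -> `|f t - f s| <= V t - V s.
Proof. by move=> s0 st tT; rewrite -lee_fin TV_incr// total_variation_ge. Qed.

Lemma chain_cons (lo c : R) p l : chain_in lo c (p :: l) ->
  [/\ lo <= p.1, p.1 <= p.2, p.2 <= c & chain_in p.2 c l].
Proof.
rewrite /chain_in/= => /andP[/andP[/and3P[h1 h2 h3] la] /andP[lp lw]].
split => //; rewrite lw andbT; apply/allP => q ql.
by have /and3P[_ k2 k3] := allP la q ql; have k1 := allP lp q ql; rewrite k1 k2 k3.
Qed.

Lemma chain_cat (lo a b c : R) l l' : lo <= a -> b <= c -> a <= b -> chain_in a b l ->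
  chain_in b c l' -> chain_in lo c (l ++ l').
Proof.
move=> loa bc ab /andP[A1 A2] /andP[B1 B2]; rewrite /chain_in all_cat pairwise_cat A2 B2 !andbT.
apply/andP; split; last first.
  apply/allrelP => p q pl ql; have /and3P[_ _ h] := allP A1 p pl.
  by have /and3P[h' _ _] := allP B1 q ql; exact: le_trans h h'.
apply/andP; split; apply/allP => p pl.
  by have /and3P[h1 h2 h3] := allP A1 p pl; rewrite (le_trans loa h1) h2 (le_trans h3 bc).
have /and3P[h1 h2 h3] := allP B1 p pl.
by rewrite (le_trans loa (le_trans ab h1)) h2 h3.
Qed.

(* Each interval is replaced by a partition that almost achieves its variation. *)
Lemma refine_chain l (lo e : R) : 0 < e -> 0 <= lo -> lo <= T -> chain_in lo T l ->
  exists l', [/\ chain_in lo T l', \sum_(p <- l') (p.2 - p.1) = \sum_(p <- l) (p.2 - p.1) &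
    \sum_(p <- l) (V p.2 - V p.1) <= \sum_(p <- l') `|f p.2 - f p.1| + (size l)%:R * e].
Proof.
move=> e0; elim: l lo => [|[a b] l IH] lo lo0 loT.
  by move=> _; exists [::]; rewrite !big_nil mul0r addr0.
move=> /chain_cons[/= loa ab bT cl].
have a0 := le_trans lo0 loa; have b0 := le_trans a0 ab.
have [l' [C E S]] := IH b b0 bT cl.
have [blk [Cb Eb Sb]] : exists blk, [/\ chain_in a b blk,
    \sum_(p <- blk) (p.2 - p.1) = b - a & V b - V a <= \sum_(p <- blk) `|f p.2 - f p.1| + e].
  have [ab0|ab0] := eqVneq a b.
    by exists [::]; rewrite !big_nil ab0 !subrr add0r; split => //; exact: ltW.
  apply: contrapT => N; have : (TV a b f <= (V b - V a - e)%:E)%E.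
    apply: ub_ereal_sup => _ [_ [s [ps /eqP ls <-] <-]]; rewrite lee_fin leNgt; apply/negP => lt.
    apply: N; exists (pairs_of a s); have [Cs Es] := pairs_of_chain ps.
    rewrite ls in Cs Es; split => //.
    by move: lt; rewrite variation_pairs_of; move: (\sum_(_ <- _) _) => z; lra.
  by rewrite -TV_incr// lee_fin; lra.
exists (blk ++ l'); split.
- exact: (chain_cat loa bT ab Cb C).
- by rewrite big_cat/= Eb E big_cons.
- rewrite big_cons big_cat/= -natr1 mulrDl mul1r.
  by move: Sb S; move: (\sum_(_ <- blk) _) (\sum_(_ <- l') _) (\sum_(_ <- l) _) (_ * e) => *; lra.
Qed.

(** The modulus of [f] is applied to the refined chain, whose total length is unchanged. *)
Lemma ac_TV : ac_real 0 T V.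
Proof.
move=> e e0; have [d d0 H] := acf (divr_gt0 e0 (ltr0n _ 2)).
exists d => // l cl ld; have e'0 : 0 < e / 2 / (size l).+1%:R by rewrite !divr_gt0.
have [l' [C E S]] := refine_chain e'0 (lexx _) T0 cl.
have h : \sum_(p <- l') `|f p.2 - f p.1| < e / 2 by apply: H => //; rewrite E.
have -> : \sum_(p <- l) `|V p.2 - V p.1| = \sum_(p <- l) (V p.2 - V p.1).
  apply: eq_big_seq => p pl; case/andP: cl => /allP/(_ p pl)/and3P[h1 h2 h3] _.
  by rewrite ger0_norm// (le_trans _ (TV_mono h1 h2 h3)).
have s : (size l)%:R * (e / 2 / (size l).+1%:R) <= e / 2.
  rewrite mulrA ler_pdivrMr ?ltr0n// mulrC; apply: ler_wpM2l; first by rewrite divr_ge0// ltW.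
  by rewrite ler_nat.
by move: S h s; move: (\sum_(_ <- l') _) (\sum_(_ <- l) _) (_ * (_ / _)) => *; lra.
Qed.
End ac_intervals.

(** * Stieltjes measures of absolutely continuous functions *)

Section chain_measure.
Context {R : realType}.
Implicit Types (l : seq (R * R)) (H : R -> R).
Local Notation BR := (measurableTypeR R).

Definition chain_union l : set R := \big[setU/set0]_(p <- l) (`]p.1, p.2]%classic : set R).

Lemma chain_unionP l (t : R) : chain_union l t <-> exists2 p, p \in l & p.1 < t <= p.2.
Proof.
rewrite /chain_union -bigcup_seq; by split => -[p pl] /= h; exists p => //; move: h; rewrite /= in_itv.
Qed.

Lemma measurable_chain_union l : measurable (chain_union l : set BR).
Proof. by apply: bigsetU_measurable => p _; exact: measurable_itv. Qed.

Lemma measure_chain_union (m : {measure set BR -> \bar R}) H :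
  (forall a b, a <= b -> m (`]a, b]%classic : set R) = (H b - H a)%:E) ->
  forall l a b, chain_in a b l -> m (chain_union l) = (\sum_(p <- l) (H p.2 - H p.1))%:E.
Proof.
move=> mH; elim=> [|p l IH] a b; first by rewrite /chain_union !big_nil measure0.
move=> /chain_cons[ap pp pb cl]; rewrite /chain_union !big_cons -/(chain_union l) measureU.
- by rewrite EFinD -(mH _ _ pp) -(IH _ _ cl).
- exact: measurable_itv.
- exact: measurable_chain_union.
- apply/seteqP; split => // t /= []; rewrite in_itv/= => /andP[_ tp] /chain_unionP[q ql].
  case/andP: cl => /allP/(_ q ql)/and3P[pq _ _] _ /andP[qt _].
  by have := lt_le_trans (le_lt_trans pq qt) tp; rewrite ltxx.
Qed.

Variables (T : R) (G : R -> R).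
Hypotheses (T0 : 0 < T) (acG : ac_real 0 T G).
Variable m : {measure set BR -> \bar R}.
Hypothesis mG : forall a b, a <= b -> m (`]a, b]%classic : set R) = (G b - G a)%:E.
Local Notation mu := (@lebesgue_measure R).

Let h (n : nat) : R := T / n.+1%:R.
Let h_gt0 n : 0 < h n. Proof. by rewrite divr_gt0. Qed.
Let cells (U : set R) n : seq (R * R) := [seq (h n * k%:R, h n * k.+1%:R) |
  k <- iota 0 n.+1 & `[< `]h n * k%:R, h n * k.+1%:R]%classic `<=` U >]].

Lemma cells_chain U n : chain_in 0 T (cells U n).
Proof.
apply/andP; split.
  apply/allP => _ /mapP[k + ->] /=; rewrite mem_filter mem_iota add0n => /andP[_ /andP[_ kn]].
  rewrite mulr_ge0 ?(ltW (h_gt0 n))//= ler_wpM2l ?(ltW (h_gt0 n)) ?ler_nat//=.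
  rewrite /h mulrAC ler_pdivrMr ?ltr0n//; apply: ler_wpM2l; first exact: ltW.
  by rewrite ler_nat.
rewrite pairwise_map; apply: pairwise_filter.
apply: (@sub_pairwise _ ltn); last by rewrite -sorted_pairwise ?iota_ltn_sorted//; exact: ltn_trans.
by move=> k k' /= kk; rewrite ler_wpM2l ?(ltW (h_gt0 n)) ?ler_nat.
Qed.

Lemma cells_sub U n : chain_union (cells U n) `<=` U.
Proof.
move=> t /chain_unionP[_ /mapP[k + ->] /= tk]; rewrite mem_filter => /andP[/asboolP kU _].
by apply: kU; rewrite /= in_itv.
Qed.

Lemma cells_cover (U : set R) (t : R) : open U -> U t -> 0 < t <= T ->
  exists m, forall n, (m <= n)%N -> chain_union (cells U n) t.
Proof.
move=> oU Ut /andP[t0 tT]; have /nbhs_ballP[e /= e0 eU] := open_nbhs_nbhs (conj oU Ut).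
exists (Num.truncn (T / e)) => n mn.
have he : h n < e.
  rewrite /h ltr_pdivrMr ?ltr0n// mulrC -ltr_pdivrMr// (lt_le_trans (truncnS_gt _))//.
  by rewrite ler_nat.
have ex : exists k : nat, t <= h n * k.+1%:R.
  by exists n; rewrite /h divfK// pnatr_eq0.
have kn : (ex_minn ex < n.+1)%N.
  by case: ex_minnP => k _ kmin; rewrite ltnS; apply: kmin; rewrite /h divfK// pnatr_eq0.
move: kn; case: ex_minnP => k tk kmin kn.
have kt : h n * k%:R < t.
  case: k tk kmin kn => [|k] tk kmin kn; first by rewrite mulr0.
  by rewrite ltNge; apply/negP => /kmin; rewrite ltnn.
apply/chain_unionP; exists (h n * k%:R, h n * k.+1%:R) => /=; last by rewrite kt.
apply/mapP; exists k => //; rewrite mem_filter mem_iota/= add0n kn andbT.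
apply/asboolP => u; rewrite /= in_itv/= => /andP[ku uk]; apply: eU.
rewrite /ball/= ltr_norml; move: kt tk ku uk he; rewrite -natr1 mulrDr mulr1.
by move: (h n * k%:R) (h n) => *; apply/andP; split; lra.
Qed.

(** An open set of small measure containing [N] is not a finite union of intervals; it is filled by
    the cells of mesh [T / (n + 1)] that it contains. For each [n] these form a chain of small total
    length, to which absolute continuity applies. *)
Lemma null_restr (N : set BR) : measurable N -> mu N = 0%E -> m (N `&` `]0, T]%classic) = 0%E.
Proof.
move=> mN N0; apply/eqP; rewrite eq_le measure_ge0 andbT; apply/lee_addgt0Pr => e e0.
rewrite add0e; have [d d0 H] := acG e0.
have Nfin : (mu N < +oo)%E by rewrite N0 ltry.
have [U [oU NU Ud]] := lebesgue_regularity_outer mN Nfin d0.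
have mU : measurable (U : set BR) by exact: open_measurable.
have {}Ud : (mu U < d%:E)%E.
  have -> : U = (U `\` N) `|` N by rewrite setUC setDUK.
  apply: (le_lt_trans (measureU2 _ _ _)) => //; first exact: measurableD.
  by rewrite [X in (_ + X)%E]N0 adde0.
pose W n := chain_union (cells U n).
have mW n : measurable (W n) by exact: measurable_chain_union.
have We n : (m (W n) <= e%:E)%E.
  rewrite (measure_chain_union mG (cells_chain U n)) lee_fin.
  have := H _ (cells_chain U n).
  have small : \sum_(p <- cells U n) (p.2 - p.1) < d.
    rewrite -lte_fin -(measure_chain_union (m := mu) (H := id) _ (cells_chain U n)).
      by apply: le_lt_trans Ud; apply: le_measure; [rewrite inE; exact: mW|rewrite inE|exact: cells_sub].
    move=> a b ab; rewrite [LHS]lebesgue_measure_itv/= lte_fin; case: ltP => // ba.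
    by have -> : b = a by [apply/eqP; rewrite eq_le ab ba]; rewrite subrr.
  move=> /(_ small)/ltW; apply: le_trans; apply: ler_sum => p _; exact: ler_norm.
(* The unions [W n] are not monotone in [n], but each point belongs to all of them eventually; hence
   a lower limit. *)
pose A k := \bigcap_(n in [set n | (k <= n)%N]) W n.
have mA k : measurable (A k) by apply: bigcap_measurableType => n _.
have mUA : measurable (\bigcup_k A k) by apply: bigcup_measurable => n _.
have ndA : nondecreasing_seq A.
  move=> k k' kk; apply/subsetPset => t At n /= k'n; apply: At => /=; exact: leq_trans kk k'n.
have cA := nondecreasing_cvg_mu (mu := m) mA mUA ndA.
apply: (@le_trans _ _ (m (\bigcup_k A k))).
  apply: le_measure; rewrite ?inE//; first by apply: measurableI => //; exact: measurable_itv.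
  move=> t [Nt]; rewrite /= in_itv/= => tT; have [k K] := cells_cover oU (NU _ Nt) tT.
  by exists k => // n /= kn; exact: K.
rewrite -(cvg_lim _ cA)//; apply: lime_le; first by apply/cvg_ex; eexists; exact: cA.
apply: nearW => k /=; apply: le_trans (We k); apply: le_measure; [rewrite inE; exact: mA|rewrite inE; exact: mW|].
by move=> t; apply; rewrite /=.
Qed.
End chain_measure.

(** * Densities of absolutely continuous functions *)

Section monotone_density.
Context {R : realType}.
Variables (T : R) (F : R -> R).
Hypotheses (T0 : 0 < T) (ndF : forall s t, 0 <= s -> s <= t -> t <= T -> F s <= F t)
  (acF : ac_real 0 T F).
Local Notation mu := (@lebesgue_measure R).
(** Extends [F] by constants outside [[0, T]], which makes it a cumulative function on the whole
    line. *)
Let clamp (t : R) := Num.min T (Num.max 0 t).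
Let G t := F (clamp t).

Lemma clampP (t : R) : 0 <= clamp t <= T.
Proof.
by rewrite le_min (ltW T0) le_max lexx/= ge_min lexx.
Qed.

Lemma clamp_le (s t : R) : s <= t -> clamp s <= clamp t.
Proof.
move=> st; rewrite le_min ge_min lexx/= ge_min; apply/orP; right.
by rewrite ge_max le_max lexx/= le_max st orbT.
Qed.

Lemma clamp_lip (s t : R) : s <= t -> clamp t - clamp s <= t - s.
Proof.
move=> st; rewrite /clamp /Num.max; case: (ltP 0 s) => s0; case: (ltP 0 t) => t0;
by rewrite /Num.min; do 2 case: ltP => ?; lra.
Qed.

Lemma clamp_id (t : R) : 0 <= t <= T -> clamp t = t.
Proof. by move=> /andP[t0 tT]; rewrite /clamp (max_idPr t0) (min_idPr tT). Qed.

Let G_nd : {homo G : x y / x <= y}.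
Proof.
move=> x y xy; have /andP[x0 _] := clampP x; have /andP[_ yT] := clampP y.
by apply: ndF => //; exact: clamp_le.
Qed.

Let G_rc : right_continuous G.
Proof.
apply: right_continuousW => x; apply/cvgrPdist_lt => e e0.
have [d d0 H] := acF e0; near=> y.
have small u v : u <= v -> v - u < d -> `|G v - G u| < e.
  move=> uv vu; have := H [:: (clamp u, clamp v)]; rewrite !big_seq1/=; apply.
    have /andP[h1 _] := clampP u; have /andP[_ h2] := clampP v.
    by rewrite /chain_in/= h1 h2 clamp_le.
  exact: le_lt_trans (clamp_lip uv) vu.
have xy : `|x - y| < d by near: y; exact: cvgr_dist_lt (@cvg_id _ _) _ d0.
have [h|/ltW h] := leP x y.
  by rewrite distrC small//; move: xy; rewrite distrC ger0_norm ?subr_ge0.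
by rewrite small//; move: xy; rewrite ger0_norm ?subr_ge0.
Unshelve. all: by end_near. Qed.

HB.instance Definition _ := isCumulative.Build R _ R G G_nd G_rc.
Let cG : cumulative R R := G.
Let ls := lebesgue_stieltjes_measure cG.
Let D : set R := `]0, T]%classic.
Let mD : measurable (D : set (measurableTypeR R)). Proof. exact: measurable_itv. Qed.

Let cGE u : (cG : R -> R) u = F (clamp u). Proof. by []. Qed.

Let ls_fin : (ls D < +oo)%E.
Proof. by rewrite /ls ls_itv ?ltry// ltW. Qed.

Let nuD : {finite_measure set (measurableTypeR R) -> \bar R} := mfrestr mD ls_fin.

Let nu_mu : nuD `<< mu.
Proof.
move=> N N0 A mA AN; rewrite /nuD /= /mfrestr /mrestr.
have acG : ac_real 0 T G.
  move=> e e0; have [d d0 H] := acF e0; exists d => // l cl ld; apply: le_lt_trans (H l cl ld).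
  rewrite le_eqVlt; apply/orP; left; apply/eqP; apply: eq_big_seq => p pl.
  case/andP: cl => /allP/(_ p pl)/and3P[h1 h2 h3] _.
  by rewrite /G !clamp_id// ?h1 ?h3 ?(le_trans h2 h3) ?(le_trans h1 h2).
by apply: (@null_restr R T G T0 acG ls _ A mA (N0 A mA AN)) => a b ab; exact: ls_itv.
Qed.

Lemma monotone_density : exists g : R -> R, [/\ forall t, 0 <= g t,
  mu.-integrable setT (EFin \o g),
  forall s t, 0 <= s -> s <= t -> t <= T -> (F t - F s)%:E = (\int[mu]_(u in `]s, t]) (g u)%:E)%E &
  {ae mu, forall t, 0 < t < T -> is_derive t 1 F (g t)}].
Proof.
have [k [k0 kfin ik kE]] := radon_nikodym_sigma_finite nu_mu.
have Ek : EFin \o (fine \o k) = k by apply/funext => t /=; rewrite fineK.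
have ig : mu.-integrable setT (EFin \o (fine \o k)) by rewrite Ek.
have incr s t : 0 <= s -> s <= t -> t <= T ->
    (F t - F s)%:E = (\int[mu]_(u in `]s, t]) (fine (k u))%:E)%E.
  move=> s0 st tT; under eq_integral do rewrite fineK//.
  rewrite -kE; last exact: measurable_itv.
  rewrite /nuD/= /mfrestr /mrestr (_ : _ `&` D = `]s, t]%classic).
    rewrite /ls ls_itv// !cGE !clamp_id// ?s0 ?tT ?(le_trans st tT) ?(le_trans s0 st)//.
  apply/seteqP; split => [u []//|u /= h]; split => //; move: h.
  by rewrite /D/= !in_itv/= => /andP[h1 h2]; rewrite (le_lt_trans s0 h1) (le_trans h2 tT).
exists (fine \o k); split => //.
  by move=> t; rewrite fine_ge0.
have cov (y : R) : measurable (`]-oo, y]%classic : set (measurableTypeR R)) by exact: measurable_itv.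
have iy y : mu.-integrable `]-oo, y] (EFin \o (fine \o k)).
  by apply: (integrableS measurableT) ig.
have := FTC1Ny iy (open_integrable_locally openT ig).
apply: filterS; first exact: (ae_filter_ringOfSetsType mu).
move=> t [dF' eF'] /andP[t0 tT].
set F' := (fun x => _) in dF' eF'.
have E y : 0 <= y <= T -> F' y = F y - F 0.
  move=> /andP[y0 yT]; rewrite /F' /Rintegral; have /= -> : (\int[mu]_(u in [set` `]-oo, y]]) (fine (k u))%:E =
      (F y - F 0)%:E)%E; last by [].
  under eq_integral do rewrite fineK//.
  rewrite -kE// /nuD/= /mfrestr /mrestr (_ : _ `&` D = `]0, y]%classic).
    by rewrite /ls ls_itv// !cGE !clamp_id// ?y0 ?yT ?lexx ?(ltW T0).
  apply/seteqP; split => u /=; rewrite /D/= !in_itv/=.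
    by move=> [uy /andP[u0 _]]; rewrite u0 uy.
  by move=> /andP[u0 uy]; rewrite u0 uy (le_trans uy yT).
have nE : \near t, F' t + F 0 = F t.
  near=> u; rewrite E ?subrK//; apply/andP; split; apply: ltW; near: u.
    exact: lt_nbhsr.
  exact: lt_nbhsl.
have dF : is_derive t 1 F' ((fine \o k) t) by rewrite -eF' derive1E; exact: derivableP.
apply: (@near_eq_is_derive R R^o R^o (F' + cst (F 0)) F t 1 _ nE).
by apply: is_derive_eq; rewrite addr0.
Unshelve. all: by end_near. Qed.
End monotone_density.

Section ac_density.
Context {R : realType}.
Local Notation mu := (@lebesgue_measure R).

Lemma ae_imp2 (P Q S : R -> Prop) : (forall t, P t -> Q t -> S t) ->
  {ae mu, forall t, P t} -> {ae mu, forall t, Q t} -> {ae mu, forall t, S t}.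
Proof. by move=> H p q; exact: (@filterS2 _ _ (ae_filter_ringOfSetsType mu) _ _ _ H p q). Qed.

Lemma ac_density (T : R) (f : R -> R) : 0 < T -> ac_real 0 T f -> exists g : R -> R,
  [/\ mu.-integrable setT (EFin \o g),
  forall s t, 0 <= s -> s <= t -> t <= T -> (f t - f s)%:E = (\int[mu]_(u in `]s, t]) (g u)%:E)%E &
  {ae mu, forall t, 0 < t < T -> is_derive t 1 f (g t)}].
Proof.
move=> T0 acf; pose V t := fine (total_variation 0 t f).
have acV : ac_real 0 T V by exact: (ac_TV (ltW T0) acf).
pose W t := V t + (-1) * f t.
have acW : ac_real 0 T W by exact: ac_realD.
have mono s t : 0 <= s -> s <= t -> t <= T -> `|f t - f s| <= V t - V s by exact: TV_mono.
have ndV s t : 0 <= s -> s <= t -> t <= T -> V s <= V t.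
  by move=> s0 st tT; rewrite -subr_ge0 (le_trans _ (mono _ _ s0 st tT)).
have ndW s t : 0 <= s -> s <= t -> t <= T -> W s <= W t.
  move=> s0 st tT; have := le_trans (ler_norm _) (mono _ _ s0 st tT).
  by rewrite /W !mulN1r; move: (V s) (V t) => *; lra.
have [gV [_ iV EV dV]] := monotone_density T0 ndV acV.
have [gW [_ iW EW dW]] := monotone_density T0 ndW acW.
have fE : f = V - W by apply/funext => t; rewrite /W !fctE; ring.
exists (fun t => gV t - gW t); split.
- have -> : EFin \o (fun t => gV t - gW t) = ((EFin \o gV) \- (EFin \o gW))%E by [].
  exact: integrableB.
- move=> s t s0 st tT; have mst : measurable (`]s, t]%classic : set (measurableTypeR R)) by exact: measurable_itv.
  under eq_integral do rewrite EFinB.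
  rewrite integralB_EFin// -?EV -?EW// -?EFinB; last 2 first.
  + exact: (integrableS measurableT) iV.
  + exact: (integrableS measurableT) iW.
  by congr EFin; rewrite /W; ring.
- apply: (ae_imp2 _ dV dW) => t HV HW t0T; rewrite fE; apply: is_deriveB; [exact: HV|exact: HW].
Qed.
End ac_density.

Section nonmeasurable.
Context d (X : measurableType d) (R : realType) (m : {measure set X -> \bar R}).
Local Open Scope ereal_scope.

(* No measurability is assumed of the larger function, whose integral is a supremum over simple functions. *)
Lemma ge0_ae_le_integral_r (D : set X) (f g : X -> \bar R) : measurable D -> measurable_fun D f ->
  (forall x, D x -> 0 <= f x) -> (forall x, D x -> 0 <= g x) ->
  {ae m, forall x, D x -> f x <= g x} -> \int[m]_(x in D) f x <= \int[m]_(x in D) g x.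
Proof.
move=> mD mf f0 g0 [N [mN N0 NP]].
pose f' := f \_ (~` N).
have mf' : measurable_fun D f'.
  by apply/(measurable_restrict _ _ _).1 => //; [exact: measurableC|exact: measurable_funS mf].
rewrite (_ : \int[m]_(x in D) f x = \int[m]_(x in D) f' x); last first.
  apply: ae_eq_integral => //; exists N; split => // x /=; apply: contra_notP => xN _.
  by rewrite /f' patchE ifT// inE.
have le : forall x, D x -> f' x <= g x.
  move=> x Dx; rewrite /f' patchE; case: ifPn => [|_]; last exact: g0.
  by rewrite inE /= => xN; apply: contrapT => h; apply: xN; apply: NP => /= /(_ Dx).
have f'0 x : D x -> 0 <= f' x by move=> Dx; rewrite /f' patchE; case: ifPn => // _; exact: f0.
rewrite (ge0_integralE _ f'0) (ge0_integralE _ g0).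
apply: ub_ereal_sup => _ [h /= hf <-]; apply: ereal_sup_ubound; exists h => //= x.
apply: (le_trans (hf x)); rewrite !patchE; case: ifPn => //; rewrite inE => Dx; exact: le.
Qed.
End nonmeasurable.

(** * The running cost *)

Section legendre.
Context {R : realType}.
Variables (Sigma : 'M[R]_2) (mu : 'cV[R]_2).
Hypotheses (Sigma_sym : Sigma^T = Sigma) (Sigma_pd : positive_definite Sigma).

Lemma positive_definite_unitmx : Sigma \in unitmx.
Proof.
rewrite unitmxE unitfE; apply/eqP => /eqP/det0P[v v0 vS].
have : v^T != 0 by apply: contra v0 => /eqP h; rewrite -[v]trmxK h trmx0.
move=> /Sigma_pd; rewrite -[Sigma]Sigma_sym -trmx_mul vS trmx0 dot0r ltxx//.
Qed.

Definition rate (u : 'cV[R]_2) : R := 2^-1 * dot (u - mu) (invmx Sigma *m (u - mu)).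

Lemma rate_mul p : rate (mu + Sigma *m p) = 2^-1 * dot p (Sigma *m p).
Proof. by rewrite /rate addrC addKr mulKmx ?positive_definite_unitmx// dotC. Qed.

Lemma rate_surj u : exists p, u = mu + Sigma *m p.
Proof.
exists (invmx Sigma *m (u - mu)).
by rewrite mulKVmx ?positive_definite_unitmx// addrC subrK.
Qed.

Lemma dot_Sigma_ge0 p : 0 <= dot p (Sigma *m p).
Proof. by have [->|/Sigma_pd/ltW//] := eqVneq p 0; rewrite dotC dot0r. Qed.

Lemma rate_ge0 u : 0 <= rate u.
Proof. by have [p ->] := rate_surj u; rewrite rate_mul mulr_ge0// dot_Sigma_ge0. Qed.

(** With [u = mu + Sigma *m p], the difference of the two sides is half the quadratic form of
    [p - th]. *)
Lemma rate_dual u th : dot th u + gamma Sigma mu th <= rate u.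
Proof.
have [p ->] := rate_surj u; rewrite rate_mul /gamma dotDr.
have := dot_Sigma_ge0 (p - th); rewrite !(quadratic_form Sigma_sym 0 (p - th)).
rewrite (quadratic_form Sigma_sym 0 th p) (quadratic_form Sigma_sym 0 th th).
rewrite (quadratic_form Sigma_sym 0 p p) (dotC mu) !mxE.
move: (Sigma _ _) (Sigma _ _) (Sigma _ _) (dot _ _) (p _ _) (p _ _) (th _ _) (th _ _) => *.
by nra.
Qed.
End legendre.

Section action_cost.
Context {R : realType}.
Variables (Sigma : 'M[R]_2) (m : 'cV[R]_2).
Hypotheses (Sigma_sym : Sigma^T = Sigma) (Sigma_pd : positive_definite Sigma).
Local Notation mu := (@lebesgue_measure R).
Local Notation rate := (rate Sigma m).

Let rateE (u : 'cV[R]_2) : rate u = 2^-1 * dot (u - m) (invmx Sigma *m (u - m)). Proof. by []. Qed.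

Lemma rate_sum (u : 'cV[R]_2) : rate u = \sum_i \sum_j 2^-1 * invmx Sigma i j * ((u i 0 - m i 0) * (u j 0 - m j 0)).
Proof.
rewrite rateE /dot mulr_sumr; apply: eq_bigr => i _; rewrite !mxE !mulr_sumr.
by apply: eq_bigr => j _; rewrite !mxE; ring.
Qed.

Lemma is_derive_coord (x : R -> 'cV[R]_2) (t : R) (g : 'cV[R]_2) :
  (forall i, is_derive t 1 (fun s => x s i 0 : R) (g i 0)) -> derive1 x t = g.
Proof.
move=> H; have dx : derivable x t 1.
  by apply/derivable_mxP => i j; rewrite (ord1 j); have [] := H i.
rewrite derive1E derive_mx//; apply/matrixP => i j; rewrite mxE (ord1 j).
by have [_ ->] := H i.
Qed.

(** The function [c] is the accumulated rate. The lower bounds use only its three properties, so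
    derivatives and integrals do not occur after this point in them. *)
Lemma action_cost (T : R) (x : R -> 'cV[R]_2) : 0 <= T -> calH x -> (action Sigma m T x < +oo)%E ->
  exists c : R -> R, [/\ c 0 = 0, ((c T)%:E <= action Sigma m T x)%E &
    forall th s t, 0 <= gamma Sigma m th -> 0 <= s -> s <= t -> t <= T ->
      dot th (x t) - dot th (x s) <= c t - c s].
Proof.
rewrite le_eqVlt => /orP[/eqP <-|T0] [x0 acx _].
  exists (fun=> 0); split => //.
    rewrite /action mule_ge0// ?lee_fin//; apply: integral_ge0 => t _; rewrite lee_fin.
    by have := rate_ge0 m Sigma_sym Sigma_pd (derive1 x t); rewrite rateE pmulr_rge0.
  by move=> th s t _ s0 st t0; have -> : s = t by [lra]; rewrite !subrr.
move=> fin.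
have /choice[g gP] : forall i : 'I_2, exists g : R -> R, [/\ mu.-integrable setT (EFin \o g),
  forall s t, 0 <= s -> s <= t -> t <= T -> (x t i 0 - x s i 0)%:E = (\int[mu]_(u in `]s, t]) (g u)%:E)%E &
  {ae mu, forall t, 0 < t < T -> is_derive t 1 (fun t => x t i 0 : R) (g t)}].
  by move=> i; apply: ac_density => //; apply: ac_real_coord; apply: acx; exact: ltW.
pose G t : 'cV[R]_2 := \col_i g i t.
pose h t := rate (G t).
have mg i : measurable_fun setT (g i).
  by have [/integrableP[/measurable_EFinP]] := gP i.
have mh : measurable_fun setT h.
  rewrite (_ : h = fun t => \sum_i \sum_j 2^-1 * invmx Sigma i j * ((g i t - m i 0) * (g j t - m j 0))); last first.
    by apply/funext => t; rewrite /h rate_sum; apply: eq_bigr => i _; apply: eq_bigr => j _; rewrite !mxE.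
  apply: measurable_sum => i; apply: measurable_sum => j.
  by apply: measurable_funM => //; apply: measurable_funM; apply: measurable_funB.
have h0 t : 0 <= h t by exact: rate_ge0.
have mI (i : interval R) : measurable ([set` i] : set (measurableTypeR R)) by exact: measurable_itv.
have le : (\int[mu]_(t in `]0%R, T]) (h t)%:E <= action Sigma m T x)%E.
  have ne (a : R) : {ae mu, forall t, t != a}.
    exists [set a]; split => //; first by rewrite [LHS]lebesgue_measure_set1.
    by move=> t /= /negP; rewrite negbK => /eqP.
  have m2h D : measurable_fun D (fun t => (2 * h t)%:E).
    by apply: measurable_funTS; apply/measurable_EFinP; exact: measurable_funM.
  have -> : (\int[mu]_(t in `]0%R, T]) (h t)%:E = (2^-1)%:E * \int[mu]_(t in `[0%R, T]) (2 * h t)%:E)%E.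
    rewrite -integral_itv_obnd_cbnd// -ge0_integralZl_EFin//; last 2 first.
    + by move=> t _; rewrite lee_fin mulr_ge0.
    + exact: m2h.
    by apply: eq_integral => t _; rewrite -EFinM mulKf.
  apply: lee_wpmul2l; first by rewrite lee_fin invr_ge0.
  (* [derive1 x] is known only almost everywhere, through the measurable representative [G]. *)
  apply: ge0_ae_le_integral_r => //.
  + exact: m2h.
  + by move=> t _; rewrite lee_fin mulr_ge0.
  + move=> t _; rewrite lee_fin.
    by have := rate_ge0 m Sigma_sym Sigma_pd (derive1 x t); rewrite rateE pmulr_rge0.
  + have [_ _ d0] := gP 0; have [_ _ d1] := gP (rev_ord 0).
    apply: (ae_imp2 _ (ae_imp2 (fun t => @conj _ _) d0 d1) (ae_imp2 (fun t => @conj _ _) (ne 0) (ne T))).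
    move=> t [D0 D1] [t0 tT]; rewrite /= in_itv/= => /andP[t0' tT'].
    have tt : 0 < t < T by rewrite !lt_neqAle eq_sym t0 t0' tT tT'.
    have -> : derive1 x t = G t.
      apply: is_derive_coord => i; rewrite mxE.
      by have [->|/ord2_neq ->] := eqVneq i 0; [exact: D0|exact: D1].
    by rewrite lee_fin /h rateE mulVKf.
have hfin : (\int[mu]_(t in `]0%R, T]) (h t)%:E < +oo)%E by exact: le_lt_trans le fin.
exists (fun t => fine (\int[mu]_(u in `]0%R, t]) (h u)%:E)); split.
- by rewrite set_itvoc0 integral_set0.
- by rewrite fineK// ge0_fin_numE// integral_ge0// => t _; rewrite lee_fin.
move=> th s t gth s0 st tT.
have cE u v : 0 <= u -> u <= v -> v <= T ->
    (\int[mu]_(r in `]0%R, v]) (h r)%:E = \int[mu]_(r in `]0%R, u]) (h r)%:E + \int[mu]_(r in `]u, v]) (h r)%:E)%E.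
  move=> u0 uv vT; have -> : `]0, v]%classic = (`]0, u] `|` `]u, v])%classic :> set R.
    by apply: itv_bndbnd_setU; rewrite bnd_simp.
  rewrite ge0_integral_setU//.
  - by apply: measurable_funTS; apply/measurable_EFinP.
  - by move=> r _; rewrite lee_fin.
  - by apply/disj_setPS => r [] /=; rewrite !in_itv/= => /andP[_ ru] /andP[ur _]; lra.
have fins u v : 0 <= u -> v <= T -> (\int[mu]_(r in `]u, v]) (h r)%:E < +oo)%E.
  move=> u0 vT; apply: le_lt_trans hfin; apply: ge0_subset_integral => //.
  - by apply: measurable_funTS; apply/measurable_EFinP.
  - by move=> r _; rewrite lee_fin.
  - by move=> r /=; rewrite !in_itv/= => /andP[r1 r2]; rewrite (le_lt_trans u0 r1) (le_trans r2 vT).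
have finn u v : 0 <= u -> v <= T -> (\int[mu]_(r in `]u, v]) (h r)%:E)%E \is a fin_num.
  by move=> u0 vT; rewrite ge0_fin_numE ?fins// integral_ge0// => r _; rewrite lee_fin.
have t0 := le_trans s0 st; have sT := le_trans st tT.
rewrite (cE s t)// fineD ?finn// [leRHS]addrC addKr -lee_fin fineK ?finn//.
have ig i : mu.-integrable `]s, t] (EFin \o g i).
  by have [ii _ _] := gP i; exact: (integrableS measurableT) ii.
have ih : mu.-integrable `]s, t] (EFin \o h).
  apply/integrableP; split; first by apply: measurable_funTS; apply/measurable_EFinP.
  have -> : (\int[mu]_(r in `]s, t]) `|(EFin \o h) r| = \int[mu]_(r in `]s, t]) (h r)%:E)%E; last exact: fins.
  by apply: eq_integral => r _; rewrite /= ger0_norm.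
have igz i : mu.-integrable `]s, t] (fun r => (th i 0)%:E * (g i r)%:E)%E.
  by apply: integrableZl => //; exact: ig.
have -> : (dot th (x t) - dot th (x s))%:E = (\int[mu]_(r in `]s, t]) (dot th (G r))%:E)%E.
  under eq_integral do rewrite (dotE 0) EFinD !EFinM !mxE.
  rewrite (integralD _ (igz 0) (igz (rev_ord 0)))//.
  rewrite !(integralZl _ (ig _))//.
  have [_ E0 _] := gP 0; have [_ E1 _] := gP (rev_ord 0).
  rewrite -E0// -E1// -!EFinM -EFinD !(dotE 0); congr EFin; ring.
apply: le_integral => //.
  have -> : (fun r => (dot th (G r))%:E) = (fun r => (th 0 0)%:E * (g 0 r)%:E + (th (rev_ord 0) 0)%:E * (g (rev_ord 0) r)%:E)%E.
    by apply/funext => r; rewrite (dotE 0) EFinD !EFinM !mxE.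
  by apply: integrableD => //; exact: igz.
move=> r _; rewrite lee_fin; have := rate_dual m Sigma_sym Sigma_pd (G r) th.
by apply: le_trans; rewrite lerDl.
Qed.
End action_cost.

(** * Lower bounds for the value function *)

Section continuity_of_regulation.
Context {R : realType}.
Local Notation ls := (@lebesgue_stieltjes_measure R).

Lemma ac_continuous (f : R -> R) : (forall T, 0 <= T -> ac_real 0 T f) ->
  continuous (fun t : R => f (Num.max 0 t)).
Proof.
move=> ac t; apply/cvgrPdist_lt => e e0.
have m0 u : 0 <= Num.max 0 u :> R by rewrite le_max lexx.
have T0 : 0 <= Num.max 0 t + 1 by rewrite addr_ge0.
have [d d0 H] := ac _ T0 e e0.
have lip (u v : R) : u <= v -> 0 <= Num.max 0 v - Num.max 0 u <= v - u.
  by move=> uv; apply/andP; rewrite /Num.max; case: (ltP 0 u) => ?; case: (ltP 0 v) => ?; split; lra.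
have close u v : u <= v -> v <= t + 1 -> v - u < d -> `|f (Num.max 0 v) - f (Num.max 0 u)| < e.
  move=> uv vt vu; have /andP[h1 h2] := lip u v uv.
  have := H [:: (Num.max 0 u, Num.max 0 v)]; rewrite !big_seq1/=; apply; last exact: le_lt_trans vu.
  rewrite /chain_in/= andbT m0 -subr_ge0 h1/= andbT.
  have : t <= Num.max 0 t by rewrite le_max lexx orbT.
  by move=> h; rewrite ge_max T0/= (le_trans vt)// lerD2r.
near=> s; have st : `|t - s| < Num.min d 1 by near: s; apply: cvgr_dist_lt; rewrite ?lt_min ?d0 ?ltr01//; exact: cvg_id.
move: st; rewrite lt_min => /andP[sd s1]; have [h|/ltW h] := leP t s.
  rewrite distrC close//; first by move: s1; rewrite distrC ger0_norm ?subr_ge0//; lra.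
  by move: sd; rewrite distrC ger0_norm ?subr_ge0.
by rewrite close ?lerDl//; move: sd; rewrite ger0_norm ?subr_ge0.
Unshelve. all: by end_near. Qed.

(** The singleton at [t] lies in the null set outside which [g] vanishes, and the measures of the
    intervals shrinking to it are increments of [F]. *)
Lemma no_atom (F : cumulative R R) (g : R -> R) (t : R) : 0 < t -> 0 < g t ->
  (forall u, 0 <= u -> 0 <= g u) -> measurable_fun (`[0, +oo[ : set R) g ->
  (\int[ls F]_(u in `[0%R, +oo[) (g u)%:E = 0)%E -> F s @[s --> t^'-] --> F t.
Proof.
move=> t0 gt g0 mg I0; have [N [mN N0 sub]] := ae_eq0_Stieltjes g0 mg I0.
pose A n : set R := `]t - n.+1%:R^-1, t]%classic.
have lsA n : ls F (A n) = (F t - F (t - n.+1%:R^-1))%:E by rewrite ls_itv// gerBl invr_ge0.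
have mt : measurable ([set t] : set (measurableTypeR R)) by exact: measurable_set1.
have At : \bigcap_n A n = [set t].
  apply/seteqP; split => [s As|_ -> n _]; last by rewrite /A/= in_itv/= lexx andbT gtrBl invr_gt0.
  apply/eqP; have := As 0%N I; rewrite /A /= in_itv/= => /andP[_ st]; rewrite eq_le st/= leNgt; apply/negP => lt.
  have d0 : 0 < t - s by rewrite subr_gt0.
  have := As (Num.truncn (t - s)^-1) I; rewrite /A/= in_itv/= => /andP[h _].
  have : (Num.truncn (t - s)^-1).+1%:R^-1 < t - s.
    by rewrite -[ltRHS]invrK ltf_pV2 ?posrE ?invr_gt0// truncnS_gt.
  by move: h; move: (_^-1) => z; lra.
have lst : ls F [set t] = 0%E.
  apply/eqP; rewrite eq_le measure_ge0 andbT -N0; apply: le_measure; rewrite ?inE//.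
  apply: subset_trans sub => _ -> /=; rewrite in_itv/= (ltW t0) => /(_ isT)/eqP.
  by rewrite eqe gt_eqF.
have cA : (ls F \o A) n @[n --> \oo] --> ls F (\bigcap_n A n).
  apply: nonincreasing_cvg_mu; rewrite ?At//.
  - by apply: (@le_lt_trans _ _ (ls F (A 0%N))) => //; rewrite lsA ltry.
  - by move=> n; exact: measurable_itv.
  - move=> n k nk; apply/subsetPset => s; rewrite /A/= !in_itv/= => /andP[h1 ->]; rewrite andbT.
    apply: le_lt_trans h1; rewrite lerD2l lerN2 lef_pV2 ?posrE//.
    by rewrite ler_nat ltnS.
move: cA; rewrite At lst (_ : ls F \o A = EFin \o (fun n => F t - F (t - n.+1%:R^-1))); last exact/funext.
move=> /fine_cvgP[_ /cvgrPdist_lt H]; apply/cvgrPdist_lt => e e0.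
have [n _ /(_ n (leqnn _))] := H e e0; rewrite /= sub0r normrN => Hn.
near=> s; have st : s < t by near: s; exact: nbhs_left_lt.
have sn : t - n.+1%:R^-1 < s by near: s; apply: nbhs_left_gt; rewrite gtrBl invr_gt0.
have F1 : F s <= F t by apply: cumulative_is_nondecreasing; exact: ltW.
have F2 : F (t - n.+1%:R^-1) <= F s by apply: cumulative_is_nondecreasing; exact: ltW.
rewrite ger0_norm ?subr_ge0//; apply: le_lt_trans Hn; apply: le_trans (ler_norm _).
by rewrite lerD2l lerN2.
Unshelve. all: by end_near. Qed.

Variable Rm : 'M[R]_2.
Hypotheses (Rdiag : forall i, 0 < Rm i i)
  (Rdet : forall i, 0 < Rm i i * Rm (rev_ord i) (rev_ord i) - Rm i (rev_ord i) * Rm (rev_ord i) i).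

(** [Rm] has positive principal minors, and such a matrix reverses the signs of no nonzero vector.
    Applied to the vector of jumps of [y]. *)
Lemma complementarity_zero (v : 'I_2 -> R) : (forall i, 0 <= v i) ->
  (forall i, 0 < v i -> Rm i i * v i + Rm i (rev_ord i) * v (rev_ord i) <= 0) -> forall i, v i = 0.
Proof.
move=> v0 H i; apply/eqP; rewrite eq_le v0 andbT leNgt; apply/negP => vi.
have h := H i vi; have hj := H (rev_ord i); rewrite rev_ordK in hj.
have d := Rdet i; have ri := Rdiag i; have rj := Rdiag (rev_ord i).
have := v0 (rev_ord i); rewrite le_eqVlt => /orP[/eqP vj|vj].
  by move: h; rewrite -vj mulr0 addr0 leNgt mulr_gt0.
have {}hj := hj vj; move: h hj d ri rj vi vj.
move: (Rm i i) (Rm i (rev_ord i)) (Rm (rev_ord i) i) (Rm (rev_ord i) (rev_ord i)) (v i) (v (rev_ord i)) => a b c e p q h1 h2 d a0 e0 p0 q0.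
have [b0|b0] := leP 0 b.
  by have := mulr_gt0 a0 p0; have := mulr_ge0 b0 (ltW q0); lra.
have m1 : e * (a * p + b * q) <= 0 by rewrite pmulr_rle0.
have m2 : 0 <= b * (c * p + e * q) by rewrite nmulr_rge0// addrC.
have := mulr_gt0 d p0; have -> : (a * e - b * c) * p = e * (a * p + b * q) - b * (c * p + e * q) by ring.
lra.
Qed.

(* At a jump time of [y], a component of [y] that jumps has its component of [z] at zero, and the value before
  the jump would have to be nonpositive. *)
Lemma reflected_continuous (x y z : R -> 'cV[R]_2) : reflected Rm x y z ->
  (forall i, continuous (fun t : R => x (Num.max 0 t) i 0 : R)) ->
  forall i, continuous (fun t : R => z (Num.max 0 t) i 0 : R).
Proof.
move=> [zxy y0 ymono /choice[F FP]] cx.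
have m0 u : 0 <= Num.max 0 u :> R by rewrite le_max lexx.
pose Z i t := z (Num.max 0 t) i 0; pose X i t := x (Num.max 0 t) i 0.
have ZE i t : Z i t = X i t + (Rm i i * F i t + Rm i (rev_ord i) * F (rev_ord i) t).
  rewrite /Z /X; have [-> _] := zxy _ (m0 t); have [Fi _] := FP i; have [Fj _] := FP (rev_ord i).
  by rewrite mxE mulmx_coord Fi Fj.
have Z0 i t : 0 <= Z i t by have [_] := zxy _ (m0 t); apply.
have mZ i : measurable_fun setT (Z i).
  rewrite (_ : Z i = fun t => X i t + (Rm i i * F i t + Rm i (rev_ord i) * F (rev_ord i) t)); last exact/funext.
  have mF k : measurable_fun setT (F k) by apply: nondecreasing_measurable => //; exact: cumulative_is_nondecreasing.
  apply: measurable_funD; first by apply: continuous_measurable_fun; exact: cx.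
  by apply: measurable_funD; apply: measurable_funM.
have left i t : F i s @[s --> t^'-] --> F i t.
  have [t0|t0] := leP t 0.
    have [FE _] := FP i; apply/cvgrPdist_lt => e e0; near=> s.
    have st : s < t by near: s; exact: nbhs_left_lt.
    by rewrite !FE (max_idPl t0) (max_idPl (le_trans (ltW st) t0)) subrr normr0.
  have /choice[L LP] : forall k, exists l : R, F k s @[s --> t^'-] --> l.
    move=> k; apply/(@cvg_ex R); apply: nondecreasing_at_left_is_cvgr.
      by apply: nearW => u p q _ _ pq; exact: cumulative_is_nondecreasing.
    apply: nearW => u; exists (F k t) => _ [s + <-]; rewrite /= in_itv/= => /andP[_ /ltW st].
    exact: cumulative_is_nondecreasing.
  have LF k : L k <= F k t.
    apply: (cvgr_to_le (LP k)); near=> s; apply: cumulative_is_nondecreasing.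
    by apply: ltW; near: s; exact: nbhs_left_lt.
  have lim k : 0 <= X k t + (Rm k k * L k + Rm k (rev_ord k) * L (rev_ord k)).
    apply: (@cvgr_to_ge _ (t^'-) _ _ (Z k)).
      rewrite (_ : Z k = fun t => X k t + (Rm k k * F k t + Rm k (rev_ord k) * F (rev_ord k) t)); last exact/funext.
      apply: cvgD; first by apply: cvg_at_left_filter; exact: cx.
      by apply: cvgD; apply: cvgM; (exact: cvg_cst || exact: LP).
    exact: nearW.
  suff : F i t - L i = 0 by move/eqP; rewrite subr_eq0 => /eqP ->; exact: LP.
  apply: (@complementarity_zero (fun k => F k t - L k)) => k; first by rewrite subr_ge0.
  move=> dk; have Zt : Z k t = 0.
    apply/eqP; rewrite eq_le Z0 andbT leNgt; apply/negP => Zp.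
    have [FE I0] := FP k; have : F k s @[s --> t^'-] --> F k t.
      apply: (@no_atom _ (Z k)) => //; first exact: measurable_funTS.
      rewrite -[RHS]I0; apply: eq_integral => u; rewrite inE/= in_itv/= andbT => u0.
      by rewrite /Z (max_idPr u0).
    by move=> /(cvg_unique _ (LP k)) E; move: dk; rewrite E// subrr ltxx.
  have := lim k; move: Zt; rewrite ZE; move: (X k t) (Rm _ _) (Rm _ _) => *; lra.
have cF i : continuous (F i).
  by move=> t; apply/left_right_continuousP; split; [exact: left|exact: cumulative_is_right_continuous].
move=> i; rewrite -/(Z i) (_ : Z i = fun t => X i t + (Rm i i * F i t + Rm i (rev_ord i) * F (rev_ord i) t)); last exact/funext.
move=> t; apply: cvgD; first exact: cx.
by apply: cvgD; apply: cvgM; (exact: cvg_cst || exact: cF).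
Unshelve. all: by end_near. Qed.

Lemma continuous_clamp_within (f : R -> R) : continuous (fun t : R => f (Num.max 0 t)) ->
  {within (`[0, +oo[ : set R), continuous f}.
Proof.
move=> cf; apply: (@subspace_eq_continuous _ (`[0, +oo[%classic : set R) _ (fun t : R => f (Num.max 0 t)) f).
  by move=> t; rewrite inE/= in_itv/= andbT => t0; rewrite (max_idPr t0).
exact: continuous_subspaceT.
Qed.
End continuity_of_regulation.

(** A supremum argument. The left end [a] is excluded because it will be the last time at the
    origin, where no local monotonicity is available. *)
Lemma locally_nonincreasing {R : realType} (W : R -> R) (a b : R) :
  (forall u, a < u <= b -> exists2 d, 0 < d & forall s t, a < s -> s <= t -> t <= b ->
    `|s - u| < d -> `|t - u| < d -> W t <= W s) ->
  forall s, a < s <= b -> W b <= W s.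
Proof.
move=> H s /andP[as_ sb].
pose S := [set t | s <= t <= b /\ forall r, s <= r <= t -> W r <= W s].
have Ss : S s by split; [rewrite lexx|move=> r; rewrite -eq_le => /eqP ->].
have hs : has_sup S by split; [exists s|exists b => t [/andP[]]].
have sm : s <= sup S by have := ub_le_sup hs.2 Ss.
have mb : sup S <= b by apply: ge_sup => //; [exists s|move=> t [/andP[]]].
have um : a < sup S <= b by rewrite (lt_le_trans as_ sm).
have [d d0 Hd] := H _ um.
have [t St tm] := sup_adherent d0 hs.
have tm' : t <= sup S by have := ub_le_sup hs.2 St.
have [/andP[st tb] Wt] := St.
pose q := Num.min b (sup S + d / 2).
have Sq : S q.
  split; first by rewrite le_min sb ge_min lexx/= (le_trans sm)// lerDl divr_ge0// ltW.
  move=> r /andP[sr]; rewrite le_min => /andP[rb rq]; have [rt|/ltW tr] := leP r t.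
    by apply: Wt; rewrite sr.
  apply: (le_trans _ (Wt t _)); last by rewrite st lexx.
  apply: Hd => //; first exact: lt_le_trans as_ st.
    by rewrite ltr_norml; apply/andP; split; lra.
  by rewrite ltr_norml; apply/andP; split; lra.
have qm : q <= sup S by have := ub_le_sup hs.2 Sq.
have bq : b <= q.
  by have [h|h] := leP b (sup S + d / 2); move: qm; rewrite /q ?(min_idPl h) ?(min_idPr (ltW h))// => qm; lra.
by case: Sq => _; apply; rewrite sb.
Qed.

(** * Linear functionals of a regulated path against its cost *)

Section lower_bound.
Context {R : realType}.
Variables (Sigma : 'M[R]_2) (mu : 'cV[R]_2) (Rm : 'M[R]_2).
Hypothesis Rdiag : forall i, 0 < Rm i i.
Variables (x y z : R -> 'cV[R]_2) (c : R -> R) (T : R).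
Hypotheses (T0 : 0 <= T) (rf : reflected Rm x y z) (z00 : z 0 = 0)
  (cz : forall i, continuous (fun t : R => z (Num.max 0 t) i 0 : R))
  (c0 : c 0 = 0)
  (cost : forall th s t, 0 <= gamma Sigma mu th -> 0 <= s -> s <= t -> t <= T ->
     dot th (x t) - dot th (x s) <= c t - c s).
Implicit Types (th : 'cV[R]_2) (i : 'I_2).

Let z0 t i : 0 <= t -> 0 <= z t i 0.
Proof. by case: rf => zxy _ _ _ /zxy[_]; apply. Qed.

Let cw i : {within (`[0, +oo[ : set R), continuous (fun t => z t i 0 : R)}.
Proof. exact: continuous_clamp_within (@cz i). Qed.

Lemma cost_nondecreasing s t : 0 <= s -> s <= t -> t <= T -> c s <= c t.
Proof.
move=> s0 st tT; have g0 : 0 <= gamma Sigma mu 0 by rewrite /gamma mulmx0 !dot0r mulr0 oppr0 addr0.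
by have := cost g0 s0 st tT; rewrite !(dotC 0) !dot0r subrr subr_ge0.
Qed.

Lemma regulation_flat i s t : 0 <= s -> s <= t -> (forall u, s < u <= t -> 0 < z u i 0) ->
  y t i 0 = y s i 0.
Proof.
move=> s0 st pos; have [_ _ _ comp] := rf.
apply: (flat_where_positive (comp i)) => //; first by move=> u u0; exact: z0.
exact: within_cy_measurable (@cw i).
Qed.

Lemma regulation_incr th s t : 0 <= s -> 0 <= t -> dot th (z t) - dot th (z s) =
  dot th (x t) - dot th (x s) + \sum_k gamma_ Rm k th * (y t k 0 - y s k 0).
Proof.
move=> s0 t0; have [zxy _ _ _] := rf.
have [-> _] := zxy _ t0; have [-> _] := zxy _ s0.
rewrite !(dotE 0) !mxE !(big_ord2_rev _ 0) /gamma_ !(dotE 0) !mxE /=; ring.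
Qed.

(** Each component of [y] either is flat on the interval or pushes in a direction that [th] does not
    reward. *)
Lemma free_cost th s t : 0 <= gamma Sigma mu th -> 0 <= s -> s <= t -> t <= T ->
  (forall k, gamma_ Rm k th <= 0 \/ forall u, s < u <= t -> 0 < z u k 0) ->
  dot th (z t) - dot th (z s) <= c t - c s.
Proof.
move=> g s0 st tT H; rewrite regulation_incr//; last exact: le_trans st.
apply: (le_trans _ (cost g s0 st tT)); rewrite gerDl; apply: sumr_le0 => k _.
have [_ _ ymono _] := rf.
case: (H k) => [gk|/(regulation_flat s0 st) ->]; last by rewrite subrr mulr0.
by apply: mulr_le0_ge0 => //; rewrite subr_ge0; exact: ymono.
Qed.

(* After its last zero [z_(rev_ord i)] is positive; before it, [th] may be replaced by [th']. *)
Lemma axis_cost i th th' s t : 0 <= s -> s <= t -> t <= T ->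
  (forall u, s < u <= t -> 0 < z u i 0) -> 0 <= gamma Sigma mu th -> 0 <= gamma Sigma mu th' ->
  th' i 0 = th i 0 -> gamma_ Rm (rev_ord i) th' <= 0 ->
  dot th (z t) - dot th (z s) <= c t - c s.
Proof.
move=> s0 st tT pos g g' E gj.
have split_k (P : 'I_2 -> Prop) : P i -> P (rev_ord i) -> forall k, P k.
  by move=> Pi Pj k; have [->//|/ord2_neq ->] := eqVneq k i.
have [lt|le] := ltP (th (rev_ord i) 0) (th' (rev_ord i) 0).
  apply: free_cost => //; apply: split_k; [by right|left].
  apply: le_trans gj; rewrite /gamma_ !(dotE i) !mxE E lerD2l ler_pM2l//; exact: ltW.
have cst a b : 0 <= a -> {within `[a, b], continuous (fun t => z t (rev_ord i) 0 : R)}.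
  by move=> a0; exact: within_cy_sub (@cw _).
have [[u0 u0st zu0]|N] := pselect (exists2 u, s <= u <= t & z u (rev_ord i) 0 = 0); last first.
  apply: free_cost => //; apply: split_k; right => // u /andP[su ut].
  rewrite lt_neqAle z0 ?andbT; last by rewrite (le_trans s0)// ltW.
  by apply/eqP => h; apply: N; exists u => //; rewrite ltW.
have [q /andP[sq qt] [zq qpos]] := last_zero st (cst s t s0) (ex_intro2 _ _ u0 u0st zu0).
have q0 := le_trans s0 sq; have qT := le_trans qt tT.
have h1 : dot th (z t) - dot th (z q) <= c t - c q.
  apply: free_cost => //; apply: split_k; right => u /andP[qu ut].
    by apply: pos; rewrite (le_lt_trans sq)/=.
  by rewrite lt_neqAle z0 ?(le_trans q0 (ltW qu))// andbT eq_sym qpos// qu.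
have h2 : dot th' (z q) - dot th' (z s) <= c q - c s.
  apply: free_cost => //; apply: split_k; [right => u /andP[su uq]|by left].
  by apply: pos; rewrite su (le_trans uq).
have : 0 <= (th (rev_ord i) 0 - th' (rev_ord i) 0) * z s (rev_ord i) 0.
  by rewrite mulr_ge0 ?subr_ge0// z0.
move: h1 h2; rewrite !(dotE i th (z q)) !(dotE i th (z s)) !(dotE i th') zq E mulrBl !mulr0 !addr0.
move: (dot _ _) (th i 0 * z q i 0) (th i 0 * z s i 0) (th (rev_ord i) 0 * _) (th' (rev_ord i) 0 * _) => *; lra.
Qed.

Lemma near_positive i u : 0 <= u -> 0 < z u i 0 ->
  exists2 d, 0 < d & forall s, 0 <= s -> `|s - u| < d -> 0 < z s i 0.
Proof.
move=> u0 zu; have [N H] := within_cy_near (@cw i) u0 (divr_gt0 zu (ltr0n _ 2)).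
exists N.+1%:R^-1; first by rewrite invr_gt0.
move=> s s0 /ltW su; have := H N (leqnn _) s s0 su; rewrite ler_norml => /andP[h _].
by move: h zu; move: (z u i 0) (z s i 0) => *; lra.
Qed.

(** Only the time after the last visit to the origin matters: there [U (z t) - c t] is locally
    nonincreasing, and before it the cost can only have grown. *)
Lemma global_cost (U : 'cV[R]_2 -> R) :
  {within (`[0, +oo[ : set R), continuous (fun t => U (z t))} -> U 0 = 0 ->
  (forall u, 0 < u <= T -> z u != 0 -> exists2 d, 0 < d & forall s t, 0 < s -> s <= t -> t <= T ->
    `|s - u| < d -> `|t - u| < d -> U (z t) - U (z s) <= c t - c s) ->
  U (z T) <= c T.
Proof.
move=> cU U0 H.
pose g t := \sum_i z t i 0.
have g0 t : 0 <= t -> g t = 0 -> z t = 0.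
  move=> t0 gt; apply/colP => i; rewrite mxE; apply/eqP.
  have /eqP := gt; rewrite psumr_eq0 => [/allP/(_ i)|k _]; last exact: z0.
  by rewrite mem_index_enum; apply.
have cg : {within `[0, T], continuous g}.
  apply: within_cy_sub => //; apply: continuous_clamp_within => t.
  by apply: cvg_big; [exact: add_continuous|move=> i _; exact: cz].
have [s0 /andP[s00 s0T] [gs0 pos]] : exists2 t, 0 <= t <= T & g t = 0 /\ forall u, t < u <= T -> g u != 0.
  apply: last_zero => //; exists 0; first by rewrite lexx T0.
  by rewrite /g big1// => i _; rewrite z00 mxE.
have zs0 := g0 _ s00 gs0.
have [->|sT] := eqVneq T s0; first by rewrite zs0 U0 -c0; exact: cost_nondecreasing.
have {}sT : s0 < T by rewrite lt_neqAle eq_sym sT.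
have dec : forall s, s0 < s <= T -> U (z T) - c T <= U (z s) - c s.
  apply: (@locally_nonincreasing _ (fun t => U (z t) - c t)) => u /andP[su uT].
  have u0 : 0 < u by exact: le_lt_trans s00 su.
  have zu : z u != 0.
    by apply: contra_neq (pos u _) => [zu|]; [rewrite /g big1// => i _; rewrite zu mxE|rewrite su].
  have [d d0 Hd] := H u (introT andP (conj u0 uT)) zu; exists d => // s t s0s st tT h1 h2.
  have := Hd s t (le_lt_trans s00 s0s) st tT h1 h2.
  by move: (U (z t)) (U (z s)) (c t) (c s) => *; lra.
apply/ler_addgt0Pr => e e0.
(* [dec] holds strictly after [s0] only; continuity of [U] along the path closes the gap. *)
have [N HN] := within_cy_near cU s00 e0.
pose s := Num.min T (s0 + N.+1%:R^-1).
have n0 : 0 < N.+1%:R^-1 :> R by rewrite invr_gt0.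
have ss0 : s0 < s by rewrite lt_min sT ltrDl.
have sle : s <= s0 + N.+1%:R^-1 by rewrite ge_min lexx orbT.
have sT' : s <= T by rewrite ge_min lexx.
have s_ge0 := le_trans s00 (ltW ss0).
have : `|U (z s) - U (z s0)| <= e.
  by apply: (HN N) => //; rewrite gtr0_norm ?subr_gt0// lerBlDl.
rewrite zs0 U0 subr0 => /(le_trans (ler_norm _)) h.
have := dec s (introT andP (conj ss0 sT')); have := cost_nondecreasing (lexx _) s_ge0 sT'.
by rewrite c0; move: h; move: (U _) (U _) (c _) (c _) => *; lra.
Qed.

Lemma within_dot th : {within (`[0, +oo[ : set R), continuous (fun t => dot th (z t))}.
Proof.
apply: continuous_clamp_within => t; rewrite /dot.
by apply: cvg_big; [exact: add_continuous|move=> i _; apply: cvgM; [exact: cvg_cst|exact: cz]].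
Qed.

Lemma nonzero_coord u : 0 <= u -> z u != 0 -> exists i, 0 < z u i 0.
Proof.
move=> u0 zu; apply: contrapT => N; move/eqP: zu; apply; apply/colP => i; rewrite mxE.
by apply/eqP; rewrite eq_le z0// andbT leNgt; apply/negP => h; apply: N; exists i.
Qed.
End lower_bound.

(** * Lower bounds from single functionals and from minima *)

Section lower_bounds.
Context {R : realType}.
Variables (Sigma : 'M[R]_2) (mu : 'cV[R]_2) (Rm : 'M[R]_2).
Hypotheses (Sigma_sym : Sigma^T = Sigma) (Sigma_pd : positive_definite Sigma)
  (Rdiag : forall i, 0 < Rm i i)
  (Rdet : forall i, 0 < Rm i i * Rm (rev_ord i) (rev_ord i) - Rm i (rev_ord i) * Rm (rev_ord i) i)
  (Rdrift : forall i,
    Rm (rev_ord i) (rev_ord i) * mu i 0 - Rm i (rev_ord i) * mu (rev_ord i) 0 < 0).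
Implicit Types (th : 'cV[R]_2) (i : 'I_2).
Local Notation thG := (theta_Gamma Sigma mu Rm).

Section path.
Variables (x y z : R -> 'cV[R]_2) (c : R -> R) (T : R).
Hypotheses (T0 : 0 <= T) (rf : reflected Rm x y z) (z00 : z 0 = 0)
  (cz : forall i, continuous (fun t : R => z (Num.max 0 t) i 0 : R))
  (c0 : c 0 = 0)
  (cost : forall th s t, 0 <= gamma Sigma mu th -> 0 <= s -> s <= t -> t <= T ->
     dot th (x t) - dot th (x s) <= c t - c s).

Let z0 t i : 0 <= t -> 0 <= z t i 0.
Proof. by case: rf => zxy _ _ _ /zxy[_]; apply. Qed.

Let cT : 0 <= c T.
Proof. by rewrite -c0; exact: (cost_nondecreasing cost (lexx _) T0 (lexx _)). Qed.

(** The witness is the point of the chord from the origin to the corner with the same coordinate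
    [i]; it serves as [th'] in [axis_cost]. *)
Lemma chord_companion th i : 0 < th i 0 < thG i i 0 -> exists th',
  [/\ 0 <= gamma Sigma mu th', th' i 0 = th i 0 & gamma_ Rm (rev_ord i) th' <= 0].
Proof.
have ok := data_ok Sigma_sym Sigma_pd Rdiag Rdet Rdrift i.
have [g0 a0 l20 _ _] := theta_Gamma_corner Sigma_sym Sigma_pd Rdiag Rdet Rdrift i.
set a := thG i i 0 in g0 a0 l20 *; set b := thG i _ 0 in g0 l20 *.
move=> /andP[t0 ta]; pose t := th i 0 / a.
have t01 : 0 <= t <= 1 by rewrite divr_ge0 ?(ltW t0) ?(ltW a0)//= ler_pdivrMr// mul1r ltW.
have [t_ge0 t1] := andP t01.
exists (vec i (t * a) (t * b)); split; last 1 first.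
- rewrite (gamma_jE Sigma Rm mu) vec_l vec_r (_ : l2 _ _ _ = t * l2 (data Sigma Rm mu i) a b) ?mulr_ge0_le0//.
  by rewrite /l2; ring.
- rewrite (gammaE Rm mu Sigma_sym i) vec_l vec_r.
  have := @Gamma_segment R (data Sigma Rm mu i) 0 0 a b t t01; rewrite pg00 g0 => /(_ (lexx _) (lexx _)).
  rewrite !mulr0 !add0r !subr0; apply: le_trans.
  by apply: divr_ge0 => //; apply: mulr_ge0; [apply: mulr_ge0 => //; rewrite subr_ge0|exact: (pq_ge0 ok)].
- by rewrite vec_l /t divfK// gt_eqF.
Qed.

(** With both coordinates positive, either axis has a companion and [global_cost] applies. With only
    coordinate [i] positive, the path is followed from the last zero of [z_i], where the functional
    is nonpositive. *)
Lemma ray_cost th : 0 <= gamma Sigma mu th -> (forall i, th i 0 < thG i i 0) -> dot th (z T) <= c T.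
Proof.
move=> g tha.
have one i : 0 < th i 0 -> th (rev_ord i) 0 <= 0 -> dot th (z T) <= c T.
  move=> ti tj.
  have [th' [g' E gj]] := @chord_companion th i (introT andP (conj ti (tha i))).
  have ci : {within `[0, T], continuous (fun t => z t i 0 : R)}.
    by apply: within_cy_sub => //; exact: continuous_clamp_within (@cz i).
  have [s /andP[s0 sT] [zs pos]] : exists2 t, 0 <= t <= T & z t i 0 = 0 /\ forall u, t < u <= T -> z u i 0 != 0.
    by apply: last_zero => //; exists 0; [rewrite lexx T0|rewrite z00 mxE].
  have := @axis_cost _ _ _ _ Rdiag _ _ _ _ _ rf cz cost i th th' s T s0 sT (lexx _) _ g g' E gj.
  have pos' u : s < u <= T -> 0 < z u i 0.
    move=> /andP[su uT]; rewrite lt_neqAle z0 ?(le_trans s0 (ltW su))// andbT eq_sym pos//.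
    by rewrite su.
  move=> /(_ pos'); rewrite (dotE i th (z s)) zs mulr0 add0r.
  have : th (rev_ord i) 0 * z s (rev_ord i) 0 <= 0 by rewrite mulr_le0_ge0// z0.
  have := cost_nondecreasing cost (lexx _) s0 sT; rewrite c0.
  by move: (dot _ _) (_ * _) (c _) (c _) => *; lra.
have [h0|h0] := ltP 0 (th 0 0); have [h1|h1] := ltP 0 (th (rev_ord 0) 0).
- have pos i : 0 < th i 0 by have [->//|/ord2_neq ->] := eqVneq i 0.
  apply: (@global_cost _ Sigma mu Rm x y z c T T0 rf z00 cz c0 cost (dot th)).
  + exact: (within_dot cz).
  + by rewrite dot0r.
  + move=> u /andP[u0 uT] zu; have [i zi] := nonzero_coord rf (ltW u0) zu.
    have [d d0 Hd] := near_positive cz (ltW u0) zi; exists d => // s t s0 st tT su tu.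
    have [th' [g' E gj]] := @chord_companion th i (introT andP (conj (pos i) (tha i))).
    apply: (@axis_cost _ _ _ _ Rdiag _ _ _ _ _ rf cz cost i th th') => //; first exact: ltW.
    move=> v /andP[sv vt]; apply: Hd; first exact: (le_trans (ltW s0) (ltW sv)).
    by move: su tu; rewrite !ltr_norml => /andP[h2 h3] /andP[h4 h5]; apply/andP; split; lra.
- exact: (one 0).
- by apply: (one (rev_ord 0)) => //; rewrite rev_ordK.
- apply: (le_trans _ cT); rewrite (dotE 0).
  by rewrite -[leRHS]addr0 lerD// mulr_le0_ge0// z0.
Qed.

(** In the interior both functionals minus the cost are nonincreasing, hence so is their minimum.
    Near axis [i] the minimum is attained by [tt i], and this is the one with a companion there. *)
Lemma min_cost (tt : 'I_2 -> 'cV[R]_2) : (forall i, 0 <= gamma Sigma mu (tt i)) ->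
  (forall i, exists th', [/\ 0 <= gamma Sigma mu th', th' i 0 = tt i i 0 & gamma_ Rm (rev_ord i) th' <= 0]) ->
  (forall i, tt i i 0 < tt (rev_ord i) i 0) ->
  Num.min (dot (tt 0) (z T)) (dot (tt (rev_ord 0)) (z T)) <= c T.
Proof.
move=> gt comp cross.
have minE i v : Num.min (dot (tt 0) v) (dot (tt (rev_ord 0)) v) = Num.min (dot (tt i) v) (dot (tt (rev_ord i)) v).
  by have [->//|/ord2_neq ->] := eqVneq i 0; rewrite rev_ordK minC.
apply: (@global_cost _ Sigma mu Rm x y z c T T0 rf z00 cz c0 cost
  (fun v => Num.min (dot (tt 0) v) (dot (tt (rev_ord 0)) v))).
- apply: continuous_clamp_within => t.
  have cd k : continuous (fun t : R => dot (tt k) (z (Num.max 0 t)) : R^o).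
    by move=> {}t; rewrite /dot /continuous_at; apply: cvg_big; [exact: add_continuous|move=> i _; apply: cvgM; [exact: cvg_cst|exact: cz]].
  exact: (continuous_min (cd 0 t) (cd (rev_ord 0) t)).
- by rewrite !dot0r minxx.
move=> u /andP[u0 uT] zu; have [i zi] := nonzero_coord rf (ltW u0) zu.
have [d d0 Hd] := near_positive cz (ltW u0) zi.
have between s t v d' : `|s - u| < d' -> `|t - u| < d' -> s < v <= t -> `|v - u| < d'.
  by rewrite !ltr_norml => /andP[h2 h3] /andP[h4 h5] /andP[h6 h7]; apply/andP; split; lra.
have := z0 (rev_ord i) (ltW u0); rewrite le_eqVlt => /orP[/eqP zj|zj]; last first.
  have [d' d'0 Hd'] := near_positive cz (ltW u0) zj.
  exists (Num.min d d'); first by rewrite lt_min d0.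
  move=> s t s0 st tT; rewrite !lt_min => /andP[su su'] /andP[tu tu'].
  have free k : dot (tt k) (z t) - dot (tt k) (z s) <= c t - c s.
    apply: (free_cost rf cz cost) => //; first exact: ltW.
    move=> k'; right => v svt; have v0 : 0 <= v by case/andP: svt => sv _; exact: (le_trans (ltW s0) (ltW sv)).
    by have [->|/ord2_neq ->] := eqVneq k' i; [apply: Hd|apply: Hd'] => //; exact: between svt.
  move: (free 0) (free (rev_ord 0)); rewrite /Num.min.
  by move: (dot _ (z t)) (dot _ (z t)) (dot _ (z s)) (dot _ (z s)) => p q p' q' h1 h2; do 2 case: ltP => ?; lra.
(* Positive at [z u], hence nonnegative nearby, which identifies the minimum. *)
pose th := tt (rev_ord i) - tt i.
have thu : 0 < dot th (z u).
  by rewrite (dotE i) -zj mulr0 addr0 mulr_gt0// /th !mxE subr_gt0.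
have wd : {within (`[0, +oo[ : set R), continuous (fun t => dot th (z t))} by exact: within_dot.
have [N HN] := within_cy_near (@wd) (ltW u0) (divr_gt0 thu (ltr0n _ 2)).
exists (Num.min d N.+1%:R^-1); first by rewrite lt_min d0 invr_gt0 ltr0n.
move=> s t s0 st tT; rewrite !lt_min => /andP[su su'] /andP[tu tu'].
have lt v : 0 <= v -> `|v - u| < N.+1%:R^-1 -> dot (tt i) (z v) <= dot (tt (rev_ord i)) (z v).
  move=> v0 /ltW vu; have := HN N (leqnn _) v v0 vu; rewrite ler_norml => /andP[h _].
  have : 0 <= dot th (z v) by move: h thu; move: (dot th _) (dot th _) => *; lra.
  by rewrite /th dotC dotBr subr_ge0 !(dotC (z v)).
rewrite !(minE i) !(min_idPl _) ?lt// ?(ltW s0)//; last exact: (le_trans (ltW s0) st).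
have [th' [g' E gj]] := comp i.
apply: (@axis_cost _ _ _ _ Rdiag _ _ _ _ _ rf cz cost i (tt i) th') => //; first exact: ltW.
move=> v svt; apply: Hd; first by case/andP: svt => sv _; exact: (le_trans (ltW s0) (ltW sv)).
exact: between svt.
Qed.
End path.

Lemma value_function_ge (v : 'cV[R]_2) (K : R) :
  (forall (x y z : R -> 'cV[R]_2) (c : R -> R) (T : R), 0 <= T -> reflected Rm x y z -> z 0 = 0 ->
    (forall i, continuous (fun t : R => z (Num.max 0 t) i 0 : R)) -> c 0 = 0 ->
    (forall th s t, 0 <= gamma Sigma mu th -> 0 <= s -> s <= t -> t <= T ->
      dot th (x t) - dot th (x s) <= c t - c s) -> z T = v -> K <= c T) ->
  (K%:E <= value_function Sigma mu Rm v)%E.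
Proof.
move=> H; apply: le_ereal_inf_tmp => _ [T /= T0 <-]; apply: le_ereal_inf_tmp => _ [x [hx [z [reg zT]]] <-].
have [aoo|aoo] := ltP (action Sigma mu T x) +oo%E; last by apply: le_trans aoo; exact: leey.
have [c [c0 cT cost]] := action_cost Sigma_sym Sigma_pd T0 hx aoo.
apply: (le_trans _ cT); rewrite lee_fin.
have [_ _ [y rf]] := reg; have [x00 acx _] := hx; have [zxy y0 _ _] := rf.
apply: (H x y z c T) => //.
  by have [-> _] := zxy 0 (lexx _); rewrite x00 y0 mulmx0 addr0.
apply: (reflected_continuous Rdiag Rdet rf) => i.
by apply: (@ac_continuous _ (fun t => x t i 0)) => S S0; apply: ac_real_coord; exact: acx.
Qed.
End lower_bounds.

(** * Upper bounds for the value function *)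

Section ramp.
Context {R : realType}.
Implicit Types (a L s t : R).

(** Time spent in [[a, a + L]] up to [s]: a path with constant velocities on successive pieces is a
    linear combination of ramps. *)
Definition ramp a L s : R := Num.min (Num.max 0 (s - a)) L.

Lemma rampP a L s : 0 <= L -> [\/ s <= a /\ ramp a L s = 0,
  a <= s <= a + L /\ ramp a L s = s - a | a + L <= s /\ ramp a L s = L].
Proof.
move=> L0; rewrite /ramp /Num.max; case: (ltP 0 (s - a)) => h; rewrite /Num.min; case: ltP => k.
- by apply: Or32; split => //; apply/andP; split; lra.
- by apply: Or33; split => //; lra.
- by apply: Or31; split => //; lra.
- by apply: Or31; split; lra.
Qed.

Lemma ramp_head a L s : 0 <= L -> s <= a -> ramp a L s = 0.
Proof. by move=> L0 sa; rewrite /ramp (max_idPl _) ?subr_le0// (min_idPl L0). Qed.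

Lemma ramp_tail a L s : 0 <= L -> a + L <= s -> ramp a L s = L.
Proof.
move=> L0 sa; rewrite /ramp; have h : L <= s - a by rewrite lerBrDl.
by rewrite (max_idPr (le_trans L0 h)) (min_idPr h).
Qed.

Lemma ramp_bound a L s : 0 <= L -> 0 <= ramp a L s <= L.
Proof. by move=> L0; rewrite le_min le_max lexx L0 ge_min lexx orbT. Qed.

Lemma ramp_incr a L s t : 0 <= L -> s <= t -> 0 <= ramp a L t - ramp a L s <= t - s.
Proof.
move=> L0 st; apply/andP.
case: (rampP a s L0) => -[+ ->]; case: (rampP a t L0) => -[+ ->].
all: by try move=> /andP[? ?]; try move=> ?; try move=> /andP[? ?]; try move=> ?; split; lra.
Qed.

Lemma continuous_ramp a L : continuous (ramp a L).
Proof.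
move=> t; apply: (@continuous_min R R (fun s => Num.max 0 (s - a)) (cst L)); last exact: cvg_cst.
apply: (@continuous_max R R (cst 0) (fun s => s - a)); first exact: cvg_cst.
by apply: cvgB; [exact: cvg_id|exact: cvg_cst].
Qed.

Lemma is_derive_ramp a L t : 0 <= L -> t != a -> t != a + L ->
  is_derive t 1 (ramp a L) (a < t < a + L)%R%:R.
Proof.
move=> L0 ta taL; have [h|h|/eqP] := ltgtP t a; last by rewrite (negbTE ta).
  apply: (@near_eq_is_derive R R^o R^o (cst 0)).
  near=> s; have : s < a by near: s; exact: lt_nbhsl.
  by case: (rampP a s L0) => -[+ ->]//; [move=> /andP[? ?] ?; lra|rewrite /cst; lra].
have [k|k|/eqP] := ltgtP t (a + L); last by rewrite (negbTE taL).
  apply: (@near_eq_is_derive R R^o R^o (id - cst a)); last by apply: is_derive_eq; rewrite subr0.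
  near=> s; have sa : a < s by near: s; exact: lt_nbhsr.
  have sL : s < a + L by near: s; exact: lt_nbhsl.
  by rewrite !fctE; case: (rampP a s L0) => -[+ ->]//; lra.
apply: (@near_eq_is_derive R R^o R^o (cst L)).
near=> s; have : a + L < s by near: s; exact: lt_nbhsr.
by case: (rampP a s L0) => -[+ ->]//; [rewrite /cst; lra|move=> /andP[? ?] ?; lra].
Unshelve. all: by end_near. Qed.
End ramp.

Section constant_tail.
Context {R : realType}.
Variables (f : R -> R).
Hypotheses (ndf : {homo f : s t / s <= t}) (rcf : right_continuous f).
HB.instance Definition _ := isCumulative.Build R _ R f ndf rcf.
Let F : cumulative R R := f.

Lemma stieltjes_integral_eq0_tail (g h : R -> R) (a : R) : 0 <= a -> (forall t, f t = h (Num.max 0 t)) ->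
  measurable_fun setT g -> (forall t, 0 <= t -> t <= a -> g t = 0) -> (forall t, a <= t -> f t = f a) ->
  stieltjes_integral_eq0 g h.
Proof.
move=> a0 fh mg ga fa; exists F; split => //.
pose N : set R := \bigcup_n `]a, a + n%:R]%classic.
have mN : measurable (N : set (measurableTypeR R)) by apply: bigcupT_measurable => n; exact: measurable_itv.
have N0 : lebesgue_stieltjes_measure F N = 0%E.
  apply/eqP; rewrite eq_le measure_ge0 andbT.
  apply: (le_trans (generalized_Boole_inequality _ _ mN)) => /=; first by move=> n; exact: measurable_itv.
  rewrite eseries0// => n _ _; rewrite ls_itv ?lerDl// (_ : F (a + n%:R) = F a) ?subrr//.
  by apply: fa; rewrite lerDl.
rewrite -[RHS](@integral0 _ _ _ (lebesgue_stieltjes_measure F) (`[0%R, +oo[%classic)).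
apply: ae_eq_integral => //.
  by apply: measurable_funTS; exact/measurable_EFinP.
exists N; split => // t /= H; apply: contrapT => tN; apply: H; rewrite in_itv/= andbT => t0.
have [ta|at_] := leP t a; first by rewrite ga.
exfalso; apply: tN; exists (Num.truncn (t - a)).+1 => //=; rewrite in_itv/= at_/=.
by rewrite -lerBlDl ltW// truncnS_gt.
Qed.
End constant_tail.

Section finite_exceptions.
Context {R : realType}.

(** For the derivative of a two-piece path, whose values at the break points are not computed. *)
Lemma measurable_fun_except (a b c : R) (f g : R -> R) : measurable_fun setT g ->
  (forall t, t != a -> t != b -> t != c -> f t = g t) -> measurable_fun setT f.
Proof.
move=> mg fg; rewrite (_ : f = fun t => if t == a then f a else if t == b then f b else if t == c then f c else g t).
  by do 3 (apply: measurable_fun_ifT => //; first exact: measurable_fun_eqr).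
apply/funext => t; case: eqVneq => [->//|ta]; case: eqVneq => [->//|tb]; case: eqVneq => [->//|tc].
exact: fg.
Qed.
End finite_exceptions.

(** * Two-piece paths and their cost *)

Section two_pieces.
Context {R : realType}.
Variables (Sigma : 'M[R]_2) (mu : 'cV[R]_2) (Rm : 'M[R]_2).
Variables (i : 'I_2) (T1 T2 eta : R) (u1 u2 : 'cV[R]_2).
Let j := rev_ord i.
(** Velocity of [z] on the first piece: regulation at rate [eta] cancels the component of [u1]
    across axis [i]. *)
Let w := u1 + eta *: col j Rm.
Let v := T1 *: w + T2 *: u2.
Hypotheses (T10 : 0 <= T1) (T20 : 0 <= T2) (eta0 : 0 <= eta) (wi : 0 <= w i 0) (wj : w j 0 = 0)
  (v0 : nonneg_vec v) (Sigma_sym : Sigma^T = Sigma) (Sigma_pd : positive_definite Sigma).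

Let m1 := ramp 0 T1.
Let m2 := ramp T1 T2.
Let x t := m1 t *: u1 + m2 t *: u2.
Let z t := m1 t *: w + m2 t *: u2.
Let y t := m1 t *: (eta *: delta_mx j 0) : 'cV[R]_2.
Let T := T1 + T2.

Let m1_tail t : T1 <= t -> m1 t = T1.
Proof. by move=> h; apply: ramp_tail; rewrite ?add0r. Qed.

Let m2_head t : t <= T1 -> m2 t = 0.
Proof. exact: ramp_head. Qed.

Let m1_ge0 t : 0 <= m1 t.
Proof. by have /andP[] := ramp_bound 0 t T10. Qed.

Let m2_ge0 t : 0 <= m2 t <= T2.
Proof. exact: ramp_bound. Qed.

Let m1_0 : m1 0 = 0.
Proof. exact: ramp_head. Qed.

Let w_ge0 k : 0 <= w k 0.
Proof. by have [->//|/ord2_neq ->] := eqVneq k i; rewrite wj. Qed.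

Let zT : z T = v.
Proof.
rewrite /z m1_tail ?lerDl// (_ : m2 T = T2)//; exact: ramp_tail.
Qed.

Let z_ge0 t : nonneg_vec (z t).
Proof.
move=> k; rewrite /z !mxE; have [h|/ltW h] := leP t T1.
  by rewrite m2_head// mul0r addr0 mulr_ge0//; have := w_ge0 k; rewrite /w !mxE.
(* On the second piece each coordinate moves linearly from [T1 *: w] to [v], and a decreasing one is
   smallest at the end. *)
rewrite m1_tail//; have /andP[h1 h2] := m2_ge0 t.
have := v0 k; rewrite /v !mxE; have := w_ge0 k; rewrite /w !mxE; set W := _ + _ => W0 V0.
have [u0|u0] := leP 0 (u2 k 0); first by rewrite addr_ge0// mulr_ge0.
apply: (le_trans V0); rewrite lerD2l ler_nM2r//.
Qed.

Let zE t : z t = x t + Rm *m y t.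
Proof.
rewrite /z /x /y -!scalemxAr -colE /w scalerDr -!addrA; congr (_ + _).
by rewrite addrC.
Qed.

Let continuous_z k : continuous (fun t : R => z t k 0 : R).
Proof.
move=> t; rewrite (_ : (fun t : R => z t k 0 : R) = fun t => m1 t * w k 0 + m2 t * u2 k 0); last first.
  by apply/funext => s; rewrite !mxE.
by apply: cvgD; apply: cvgM; (exact: cvg_cst || exact: continuous_ramp).
Qed.

Lemma rcll_of_continuous (p : R -> 'cV[R]_2) : continuous p -> rcll p.
Proof.
move=> cp; split => t _; first exact: (cvg_at_right_filter (cp t)).
by apply/cvg_ex; exists (p t); exact: (cvg_at_left_filter (cp t)).
Qed.

Let cont_scale (a b : 'cV[R]_2) : continuous (fun t : R => m1 t *: a + m2 t *: b).
Proof. by move=> t; apply: cvgD; apply: cvgZr_tmp; exact: continuous_ramp. Qed.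

Let regulation_xz : regulation Rm x z.
Proof.
split; [exact/rcll_of_continuous/cont_scale|exact/rcll_of_continuous/cont_scale|exists y; split].
- by move=> t _; split; [exact: zE|exact: z_ge0].
- by rewrite /y m1_0 scale0r.
- move=> k s t s0 st; rewrite !mxE ler_wpM2r ?mulr_ge0//.
  by have := ramp_incr 0 T10 st; rewrite subr_ge0 => /andP[].
- move=> k; have mz : measurable_fun setT (fun t => z t k 0 : R).
    by apply: continuous_measurable_fun; exact: continuous_z.
  pose e := eta * (delta_mx j 0 : 'cV[R]_2) k 0.
  have e0 : 0 <= e by rewrite mulr_ge0// mxE.
  pose f t := m1 t * e.
  have ndf : {homo f : s t / s <= t}.
    by move=> s t st; rewrite ler_wpM2r//; have := ramp_incr 0 T10 st; rewrite subr_ge0 => /andP[].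
  have rcf : right_continuous f.
    by apply: right_continuousW => t; apply: cvgM; [exact: continuous_ramp|exact: cvg_cst].
  have fh t : f t = y (Num.max 0 t) k 0.
    rewrite /f /y !mxE /e mxE; congr (_ * _); rewrite /m1 /ramp !subr0.
    by rewrite maxA maxxx.
  have [ki|/ord2_neq kj] := eqVneq k i.
    have e00 : e = 0 by rewrite /e mxE ki /j eq_sym (negbTE (neq_rev_ord i)) mulr0.
    apply: (stieltjes_integral_eq0_tail ndf rcf (lexx _)) => //; last by move=> t _; rewrite /f e00 !mulr0.
    by move=> t t0 t0'; have -> : t = 0 by [lra]; rewrite /z m1_0 m2_head// !scale0r addr0 mxE.
  apply: (stieltjes_integral_eq0_tail ndf rcf T10) => //; last by move=> t tT; rewrite /f !m1_tail.
  by move=> t t0 tT; rewrite /z m2_head// scale0r addr0 mxE kj wj mulr0.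
Qed.

Let derive_x t : t != 0 -> t != T1 -> t != T ->
  derive1 x t = (0 < t < T1)%R%:R *: u1 + (T1 < t < T)%R%:R *: u2.
Proof.
move=> t0 t1 tT; apply: is_derive_coord => k.
have d1 : is_derive t 1 m1 (0 < t < T1)%R%:R.
  by have := @is_derive_ramp _ 0 T1 t T10; rewrite add0r; apply.
have d2 : is_derive t 1 m2 (T1 < t < T)%R%:R by exact: is_derive_ramp.
rewrite (_ : (fun s : R => x s k 0 : R) = u1 k 0 *: (m1 : R -> R^o) + u2 k 0 *: (m2 : R -> R^o)); last first.
  by apply/funext => s; rewrite !mxE/= ![_ * u1 _ _]mulrC ![_ * u2 _ _]mulrC.
by apply: is_derive_eq; rewrite !mxE/= mulrC [u2 _ _ *: _]mulrC.
Qed.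

Let step (phi : 'cV[R]_2 -> R) t := if 0 < t < T1 then phi u1 else if T1 < t < T then phi u2 else phi 0.

Let step_derive phi t : t != 0 -> t != T1 -> t != T -> phi (derive1 x t) = step phi t.
Proof.
move=> t0 t1 tT; rewrite derive_x// /step.
have [/andP[h1 h2]|_] := boolP (0 < t < T1).
  by rewrite ltNge (ltW h2)/= scale0r addr0 scale1r.
by rewrite scale0r add0r; case: ifP => _; rewrite ?scale1r ?scale0r.
Qed.

Let measurable_step phi : measurable_fun setT (step phi).
Proof.
apply: measurable_fun_ifT => //; first by apply: measurable_and; exact: measurable_fun_ltr.
by apply: measurable_fun_ifT => //; apply: measurable_and; exact: measurable_fun_ltr.
Qed.

Let measurable_derive phi : measurable_fun setT (fun t => phi (derive1 x t) : R).
Proof.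
by apply: (@measurable_fun_except _ 0 T1 T _ (step phi)) => //; exact: step_derive.
Qed.

Let ae_step phi D : ae_eq (@lebesgue_measure R) D (fun t => (phi (derive1 x t))%:E) (fun t => (step phi t)%:E).
Proof.
have ne (a : R) : {ae (@lebesgue_measure R), forall t, t != a}.
  exists [set a]; split => //; first by rewrite [LHS]lebesgue_measure_set1.
  by move=> t /= /negP; rewrite negbK => /eqP.
apply: (ae_imp2 _ (ae_imp2 (fun t => @conj _ _) (ne 0) (ne T1)) (ne T)) => t [t0 t1] tT _.
by congr EFin; exact: step_derive.
Qed.

Let calH_x : calH x.
Proof.
split.
- by rewrite /x m1_0 m2_head// !scale0r addr0.
- move=> S S0 e e0; pose K : R := `|u1| + `|u2| + 1.
  have K0 : 0 < K by rewrite ltr_wpDl// addr_ge0.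
  exists (e / K); first exact: divr_gt0.
  move=> n s t H _; rewrite ltr_pdivlMr//; apply: le_lt_trans; rewrite mulr_suml; apply: ler_sum => k _.
  have [_ st _] := H k; have /andP[h1 h2] := ramp_incr 0 T10 st; have /andP[h3 h4] := ramp_incr T1 T20 st.
  have -> : x (t k) - x (s k) = (m1 (t k) - m1 (s k)) *: u1 + (m2 (t k) - m2 (s k)) *: u2.
    by rewrite /x !scalerBl opprD addrACA.
  apply: (le_trans (ler_normD _ _)); rewrite !normrZ !ger0_norm// /K !mulrDr mulr1.
  apply: ler_wpDr; first by rewrite subr_ge0.
  by apply: lerD; apply: ler_wpM2r.
- move=> S S0; pose phi (u : 'cV[R]_2) := dot u u.
  have mphi : measurable_fun (`[0, S] : set R) (fun t => (phi (derive1 x t))%:E).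
    by apply: measurable_funTS; exact/measurable_EFinP.
  apply/integrableP; split => //.
  have phi0 u : 0 <= phi u by rewrite /phi (dotE 0) addr_ge0// -expr2 sqr_ge0.
  pose K := phi u1 + phi u2 + phi 0.
  have -> : (\int[@lebesgue_measure R]_(t in `[0%R, S]) `|(phi (derive1 x t))%:E| =
      \int[@lebesgue_measure R]_(t in `[0%R, S]) (step phi t)%:E)%E.
    transitivity (\int[@lebesgue_measure R]_(t in `[0%R, S]) (phi (derive1 x t))%:E)%E.
      by apply: eq_integral => t _ /=; rewrite ger0_norm// phi0.
    apply: ae_eq_integral; [exact: measurable_itv|exact: mphi| |exact: ae_step].
    by apply: measurable_funTS; apply/measurable_EFinP; exact: measurable_step.
  apply: (@le_lt_trans _ _ (\int[@lebesgue_measure R]_(t in `[0%R, S]) (cst K%:E) t)%E).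
    apply: ge0_le_integral => //.
    + by move=> t _; rewrite lee_fin /step; case: ifP => _ //; case: ifP.
    + by apply: measurable_funTS; apply/measurable_EFinP; exact: measurable_step.
    + by move=> t _; rewrite lee_fin /step /K; have := phi0 u1; have := phi0 u2; have := phi0 0;
        case: ifP => _; [|case: ifP => _]; lra.
  by rewrite integral_cst//= lebesgue_measure_itv/= lte_fin; case: ifP => _; rewrite ?mule0 ?ltry// -EFinD -EFinM ltry.
Qed.

Let action_x : action Sigma mu T x = (T1 * rate Sigma mu u1 + T2 * rate Sigma mu u2)%:E.
Proof.
pose psi u := dot (u - mu) (invmx Sigma *m (u - mu)).
have psi0 u : 0 <= psi u by have := rate_ge0 mu Sigma_sym Sigma_pd u; rewrite /rate pmulr_rge0.
pose g t := if t < T1 then psi u1 else psi u2.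
have mg D : measurable_fun D (fun t => (g t)%:E).
  by apply: measurable_funTS; apply/measurable_EFinP; apply: measurable_fun_ifT => //; exact: measurable_fun_ltr.
have g0 t : (0 <= (g t)%:E)%E by rewrite lee_fin /g; case: ifP.
rewrite /action -/psi.
have -> : (\int[@lebesgue_measure R]_(t in `[0%R, T]) (psi (derive1 x t))%:E =
   \int[@lebesgue_measure R]_(t in `[0%R, T]) (g t)%:E)%E.
  apply: ae_eq_integral; [exact: measurable_itv| |exact: mg|].
    by apply: measurable_funTS; apply/measurable_EFinP; exact: measurable_derive.
  have ne (a : R) : {ae (@lebesgue_measure R), forall t, t != a}.
    exists [set a]; split => //; first by rewrite [LHS]lebesgue_measure_set1.
    by move=> t /= /negP; rewrite negbK => /eqP.
  apply: (ae_imp2 _ (ae_imp2 (fun t => @conj _ _) (ne 0) (ne T1)) (ne T)) => t [t0 t1] tT.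
  rewrite /= in_itv/= => /andP[t0' tT']; congr EFin; rewrite step_derive// /step /g.
  rewrite lt_neqAle eq_sym t0 t0'/=; case: ltP => // t1'.
  by rewrite lt_neqAle eq_sym t1 t1'/= lt_neqAle tT tT'.
have -> : `[0, T]%classic = (`[0, T1[ `|` `[T1, T])%classic :> set R.
  by apply: itv_bndbnd_setU; rewrite bnd_simp// lerDl.
rewrite ge0_integral_setU//; last first.
  by apply/disj_setPS => r [] /=; rewrite !in_itv/= => /andP[_ r1] /andP[r2 _]; lra.
  exact: mg.
have -> : (\int[@lebesgue_measure R]_(t in `[0%R, T1[) (g t)%:E = (psi u1 * T1)%:E)%E.
  transitivity (\int[@lebesgue_measure R]_(t in `[0%R, T1[) (cst (psi u1)%:E) t)%E.
    by apply: eq_integral => t; rewrite inE/= in_itv/= /g => /andP[_ ->].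
  rewrite integral_cst//= lebesgue_measure_itv/= lte_fin; case: ltP => h; first by rewrite oppr0 addr0 -EFinM.
  by have -> : T1 = 0 by [apply/eqP; rewrite eq_le h T10]; rewrite mule0 mulr0.
have -> : (\int[@lebesgue_measure R]_(t in `[T1, T]) (g t)%:E = (psi u2 * T2)%:E)%E.
  transitivity (\int[@lebesgue_measure R]_(t in `[T1, T]) (cst (psi u2)%:E) t)%E.
    by apply: eq_integral => t; rewrite inE/= in_itv/= /g => /andP[h _]; rewrite ltNge h.
  rewrite integral_cst//= lebesgue_measure_itv/= lte_fin /T; case: ltP => h; first by rewrite -EFinB -EFinM; congr (_ * _)%:E; ring.
  by have -> : T2 = 0 by [apply/eqP; rewrite eq_le T20 -(gerDl T1) h]; rewrite mule0 mulr0.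
by rewrite -EFinD -EFinM /rate -/(psi u1) -/(psi u2); congr EFin; ring.
Qed.

(** Durations may be zero, so straight rays and the empty path are instances. *)
Lemma two_piece_bound : (value_function Sigma mu Rm v <= (T1 * rate Sigma mu u1 + T2 * rate Sigma mu u2)%:E)%E.
Proof.
rewrite -action_x; apply: ge_ereal_inf; exists (ereal_inf [set action Sigma mu T x | x in
      [set x | calH x /\ exists z, regulation Rm x z /\ z T = v]]).
  by exists T => //=; rewrite addr_ge0.
by apply: ereal_inf_lbound; exists x => //; split; [exact: calH_x|exists z; split; [exact: regulation_xz|exact: zT]].
Qed.
End two_pieces.

Section planar_facts.
Context {R : realType}.
Variables (D : @planar_data R).
Hypothesis ok : planar_ok D.

Lemma pg_vertical a y z : pg D a y = 0 ->
  pg D a z = s2 D / 2 * (z - y) * (y + 2 * pgy D a y / s2 D - z).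
Proof.
move=> g; have s20 : s2 D != 0 by rewrite gt_eqF// (ok_s2 ok).
have -> : pg D a z = pg D a y + pgy D a y * (z - y) - s2 D / 2 * (z - y) ^+ 2 by rewrite /pg /pgy; field.
by rewrite g; field.
Qed.

(** If [pgy] vanished, the corner would be the rightmost point and nothing of the closed region
    would lie beyond it. *)
Lemma corner_pgy_gt0 a y x' y' : corner D a y -> 0 <= pg D x' y' -> a < x' \/ (a <= x' /\ 0 < pg D x' y') ->
  0 < pgy D a y.
Proof.
move=> C g H; have [g0 a0 _ gy0 _] := C; rewrite lt_neqAle gy0 andbT eq_sym; apply/negP => /eqP gy.
have gx := corner_max ok C gy; have := pgB D a y x' y'; rewrite gy mul0r addr0.
move=> E0; have E := pgD D a y (x' - a) (y' - y); rewrite g0 gy mul0r addr0 add0r !subrKC in E.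
have q := pq_ge0 ok (x' - a) (y' - y).
have m : pgx D a y * (x' - a) <= 0.
  by apply: mulr_le0_ge0; [exact: ltW|rewrite subr_ge0; case: H => [/ltW|[]]].
case: H => [ax|[ax gp]].
  have : pgx D a y * (x' - a) < 0 by rewrite nmulr_rlt0// subr_gt0.
  by move: E g; move: (pq _ _ _) q (pgx _ _ _ * _) (pg _ _ _) => u ? v w *; lra.
by move: E gp m q; move: (pq _ _ _) (pgx _ _ _ * _) (pg _ _ _) => u v w *; lra.
Qed.

Lemma above_corner a y x' y' : corner D a y -> 0 < y -> 0 < pgy D a y -> 0 <= pg D x' y' -> a < x' -> y < y'.
Proof.
move=> [g0 a0 _ _ _] y0 gy g ax; rewrite ltNge; apply/negP => y'y.
have E := pgD D a y (x' - a) (y' - y); rewrite g0 add0r !subrKC in E.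
have q := pq_ge0 ok (x' - a) (y' - y); have T := toward_origin g0; have q0 := pq_ge0 ok a y.
have h1 : pgy D a y * (y' - y) <= 0 by rewrite mulr_ge0_le0// ?subr_le0// ltW.
have h2 : 0 <= pgx D a y * (x' - a).
  by move: E g h1 q; move: (pq _ _ _) (_ * _) (_ * _) (pg _ _ _) => *; lra.
have gx : 0 <= pgx D a y by move: h2; rewrite pmulr_lge0// subr_gt0.
have h3 := mulr_ge0 gx (ltW a0); have h4 := mulr_gt0 gy y0.
by move: T q0 h3 h4; move: (pq _ _ _) (_ * _) (_ * _) => *; lra.
Qed.
End planar_facts.

(** * Upper bounds, and the formula for the value function *)

Section upper_bounds.
Context {R : realType}.
Variables (Sigma Rm : 'M[R]_2) (mu : 'cV[R]_2).
Hypotheses (Sigma_sym : Sigma^T = Sigma) (Sigma_pd : positive_definite Sigma)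
  (Rdiag : forall i, 0 < Rm i i)
  (Rdet : forall i, 0 < Rm i i * Rm (rev_ord i) (rev_ord i) - Rm i (rev_ord i) * Rm (rev_ord i) i)
  (Rdrift : forall i,
    Rm (rev_ord i) (rev_ord i) * mu i 0 - Rm i (rev_ord i) * mu (rev_ord i) 0 < 0).
Implicit Types (th v p : 'cV[R]_2) (i : 'I_2).
Local Notation thG := (theta_Gamma Sigma mu Rm).
Local Notation D i := (data Sigma Rm mu i).
Let ok i : planar_ok (D i). Proof. exact: data_ok. Qed.
Let a i := thG i i 0.
Let b i := thG i (rev_ord i) 0.
Let C i : corner (D i) (a i) (b i). Proof. exact: theta_Gamma_corner. Qed.
(** By [pg_vertical], the other ordinate of the ellipse at the abscissa of the corner; [tilde i] is
    the point there. *)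
Let bt i := b i + 2 * pgy (D i) (a i) (b i) / s2 (D i).
Let tilde i := vec i (a i) (bt i).
Let VF v := value_function Sigma mu Rm v.
Let gE i th : gamma Sigma mu th = pg (D i) (th i 0) (th (rev_ord i) 0). Proof. exact: gammaE. Qed.
Let a0 i : 0 < a i. Proof. by case: (C i). Qed.
Let g0 i : pg (D i) (a i) (b i) = 0. Proof. by case: (C i). Qed.

Lemma velocity_i i th : (mu + Sigma *m th) i 0 = - pgx (D i) (th i 0) (th (rev_ord i) 0).
Proof. by rewrite !mxE (big_ord2_rev _ i) /pgx/=; ring. Qed.

Lemma velocity_j i th : (mu + Sigma *m th) (rev_ord i) 0 = - pgy (D i) (th i 0) (th (rev_ord i) 0).
Proof. by rewrite !mxE (big_ord2_rev _ i) /pgy/= (Sigma_symE Sigma_sym (rev_ord i) i); ring. Qed.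

Lemma rate_ellipse th : gamma Sigma mu th = 0 -> rate Sigma mu (mu + Sigma *m th) = dot th (mu + Sigma *m th).
Proof. by rewrite rate_mul// dotDr /gamma (dotC mu); move: (dot _ _) (dot _ _) => *; lra. Qed.

Lemma tilde_gamma i : gamma Sigma mu (tilde i) = 0.
Proof. by rewrite (gE i) vec_l vec_r (pg_vertical (ok i) _ (g0 i)) subrr mulr0. Qed.

(* The first piece follows the boundary at the velocity conjugate to the corner, the second crosses the interior
  at the velocity conjugate to the opposite point of the ellipse. *)
Lemma path_bound i v p : nonneg_vec v -> 0 < pgy (D i) (a i) (b i) -> 0 <= gamma Sigma mu p -> a i < p i 0 ->
  dot v (tilde i) <= dot v p -> (VF v <= (dot v (tilde i))%:E)%E.
Proof.
move=> v0 gy gp ap vp; set j := rev_ord i.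
have p22 : 0 < Rm j j := Rdiag j.
have s20 := ok_s2 (ok i).
pose tc := vec i (a i) (b i).
have gtc : gamma Sigma mu tc = 0 by rewrite (gE i) vec_l vec_r.
pose u1 := mu + Sigma *m tc; pose u2 := mu + Sigma *m tilde i.
(* Cancels the component [- pgy] of [u1] across axis [i]. *)
pose eta := pgy (D i) (a i) (b i) / Rm j j.
pose w := u1 + eta *: col j Rm.
have eta0 : 0 <= eta by rewrite divr_ge0// ltW.
have wj : w j 0 = 0.
  by rewrite /w mxE /u1 velocity_j vec_l vec_r !mxE /eta divfK ?gt_eqF// addNr.
(* The rate at an ellipse point is the pairing with its velocity, and the push adds nothing to it
   since [l2 * pgy = 0] at a corner. *)
have aw : a i * w i 0 = rate Sigma mu u1.
  rewrite rate_ellipse//; have := dotDr tc u1 (eta *: col j Rm); rewrite -/w (dotE i tc w) wj mulr0 addr0 vec_l => ->.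
  rewrite dotZr (dotC tc (col j Rm)) [dot (col j Rm) tc](gamma_jE Sigma Rm mu i) vec_l vec_r /eta.
  have [_ _ _ _ cz] := C i.
  by rewrite mulrAC [X in _ + X / _]mulrC cz mul0r addr0.
have rate0 : 0 < rate Sigma mu u1.
  rewrite rate_mul// mulr_gt0// ?invr_gt0//; apply: Sigma_pd; apply: contraTneq (a0 i) => /(congr1 (fun v => v i 0)).
  by rewrite vec_l mxE => ->; rewrite ltxx.
have wi : 0 < w i 0 by rewrite -(pmulr_rgt0 _ (a0 i)) aw.
have u2j : u2 j 0 = pgy (D i) (a i) (b i).
  by rewrite /u2 velocity_j vec_l vec_r /bt /pgy; field; rewrite gt_eqF.
(* This is [T1 >= 0]. The vector [u2] is the outward normal at [tilde i], so it pairs nonpositively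
   with [p - tilde i], while [v] pairs nonnegatively with it and [p] lies to the right. *)
have feas : 0 <= v i 0 * u2 j 0 - v j 0 * u2 i 0.
  pose d := p - tilde i.
  have di : 0 < d i 0 by rewrite /d mxE [X in _ + X]mxE vec_l subr_gt0.
  have h1 : u2 i 0 * d i 0 + u2 j 0 * d j 0 <= 0.
    have := pgD (D i) (tilde i i 0) (tilde i j 0) (d i 0) (d j 0).
    have dE k : tilde i k 0 + d k 0 = p k 0.
      have -> : d k 0 = p k 0 - tilde i k 0 by rewrite /d mxE [X in _ + X]mxE.
      by rewrite addrC subrK.
    rewrite !dE.
    rewrite -!(gE i) tilde_gamma add0r /u2 velocity_i velocity_j !mulNr.
    have := pq_ge0 (ok i) (d i 0) (d j 0); move: gp.
    by move: (gamma _ _ _) (pq _ _ _) (_ * d i 0) (_ * d j 0) => *; lra.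
  have h2 : 0 <= v i 0 * d i 0 + v j 0 * d j 0 by rewrite -dotE dotBr subr_ge0.
  have u2j0 : 0 <= u2 j 0 by rewrite u2j ltW.
  have h3 := mulr_ge0 u2j0 h2; have h4 := mulr_ge0_le0 (v0 j) h1.
  rewrite -(pmulr_lge0 _ di).
  have -> : (v i 0 * u2 j 0 - v j 0 * u2 i 0) * d i 0 =
    u2 j 0 * (v i 0 * d i 0 + v j 0 * d j 0) - v j 0 * (u2 i 0 * d i 0 + u2 j 0 * d j 0) by ring.
  by rewrite subr_ge0 (le_trans h4 h3).
have u2jp : 0 < u2 j 0 by rewrite u2j.
pose T2 := v j 0 / u2 j 0; pose T1 := (v i 0 - T2 * u2 i 0) / w i 0.
have T20 : 0 <= T2 by rewrite divr_ge0// ltW.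
have T10 : 0 <= T1.
  rewrite divr_ge0 ?(ltW wi)// -(pmulr_lge0 _ u2jp).
  have -> : (v i 0 - T2 * u2 i 0) * u2 j 0 = v i 0 * u2 j 0 - v j 0 * u2 i 0; last by [].
  by rewrite /T2; field; rewrite gt_eqF.
have vE : v = T1 *: w + T2 *: u2.
  apply: (eq_cV2 (i := i)); rewrite [in RHS]mxE [X in X + _]mxE [X in _ + X]mxE.
    by rewrite /T1 divfK ?gt_eqF// subrK.
  by rewrite -/j wj mulr0 add0r /T2 divfK// gt_eqF.
have := @two_piece_bound R Sigma mu Rm i T1 T2 eta u1 u2 T10 T20 eta0 (ltW wi) wj.
rewrite -/j -/w -vE => /(_ v0 Sigma_sym Sigma_pd); rewrite /VF; move=> /le_trans; apply; rewrite lee_fin.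
rewrite -aw rate_ellipse ?tilde_gamma// -/u2 (dotC v) (dotE i (tilde i) v) (dotE i (tilde i) u2) vec_l vec_r.
rewrite le_eqVlt; apply/orP; left; apply/eqP.
have -> : T1 * (a i * w i 0) = a i * (v i 0 - T2 * u2 i 0) by rewrite /T1; field; rewrite gt_eqF.
have -> : v j 0 = T2 * u2 j 0 by rewrite /T2 divfK// gt_eqF.
by ring.
Qed.

Lemma mu_neq0 : mu != 0.
Proof.
apply: contraTneq (Rdrift 0) => ->; rewrite !mxE !mulr0 subrr ltxx //.
Qed.

(** The maximiser [p] of [dot v] over the closed region is the ellipse point whose normal velocity
    [mu + Sigma *m p] is a multiple [s *: v]; the straight ray with that velocity costs [dot v p],
    and [rate_dual] gives maximality. *)
Lemma ray_bound v : nonneg_vec v -> v != 0 -> exists p, [/\ gamma Sigma mu p = 0,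
  forall q, 0 <= gamma Sigma mu q -> dot v q <= dot v p & (VF v <= (dot v p)%:E)%E].
Proof.
move=> v0 vn; have uS := positive_definite_unitmx Sigma_sym Sigma_pd.
have inv0 (u : 'cV[R]_2) : u != 0 -> 0 < dot u (invmx Sigma *m u).
  move=> un; have [q0 uE] : exists q0, u = Sigma *m q0 by exists (invmx Sigma *m u); rewrite mulKVmx.
  rewrite uE mulKmx// dotC; apply: Sigma_pd; apply: contra un => /eqP q00.
  by rewrite uE q00 mulmx0.
pose M := dot mu (invmx Sigma *m mu); pose V := dot v (invmx Sigma *m v).
have sym : dot v (invmx Sigma *m mu) = dot mu (invmx Sigma *m v).
  by rewrite -{1}(mulKVmx uS v) -{2}(mulKVmx uS mu) dotC [RHS]dotC !(quadratic_form Sigma_sym 0); ring.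
have M0 : 0 < M by exact/inv0/mu_neq0.
have V0 : 0 < V by exact: inv0.
(* The speed that puts [p] on the ellipse, as [2 * gamma p = M - s^2 * V]. *)
pose s := Num.sqrt (M / V).
have s0 : 0 < s by rewrite sqrtr_gt0 divr_gt0.
have s2V : s ^+ 2 * V = M by rewrite sqr_sqrtr ?divr_ge0 ?(ltW M0) ?(ltW V0)// divfK// gt_eqF.
pose p := invmx Sigma *m (s *: v - mu).
have Sp : Sigma *m p = s *: v - mu by rewrite mulKVmx.
have up : mu + Sigma *m p = s *: v by rewrite Sp addrC subrK.
have gp : gamma Sigma mu p = 0.
  have E : dot p (Sigma *m p) + 2 * dot mu p = s ^+ 2 * V - M.
    rewrite Sp /p dotC mulmxBr -scalemxAr !dotBr !dotZr /V /M.
    rewrite (dotC (s *: v - mu)) dotBr dotZr (dotC _ mu) (dotC (s *: v - mu)) dotBr dotZr.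
    rewrite !(dotC (invmx Sigma *m v)) !(dotC (invmx Sigma *m mu)).
    by rewrite sym; ring.
  by rewrite /gamma; move: E; rewrite s2V subrr; move: (dot _ _) (dot _ _) => *; lra.
have rp : rate Sigma mu (s *: v) = s * dot v p by rewrite -up rate_ellipse// up dotZr dotC.
exists p; split => //.
  move=> q gq; rewrite -(ler_pM2l s0) -rp.
  apply: le_trans (rate_dual mu Sigma_sym Sigma_pd (s *: v) q).
  by rewrite dotZr (dotC q) lerDl.
have w0 : (0 + 0 *: col (rev_ord 0) Rm : 'cV[R]_2) = 0 by rewrite scale0r addr0.
have vE : v = 0 *: (0 + 0 *: col (rev_ord 0) Rm) + s^-1 *: (s *: v).
  by rewrite scale0r add0r scalerA mulVf ?scale1r// gt_eqF.
have := @two_piece_bound R Sigma mu Rm 0 0 s^-1 0 0 (s *: v) (lexx _) _ (lexx _).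
rewrite -vE w0 !mxE lexx => /(_ _ isT erefl v0 Sigma_sym Sigma_pd).
rewrite rp mul0r add0r mulKf ?gt_eqF//; apply; by rewrite invr_ge0 ltW.
Qed.

Lemma zero_bound : (VF 0 <= 0)%E.
Proof.
have := @two_piece_bound R Sigma mu Rm 0 0 0 0 0 0 (lexx _) (lexx _) (lexx _).
rewrite !scale0r !addr0 !mul0r addr0 !mxE lexx; apply => //.
by move=> k; rewrite mxE.
Qed.

(** Coordinatewise upper bound for the domain. Its position replaces that of [tau]: inside [Gamma]
    the two agree, and otherwise [tau] is outside too. *)
Let avec : 'cV[R]_2 := \col_k a k.
Let inD th := forall i, D_ Sigma mu Rm i th.
Let S v := ereal_sup [set (dot v th)%:E | th in inD].

Let gavec i : gamma Sigma mu avec = pg (D i) (a i) (a (rev_ord i)).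
Proof. by rewrite (gE i) !mxE. Qed.

Lemma common_dominating th q' q'' : 0 < gamma Sigma mu q' -> lt_vec th q' -> q' 0 0 < a 0 ->
  0 < gamma Sigma mu q'' -> lt_vec th q'' -> q'' (rev_ord 0) 0 < a (rev_ord 0) ->
  exists q, 0 < gamma Sigma mu q /\ forall i, th i 0 < q i 0 < a i.
Proof.
rewrite !(gE 0) => h1 h2 h3 h4 h5 h6.
have C' : corner (swap_data (D 0)) (a (rev_ord 0)) (b (rev_ord 0)) by rewrite data_swap.
have [x [y [G hx hy]]] := Gamma_below_corners (ok 0) (C 0) C' h1 (h2 0) (h2 _) h3 h4 (h5 0) (h5 _) h6.
exists (vec 0 x y); split; first by rewrite (gE 0) vec_l vec_r.
by move=> i; have [->|/ord2_neq ->] := eqVneq i 0; rewrite ?vec_l ?vec_r.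
Qed.

Lemma inD_dominated th : inD th -> exists q, 0 < gamma Sigma mu q /\ forall i, th i 0 < q i 0 < a i.
Proof.
move=> H; have [q' [h1 h2 h3]] := H 0; have [q'' [h4 h5 h6]] := H (rev_ord 0).
exact: (common_dominating h1 h2 h3 h4 h5 h6).
Qed.

Lemma inner_point : exists q, 0 < gamma Sigma mu q /\ forall i, q i 0 < a i.
Proof.
have pt i : exists q, 0 < gamma Sigma mu q /\ q i 0 < a i.
  have [x' [y' [/andP[_ xa] _ G _]]] := corner_approach (ok i) (C i) ltr01.
  by exists (vec i x' y'); rewrite (gE i) vec_l vec_r.
have [q' [g' h']] := pt 0; have [q'' [g'' h'']] := pt (rev_ord 0).
(* An auxiliary point strictly below both, introduced only to apply [common_dominating]. *)
pose th : 'cV[R]_2 := \col_k (Num.min (q' k 0) (q'' k 0) - 1).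
have [||q [gq hq]] := common_dominating (th := th) g' _ h' g'' _ h''.
- by move=> k; rewrite mxE ltrBlDr (@le_lt_trans _ _ (q' k 0)) ?ltrDl ?ltr01// ge_min lexx.
- by move=> k; rewrite mxE ltrBlDr (@le_lt_trans _ _ (q'' k 0)) ?ltrDl ?ltr01// ge_min lexx orbT.
- by exists q; split => // i; case/andP: (hq i).
Qed.

Lemma inD_below q e : 0 < gamma Sigma mu q -> (forall i, q i 0 < a i) -> 0 < e -> inD (q - const_mx e).
Proof.
move=> gq qa e0 i; exists q; split => //.
by move=> k; rewrite !mxE gtrBl.
Qed.

(** Points of the closed region, corners and [tilde] points among them, become usable in the
    supremum after a small pull toward an inner point and a small shift down. *)
Lemma sup_ge v p : nonneg_vec v -> 0 <= gamma Sigma mu p -> (forall i, p i 0 <= a i) -> ((dot v p)%:E <= S v)%E.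
Proof.
move=> v0 gp pa; have [q [gq qa]] := inner_point; apply/lee_addgt0Pr => e e0.
(* Bounds the loss per unit of [t], from the pull toward [q] and from the shift by [t] in both
   coordinates. *)
pose K := `|dot v p - dot v q| + (v 0 0 + v (rev_ord 0) 0) + 1.
have K0 : 0 < K by rewrite ltr_wpDl// !addr_ge0.
pose t := Num.min 2^-1 (e / K).
have t0 : 0 < t by rewrite lt_min invr_gt0 ltr0n divr_gt0.
have t1 : t < 1 by rewrite gt_min invf_lt1 ?ltr1n.
have tK : t * K <= e by rewrite -ler_pdivlMr// ge_min lexx orbT.
pose r := (1 - t) *: p + t *: q.
have gr : 0 < gamma Sigma mu r.
  rewrite (gE 0) !mxE; move: gp gq; rewrite !(gE 0).
  move: (p 0 0) (p (rev_ord 0) 0) (q 0 0) (q (rev_ord 0) 0) => x y h k g1 g2.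
  have -> : pg (D 0) ((1 - t) * x + t * h) ((1 - t) * y + t * k) =
     (1 - t) * pg (D 0) x y + t * pg (D 0) h k + t * (1 - t) * pq (D 0) (h - x) (k - y) / 2.
    by rewrite /pg /pq; field.
  have q0 := pq_ge0 (ok 0) (h - x) (k - y); have t1' : 0 <= 1 - t by rewrite subr_ge0 ltW.
  rewrite ltr_wpDr ?ltr_wpDl ?mulr_gt0 ?(mulr_ge0 t1' g1)//.
  by apply: divr_ge0 => //; apply: mulr_ge0 => //; apply: mulr_ge0 => //; exact: ltW.
have ra i : r i 0 < a i.
  rewrite !mxE -[ltRHS](_ : (1 - t) * a i + t * a i = _); last by ring.
  by apply: ler_ltD; [rewrite ler_pM2l ?subr_gt0|rewrite ltr_pM2l].
have Dr := inD_below gr ra t0.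
apply: (@le_trans _ _ ((dot v (r - const_mx t))%:E + e%:E)%E); last first.
  by apply: leeD2r; apply: ereal_sup_ubound; exists (r - const_mx t).
rewrite -EFinD lee_fin dotBr dotDr !dotZr (dotE 0 v (const_mx t)) !mxE.
have h1 : t * (dot v p - dot v q) <= t * `|dot v p - dot v q| by rewrite ler_pM2l// ler_norm.
rewrite -subr_ge0.
have -> : (1 - t) * dot v p + t * dot v q - (v 0 0 * t + v (rev_ord 0) 0 * t) + e - dot v p =
    (e - t * K) + (t * `|dot v p - dot v q| - t * (dot v p - dot v q)) + t by rewrite /K; ring.
by apply: addr_ge0; [apply: addr_ge0; rewrite subr_ge0|exact: ltW].
Qed.

Lemma outside_side i : gamma Sigma mu avec <= 0 -> b i < a (rev_ord i) -> bt i <= a (rev_ord i).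
Proof.
rewrite (gavec i) (pg_vertical (ok i) _ (g0 i)) -/(bt i) => h ba; rewrite leNgt; apply/negP => ab.
move: h; rewrite leNgt => /negP; apply; by rewrite !mulr_gt0 ?subr_gt0// ?divr_gt0 ?(ok_s2 (ok i)).
Qed.

Lemma b_le_bt i : b i <= bt i.
Proof.
have [_ _ _ gy _] := C i; rewrite /bt lerDl divr_ge0 ?mulr_ge0//; exact: ltW (ok_s2 (ok i)).
Qed.

Lemma inside_side i : 0 < gamma Sigma mu avec -> b i < a (rev_ord i) < bt i.
Proof.
rewrite (gavec i) (pg_vertical (ok i) _ (g0 i)) -/(bt i) => h.
have := b_le_bt i; have s20 := ok_s2 (ok i).
move: h; rewrite -mulrA pmulr_rgt0 ?divr_gt0//.
move: (b i) (bt i) (a (rev_ord i)) => x y z h xy.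
have [zx|xz] := leP z x.
  by move: h; rewrite ltNge mulr_le0_ge0// ?subr_le0// subr_ge0 (le_trans zx).
by move: h; rewrite pmulr_rgt0 ?subr_gt0.
Qed.

(** If the maximiser [p] is below [avec], the straight ray suffices. If [a i < p i 0], the two-piece
    path along axis [i] does, provided [tilde i] is below [avec]; if it is not, then [a j <= b i],
    [corners_cross] places the other corner favourably, and [p] also exceeds [a j], so that axis [j]
    can be used. *)
Lemma upper_outside v : gamma Sigma mu avec <= 0 -> nonneg_vec v -> (VF v <= S v)%E.
Proof.
move=> ga v0; have [->|vn] := eqVneq v 0.
  apply: (le_trans zero_bound); have [q [gq qa]] := inner_point.
  have n0 : nonneg_vec (0 : 'cV[R]_2) by move=> k; rewrite mxE.
  by have := sup_ge n0 (ltW gq) (fun i => ltW (qa i)); rewrite dotC dot0r.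
have [p [gp pmax pV]] := ray_bound v0 vn.
have gp0 : 0 <= gamma Sigma mu p by rewrite gp.
have useB i : a i < p i 0 -> bt i <= a (rev_ord i) -> (VF v <= S v)%E.
  move=> ap ba; have gt : 0 <= gamma Sigma mu (tilde i) by rewrite tilde_gamma.
  have gy : 0 < pgy (D i) (a i) (b i).
    by apply: (corner_pgy_gt0 (ok i) (C i) (x' := p i 0) (y' := p (rev_ord i) 0)); [rewrite -gE gp|left].
  apply: (le_trans (path_bound v0 gy gp0 ap (pmax _ gt))); apply: sup_ge => // k.
  by have [->|/ord2_neq ->] := eqVneq k i; rewrite ?vec_l ?vec_r.
have one i : a i < p i 0 -> (VF v <= S v)%E.
  move=> ap; have [|ab] := leP (bt i) (a (rev_ord i)); first exact: useB.
  have ba : a (rev_ord i) <= b i.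
    by rewrite leNgt; apply/negP => /(outside_side ga); rewrite leNgt ab.
  have bi0 : 0 < b i := lt_le_trans (a0 _) ba.
  have bj : b (rev_ord i) < a i.
    rewrite ltNge; apply/negP => ab'.
    have C' : corner (swap_data (D i)) (a (rev_ord i)) (b (rev_ord i)) by rewrite data_swap.
    apply: (corners_cross (ok i) (C i) C'); split => //; first exact: lt_le_trans (a0 _) ab'.
    by rewrite mulrC; apply: ler_pM => //; exact: ltW.
  have gy : 0 < pgy (D i) (a i) (b i).
    by apply: (corner_pgy_gt0 (ok i) (C i) (x' := p i 0) (y' := p (rev_ord i) 0)); [rewrite -gE gp|left].
  have pj : b i < p (rev_ord i) 0.
    by apply: (above_corner (ok i) (C i) bi0 gy _ ap); rewrite -gE gp.
  apply: (useB (rev_ord i)); first exact: le_lt_trans ba pj.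
  by rewrite rev_ordK; have := @outside_side (rev_ord i) ga; rewrite rev_ordK; apply.
have [h0|/one//] := leP (p 0 0) (a 0); have [h1|/one//] := leP (p (rev_ord 0) 0) (a (rev_ord 0)).
apply: (le_trans pV); apply: sup_ge => // k.
by have [->|/ord2_neq ->] := eqVneq k 0.
Qed.

Lemma tilde_cross i : 0 < gamma Sigma mu avec -> tilde i i 0 < tilde (rev_ord i) i 0.
Proof.
move=> ga; have /andP[_] := inside_side (rev_ord i) ga.
by rewrite rev_ordK vec_l /tilde mxE eq_sym (negbTE (neq_rev_ord i)).
Qed.

Lemma inside_pgy i : 0 < gamma Sigma mu avec -> 0 < pgy (D i) (a i) (b i).
Proof.
rewrite (gavec i) => ga.
by apply: (corner_pgy_gt0 (ok i) (C i) (ltW ga)); right.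
Qed.

(** Each [tilde] point lies beyond the abscissa of the other one, so it can play the part of [p] in
    [path_bound] for the smaller of the two pairings. *)
Lemma upper_inside v : 0 < gamma Sigma mu avec -> nonneg_vec v ->
  (VF v <= (Num.min (dot v (tilde 0)) (dot v (tilde (rev_ord 0))))%:E)%E.
Proof.
move=> ga v0.
have one i : dot v (tilde i) <= dot v (tilde (rev_ord i)) -> (VF v <= (dot v (tilde i))%:E)%E.
  move=> le; apply: (@path_bound i v (tilde (rev_ord i))) => //.
  - exact: inside_pgy.
  - by rewrite tilde_gamma.
  - by have := tilde_cross i ga; rewrite {1}vec_l.
have [h|/ltW h] := leP (dot v (tilde 0)) (dot v (tilde (rev_ord 0))); first exact: one.
by apply: (one (rev_ord 0)); rewrite rev_ordK.
Qed.

Lemma lower_outside v : nonneg_vec v -> (S v <= VF v)%E.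
Proof.
move=> v0; apply: ub_ereal_sup => _ [th inth <-].
apply: (value_function_ge Sigma_sym Sigma_pd Rdiag Rdet) => x y z c T T0 rf z00 cz c0 cost zT.
have [q [gq hq]] := inD_dominated inth.
have h := @ray_cost _ Sigma mu Rm Sigma_sym Sigma_pd Rdiag Rdet Rdrift x y z c T T0 rf z00 cz c0 cost q (ltW gq).
have {}h := h (fun i => proj2 (andP (hq i))); rewrite zT dotC in h; apply: le_trans h.
rewrite !(dotE 0); apply: lerD; apply: ler_wpM2l => //; by case/andP: (hq 0) => /ltW; case/andP: (hq (rev_ord 0)) => /ltW.
Qed.

(** The corners themselves are the companions required by [min_cost]: they share the coordinate of
    the [tilde] points and satisfy [gamma_j <= 0]. *)
Lemma lower_inside v : 0 < gamma Sigma mu avec -> 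
  ((Num.min (dot v (tilde 0)) (dot v (tilde (rev_ord 0))))%:E <= VF v)%E.
Proof.
move=> ga; apply: (value_function_ge Sigma_sym Sigma_pd Rdiag Rdet) => x y z c T T0 rf z00 cz c0 cost zT.
rewrite !(dotC v) -zT.
apply: (@min_cost _ Sigma mu Rm Rdiag x y z c T T0 rf z00 cz c0 cost tilde) => i.
- by rewrite tilde_gamma.
- exists (vec i (a i) (b i)); split; rewrite ?(gE i) ?(gamma_jE Sigma Rm mu i) !vec_l ?vec_r ?g0//.
  by case: (C i).
- exact: tilde_cross.
Qed.

(** A positive [pgy] excludes the rightmost point, so the corner is the ray point, and the vertical
    line through it meets the ellipse exactly once more. *)
Lemma theta_r_tildeE i : 0 < pgy (D i) (a i) (b i) -> theta_r_tilde Sigma mu Rm i = tilde i.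
Proof.
move=> gy; have [_ gm _ _] := theta_maxP Sigma_sym Sigma_pd Rdiag Rdet Rdrift i.
have thN : thG i != theta_max Sigma mu i.
  by apply: contraTneq gy; rewrite /a /b => ->; rewrite gm ltxx.
have thr : theta_r Sigma mu Rm i = thG i.
  by move: thN; rewrite /theta_Gamma; case: ifP => //; rewrite eqxx.
rewrite /theta_r_tilde thr (negbTE thN).
set P := [set th | _].
have Pt : P (tilde i).
  split; rewrite ?(ellipseE Rm mu Sigma_sym i) -?(gE i) ?tilde_gamma ?vec_l ?vec_r//.
  by rewrite /bt gt_eqF// ltrDl divr_gt0 ?mulr_gt0//; exact: ok_s2 (ok i).
have [E1 E2 E3] : P (get P) := getPex (ex_intro _ _ Pt).
apply: (eq_cV2 (i := i)); first by rewrite E2 vec_l.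
move: E1; rewrite (ellipseE Rm mu Sigma_sym i) E2 (pg_vertical (ok i) _ (g0 i)) vec_r => /eqP.
rewrite !mulf_eq0 !subr_eq0 (negbTE E3) orbF gt_eqF ?divr_gt0 ?(ok_s2 (ok i))//=.
by rewrite invr_eq0 pnatr_eq0 => /eqP <-.
Qed.

Lemma inDE th : inD th <-> (D_ Sigma mu Rm 0 `&` D_ Sigma mu Rm 1) th.
Proof.
have E : rev_ord 0 = 1 :> 'I_2 by exact: val_inj.
by split=> [H|[h0 h1] i]; [split; exact: H|have [->//|/ord2_neq ->] := eqVneq i 0; rewrite E].
Qed.

Lemma dot_delta i th : dot (delta_mx i 0) th = th i 0.
Proof. by rewrite (dotE i) !mxE !eqxx (negbTE (neq_rev_ord i)) mul1r mul0r addr0. Qed.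

Lemma nonneg_delta i : nonneg_vec (delta_mx i 0 : 'cV[R]_2).
Proof. by move=> k; rewrite mxE ler0n. Qed.

(** A point of the chord to corner [i], scaled by [t] to lie below [avec]. It ensures that the set
    defining [tau] is nonempty. *)
Lemma inD_positive i : exists2 th, inD th & 0 < th i 0.
Proof.
pose t := Num.min 1 (a (rev_ord i) / (`|b i| + 1)).
have b1 : 0 < `|b i| + 1 by rewrite ltr_wpDl.
have t0 : 0 < t by rewrite lt_min ltr01 divr_gt0.
have t1 : t <= 1 by rewrite ge_min lexx.
have tb : t * (`|b i| + 1) <= a (rev_ord i) by rewrite -ler_pdivlMr// ge_min lexx orbT.
have t01 : 0 <= t <= 1 by rewrite t1 ltW.
pose p := vec i (t * a i) (t * b i).
have gp : 0 <= gamma Sigma mu p.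
  rewrite (gE i) vec_l vec_r; have := @Gamma_segment R (D i) 0 0 (a i) (b i) t t01.
  rewrite pg00 g0 => /(_ (lexx _) (lexx _)); rewrite !mulr0 !add0r !subr0; apply: le_trans.
  by apply: divr_ge0 => //; apply: mulr_ge0; [apply: mulr_ge0; rewrite ?subr_ge0// ltW|exact: (pq_ge0 (ok i))].
have pa k : p k 0 <= a k.
  have [->|/ord2_neq ->] := eqVneq k i; rewrite ?vec_l ?vec_r; first by rewrite ler_piMl// ltW.
  apply: le_trans tb; rewrite ler_pM2l//; apply: (le_trans (ler_norm _)); by rewrite lerDl.
have : (0 < S (delta_mx i 0%R))%E.
  apply: lt_le_trans (sup_ge (@nonneg_delta i) gp pa).
  by rewrite dot_delta vec_l lte_fin mulr_gt0.
by move=> /ereal_sup_gt[_ [th inth <-]]; rewrite dot_delta lte_fin; exists th.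
Qed.

Let tset i := [set r : R | exists th, [/\ (D_ Sigma mu Rm 0 `&` D_ Sigma mu Rm 1) th, 0 < th i 0 & r = th i 0]].

Lemma tset_sup i : has_sup (tset i) /\ ubound (tset i) (a i).
Proof.
have ub : ubound (tset i) (a i).
  by move=> _ [th [/inDE/inD_dominated[q [_ hq]] _ ->]]; case/andP: (hq i) => h1 h2; apply: ltW; exact: lt_trans h1 h2.
split => //; split; last by exists (a i).
by have [th inth th0] := inD_positive i; exists (th i 0), th; split => //; exact/inDE.
Qed.

Lemma tauE i : tau Sigma mu Rm i 0 = sup (tset i).
Proof. by rewrite mxE. Qed.

Lemma tau_le i : tau Sigma mu Rm i 0 <= a i.
Proof. by rewrite tauE; have [[ne _] ub] := tset_sup i; exact: ge_sup. Qed.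

Lemma sup_delta i : S (delta_mx i 0) = (tau Sigma mu Rm i 0)%:E.
Proof.
rewrite tauE; have [hs _] := tset_sup i; apply/eqP; rewrite eq_le; apply/andP; split.
  apply: ub_ereal_sup => _ [th inth <-]; rewrite dot_delta lee_fin.
  have [th1 [inth1 th10]] : exists th', inD th' /\ 0 < th' i 0 by have [th' h1 h2] := inD_positive i; exists th'.
  have [h|h] := ltP 0 (th i 0).
    by apply: ub_le_sup; [exact: hs.2|exists th; split => //; exact/inDE].
  apply: (le_trans h); apply: (le_trans (ltW th10)).
  by apply: ub_le_sup; [exact: hs.2|exists th1; split => //; exact/inDE].
apply/lee_addgt0Pr => e e0; have [r [th [/inDE inth _ ->]] lt] := sup_adherent e0 hs.
apply: (@le_trans _ _ ((th i 0)%:E + e%:E)%E).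
  by rewrite -EFinD lee_fin -lerBlDr ltW.
by apply: leeD2r; apply: ereal_sup_ubound; exists th => //; rewrite dot_delta.
Qed.

Lemma tau_inside : 0 < gamma Sigma mu avec -> tau Sigma mu Rm = avec.
Proof.
move=> ga; apply/colP => i; rewrite [RHS]mxE; apply/eqP; rewrite eq_le tau_le/= -lee_fin -sup_delta.
have := sup_ge (@nonneg_delta i) (ltW ga) (fun k => _ : avec k 0 <= a k).
by rewrite dot_delta mxE; apply => k; rewrite mxE.
Qed.

(** If [tau] were in the open set [Gamma] with some coordinate below that of [avec], a small move
    would increase this coordinate while staying in the closed region below [avec], against the
    supremum. Hence [tau] would be [avec], which is outside. *)
Lemma tau_outside : gamma Sigma mu avec <= 0 -> gamma Sigma mu (tau Sigma mu Rm) <= 0.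
Proof.
move=> ga; rewrite leNgt; apply/negP => gt.
suff E : tau Sigma mu Rm = avec by move: gt; rewrite E ltNge ga.
apply/colP => i; rewrite [RHS]mxE; apply/eqP; rewrite eq_le tau_le/= leNgt; apply/negP => lt.
move: gt; rewrite (gE i); set x := tau Sigma mu Rm i 0 in lt *; set y := tau Sigma mu Rm (rev_ord i) 0 => gt.
pose M := `|pgx (D i) x y - pgy (D i) x y| + pq (D i) 1 (-1) / 2 + 1.
have q0 := pq_ge0 (ok i) 1 (-1).
have M0 : 0 < M by rewrite ltr_wpDl// addr_ge0// divr_ge0.
pose e := Num.min 1 (Num.min (a i - x) (pg (D i) x y / M)).
have e0 : 0 < e by rewrite !lt_min ltr01 subr_gt0 lt divr_gt0.
have e1 : e <= 1 by rewrite ge_min lexx.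
have ea : e <= a i - x by rewrite !ge_min lexx orbT.
have eM : e * M <= pg (D i) x y by rewrite -ler_pdivlMr// !ge_min lexx !orbT.
clearbody e.
have ge : 0 <= pg (D i) (x + e) (y - e).
  rewrite pgD (_ : pq (D i) e (- e) = e ^+ 2 * pq (D i) 1 (-1)); last by rewrite /pq; ring.
  have h1 : e ^+ 2 * pq (D i) 1 (-1) <= e * pq (D i) 1 (-1).
    by apply: ler_wpM2r => //; rewrite expr2 ler_piMl// ltW.
  have h2 : - (e * (pgx (D i) x y - pgy (D i) x y)) <= e * `|pgx (D i) x y - pgy (D i) x y|.
    by rewrite -mulrN ler_pM2l// -normrN ler_norm.
  rewrite /M in eM; move: h1 h2 eM e0.
  move: (pgx (D i) x y) (pgy (D i) x y) (pq (D i) 1 (-1)) (pg (D i) x y) => X Y Q P h1 h2 h3 h4.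
  have -> : P + X * e + Y * - e - e ^+ 2 * Q / 2 =
    (P - e * (`|X - Y| + Q / 2 + 1)) + (e * `|X - Y| - - (e * (X - Y))) + (e * Q - e ^+ 2 * Q) / 2 + e by field.
  apply: addr_ge0; last exact: ltW.
  apply: addr_ge0; last by rewrite divr_ge0// subr_ge0.
  by apply: addr_ge0; rewrite subr_ge0.
have le k : vec i (x + e) (y - e) k 0 <= a k.
  have [->|/ord2_neq ->] := eqVneq k i; rewrite ?vec_l ?vec_r; first by rewrite addrC -lerBrDr.
  by apply: (le_trans _ (tau_le _)); rewrite gerBl ltW.
have := sup_ge (@nonneg_delta i) (_ : 0 <= gamma Sigma mu (vec i (x + e) (y - e))) le.
rewrite (gE i) vec_l vec_r => /(_ ge); rewrite sup_delta dot_delta vec_l lee_fin -/x gerDl.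
by rewrite leNgt e0.
Qed.

Lemma value_formula v : nonneg_vec v -> value_function Sigma mu Rm v =
  if tau Sigma mu Rm \in Gamma Sigma mu then
    (Num.min (dot v (theta_r_tilde Sigma mu Rm 0)) (dot v (theta_r_tilde Sigma mu Rm (rev_ord 0))))%:E
  else ereal_sup [set (dot v th)%:E | th in D_ Sigma mu Rm 0 `&` D_ Sigma mu Rm 1].
Proof.
move=> v0; have inDs : [set th | inD th] = D_ Sigma mu Rm 0 `&` D_ Sigma mu Rm 1.
  by apply/seteqP; split => th /inDE.
have [ga|ga] := leP (gamma Sigma mu avec) 0.
  rewrite memNset; last by rewrite /Gamma/= ltNge (tau_outside ga).
  by rewrite -inDs; apply/eqP; rewrite eq_le upper_outside// lower_outside.
rewrite mem_set; last by rewrite /Gamma/= tau_inside.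
rewrite !theta_r_tildeE; try exact: inside_pgy.
by apply/eqP; rewrite eq_le upper_inside// lower_inside.
Qed.

Lemma value_delta i : value_function Sigma mu Rm (delta_mx i 0) = (tau Sigma mu Rm i 0)%:E.
Proof.
have [ga|ga] := leP (gamma Sigma mu avec) 0.
  rewrite -sup_delta; apply/eqP; rewrite eq_le upper_outside//; last exact: nonneg_delta.
  by rewrite lower_outside//; exact: nonneg_delta.
have E : Num.min (dot (delta_mx i 0) (tilde 0)) (dot (delta_mx i 0) (tilde (rev_ord 0))) = a i.
  have -> : Num.min (dot (delta_mx i 0) (tilde 0)) (dot (delta_mx i 0) (tilde (rev_ord 0))) =
    Num.min (tilde i i 0) (tilde (rev_ord i) i 0).
    by rewrite !dot_delta; have [->//|/ord2_neq ->] := eqVneq i 0; rewrite rev_ordK minC.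
  by rewrite (min_idPl (ltW (tilde_cross i ga))) vec_l.
rewrite (tau_inside ga) mxE -E; apply/eqP; rewrite eq_le upper_inside//; last exact: nonneg_delta.
exact: lower_inside.
Qed.
End upper_bounds.

Theorem theorem3p2 (R : realType) (Sigma Rm : 'M[R]_2) (mu : 'cV[R]_2)
    (nu : probability (plane R) R)
    (Sigma_sym : Sigma^T = Sigma) (Sigma_pd : positive_definite Sigma)
    (r11_gt0 : 0 < Rm 0 0) (r22_gt0 : 0 < Rm 1 1)
    (det_gt0 : 0 < Rm 0 0 * Rm 1 1 - Rm 0 1 * Rm 1 0)
    (drift1 : Rm 1 1 * mu 0 0 - Rm 0 1 * mu 1 0 < 0)
    (drift2 : Rm 0 0 * mu 1 0 - Rm 1 0 * mu 0 0 < 0)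
    (nu_stationary : stationary_distribution Sigma mu Rm nu) :
  [/\ mgf_domain nu = D_ Sigma mu Rm 0 `&` D_ Sigma mu Rm 1,
      forall v : 'cV[R]_2, nonneg_vec v ->
        value_function Sigma mu Rm v =
        if tau Sigma mu Rm \in Gamma Sigma mu then
          (Num.min (dot v (theta_r_tilde Sigma mu Rm 0))
                   (dot v (theta_r_tilde Sigma mu Rm 1)))%:E
        else ereal_sup [set (dot v theta)%:E | theta in mgf_domain nu] &
      forall i : 'I_2,
        value_function Sigma mu Rm (delta_mx i 0) =
        (tau Sigma mu Rm i 0)%:E].
Proof.
have r1 : rev_ord 0 = 1 :> 'I_2 by exact: val_inj.
have r0 : rev_ord 1 = 0 :> 'I_2 by exact: val_inj.
have all2 (Q : 'I_2 -> Prop) : Q 0 -> Q 1 -> forall i, Q i.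
  by move=> Q0 Q1 i; have [->//|/ord2_neq ->] := eqVneq i 0; rewrite r1.
have Rdiag : forall i, 0 < Rm i i by apply: all2.
have Rdet : forall i, 0 < Rm i i * Rm (rev_ord i) (rev_ord i) - Rm i (rev_ord i) * Rm (rev_ord i) i.
  apply: all2; rewrite ?r1 ?r0//.
  by rewrite (mulrC (Rm 1 1)) (mulrC (Rm 1 0)).
have Rdrift : forall i, Rm (rev_ord i) (rev_ord i) * mu i 0 - Rm i (rev_ord i) * mu (rev_ord i) 0 < 0.
  by apply: all2; rewrite ?r1 ?r0.
have [B bs] := stationary_boundary_system Sigma_pd Rdiag Rdet Rdrift nu_stationary.
have domE : mgf_domain nu = D_ Sigma mu Rm 0 `&` D_ Sigma mu Rm 1.
  by rewrite (mgf_domain_eq Sigma_sym Sigma_pd Rdiag Rdet Rdrift bs 0) r1.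
split => //.
- move=> v v0; rewrite domE -r1.
  have := value_formula Sigma_sym Sigma_pd Rdiag Rdet Rdrift v0; rewrite r1; exact.
- exact: value_delta.
Qed.
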